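(* Let $\alpha>0$, let $d\ge 1$ be an integer with $d>2(\alpha\wedge 2)$, and let $h$ be as in the context. There is $L_0$ (depending on $d,\alpha,h$) such that for all $L\ge L_0$ the following holds for self-avoiding walk with step distribution $D(x)=h(x/L)/\sum_{y\in\mathbb{Z}^d}h(y/L)$. Let $(b_n)$ be a sequence with $b_n\to\infty$ and $f_\alpha(n)^{\alpha\wedge1}\,b_n\to0$ as $n\to\infty$. Let $N$ be a positive integer, $k^{(1)},\dots,k^{(N)}\in\mathbb{R}^d$, and $0=t^{(0)}<t^{(1)}<\dots<t^{(N)}\le1$. Let $g=(g_n)$ be a sequence of real numbers with $0\le g_n\le b_n/n$, and put $$\boldsymbol{k}_n=f_\alpha(n)\,\big(k^{(1)},\dots,k^{(N)}\big),\qquad T=t^{(N)}(1-g_n),\qquad n\boldsymbol{T}=\big(\lfloor nt^{(1)}\rfloor,\dots,\lfloor nt^{(N-1)}\rfloor,\lfloor nT\rfloor\big).$$ Then $$\lim_{n\to\infty}\frac{\hat{\boldsymbol c}^{(N)}_{n\boldsymbol T}(\boldsymbol k_n)}{\hat c_{\lfloor nT\rfloor}(0)}=\exp\Big\{-K_\alpha\sum_{j=1}^N|k^{(j)}|^{\alpha\wedge2}\,\big(t^{(j)}-t^{(j-1)}\big)\Big\},$$ and the convergence is uniform over all sequences $g=(g_n)$ with $0\le g_n\le b_n/n$.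
   Context: Notation: $a\wedge b=\min\{a,b\}$; $|\cdot|$ is the Euclidean norm on $\mathbb{R}^d$; $*$ is convolution on $\mathbb{Z}^d$; for $f:\mathbb{Z}^d\to\mathbb{C}$, $\hat f(k)=\sum_{x\in\mathbb{Z}^d}f(x)e^{ik\cdot x}$. Step distribution. $h$ is a non-negative bounded function on $\mathbb{R}^d$, almost everywhere continuous, symmetric under reflections in coordinate hyperplanes and rotations by ninety degrees, with $h(x)\sim c_h|x|^{-d-\alpha}$ as $|x|\to\infty$ for some constant $c_h>0$ (ratio tends to 1). If $\alpha\le 2$, $h$ is moreover assumed to be completely rotation invariant on $\mathbb{R}^d$. For a spread-out parameter $L\ge1$, $D(x)=h(x/L)/\sum_{y\in\mathbb{Z}^d}h(y/L)$, $x\in\mathbb{Z}^d$. It is assumed that $D(0)=0$. The constant $v_\alpha>0$ is defined by: as $|k|\to0$, $1-\hat D(k)\sim v_\alpha|k|^{\alpha\wedge2}$ if $\alpha\ne2$, and $1-\hat D(k)\sim v_2|k|^2\log(1/|k|)$ if $\alpha=2$. Self-avoiding walk. $\mathcal W_n(x)$ is the set of $w=(w_0,\dots,w_n)$ with $w_i\in\mathbb{Z}^d$, $w_0=0$, $w_n=x$, and $\mathcal W_n=\bigcup_x\mathcal W_n(x)$; $w$ is self-avoiding if $w_i\ne w_j$ for $i\ne j$. $c_0(x)=\delta_{0,x}$ and, for $n\ge1$, $c_n(x)=\sum_{w\in\mathcal W_n(x)}\prod_{i=1}^nD(w_i-w_{i-1})\mathbf 1\{w\text{ is self-avoiding}\}$;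 $c_n=\sum_xc_n(x)=\hat c_n(0)$. $z_c\in(0,\infty)$ is the radius of convergence of $\chi(z)=\sum_{n\ge0}c_nz^n$. For $\boldsymbol n=(n^{(1)},\dots,n^{(N)})\in\mathbb{N}^N$ with $n^{(1)}<\dots<n^{(N)}$, $n^{(0)}=0$, and $\boldsymbol k=(k^{(1)},\dots,k^{(N)})\in\mathbb{R}^{dN}$, $$\hat{\boldsymbol c}^{(N)}_{\boldsymbol n}(\boldsymbol k)=\sum_{w\in\mathcal W_{n^{(N)}}}\exp\Big\{i\sum_{j=1}^Nk^{(j)}\cdot\big(w_{n^{(j)}}-w_{n^{(j-1)}}\big)\Big\}\prod_{i=1}^{n^{(N)}}D(w_i-w_{i-1})\,\mathbf 1\{w\text{ is self-avoiding}\}.$$ (In the claim, $n\boldsymbol T$ has strictly increasing positive entries for all sufficiently large $n$, uniformly in $g$.) Lace expansion coefficients. The functions $\pi_m:\mathbb{Z}^d\to\mathbb{R}$, $m\ge2$, are those determined by the recursion $c_{n+1}(x)=(D*c_n)(x)+\sum_{m=2}^{n+1}(\pi_m*c_{n+1-m})(x)$ for all $n\ge0$, $x\in\mathbb{Z}^d$. Constants and scaling. $K_\alpha=\big(1+\sum_{x}\sum_{n\ge2}n\,\pi_n(x)z_c^{n-1}\big)^{-1}\cdot\kappa$, with $\kappa=1$ if $\alpha\le2$ and $\kappa=1+(2dz_cv_\alpha)^{-1}\sum_x\sum_{n\ge2}|x|^2\pi_n(x)z_c^n$ if $\alpha>2$; under the conditions of the claim ($L$ large) these sums converge absolutely and $K_\alpha\in(0,\infty)$.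 For $n\ge2$, $f_\alpha(n)=(v_\alpha n)^{-1/(\alpha\wedge2)}$ if $\alpha\neq2$ and $f_2(n)=(v_2\,n\log\sqrt n)^{-1/2}$ if $\alpha=2$. *)

(* Defs.v *)
From HB Require Import structures.
From mathcomp Require Import all_boot all_order all_algebra.
From mathcomp Require Import all_classical all_reals all_analysis.
From mathcomp Require Import complex.

Set Implicit Arguments.
Unset Strict Implicit.
Unset Printing Implicit Defensive.
Import Order.TTheory GRing.Theory Num.Theory.
Import numFieldNormedType.Exports.

Local Open Scope classical_set_scope.
Local Open Scope ring_scope.
Local Open Scope complex_scope.

(** Points of R^d and Z^d are row vectors ['rV[R]_d] and ['rV[int]_d]. The norm
    that the library puts on ['rV[R]_d] is the sup norm, so the Euclidean norm
    is introduced as [enorm]. *)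

Section euclidean.
Variables (R : realType) (d : nat).
Implicit Types x y : 'rV[R]_d.

Definition dot x y : R := \sum_(i < d) x 0 i * y 0 i.

Definition enorm x : R := Num.sqrt (dot x x).

Definition of_lattice (x : 'rV[int]_d) : 'rV[R]_d := map_mx intr x.

Definition lebesgue_null (A : set 'rV[R]_d) : Prop :=
  forall e : R, 0 < e -> exists a b : nat -> 'rV[R]_d,
    [/\ forall n i, a n 0 i <= b n 0 i,
        A `<=` \bigcup_n [set x | forall i, a n 0 i <= x 0 i <= b n 0 i]
      & (\sum_(0 <= n <oo) (\prod_(i < d) (b n 0 i - a n 0 i))%:E <= e%:E)%E].

Definition reflect (i : 'I_d) x : 'rV[R]_d :=
  \row_j (if j == i then - x 0 j else x 0 j).

Definition rot90 (i j : 'I_d) x : 'rV[R]_d :=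
  \row_l (if l == i then - x 0 j else if l == j then x 0 i else x 0 l).

Record step_profile (alpha : R) (h : 'rV[R]_d -> R) : Prop := StepProfile {
  profile_ge0 : forall x, 0 <= h x;
  profile_bounded : exists M, forall x, h x <= M;
  profile_ae_continuous : lebesgue_null [set x | ~ {for x, continuous h}];
  profile_reflect : forall i x, h (reflect i x) = h x;
  profile_rot90 : forall i j x, i != j -> h (rot90 i j x) = h x;
  profile_tail : exists2 c_h : R, 0 < c_h &
    forall e, 0 < e -> exists r : R, forall x, r < enorm x ->
      `|h x / (c_h * enorm x `^ (- d%:R - alpha)) - 1| < e;
  profile_rotation : alpha <= 2 -> forall (Q : 'M[R]_d) x,
    Q *m Q^T = 1%:M -> \det Q = 1 -> h (x *m Q) = h x }.

End euclidean.

(** [asum A f] is the sum of an absolutely summable family. It is 0 when the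
    family is not absolutely summable. *)
Definition asum (R : realType) (I : choiceType) (A : set I) (f : I -> R) : R :=
  fine (esum A (EFin \o f)^\+ - esum A (EFin \o f)^\-)%E.

Definition csum (R : realType) (I : choiceType) (A : set I) (f : I -> R[i]) :
    R[i] :=
  asum A (fun i => complex.Re (f i)) +i* asum A (fun i => complex.Im (f i)).

Definition expi (R : realType) (theta : R) : R[i] := cos theta +i* sin theta.

Section lattice.
Variables (R : realType) (d : nat).
Local Notation Zd := 'rV[int]_d.

Definition conv (f g : Zd -> R) (x : Zd) : R :=
  asum setT (fun y => f y * g (x - y)).

Definition fourier (f : Zd -> R) (k : 'rV[R]_d) : R[i] :=
  csum setT (fun x => (f x)%:C * expi (dot k (of_lattice R x))).

Definition step_dist (h : 'rV[R]_d -> R) (L : R) (x : Zd) : R :=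
  h (L^-1 *: of_lattice R x) /
  asum setT (fun y : Zd => h (L^-1 *: of_lattice R y)).

Definition dispersion_const (alpha : R) (D : Zd -> R) (v : R) : Prop :=
  0 < v /\
  forall e : R, 0 < e -> exists2 delta : R, 0 < delta &
    forall k : 'rV[R]_d, 0 < enorm k < delta ->
      `|(1 - fourier D k) /
        (if alpha == 2 then v * enorm k ^+ 2 * ln (1 / enorm k)
         else v * enorm k `^ Num.min alpha 2)%:C - 1| < e%:C.

(** An [n]-step walk [(w_0, ..., w_n)] is an [n.+1]-tuple of sites, and [w`_i]
    is its [i]-th site. It is self-avoiding iff [uniq w]. *)
Definition saw_weight (D : Zd -> R) (n : nat) (w : n.+1.-tuple Zd) : R :=
  (\prod_(i < n) D (w`_i.+1 - w`_i)) * (uniq w)%:R.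

(** At [n = 0] the only walk is [(0)] and the product is empty, so that
    [saw D 0] is the Kronecker delta at the origin. *)
Definition saw (D : Zd -> R) (n : nat) (x : Zd) : R :=
  asum [set w : n.+1.-tuple Zd | w`_0 = 0 /\ w`_n = x] (saw_weight D (n := n)).

Definition saw_total (D : Zd -> R) (n : nat) : R := asum setT (saw D n).

(** The coefficients of the generating function are non-negative, so its radius
    of convergence is the supremum of the non-negative reals at which it
    converges. *)
Definition z_crit (D : Zd -> R) : R :=
  sup [set z : R | 0 <= z /\ cvgn (series (fun n => saw_total D n * z ^+ n))].

(** [m] lists [n^(0), n^(1), ..., n^(N)], with [n^(0)] at [ord0] and [n^(N)] at
    [ord_max]. The [j]-th frequency [k j] is paired with the increment of the
    walk from time [m (widen_ord _ j)] to time [m (lift ord0 j)]. *)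
Definition saw_multi (D : Zd -> R) (N : nat) (m : 'I_N.+1 -> nat)
    (k : 'I_N -> 'rV[R]_d) : R[i] :=
  csum [set w : (m ord_max).+1.-tuple Zd | w`_0 = 0]
    (fun w => expi (\sum_(j < N) dot (k j)
        (of_lattice R (w`_(m (lift ord0 j)) - w`_(m (widen_ord (leqnSn N) j)))))
      * (saw_weight D w)%:C).

(** Since [saw D 0] is the unit of [conv], the recursion determines [pi m] for
    every [m >= 2]. The values [pi 0] and [pi 1] are irrelevant. *)
Definition lace_coefficients (D : Zd -> R) (pi : nat -> Zd -> R) : Prop :=
  forall (n : nat) (x : Zd),
    saw D n.+1 x = conv D (saw D n) x
      + \sum_(2 <= m < n.+2) conv (pi m) (saw D (n.+1 - m)) x.

Definition K_const (alpha : R) (D : Zd -> R) (v : R) (pi : nat -> Zd -> R) : R :=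
  let zc := z_crit D in
  let kappa :=
    if alpha <= 2 then 1 else
      1 + (2 * d%:R * zc * v)^-1 *
        asum setT (fun x : Zd => asum [set n | (2 <= n)%N]
          (fun n => enorm (of_lattice R x) ^+ 2 * pi n x * zc ^+ n)) in
  (1 + asum setT (fun x : Zd => asum [set n | (2 <= n)%N]
         (fun n => n%:R * pi n x * zc ^+ n.-1)))^-1 * kappa.

End lattice.

Definition f_scale (R : realType) (alpha v : R) (n : nat) : R :=
  if alpha == 2 then (v * n%:R * ln (Num.sqrt n%:R)) `^ (- (1 / 2))
  else (v * n%:R) `^ (- (1 / Num.min alpha 2)).

(** The time vector [(0, floor (n t^(1)), ..., floor (n t^(N-1)), floor (n T))]
    with [T = t^(N) (1 - gn)]. *)
Definition scaled_times (R : realType) (N : nat) (t : 'I_N.+1 -> R) (gn : R)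
    (n : nat) (j : 'I_N.+1) : nat :=
  if j == ord_max then Num.truncn (n%:R * (t ord_max * (1 - gn)))
  else Num.truncn (n%:R * t j).

(* Main.v *)
(** The self-avoidance indicator factorises over the bonds of a lace, which gives
[c_(n+1) = D * c_n + sum_m pi_m * c_(n+1-m)] together with a majorant of the
laces by loops of self-avoiding pieces.  Below [z_c], closing these loops bounds
[sum_m m |pi_m| z^m] by bubbles, and the bubbles by an infrared bound; the latter
reduces, on finite tori, to the decay of the step profile.  Both bounds improve
each other, and by continuity in [z] they persist up to [z_c], where
[sum_m m |pi_m| z_c^m <= 1/2].  The recursion at [z_c] is then a perturbed renewal
equation: [c_n z_c^n] converges to [A], and [c_n^(k_n) z_c^n / A] behaves like
the [n]-th power of [1 - rate(k) / n].  For several times, the walk is cut at the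
bond of the lace straddling the first time point; only bonds of bounded length
matter, so the limit factorises and one concludes by induction.  The reflection
and rotation symmetries identify the rate with [K_alpha |k|^(alpha /\ 2)]. *)

Require Import Defs.
From mathcomp Require Import all_boot all_order all_algebra.
From mathcomp Require Import all_classical all_reals all_analysis.
From mathcomp Require Import complex.
From mathcomp Require Import ring lra zify.
Import Order.TTheory GRing.Theory Num.Theory.
Import numFieldNormedType.Exports.

Set Implicit Arguments.
Unset Strict Implicit.
Unset Printing Implicit Defensive.

Local Open Scope classical_set_scope.
Local Open Scope ring_scope.

Notation "\asum_ i F" := (asum setT (fun i => F))
 (at level 41, i at level 0, F at level 41, format "\asum_ i  F") : ring_scope.

Notation "\asum_ ( i : T ) F" := (asum setT (fun i : T => F))
 (at level 41, i name, T at level 200, F at level 41) : ring_scope.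

(** The bootstrap controls two quantities: the bubble of [G] and [G - delta], by [10 * eta], and
    [(1 - cos (k . x))] times [G - delta], by a constant times [gap D k]. The second is a whole
    family in [k]; it can be carried along because its growth in [z] is itself bounded by the
    increment of [z] times [gap D k]. On a finite torus a nonnegative function is at most the grid
    average of the modulus of its transform, which takes the place of Fourier inversion. The price
    is the zero mode, of size [chi ^ 2] over the number of grid points; it is absorbed by refining
    the grid for each fixed subcritical [z]. The bounds are thus known at rational frequencies and
    pass to real ones by density. In the scaling limit, domination is obtained without a moment
    assumption: the running maxima of [n (1 - cos (k_n . x))] are again admissible diagram weights,
    with a bound that does not depend on the range of [n]. Gluing two time intervals at first gives
    [A ^ 2] in place of [A]; the straddling bonds repair this because
    [A (1 + sum_m (m - 1) pi_m z_c ^ m) = 1]. *)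

Lemma le_of_eq (R : realType) (x y : R) : x = y -> x <= y.
Proof. by move=> ->. Qed.

Lemma le_via (R : realType) (y x z : R) : x <= y -> y <= z -> x <= z.
Proof. exact: le_trans. Qed.
Arguments le_via {R} y {x z}.

(** * Absolutely summable families *)

Section asum_theory.
Variable R : realType.
Implicit Types I J : choiceType.

(** Stated through finite lists, so that comparison tests become inequalities between finite sums
    and extended reals stay confined to the first lemmas. *)
Definition summ I (f : I -> R) : Prop :=
 exists C, forall s : seq I, uniq s -> \sum_(i <- s) `|f i| <= C.

Lemma nneg_asumE I (A : set I) (f : I -> R) : (forall i, 0 <= f i) ->
 asum A f = fine (esum A (EFin \o f)).
Proof.
move=> f0; rewrite /asum; congr fine.
have -> : ((EFin \o f)^\+ = EFin \o f)%E.
 by apply/funext => i; rewrite funeposE /= -EFin_max; congr EFin; apply/max_idPl.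
rewrite [X in (_ - X)%E]esum1 ?sube0// => i _.
by rewrite funenegE /= -EFin_max; congr EFin; apply/max_idPr; rewrite oppr_le0.
Qed.

Lemma sum_finite_le_esum I (f : I -> R) (s : seq I) : (forall i, 0 <= f i) -> uniq s ->
 ((\sum_(i <- s) f i)%:E <= esum setT (EFin \o f))%E.
Proof.
move=> f0 us; apply: esum_ge; exists [set` s]; first by split => //; exact: finite_seq.
by rewrite -fsbig_seq//= sumEFin.
Qed.

Lemma esum_le_bound I (f : I -> R) (C : R) : (forall i, 0 <= f i) ->
 (forall s : seq I, uniq s -> \sum_(i <- s) f i <= C) ->
 (esum setT (EFin \o f) <= C%:E)%E.
Proof.
move=> f0 H; apply: ge_ereal_sup => _ [X [finX _]] <-.
case/finite_seqP: finX => s ->.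
have -> : [set` s] = [set` undup s] by apply/seteqP; split=> i /=; rewrite mem_undup.
rewrite -fsbig_seq ?undup_uniq//= sumEFin lee_fin; apply: H; exact: undup_uniq.
Qed.

Lemma summ_bound I (f : I -> R) (C : R) :
 (forall s : seq I, uniq s -> \sum_(i <- s) `|f i| <= C) -> summ f.
Proof. by exists C. Qed.

Lemma summ_abs I (f : I -> R) : summ f -> summ (fun i => `|f i|).
Proof. by move=> [C H]; exists C => s /H; under eq_bigr do rewrite -normr_id. Qed.

Lemma summ_of_abs I (f : I -> R) : summ (fun i => `|f i|) -> summ f.
Proof. by move=> [C H]; exists C => s /H; under eq_bigr do rewrite normr_id. Qed.

Lemma esum_ltoo I (f : I -> R) : (forall i, 0 <= f i) -> summ f ->
 (esum setT (EFin \o f) < +oo)%E.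
Proof.
move=> f0 [C H]; apply: (@le_lt_trans _ _ C%:E); last by rewrite ltry.
apply: esum_le_bound => // s /H; congr (_ <= _).
by apply: eq_bigr => i _; rewrite ger0_norm.
Qed.

Lemma summ_esum I (f : I -> R) : (forall i, 0 <= f i) ->
 (esum setT (EFin \o f) < +oo)%E -> summ f.
Proof.
move=> f0 h; exists (fine (esum setT (EFin \o f))) => s us.
have h0 : (0 <= esum setT (EFin \o f))%E by apply: esum_ge0 => i _; rewrite lee_fin.
rewrite -lee_fin fineK; last by rewrite ge0_fin_numE.
rewrite (eq_bigr f); last by move=> i _; rewrite ger0_norm.
exact: sum_finite_le_esum.
Qed.

Lemma summ_summable I (f : I -> R) : summ f -> summable setT (EFin \o f).
Proof. by move=> /summ_abs sf; exact: (esum_ltoo _ sf). Qed.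

Lemma asum_le_bound I (f : I -> R) (C : R) : (forall i, 0 <= f i) ->
 (forall s : seq I, uniq s -> \sum_(i <- s) f i <= C) -> asum setT f <= C.
Proof.
move=> f0 H; rewrite nneg_asumE//.
have h := esum_le_bound f0 H.
have h0 : (0 <= esum setT (EFin \o f))%E by apply: esum_ge0 => i _; rewrite lee_fin.
by rewrite -lee_fin fineK// ge0_fin_numE// (le_lt_trans h)// ltry.
Qed.

Lemma nneg_summ_fin I (f : I -> R) : (forall i, 0 <= f i) -> summ f ->
 esum setT (EFin \o f) \is a fin_num.
Proof.
move=> f0 sf; rewrite ge0_fin_numE; first exact: esum_ltoo.
by apply: esum_ge0 => i _; rewrite lee_fin.
Qed.

Lemma nneg_asum_EFin I (f : I -> R) : (forall i, 0 <= f i) -> summ f ->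
 (asum setT f)%:E = esum setT (EFin \o f).
Proof. by move=> f0 sf; rewrite nneg_asumE// fineK// nneg_summ_fin. Qed.

Lemma sum_finite_le_asum I (f : I -> R) (s : seq I) : (forall i, 0 <= f i) -> summ f ->
 uniq s -> \sum_(i <- s) f i <= asum setT f.
Proof.
by move=> f0 sf us; rewrite -lee_fin nneg_asum_EFin//; exact: sum_finite_le_esum.
Qed.

Lemma summ_finite_bound I (f : I -> R) (s : seq I) : summ f -> uniq s ->
 \sum_(i <- s) `|f i| <= \asum_i `|f i|.
Proof. by move=> sf us; apply: sum_finite_le_asum => //; exact: summ_abs. Qed.

Lemma asum_ge0 I (A : set I) (f : I -> R) : (forall i, 0 <= f i) -> 0 <= asum A f.
Proof.
move=> f0; rewrite nneg_asumE//; apply: fine_ge0.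
by apply: esum_ge0 => i _; rewrite lee_fin.
Qed.

Lemma eq_asum I (A : set I) (f g : I -> R) : f =1 g -> asum A f = asum A g.
Proof. by move=> /funext ->. Qed.

Lemma eq_summ I (f g : I -> R) : f =1 g -> summ f -> summ g.
Proof. by move=> /funext ->. Qed.

Lemma summ_le I (f g : I -> R) : (forall i, `|f i| <= g i) -> summ g -> summ f.
Proof.
move=> fg sg; have g0 i : 0 <= g i by rewrite (le_trans _ (fg i)).
apply: (@summ_bound _ _ (asum setT g)) => s us.
by apply: (le_trans _ (sum_finite_le_asum g0 sg us)); apply: ler_sum => i _.
Qed.

Lemma summD I (f g : I -> R) : summ f -> summ g -> summ (fun i => f i + g i).
Proof.
move=> [C H] [C' H']; exists (C + C') => s us.
apply: le_trans (lerD (H s us) (H' s us)).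
by rewrite -big_split; apply: ler_sum => i _; exact: ler_normD.
Qed.

Lemma summN I (f : I -> R) : summ f -> summ (fun i => - f i).
Proof. by move=> [C H]; exists C => s /H; under eq_bigr do rewrite -normrN. Qed.

Lemma summZ I (f : I -> R) c : summ f -> summ (fun i => c * f i).
Proof.
move=> sf; apply: (@summ_bound _ _ (`|c| * \asum_i `|f i|)) => s us.
under eq_bigr do rewrite normrM.
rewrite -mulr_sumr ler_wpM2l//; exact: summ_finite_bound.
Qed.

Lemma summZr I (f : I -> R) c : summ f -> summ (fun i => f i * c).
Proof. by move=> sf; apply: eq_summ (summZ c sf) => i; rewrite mulrC. Qed.

Lemma summB I (f g : I -> R) : summ f -> summ g -> summ (fun i => f i - g i).
Proof. by move=> sf sg; apply: summD => //; exact: summN. Qed.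

Lemma summ0 I : summ (fun _ : I => 0).
Proof. by apply: (@summ_bound _ _ 0) => s _; rewrite big1// => i _; rewrite normr0. Qed.

Lemma summ_sum I (T : Type) (r : seq T) (P : pred T) (f : T -> I -> R) :
 (forall t, P t -> summ (f t)) -> summ (fun i => \sum_(t <- r | P t) f t i).
Proof.
move=> H; elim: r => [|t r IH]; first by apply: eq_summ (summ0 I) => i; rewrite big_nil.
case Pt: (P t).
 by apply: eq_summ (summD (H _ Pt) IH) => i; rewrite big_cons Pt.
by apply: eq_summ IH => i; rewrite big_cons Pt.
Qed.

Lemma summ_bndM I (f g : I -> R) C : (forall i, `|g i| <= C) -> summ f ->
 summ (fun i => f i * g i).
Proof.
move=> gC /summ_abs sf; apply: (@summ_le _ _ (fun i => C * `|f i|)); last exact: summZ.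
by move=> i; rewrite normrM mulrC ler_wpM2r.
Qed.

(** Any splitting into two nonnegative summable families computes the sum, not only the one into
    positive and negative parts. Additivity rests on this, since the positive part of [f + g] is not
    the sum of the positive parts. *)
Lemma asum_diff I (f g : I -> R) : (forall i, 0 <= f i) -> (forall i, 0 <= g i) ->
 summ f -> summ g -> \asum_i (f i - g i) = asum setT f - asum setT g.
Proof.
move=> f0 g0 sf sg; rewrite {1}/asum.
have -> : EFin \o (fun i => f i - g i) = ((EFin \o f) \- (EFin \o g))%E.
 by apply/funext => i /=.
rewrite esumB//; try exact: summ_summable; try by move=> i _ /=; rewrite lee_fin.
by rewrite -!nneg_asum_EFin//= -EFinB.
Qed.

Lemma nneg_asumD I (f g : I -> R) : (forall i, 0 <= f i) -> (forall i, 0 <= g i) ->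
 summ f -> summ g -> \asum_i (f i + g i) = asum setT f + asum setT g.
Proof.
move=> f0 g0 sf sg; apply: EFin_inj; rewrite EFinD !nneg_asum_EFin//.
- by rewrite -esumD//; try by move=> i _ /=; rewrite lee_fin.
- by move=> i; rewrite addr_ge0.
- exact: summD.
Qed.

Lemma asum_posneg I (f : I -> R) : summ f ->
 asum setT f = \asum_i Num.max (f i) 0 - \asum_i Num.max (- f i) 0.
Proof.
move=> sf; have sn := summ_abs sf.
rewrite -asum_diff; first last.
- by apply: summ_le sn => i; rewrite ger0_norm ?le_max ?lexx ?orbT// ge_max -normrN ler_norm normr_ge0.
- by apply: summ_le sn => i; rewrite ger0_norm ?le_max ?lexx ?orbT// ge_max ler_norm normr_ge0.
- by move=> i; rewrite le_max lexx orbT.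
- by move=> i; rewrite le_max lexx orbT.
by apply: eq_asum => i; case: (lerP (f i) 0) => h; case: (lerP (- f i) 0) => h'; lra.
Qed.

Lemma summ_pos I (f : I -> R) : summ f -> summ (fun i => Num.max (f i) 0).
Proof.
move=> /summ_abs sn; apply: summ_le sn => i.
by rewrite ger0_norm ?le_max ?lexx ?orbT// ge_max ler_norm normr_ge0.
Qed.

Lemma asumD I (f g : I -> R) : summ f -> summ g ->
 \asum_i (f i + g i) = asum setT f + asum setT g.
Proof.
move=> sf sg; have nsf := summN sf; have nsg := summN sg.
have m0 (x : R) : 0 <= Num.max x 0 by rewrite le_max lexx orbT.
rewrite (asum_posneg sf) (asum_posneg sg).
rewrite addrACA -opprD -!nneg_asumD//; try exact: summ_pos.
rewrite -asum_diff//; try by move=> i; rewrite addr_ge0.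
- apply: eq_asum => i.
 case: (lerP (f i) 0) => h; case: (lerP (- f i) 0) => h';
 case: (lerP (g i) 0) => h2; case: (lerP (- g i) 0) => h2'; lra.
- by apply: summD; exact: summ_pos.
- by apply: summD; exact: summ_pos.
Qed.

Lemma asumN I (f : I -> R) : summ f -> \asum_i (- f i) = - asum setT f.
Proof.
move=> sf; rewrite (asum_posneg sf) (asum_posneg (summN sf)) opprB; congr (_ - _).
by apply: eq_asum => i; rewrite opprK.
Qed.

Lemma asumB I (f g : I -> R) : summ f -> summ g ->
 \asum_i (f i - g i) = asum setT f - asum setT g.
Proof. by move=> sf sg; rewrite asumD ?asumN//; exact: summN. Qed.

Lemma asum0 I : asum setT (fun _ : I => 0 : R) = 0.
Proof.
by apply/eqP; rewrite eq_le asum_ge0// andbT; apply: asum_le_bound => // s _; rewrite big1.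
Qed.

Lemma asum_eq0 I (f : I -> R) : (forall i, f i = 0) -> asum setT f = 0.
Proof. by move=> f0; rewrite -[RHS](asum0 I); exact: eq_asum. Qed.

Lemma nneg_asumZ I (f : I -> R) c : 0 <= c -> (forall i, 0 <= f i) -> summ f ->
 \asum_i (c * f i) = c * asum setT f.
Proof.
move=> c0 f0 sf; apply/eqP; rewrite eq_le; apply/andP; split.
 apply: asum_le_bound => [i|s us]; first by rewrite mulr_ge0.
 by rewrite -mulr_sumr ler_wpM2l//; exact: sum_finite_le_asum.
have [->|cn0] := eqVneq c 0.
 by rewrite mul0r asum_ge0// => i; rewrite mul0r.
have cp : 0 < c by rewrite lt_def cn0.
rewrite -ler_pdivlMl//; apply: asum_le_bound => // s us.
rewrite ler_pdivlMl// mulr_sumr; apply: (@sum_finite_le_asum _ (fun i => c * f i)) => //.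
- by move=> i; rewrite mulr_ge0.
- exact: summZ.
Qed.

Lemma asumZ I (f : I -> R) c : summ f -> \asum_i (c * f i) = c * asum setT f.
Proof.
wlog c0 : c / 0 <= c => [H|] sf.
 have [|/ltW cl] := leP 0 c; first by move/H; apply.
 have := H (- c) _ sf; rewrite oppr_ge0 => /(_ cl) h.
 rewrite -[RHS]opprK -mulNr -h -asumN; last exact: summZ.
 by apply: eq_asum => i; rewrite mulNr opprK.
rewrite (asum_posneg sf) (asum_posneg (summZ c sf)) mulrBr.
have m0 (x : R) : 0 <= Num.max x 0 by rewrite le_max lexx orbT.
rewrite -!nneg_asumZ//; try exact: summ_pos.
 by congr (_ - _); apply: eq_asum => i; rewrite -?mulrN maxr_pMr// mulr0.
by apply: summ_pos; exact: summN.
Qed.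

Lemma asumZr I (f : I -> R) c : summ f -> \asum_i (f i * c) = asum setT f * c.
Proof. by move=> sf; rewrite mulrC -asumZ//; apply: eq_asum => i; rewrite mulrC. Qed.

Lemma asum_sum I (T : Type) (r : seq T) (P : pred T) (f : T -> I -> R) :
 (forall t, P t -> summ (f t)) ->
 \asum_i (\sum_(t <- r | P t) f t i) = \sum_(t <- r | P t) asum setT (f t).
Proof.
move=> H; elim: r => [|t r IH].
 by rewrite big_nil -[RHS](asum0 I); apply: eq_asum => i; rewrite big_nil.
rewrite big_cons; case Pt: (P t); rewrite -IH; last by apply: eq_asum => i; rewrite big_cons Pt.
rewrite -asumD//; [|exact: H|exact: summ_sum].
by apply: eq_asum => i; rewrite big_cons Pt.
Qed.

Lemma asum_le I (f g : I -> R) : summ f -> summ g -> (forall i, f i <= g i) ->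
 asum setT f <= asum setT g.
Proof.
move=> sf sg fg; rewrite -subr_ge0 -asumB//; apply: asum_ge0 => i.
by rewrite subr_ge0.
Qed.

Lemma nneg_asum_le I (f g : I -> R) : (forall i, 0 <= f i) -> summ g ->
 (forall i, f i <= g i) -> asum setT f <= asum setT g.
Proof.
by move=> f0 sg fg; apply: asum_le => //; apply: summ_le sg => i; rewrite ger0_norm.
Qed.

Lemma ler_norm_asum I (f : I -> R) : summ f -> `|asum setT f| <= \asum_i `|f i|.
Proof.
move=> sf; have sn := summ_abs sf; rewrite ler_norml; apply/andP; split.
 rewrite -asumN//; apply: asum_le => //; first exact: summN.
 by move=> i; rewrite lerNl -normrN ler_norm.
by apply: asum_le => // i; rewrite ler_norm.
Qed.

Lemma asum_norm_le I (f g : I -> R) : summ g -> (forall i, `|f i| <= g i) ->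
 `|asum setT f| <= asum setT g.
Proof.
move=> sg fg; have sf := summ_le fg sg.
by apply: (le_trans (ler_norm_asum sf)); apply: nneg_asum_le.
Qed.

Lemma asum_ge_term I (f : I -> R) i : (forall i, 0 <= f i) -> summ f -> f i <= asum setT f.
Proof.
by move=> f0 sf; rewrite -[f i](big_seq1 +%R i); exact: sum_finite_le_asum.
Qed.

Lemma ler_sum_subseq I (f : I -> R) (t s : seq I) : (forall i, 0 <= f i) ->
 uniq t -> uniq s -> (forall i, i \in t -> i \in s) ->
 \sum_(i <- t) f i <= \sum_(i <- s) f i.
Proof.
move=> f0 ut us ts; rewrite [leRHS](bigID (mem t))/=.
rewrite (_ : \sum_(i <- t) f i = \sum_(i <- s | i \in t) f i) ?lerDl ?sumr_ge0//.
rewrite -[RHS]big_filter; apply: perm_big; apply: uniq_perm; rewrite ?filter_uniq// => i.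
by rewrite mem_filter; case: (boolP (i \in t)) => //= /ts ->.
Qed.

Lemma summ_seq I (f : I -> R) (s : seq I) : (forall i, i \notin s -> f i = 0) -> summ f.
Proof.
move=> H; apply: (@summ_bound _ _ (\sum_(i <- undup s) `|f i|)) => t ut.
rewrite (bigID (mem s))/= [X in _ + X]big1 ?addr0; last by move=> i /H ->; rewrite normr0.
rewrite -big_filter; apply: ler_sum_subseq; rewrite ?filter_uniq ?undup_uniq//.
 by move=> i; rewrite mem_filter mem_undup => /andP[].
Qed.

Lemma asum_seq I (f : I -> R) (s : seq I) : uniq s ->
 (forall i, i \notin s -> f i = 0) -> asum setT f = \sum_(i <- s) f i.
Proof.
move=> us; have key (g : I -> R) : (forall i, 0 <= g i) -> (forall i, i \notin s -> g i = 0) ->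
  asum setT g = \sum_(i <- s) g i.
 move=> g0 H; apply/eqP; rewrite eq_le; apply/andP; split; last first.
  by apply: sum_finite_le_asum => //; exact: summ_seq H.
 apply: asum_le_bound => // t ut.
 rewrite (bigID (mem s))/= [X in _ + X]big1 ?addr0; last by move=> i /H ->.
 rewrite -big_filter; apply: ler_sum_subseq; rewrite ?filter_uniq//.
 by move=> i; rewrite mem_filter => /andP[].
move=> H; rewrite asum_posneg; last exact: summ_seq H.
have m0 (x : R) : 0 <= Num.max x 0 by rewrite le_max lexx orbT.
rewrite !key//; try by move=> i /H ->; rewrite ?oppr0 maxxx.
rewrite -sumrB; apply: eq_bigr => i _.
by case: (lerP (f i) 0) => h; case: (lerP (- f i) 0) => h'; lra.
Qed.

Lemma asum_single I (f : I -> R) i0 : (forall i, i != i0 -> f i = 0) -> asum setT f = f i0.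
Proof.
move=> H; rewrite (@asum_seq _ _ [:: i0])// ?big_seq1// => i.
by rewrite inE => /H.
Qed.

Lemma summ_single I (f : I -> R) i0 : (forall i, i != i0 -> f i = 0) -> summ f.
Proof. by move=> H; apply: (@summ_seq _ _ [:: i0]) => i; rewrite inE => /H. Qed.

Lemma asum_mkcond I (A : set I) (f : I -> R) :
 asum A f = \asum_i (if i \in A then f i else 0).
Proof.
rewrite /asum; congr fine; congr (_ - _)%E; rewrite esum_mkcond; apply: eq_esum => i _.
 by rewrite !funeposE /=; case: (i \in A) => //; rewrite maxxx.
by rewrite !funenegE /=; case: (i \in A) => //=; rewrite oppr0 maxxx.
Qed.

Lemma asum_reindex I J (A : set I) (B : set J) (e : I -> J) (f : J -> R) :
 set_bij A B e -> asum B f = asum A (f \o e).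
Proof.
move=> be; rewrite /asum; congr fine.
by congr (_ - _)%E; rewrite (@reindex_esum _ _ _ A B e _ be); apply: eq_esum => i _; rewrite ?funeposE ?funenegE.
Qed.

Lemma asum_bij I J (e : I -> J) (f : J -> R) : bijective e ->
 asum setT f = \asum_i f (e i).
Proof.
move=> [e' eK e'K]; apply: asum_reindex; split => //.
- by move=> x y _ _ /(can_inj eK).
- by move=> y _; exists (e' y).
Qed.

Lemma summ_bij I J (e : I -> J) (f : J -> R) : bijective e ->
 summ f <-> summ (f \o e).
Proof.
move=> [e' eK e'K]; split => -[C H]; exists C => s us.
 have := H [seq e i | i <- s]; rewrite big_map; apply.
 by rewrite map_inj_uniq//; exact: can_inj eK.
have := H [seq e' i | i <- s]; rewrite big_map map_inj_uniq//; last exact: can_inj e'K.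
by move=> /(_ us); under eq_bigr do rewrite /= e'K.
Qed.

Lemma nneg_summ_pair I J (f : I -> J -> R) : (forall i j, 0 <= f i j) ->
 (forall i, summ (f i)) -> summ (fun i => asum setT (f i)) ->
 summ (fun p : I * J => f p.1 p.2).
Proof.
move=> f0 sf ss; apply: summ_esum; first by move=> p.
have -> : [set: I * J] = setT `*`` (fun=> setT) by apply/seteqP.
rewrite -(@esum_esum _ _ _ setT (fun=> setT) (fun i j => (f i j)%:E)); last first.
 by move=> i j _ _; rewrite lee_fin.
rewrite (eq_esum (b := EFin \o (fun i => asum setT (f i)))); last first.
 by move=> i _ /=; rewrite nneg_asum_EFin.
by apply: esum_ltoo => // i; exact: asum_ge0.
Qed.

Lemma summ_pair I J (f : I -> J -> R) (g : I -> R) :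
 (forall i, summ (f i)) -> (forall i, \asum_j `|f i j| <= g i) -> summ g ->
 summ (fun p : I * J => f p.1 p.2).
Proof.
move=> sf fg sg; apply: summ_of_abs; apply: (@nneg_summ_pair _ _ (fun i j => `|f i j|)) => //.
 by move=> i; exact: summ_abs.
by apply: summ_le sg => i; rewrite ger0_norm// asum_ge0.
Qed.

Lemma summ_pair_row I J (f : I * J -> R) i : summ f -> summ (fun j => f (i, j)).
Proof.
move=> sf; apply: (@summ_bound _ _ (\asum_p `|f p|)) => s us.
have := @summ_finite_bound _ f [seq (i, j) | j <- s] sf; rewrite big_map; apply.
by rewrite map_inj_uniq// => x y [].
Qed.

Lemma nneg_asum_pair I J (f : I * J -> R) : (forall p, 0 <= f p) -> summ f ->
 summ (fun i => \asum_j f (i, j)) /\ asum setT f = \asum_i \asum_j f (i, j).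
Proof.
move=> f0 sf.
have E : esum setT (EFin \o f) = (\esum_(i in setT) (\asum_j f (i, j))%:E)%E.
 have -> : [set: I * J] = setT `*`` (fun=> setT) by apply/seteqP.
 transitivity (esum (setT `*`` (fun=> setT)) (fun p => (f (p.1, p.2))%:E)).
  by apply: eq_esum => -[].
 rewrite -(@esum_esum _ _ _ setT (fun=> setT) (fun i j => (f (i, j))%:E)); last first.
  by move=> i j _ _; rewrite lee_fin.
 apply: eq_esum => i _; rewrite nneg_asum_EFin//; exact: summ_pair_row.
have s0 i : 0 <= \asum_j f (i, j) by exact: asum_ge0.
have ss : summ (fun i => \asum_j f (i, j)).
 by apply: summ_esum => //; apply: (@le_lt_trans _ _ (esum setT (EFin \o f))); [by rewrite E|exact: esum_ltoo].
by split => //; apply: EFin_inj; rewrite !nneg_asum_EFin//.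
Qed.

Lemma summ_pair_sum I J (f : I * J -> R) : summ f -> summ (fun i => \asum_j f (i, j)).
Proof.
move=> sf; have [] := @nneg_asum_pair I J (fun p => `|f p|) (fun=> normr_ge0 _) (summ_abs sf).
move=> h _; apply: summ_le h => i; apply: ler_norm_asum; exact: summ_pair_row.
Qed.

Lemma asum_pair I J (f : I * J -> R) : summ f -> asum setT f = \asum_i \asum_j f (i, j).
Proof.
move=> sf; have m0 (x : R) : 0 <= Num.max x 0 by rewrite le_max lexx orbT.
rewrite (asum_posneg sf).
have sp := summ_pos sf; have sn := summ_pos (summN sf).
have [s1 ->] := @nneg_asum_pair _ _ _ (fun p => m0 (f p)) sp.
have [s2 ->] := @nneg_asum_pair _ _ _ (fun p => m0 (- f p)) sn.
rewrite -asumB//; apply: eq_asum => i; rewrite -asum_posneg//.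
exact: summ_pair_row.
Qed.

Lemma pair_swap_bij I J : bijective (fun p : I * J => (p.2, p.1)).
Proof. by exists (fun p : J * I => (p.2, p.1)) => -[]. Qed.

Lemma asum_swap I J (f : I -> J -> R) : summ (fun p : I * J => f p.1 p.2) ->
 \asum_i \asum_j f i j = \asum_j \asum_i f i j.
Proof.
move=> sf; rewrite -(asum_pair sf).
have sf' := iffLR (summ_bij _ (pair_swap_bij J I)) sf.
by rewrite (asum_bij _ (pair_swap_bij J I)) (asum_pair sf').
Qed.

Lemma summ_swap I J (f : I -> J -> R) : summ (fun p : I * J => f p.1 p.2) ->
 summ (fun p : J * I => f p.2 p.1).
Proof. by move=> sf; exact: (iffLR (summ_bij _ (pair_swap_bij J I)) sf). Qed.

Lemma summ_prod I J (f : I -> R) (g : J -> R) : summ f -> summ g ->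
 summ (fun p : I * J => f p.1 * g p.2).
Proof.
move=> sf sg; apply: (@summ_pair _ _ (fun i j => f i * g j) (fun i => `|f i| * \asum_j `|g j|)).
- by move=> i; exact: summZ.
- move=> i; rewrite -asumZ; last exact: summ_abs.
 by rewrite (@eq_asum _ _ _ (fun j => `|f i| * `|g j|))// => j; rewrite normrM.
- by apply: summZr; exact: summ_abs.
Qed.

Lemma asum_prod I J (f : I -> R) (g : J -> R) : summ f -> summ g ->
 asum setT (fun p : I * J => f p.1 * g p.2) = asum setT f * asum setT g.
Proof.
move=> sf sg; rewrite asum_pair/=; last exact: summ_prod.
by rewrite -asumZr//; apply: eq_asum => i; rewrite asumZ.
Qed.

(** Otherwise every finite list could be enlarged by a disjoint list of mass more than [e], and
    enough enlargements would exceed the total sum. *)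
Lemma asum_tail I (f : I -> R) (e : R) : summ f -> 0 < e ->
 exists2 s : seq I, uniq s & forall t : seq I, uniq t -> (forall i, i \in t -> i \notin s) ->
  \sum_(i <- t) `|f i| <= e.
Proof.
move=> /summ_abs sf e0; apply: contrapT => H.
have {}H s : uniq s -> exists t : seq I, [/\ uniq t, forall i, i \in t -> i \notin s
  & e < \sum_(i <- t) `|f i|].
 move=> us; apply: contrapT => H'; apply: H; exists s => // t ut ts.
 by rewrite leNgt; apply/negP => h; apply: H'; exists t.
have K n : exists2 s : seq I, uniq s & n%:R * e <= \sum_(i <- s) `|f i|.
 elim: n => [|n [s us sn]]; first by exists [::] => //; rewrite big_nil mul0r.
 have [t [ut ts te]] := H s us; exists (s ++ t).
  by rewrite cat_uniq us ut andbT/=; apply/hasPn => i /ts.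
 by rewrite big_cat/= -natr1 mulrDl mul1r lerD// ltW.
have [n ln] : exists n : nat, \asum_i `|f i| < n%:R * e.
 exists (Num.truncn ((\asum_i `|f i|) / e)).+1.
 by rewrite -ltr_pdivrMr//; exact: truncnS_gt.
have [s us hs] := K n.
have := sum_finite_le_asum (fun i => normr_ge0 (f i)) sf us.
by rewrite leNgt (lt_le_trans ln hs).
Qed.

(** One list serves every [g] dominated by [f]; this uniformity is what dominated convergence
    uses. *)
Lemma asum_tail_le I (f : I -> R) (e : R) : summ f -> 0 < e ->
 exists2 s : seq I, uniq s & forall g : I -> R, (forall i, `|g i| <= `|f i|) ->
  `|asum setT g - \sum_(i <- s) g i| <= e.
Proof.
move=> sf e0; have [s us H] := asum_tail sf e0; exists s => // g gf.
have sg : summ g by apply: summ_le gf _; exact: summ_abs.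
pose g' i := if i \in s then g i else 0.
have sg' : summ g' by apply: (@summ_seq _ _ s) => i; rewrite /g' => /negbTE ->.
have -> : \sum_(i <- s) g i = asum setT g'.
 rewrite (@asum_seq _ g' s us); last by move=> i; rewrite /g' => /negbTE ->.
 by rewrite big_seq [RHS]big_seq; apply: eq_bigr => i; rewrite /g' => ->.
rewrite -asumB//; apply: (le_trans (ler_norm_asum (summB sg sg'))).
apply: asum_le_bound => // t ut.
rewrite (bigID (mem s))/= big1 ?add0r; last first.
 by move=> i; rewrite /g' => ->; rewrite subrr normr0.
rewrite -big_filter; apply: le_trans (H [seq i <- t | i \notin s] (filter_uniq _ ut) _).
 rewrite big_seq [leRHS]big_seq; apply: ler_sum => i; rewrite mem_filter /g' => /andP[/negbTE -> _].
 by rewrite subr0.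
by move=> i; rewrite mem_filter => /andP[].
Qed.

Lemma near_nat (P : nat -> Prop) : (\forall n \near \oo, P n) <->
 exists n0, forall n, (n0 <= n)%N -> P n.
Proof. by split=> [[n0 _ H]|[n0 H]]; exists n0. Qed.

Lemma cvg_eps (u : nat -> R) (l : R) : (u n @[n --> \oo] --> l) <->
 forall e, 0 < e -> exists n0, forall n, (n0 <= n)%N -> `|u n - l| <= e.
Proof.
split=> [/cvgrPdist_le H e e0|H].
 by have /near_nat[n0 h] := H e e0; exists n0 => n /h; rewrite distrC.
apply/cvgrPdist_le => e e0; apply/near_nat; have [n0 h] := H e e0.
by exists n0 => n /h; rewrite distrC.
Qed.

Lemma cvg_le_bound (u : nat -> R) (l C : R) : u n @[n --> \oo] --> l ->
 (forall n, u n <= C) -> l <= C.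
Proof.
move=> /cvg_eps H uC; apply/ler_addgt0Pr => e e0; have [n0 h] := H e e0.
have := h n0 (leqnn _); rewrite ler_distlC => /andP[_ h2].
by have := uC n0; lra.
Qed.

Lemma cvg_bigsum (T : Type) (s : seq T) (f : nat -> T -> R) (F : T -> R) :
 (forall i, f n i @[n --> \oo] --> F i) ->
 \sum_(i <- s) f n i @[n --> \oo] --> \sum_(i <- s) F i.
Proof.
move=> fF; elim: s => [|i s IH].
 by rewrite big_nil; under eq_fun do rewrite big_nil; exact: cvg_cst.
rewrite big_cons; under eq_fun do rewrite big_cons; exact: cvgD.
Qed.

Lemma asum_dominated I (f : nat -> I -> R) (g F : I -> R) : summ g ->
 (forall n i, `|f n i| <= g i) -> (forall i, f n i @[n --> \oo] --> F i) ->
 asum setT (f n) @[n --> \oo] --> asum setT F.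
Proof.
move=> sg fg fF.
have Fg i : `|F i| <= g i.
 rewrite ler_norml; apply/andP; split; last first.
  by apply: (cvg_le_bound (fF i)) => n; apply: le_trans (ler_norm _) (fg _ _).
 rewrite lerNl; apply: (@cvg_le_bound (fun n => - f n i)); first exact: cvgN.
 by move=> n; apply: le_trans (ler_norm _) _; rewrite normrN.
apply/cvg_eps => /= e e0; have e3 : 0 < e / 3 by rewrite divr_gt0.
have [s us H] := asum_tail_le sg e3.
have /cvg_eps/(_ _ e3)[n0 h] : (\sum_(i <- s) f n i) @[n --> \oo] --> \sum_(i <- s) F i.
 exact: cvg_bigsum.
exists n0 => n /h hn.
have H1 := H (f n) (fun i => le_trans (fg n i) (ler_norm _)).
have H2 := H F (fun i => le_trans (Fg i) (ler_norm _)).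
have -> : asum setT (f n) - asum setT F =
 (asum setT (f n) - \sum_(i <- s) f n i) +
 (\sum_(i <- s) f n i - \sum_(i <- s) F i) - (asum setT F - \sum_(i <- s) F i) by ring.
apply: (le_trans (ler_normB _ _)); apply: (le_trans (lerD (ler_normD _ _) (lexx _))).
by lra.
Qed.

Lemma nneg_summ_nat (f : nat -> R) (C : R) : (forall n, 0 <= f n) ->
 (forall n, \sum_(i < n) f i <= C) -> summ f /\ asum setT f <= C.
Proof.
move=> f0 H.
have K (s : seq nat) : uniq s -> \sum_(i <- s) f i <= C.
 move=> us; apply: le_trans (H (\max_(i <- s) i).+1).
 rewrite -(big_mkord xpredT); apply: ler_sum_subseq => //; first exact: iota_uniq.
 move=> i si; rewrite mem_index_iota/= ltnS.
 by apply: (@leq_bigmax_seq _ s xpredT (fun i => i)).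
split; last exact: asum_le_bound.
by exists C => s /K; congr (_ <= _); apply: eq_bigr => i _; rewrite ger0_norm.
Qed.

Lemma asum_nat_cvg (f : nat -> R) : summ f ->
 \sum_(i < n) f i @[n --> \oo] --> asum setT f.
Proof.
move=> sf; have key n : asum setT (fun i => if (i < n)%N then f i else 0) = \sum_(i < n) f i.
 rewrite -(big_mkord xpredT) (@asum_seq _ _ (index_iota 0 n)) ?iota_uniq//.
  by rewrite big_seq [RHS]big_seq; apply: eq_bigr => i; rewrite mem_index_iota => /andP[_ ->].
 by move=> i; rewrite mem_index_iota/= => /negbTE ->.
under eq_fun do rewrite -key.
apply: (asum_dominated (g := fun i => `|f i|)); first exact: summ_abs.
 by move=> n i; case: ifP => //; rewrite normr0.
move=> i; apply/cvg_eps => e e0; exists i.+1 => n ni; rewrite ni subrr normr0; exact: ltW.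
Qed.

Lemma nneg_asum_nat_ge (f : nat -> R) n : (forall n, 0 <= f n) -> summ f ->
 \sum_(i < n) f i <= asum setT f.
Proof.
move=> f0 sf; rewrite -(big_mkord xpredT); apply: sum_finite_le_asum => //.
exact: iota_uniq.
Qed.

(** Connects summability with convergence of series, the form in which the critical point is
    defined. *)
Lemma summ_series_cvg (f : nat -> R) : (forall n, 0 <= f n) ->
 summ f <-> cvgn (series f).
Proof.
move=> f0; split=> [/asum_nat_cvg H|H].
 apply/cvg_ex; exists (asum setT f); move: H; apply: cvg_trans; apply: near_eq_cvg.
 by near=> n; rewrite /series/= big_mkord.
apply: (proj1 (@nneg_summ_nat f (limn (series f)) f0 _)) => n.
have := @nondecreasing_cvgn_le _ (series f) _ H n; rewrite /series/= big_mkord; apply.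
by apply/nondecreasing_seqP => m; rewrite /series/= big_nat_recr//= lerDl.
Unshelve. all: by end_near.
Qed.

End asum_theory.

Lemma eq_asum_to (R : realType) (I : choiceType) (A : set I) (g f : I -> R) : f =1 g -> asum A f = asum A g.
Proof. exact: eq_asum. Qed.
Arguments eq_asum_to {R I A} g {f}.

(** * Walks as sequences of independent steps *)

Definition pos d (ys : seq 'rV[int]_d) : 'rV[int]_d := \sum_(y <- ys) y.

Definition walk d (ys : seq 'rV[int]_d) (i : nat) : 'rV[int]_d := pos (take i ys).

Definition bnd (R : realType) d (phi : seq 'rV[int]_d -> R) : Prop :=
 exists C : R, forall ys, `|phi ys| <= C.

Definition bddf (R : realType) d (f : 'rV[int]_d -> R) : Prop := exists C : R, forall x, `|f x| <= C.

Definition step_weight (R : realType) d (D : 'rV[int]_d -> R) (ys : seq 'rV[int]_d) : R :=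
 \prod_(y <- ys) D y.

(** A walk is recorded by its steps instead of its sites: the weight is then a product measure, of
    total mass 1 when [D] sums to 1, and every bounded functional of the walk is summable. *)
Definition expect (R : realType) d (D : 'rV[int]_d -> R) n (phi : seq 'rV[int]_d -> R) : R :=
 \asum_(ys : n.-tuple 'rV[int]_d) (step_weight D ys * phi ys).

Lemma bddf_cst (R : realType) d (C : R) : bddf (fun _ : 'rV[int]_d => C).
Proof. by exists `|C|. Qed.
Arguments bddf_cst {R d} C.

Section bounded.
Variables (R : realType) (d : nat).
Local Notation Zd := 'rV[int]_d.
Implicit Types (phi psi : seq Zd -> R).

Lemma bnd_cst c : bnd (fun _ : seq Zd => c : R).
Proof. by exists `|c|. Qed.

Lemma bndD phi psi : bnd phi -> bnd psi -> bnd (fun ys => phi ys + psi ys).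
Proof.
move=> [C H] [C' H']; exists (C + C') => ys.
by apply: (le_trans (ler_normD _ _)); exact: lerD.
Qed.

Lemma bndN phi : bnd phi -> bnd (fun ys => - phi ys).
Proof. by move=> [C H]; exists C => ys; rewrite normrN. Qed.

Lemma bndB phi psi : bnd phi -> bnd psi -> bnd (fun ys => phi ys - psi ys).
Proof. by move=> h1 h2; apply: bndD => //; exact: bndN. Qed.

Lemma bndM phi psi : bnd phi -> bnd psi -> bnd (fun ys => phi ys * psi ys).
Proof.
move=> [C H] [C' H']; exists (C * C') => ys.
by rewrite normrM ler_pM.
Qed.

Lemma bnd_abs phi : bnd phi -> bnd (fun ys => `|phi ys|).
Proof. by move=> [C H]; exists C => ys; rewrite normr_id. Qed.

Lemma bnd_bool (P : seq Zd -> bool) : bnd (fun ys => (P ys)%:R : R).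
Proof. by exists 1 => ys; case: (P ys); rewrite ?normr1 ?normr0. Qed.

Lemma bnd_cos (f : seq Zd -> R) : bnd (fun ys => cos (f ys)).
Proof. by exists 1 => ys; exact: cos_max. Qed.

Lemma bnd_sin (f : seq Zd -> R) : bnd (fun ys => sin (f ys)).
Proof. by exists 1 => ys; exact: sin_max. Qed.

Lemma bnd_comp phi (f : seq Zd -> seq Zd) : bnd phi -> bnd (fun ys => phi (f ys)).
Proof. by move=> [C H]; exists C. Qed.

Lemma bnd_sum (T : Type) (r : seq T) (P : pred T) (f : T -> seq Zd -> R) :
 (forall t, bnd (f t)) -> bnd (fun ys => \sum_(t <- r | P t) f t ys).
Proof.
move=> H; elim: r => [|t r IH].
 by exists 0 => ys; rewrite big_nil normr0.
have [C h] := IH; have [C' h'] := H t; exists (C' + C) => ys; rewrite big_cons.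
have C0 : 0 <= C' by apply: le_trans (h' [::]).
case: (P t); last by apply: (le_trans (h _)); rewrite lerDr.
by apply: (le_trans (ler_normD _ _)); exact: lerD.
Qed.

End bounded.
#[export] Hint Resolve bnd_cst bndD bndN bndB bndM bnd_abs bnd_bool bnd_cos bnd_sin : bnd.
#[export] Hint Extern 2 (bnd (fun ys => ?F (take ?i ys))) => apply: (@bnd_comp _ _ F (take i)) : bnd.
#[export] Hint Extern 2 (bnd (fun ys => ?F (drop ?i ys))) => apply: (@bnd_comp _ _ F (drop i)) : bnd.
#[export] Hint Extern 2 (bnd (fun ys => ?F (take ?i (drop ?j ys)))) =>
 apply: (@bnd_comp _ _ F (fun ys => take i (drop j ys))) : bnd.
Ltac bounded := solve [auto 9 with bnd].

Section positions.
Variable d : nat.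
Implicit Types ys zs : seq 'rV[int]_d.

Lemma pos_nil : pos [::] = 0 :> 'rV[int]_d. Proof. by rewrite /pos big_nil. Qed.

Lemma pos_cat ys zs : pos (ys ++ zs) = pos ys + pos zs.
Proof. by rewrite /pos big_cat. Qed.

Lemma pos_cons y ys : pos (y :: ys) = y + pos ys.
Proof. by rewrite /pos big_cons. Qed.

Lemma walk0 ys : walk ys 0 = 0.
Proof. by rewrite /walk take0 pos_nil. Qed.

Lemma walk_size ys : walk ys (size ys) = pos ys.
Proof. by rewrite /walk take_size. Qed.

Lemma walk_take ys n i : (i <= n)%N -> walk (take n ys) i = walk ys i.
Proof. by move=> h; rewrite /walk take_takel. Qed.

Lemma walk_drop ys a i : walk (drop a ys) i = walk ys (a + i) - walk ys a.
Proof. by rewrite /walk takeD pos_cat addrC addKr. Qed.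

Lemma walkS ys i : (i < size ys)%N -> walk ys i.+1 = walk ys i + ys`_i.
Proof. by move=> h; rewrite /walk (take_nth 0)// -cats1 pos_cat pos_cons pos_nil addr0. Qed.

End positions.

Section expectation.
Variables (R : realType) (d : nat) (D : 'rV[int]_d -> R).
Local Notation Zd := 'rV[int]_d.
Local Notation E := (expect D).
Local Notation W := (step_weight D).
Hypotheses (D_ge0 : forall x, 0 <= D x)
 (D_summ : summ D)
 (D_sum1 : asum setT D = 1).
Implicit Types (phi psi : seq Zd -> R).

Lemma step_weight_ge0 ys : 0 <= W ys.
Proof. by rewrite /step_weight; apply: prodr_ge0. Qed.

Lemma step_weight_cat ys zs : W (ys ++ zs) = W ys * W zs.
Proof. by rewrite /step_weight big_cat. Qed.

Lemma cons_tuple_bij n : bijective (fun p : Zd * n.-tuple Zd => [tuple of p.1 :: p.2]).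
Proof.
exists (fun t : n.+1.-tuple Zd => (thead t, [tuple of behead t])) => [[x t]|t] /=.
 by congr pair; apply: val_inj.
by rewrite -tuple_eta.
Qed.

Lemma cat_tuple_bij n m :
 bijective (fun p : n.-tuple Zd * m.-tuple Zd => [tuple of p.1 ++ p.2]).
Proof.
have s1 (t : (n + m).-tuple Zd) : size (take n t) == n.
 by rewrite size_takel// size_tuple leq_addr.
have s2 (t : (n + m).-tuple Zd) : size (drop n t) == m.
 by rewrite size_drop size_tuple addKn.
exists (fun t : (n + m).-tuple Zd => (Tuple (s1 t), Tuple (s2 t))) => [[x t]|t] /=.
 congr pair; apply: val_inj => /=.
  by rewrite take_size_cat// size_tuple.
 by rewrite drop_size_cat// size_tuple.
by apply: val_inj; rewrite /= cat_take_drop.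
Qed.

Lemma tuple0_single (f : 0.-tuple Zd -> R) : summ f /\ asum setT f = f [tuple].
Proof.
by split; [apply: (@summ_single _ _ _ [tuple])|apply: asum_single] => t;
 rewrite (tuple0 t) eqxx.
Qed.

Lemma step_weight_summ n : summ (fun ys : n.-tuple Zd => W ys).
Proof.
elim: n => [|n IH]; first by have [] := tuple0_single (fun t => W t).
apply/(summ_bij _ (cons_tuple_bij n)).
apply: eq_summ (summ_prod D_summ IH) => -[y ys] /=.
by rewrite /step_weight big_cons.
Qed.

Lemma expect_summ n phi : bnd phi -> summ (fun ys : n.-tuple Zd => W ys * phi ys).
Proof. by move=> [C H]; apply: (@summ_bndM _ _ _ _ C) => //; exact: step_weight_summ. Qed.

Lemma expect0 phi : E 0 phi = phi [::].
Proof. by rewrite /expect (tuple0_single _).2 /step_weight big_nil mul1r. Qed.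

Lemma tuple1_bij : bijective (fun y : Zd => [tuple y]).
Proof.
exists (fun t : 1.-tuple Zd => thead t) => [y|t] //.
by case/tupleP: t => y t; rewrite theadE (tuple0 t); apply: val_inj.
Qed.

Lemma expect_one phi : E 1 phi = \asum_y (D y * phi [:: y]).
Proof.
rewrite /expect (asum_bij _ tuple1_bij); apply: eq_asum => y.
by rewrite /step_weight big_seq1.
Qed.

Lemma eq_expect n phi psi : (forall ys, size ys = n -> phi ys = psi ys) -> E n phi = E n psi.
Proof. by move=> H; apply: eq_asum => ys; rewrite H// size_tuple. Qed.

Lemma expect1 n : E n (fun=> 1) = 1.
Proof.
elim: n => [|n IH]; first by rewrite expect0.
rewrite /expect (asum_bij _ (cons_tuple_bij n)).
under eq_asum do rewrite mulr1.
transitivity (asum setT D * E n (fun=> 1)); last by rewrite IH D_sum1 mulr1.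
rewrite /expect.
have s1 : summ (fun ys : n.-tuple Zd => W ys * 1) := @expect_summ n (fun=> 1) (bnd_cst _ _).
rewrite -(asum_prod D_summ s1); by apply: eq_asum => -[y ys] /=; rewrite /step_weight big_cons mulr1.
Qed.

Lemma expectD n phi psi : bnd phi -> bnd psi ->
 E n (fun ys => phi ys + psi ys) = E n phi + E n psi.
Proof.
move=> h1 h2; rewrite /expect -asumD; try exact: expect_summ.
by apply: eq_asum => ys; rewrite mulrDr.
Qed.

Lemma expectN n phi : bnd phi -> E n (fun ys => - phi ys) = - E n phi.
Proof.
move=> h1; rewrite /expect -asumN; last exact: expect_summ.
by apply: eq_asum => ys; rewrite mulrN.
Qed.

Lemma expectB n phi psi : bnd phi -> bnd psi ->
 E n (fun ys => phi ys - psi ys) = E n phi - E n psi.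
Proof. by move=> h1 h2; rewrite expectD ?expectN//; exact: bndN. Qed.

Lemma expectZ n phi c : bnd phi -> E n (fun ys => c * phi ys) = c * E n phi.
Proof.
move=> h1; rewrite /expect -asumZ; last exact: expect_summ.
by apply: eq_asum => ys; rewrite mulrCA.
Qed.

Lemma expectZr n phi c : bnd phi -> E n (fun ys => phi ys * c) = E n phi * c.
Proof. by move=> h; rewrite mulrC -expectZ//; apply: eq_expect => ys _; rewrite mulrC. Qed.

Lemma expect_sum n (T : Type) (r : seq T) (P : pred T) (f : T -> seq Zd -> R) :
 (forall t, bnd (f t)) ->
 E n (fun ys => \sum_(t <- r | P t) f t ys) = \sum_(t <- r | P t) E n (f t).
Proof.
move=> H; rewrite /expect -asum_sum; last by move=> t _; exact: expect_summ.
by apply: eq_asum => ys; rewrite mulr_sumr.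
Qed.

Lemma expect_ge0 n phi : (forall ys, size ys = n -> 0 <= phi ys) -> 0 <= E n phi.
Proof.
move=> H; apply: asum_ge0 => ys; rewrite mulr_ge0 ?step_weight_ge0//.
by rewrite H// size_tuple.
Qed.

Lemma expect_le n phi psi : bnd phi -> bnd psi ->
 (forall ys, size ys = n -> phi ys <= psi ys) -> E n phi <= E n psi.
Proof.
move=> h1 h2 H; apply: asum_le; try exact: expect_summ.
by move=> ys; rewrite ler_wpM2l ?step_weight_ge0// H// size_tuple.
Qed.

Lemma expect_norm n phi : bnd phi -> `|E n phi| <= E n (fun ys => `|phi ys|).
Proof.
move=> h; apply: le_trans (ler_norm_asum (expect_summ _ h)) _.
apply: le_of_eq; apply: eq_asum => ys.
by rewrite normrM (ger0_norm (step_weight_ge0 _)).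
Qed.

(** Independence of the first [n] and the last [m] steps, as Fubini on pairs of tuples. *)
Lemma expect_cat n m phi : bnd phi ->
 E (n + m) phi = E n (fun ys => E m (fun zs => phi (ys ++ zs))).
Proof.
move=> h; rewrite /expect (asum_bij _ (cat_tuple_bij n m)) asum_pair/=; last first.
 exact: (iffLR (summ_bij _ (cat_tuple_bij n m)) (expect_summ _ h)).
apply: eq_asum => ys; rewrite -asumZ.
 by apply: eq_asum => zs; rewrite step_weight_cat mulrA.
exact: (expect_summ m (bnd_comp (fun zs => ys ++ zs) h)).
Qed.

Lemma expect_inner_bnd m phi : bnd phi -> bnd (fun ys => E m (fun zs => phi (ys ++ zs))).
Proof.
move=> [C H]; exists C => ys; apply: (le_trans (expect_norm _ _)).
 by exists C.
rewrite -[leRHS]mulr1 -(expect1 m) -expectZ; last exact: bnd_cst.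
apply: expect_le; [by exists C => zs; rewrite normr_id| |by move=> zs _; rewrite mulr1].
by exists `|C * 1|.
Qed.

Lemma expect_prod n m phi psi : bnd phi -> bnd psi ->
 E (n + m) (fun ys => phi (take n ys) * psi (drop n ys)) = E n phi * E m psi.
Proof.
move=> h1 h2; rewrite expect_cat; last bounded.
rewrite -expectZr//; apply: eq_expect => ys sys.
rewrite -expectZ//; apply: eq_expect => zs _.
by rewrite take_size_cat// drop_size_cat.
Qed.

Lemma expect_prod_at a n phi psi : (a <= n)%N -> bnd phi -> bnd psi ->
 E n (fun ys => phi (take a ys) * psi (drop a ys)) = E a phi * E (n - a) psi.
Proof. by move=> an h1 h2; rewrite -expect_prod// subnKC. Qed.

Lemma expect_map n (T : Zd -> Zd) phi : bijective T -> (forall x, D (T x) = D x) ->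
 E n (fun ys => phi (map T ys)) = E n phi.
Proof.
move=> [T' TK T'K] DT.
have b : bijective (fun ys : n.-tuple Zd => [tuple of map T ys]).
 exists (fun ys : n.-tuple Zd => [tuple of map T' ys]) => ys; apply: val_inj => /=.
  by rewrite -map_comp map_id_in// => y _ /=; rewrite TK.
 by rewrite -map_comp map_id_in// => y _ /=; rewrite T'K.
rewrite [RHS]/expect (asum_bij _ b); apply: eq_asum => ys /=.
by congr (_ * _); rewrite /step_weight big_map; apply: eq_bigr => y _; rewrite DT.
Qed.

Lemma at_pos_pair_summ n phi (f : Zd -> R) : bnd phi -> bddf f ->
 summ (fun p : n.-tuple Zd * Zd => W p.1 * (phi p.1 * (pos p.1 == p.2)%:R) * f p.2).
Proof.
move=> h [C fC].
apply: (@summ_pair _ _ _ (fun (ys : n.-tuple Zd) y => W ys * (phi ys * (pos ys == y)%:R) * f y)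
 (fun ys : n.-tuple Zd => W ys * `|phi ys| * C)).
- move=> ys; apply: (@summ_single _ _ _ (pos ys)) => y; rewrite eq_sym => /negbTE ->.
 by rewrite !mulr0 mul0r.
- move=> ys; rewrite (@asum_single _ _ _ (pos ys)); last first.
  by move=> y; rewrite eq_sym => /negbTE ->; rewrite !mulr0 mul0r normr0.
 rewrite eqxx mulr1 !normrM (ger0_norm (step_weight_ge0 _)) ler_wpM2l//.
 by rewrite mulr_ge0 ?step_weight_ge0.
- by apply: summZr; exact: (expect_summ _ (bnd_abs h)).
Qed.

(** Fubini between walks and endpoints: for each walk only the single site [pos ys] contributes. *)
Lemma expect_at_pos n phi (f : Zd -> R) : bnd phi -> bddf f ->
 summ (fun y => E n (fun ys => phi ys * (pos ys == y)%:R) * f y) /\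
 \asum_y (E n (fun ys => phi ys * (pos ys == y)%:R) * f y) =
 E n (fun ys => phi ys * f (pos ys)).
Proof.
move=> h fC; have S := at_pos_pair_summ n h fC.
have e y : E n (fun ys => phi ys * (pos ys == y)%:R) * f y =
  \asum_(ys : n.-tuple Zd) (W ys * (phi ys * (pos ys == y)%:R) * f y).
 rewrite asumZr//.
 exact: (@expect_summ n (fun ys => phi ys * (pos ys == y)%:R) (bndM h (bnd_bool _ _))).
have S' := summ_swap (f := fun (ys : n.-tuple Zd) y => W ys * (phi ys * (pos ys == y)%:R) * f y) S.
split.
 under eq_fun do rewrite e.
 exact: (summ_pair_sum S').
under eq_asum do rewrite e.
rewrite -(@asum_swap _ _ _ (fun (ys : n.-tuple Zd) y => W ys * (phi ys * (pos ys == y)%:R) * f y) S).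
apply: eq_asum => ys; rewrite (@asum_single _ _ _ (pos ys)); last first.
 by move=> y; rewrite eq_sym => /negbTE ->; rewrite !mulr0 mul0r.
by rewrite eqxx mulr1 mulrA.
Qed.

Lemma expect_at_pos_summ n phi : bnd phi ->
 summ (fun y => E n (fun ys => phi ys * (pos ys == y)%:R)).
Proof.
move=> h; have [|S _] := @expect_at_pos n phi (fun=> 1) h; first by exists 1 => _; rewrite normr1.
by apply: eq_summ S => y; rewrite mulr1.
Qed.

Lemma expect_at_pos_sum n phi : bnd phi ->
 \asum_y E n (fun ys => phi ys * (pos ys == y)%:R) = E n phi.
Proof.
move=> h; have [|_ S] := @expect_at_pos n phi (fun=> 1) h; first by exists 1 => _; rewrite normr1.
transitivity (E n (fun ys => phi ys * 1)); last by apply: eq_expect => ys _; rewrite mulr1.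
by rewrite -S; apply: eq_asum => y; rewrite mulr1.
Qed.

Lemma expect_at_pos_bnd n phi : bnd phi ->
 exists C : R, forall y, `|E n (fun ys => phi ys * (pos ys == y)%:R)| <= C.
Proof.
move=> [C H]; exists C => y; apply: (le_trans (expect_norm _ _)).
 by apply: bndM; [exists C|exact: bnd_bool].
have -> : C = E n (fun=> C * 1) by rewrite expectZ ?expect1 ?mulr1//; exact: bnd_cst.
apply: expect_le.
- by apply: bnd_abs; apply: bndM; [exists C|exact: bnd_bool].
- exact: bnd_cst.
- move=> ys _; rewrite mulr1 normrM; case: (_ == _); rewrite ?normr1 ?mulr1// normr0 mulr0.
 by apply: le_trans (H ys).
Qed.

(** Convolving endpoint laws amounts to concatenating the walks, with the two functionals looking at
    disjoint blocks of steps. *)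
Lemma conv_expect n m phi psi x : bnd phi -> bnd psi ->
 Defs.conv (fun y => E n (fun ys => phi ys * (pos ys == y)%:R))
    (fun y => E m (fun ys => psi ys * (pos ys == y)%:R)) x =
 E (n + m) (fun ys => phi (take n ys) * psi (drop n ys) * (pos ys == x)%:R).
Proof.
move=> h1 h2; rewrite /Defs.conv.
have [C HC] := expect_at_pos_bnd m h2.
rewrite (expect_at_pos n h1 (f := fun y => E m (fun ys => psi ys * (pos ys == x - y)%:R)) _).2; last by exists C.
rewrite expect_cat; last bounded.
apply: eq_expect => ys sys; rewrite -expectZ; last bounded.
apply: eq_expect => zs _; rewrite take_size_cat// drop_size_cat// pos_cat mulrA; congr (_ * _).
by rewrite eq_sym subr_eq eq_sym addrC.
Qed.

End expectation.

(** * The lace expansion of the self-avoidance indicator *)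

Section walk_predicates.
Variable T : eqType.
Implicit Types w : nat -> T.

Definition saw_on w a b : bool :=
 (a <= b)%N && uniq [seq w i | i <- index_iota a b.+1].

Definition hits w a b (x : T) : bool := x \in [seq w i | i <- index_iota a b].

Definition no_hit w a b c e : bool := all (fun i => ~~ hits w a b (w i)) (index_iota c e).

(** Here [[a, b)] is a past that may not be revisited and [[b, n]] the current stretch. Time [b]
    itself is not compared with the past. *)
Definition avoids w a b n : bool := saw_on w b n && no_hit w a b b.+1 n.+1.

(** These are the bonds of the lace. After the return at [c] the next past to be avoided is
    [[b, c)]. *)
Definition first_hit w a b c : bool :=
 [&& (b < c)%N, saw_on w b c, hits w a b (w c) & no_hit w a b b.+1 c].

Lemma saw_onP w a b : reflect ((a <= b)%N /\
  forall i j, (a <= i)%N -> (i < j)%N -> (j <= b)%N -> w i != w j) (saw_on w a b).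
Proof.
apply: (iffP andP) => [[ab /uniqP U]|[ab H]]; split=> //.
 move=> i j ai ij jb; apply/eqP => e.
 have sz k : (a <= k)%N -> (k <= b)%N -> (k - a < b.+1 - a)%N by lia.
 have nthE k : (a <= k)%N -> (k <= b)%N ->
   nth (w a) [seq w i | i <- index_iota a b.+1] (k - a) = w k.
  by move=> ak kb; rewrite (nth_map 0%N) ?size_iota ?sz// nth_iota ?sz// subnKC.
 have := U (w a) (i - a)%N (j - a)%N; rewrite !inE size_map size_iota.
 rewrite !sz//; try lia.
 rewrite !nthE//; try lia.
 by move=> /(_ isT isT e); lia.
rewrite map_inj_in_uniq ?iota_uniq// => i j; rewrite !mem_index_iota => hi hj e.
apply/eqP; rewrite eqn_leq leqNgt [X in _ && X]leqNgt -negb_or; apply/negP => /orP[] h.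
 by have := H j i ltac:(lia) h ltac:(lia); rewrite e eqxx.
by have := H i j ltac:(lia) h ltac:(lia); rewrite e eqxx.
Qed.

Lemma hitsP w a b x : reflect (exists i, [/\ (a <= i)%N, (i < b)%N & x = w i]) (hits w a b x).
Proof.
apply: (iffP mapP) => [[k]|[i [ai ib e]]].
 by rewrite mem_index_iota => /andP[ak kb] ->; exists k.
by exists i => //; rewrite mem_index_iota ai.
Qed.

Lemma no_hitP w a b c e : reflect (forall i j, (c <= i)%N -> (i < e)%N -> (a <= j)%N ->
  (j < b)%N -> w i != w j) (no_hit w a b c e).
Proof.
apply: (iffP allP) => H.
 move=> i j ci ie aj jb; apply/eqP => ee.
 by have := H i; rewrite mem_index_iota ci ie => /(_ isT)/hitsP; apply; exists j.
move=> i; rewrite mem_index_iota => /andP[ci ie]; apply/hitsP => -[j [aj jb ee]].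
by have /eqP := H i j ci ie aj jb.
Qed.

Lemma saw_on_sub w a b c e : saw_on w a b -> (a <= c)%N -> (c <= e)%N -> (e <= b)%N ->
 saw_on w c e.
Proof.
move=> /saw_onP[ab H] ac ce eb; apply/saw_onP; split=> // i j ci ij je.
by apply: H; lia.
Qed.

Lemma saw_on_refl w a : saw_on w a a.
Proof. by apply/saw_onP; split=> // i j; lia. Qed.

End walk_predicates.

Section lace_identity.
Variables (R : realType) (T : eqType).
Implicit Types w : nat -> T.

Local Notation K w a b := ((saw_on w a b)%:R : R).
Local Notation Av w a b n := ((avoids w a b n)%:R : R).
Local Notation Y w a b c := ((first_hit w a b c)%:R : R).

(** On a self-avoiding stretch that meets the past, let [c] be the first return: self-avoidance of
    [[b, n]] contains that of [[c, n]] and the avoidance of [[b, c)] afterwards. Conversely these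
    two, with [[b, c]] self-avoiding, glue to [[b, n]]. The bound [N] gives all sums a common
    range. *)
Lemma avoids_first_hit w a b n N : (n < N)%N -> (b <= n)%N ->
 Av w a b n = K w b n - \sum_(c < N) Y w a b c * Av w b c n.
Proof.
move=> nN bn; case: (boolP (saw_on w b n)) => Kbn; last first.
 rewrite /avoids (negbTE Kbn)/= sub0r big1 ?oppr0// => c _.
 rewrite -natrM mulnb; case: andP => // -[/and4P[bc sc _ _]] /andP[sn /no_hitP h].
 case/negP: Kbn; apply/saw_onP; split=> // i j bi ij jn.
 have [jc|cj] := leqP j c; first by move/saw_onP: sc => [_]; apply.
 have [ci|ic] := leqP c i; first by move/saw_onP: sn => [_]; apply.
 by rewrite eq_sym h.
case: (boolP (no_hit w a b b.+1 n.+1)) => nh.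
 rewrite /avoids Kbn nh big1 ?subr0// => c _.
 rewrite -natrM mulnb; case: andP => // -[/and4P[bc sc /hitsP[i [ai ib e]] _]] /andP[/andP[cn _] _].
 by move/no_hitP: nh => /(_ c i bc ltac:(lia) ai ib)/eqP.
rewrite /avoids Kbn (negbTE nh)/=.
have exc : exists c, (b < c <= n)%N && hits w a b (w c).
 have /allPn[c] := nh; rewrite mem_index_iota => hc /negPn hh.
 by exists c; rewrite hh andbT; lia.
case: (ex_minnP exc) => c /andP[/andP[bc cn] hc] cmin.
have cN : (c < N)%N by lia.
rewrite (bigD1 (Ordinal cN))//= big1 ?addr0.
 rewrite -natrM mulnb; have -> : first_hit w a b c.
  rewrite /first_hit bc hc (saw_on_sub Kbn)//=; last by lia.
  by apply/allP => i; rewrite mem_index_iota => /andP[bi ic]; apply/negP => hi;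
   have := cmin i; rewrite hi; lia.
 have -> : saw_on w c n by apply: (saw_on_sub Kbn); lia.
 have -> : no_hit w b c c.+1 n.+1; last by rewrite subrr.
 apply/no_hitP => i j ci iN bj jc; rewrite eq_sym.
 by move/saw_onP: Kbn => [_]; apply; lia.
move=> e /negP ne; rewrite -natrM mulnb; case: andP => // -[/and4P[be se he he'] /andP[/andP[en _] _]].
case: ne; apply/eqP/val_inj => /=.
have ce : (c <= e)%N by apply: cmin; rewrite he; lia.
have [//|] := eqVneq (nat_of_ord e) c => enc.
move/allP: he' => /(_ c); rewrite mem_index_iota hc => /(_ ltac:(lia)) //.
Qed.

Fixpoint lace_rec (f : nat) w a b n : R :=
 if f is f'.+1 then
  - Y w a b n - \sum_(c < n) Y w a b c * lace_rec f' w b c n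
 else 0.

(* The signed sum over the laces of [[a, n]] whose first bond ends in [b]. *)
Definition lace w a b n : R := lace_rec n w a b n.

(** A bond moves [b] strictly to the right, so fuel [n - b] already exhausts the recursion. *)
Lemma lace_rec_fuel f f' w a b n : (n - b <= f)%N -> (n - b <= f')%N ->
 lace_rec f w a b n = lace_rec f' w a b n.
Proof.
elim: f f' a b => [|f IH] [|f'] a b hf hf' //=.
- have nb : (n <= b)%N by lia.
 rewrite /first_hit ltnNge nb/= oppr0 sub0r big1 ?oppr0// => c _.
 by case: ltnP => //= bc; [have := ltn_ord c; lia|rewrite mul0r].
- have nb : (n <= b)%N by lia.
 rewrite /first_hit ltnNge nb/= oppr0 sub0r big1 ?oppr0// => c _.
 by case: ltnP => //= bc; [have := ltn_ord c; lia|rewrite mul0r].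
- congr (_ - _); apply: eq_bigr => c _; case: (ltnP b c) => bc.
  by congr (_ * _); apply: IH; lia.
 by rewrite /first_hit ltnNge bc/= !mul0r.
Qed.

Lemma lace_small w a b n : (n <= b)%N -> lace w a b n = 0.
Proof. by move=> nb; rewrite /lace (@lace_rec_fuel n 0)//; lia. Qed.

Lemma sum_ord_extend (n N : nat) (F : nat -> R) : (n <= N)%N ->
 (forall c, (n <= c)%N -> F c = 0) -> \sum_(c < N) F c = \sum_(c < n) F c.
Proof.
move=> nN F0; rewrite -!(big_mkord xpredT F) (big_cat_nat _ nN)//=.
rewrite [X in _ + X]big_nat_cond [X in _ + X]big1 ?addr0// => c /andP[/andP[nc _] _].
exact: F0.
Qed.

Lemma laceE w a b n N : (n <= N)%N ->
 lace w a b n = - Y w a b n - \sum_(c < N) Y w a b c * lace w b c n.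
Proof.
move=> nN; rewrite (@sum_ord_extend n N (fun c => Y w a b c * lace w b c n))//; last first.
 by move=> c nc; rewrite lace_small// mulr0.
by rewrite {1}/lace (@lace_rec_fuel n n.+1)//=; lia.
Qed.

(** Iteration of [avoids_first_hit]: the leftover avoidance indicator starts at a later time, and
    the alternating signs collect in [lace]. *)
Lemma avoids_lace w a b n N : (n < N)%N -> (b <= n)%N ->
 Av w a b n = K w b n + \sum_(c < N) lace w a b c * K w c n.
Proof.
move=> nN; move: {2}(n - b)%N (leqnn (n - b)%N) => f; elim: f a b => [|f IH] a b hf bn.
 rewrite (avoids_first_hit w a nN bn) [in RHS]big1; last first.
  move=> c _; case: (leqP c n) => cn; first by rewrite lace_small ?mul0r//; lia.
  by rewrite /saw_on leqNgt cn/= mulr0.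
 rewrite addr0 big1 ?subr0// => c _; case: (leqP c n) => cn.
  by rewrite /first_hit (_ : (b < c)%N = false) ?mul0r//; lia.
 by rewrite /avoids /saw_on leqNgt cn/= mulr0.
rewrite (avoids_first_hit w a nN bn); congr (_ + _).
have E c : Y w a b c * Av w b c n =
  Y w a b c * (K w c n + \sum_(e < N) lace w b c e * K w e n).
 case: (boolP (first_hit w a b c)) => [/andP[bc _]|_]; last by rewrite !mul0r.
 case: (leqP c n) => cn; first by rewrite (IH b c)//; lia.
 rewrite /avoids [in X in _ * (X + _)]/saw_on [saw_on w c n]/saw_on leqNgt cn/= add0r.
 rewrite big1// => e _; case: (leqP e n) => en; first by rewrite lace_small ?mul0r//; lia.
 by rewrite /saw_on leqNgt en/= mulr0.
under eq_bigr do rewrite E.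
under eq_bigr do rewrite mulrDr mulr_sumr.
rewrite big_split/= exchange_big/= opprD -!sumrN -big_split/=; apply: eq_bigr => e _.
rewrite (laceE w a b (n := e) (N := N)); last exact: ltnW.
rewrite mulrBl mulNr; congr (_ - _).
by rewrite mulr_suml; apply: eq_bigr => c _; rewrite mulrA.
Qed.

(* Entry [(a, b)] of [1 - K^-1], where [K] is the upper triangular matrix of
  self-avoidance indicators. *)
Definition bond w a b : R := (b == a.+1)%:R + lace w a a.+1 b.

(** With the one-point past [[a, a.+1)], [avoids] does not compare the times [a] and [a.+1]. This is
    the missing condition; it holds on every walk of nonzero weight because [D 0 = 0]. *)
Definition moving w n := forall i, (i < n)%N -> w i != w i.+1.

Lemma saw_on_bond w a n N : (n < N)%N -> (a < n)%N -> moving w n ->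
 K w a n = \sum_(c < N) bond w a c * K w c n.
Proof.
move=> nN an mw; under eq_bigr do rewrite mulrDl.
have a1N : (a.+1 < N)%N by lia.
rewrite big_split/= (bigD1 (Ordinal a1N))//= eqxx mul1r big1 ?addr0; last first.
 by move=> c; rewrite -val_eqE /= => /negbTE ->; rewrite mul0r.
rewrite -(avoids_lace w a nN)//; congr (_%:R); congr nat_of_bool.
apply/idP/idP => [/saw_onP[_ H]|/andP[/saw_onP[_ H] /no_hitP h]].
 rewrite /avoids; apply/andP; split; first by apply/saw_onP; split=> // i j ai; apply: H; lia.
 by apply/no_hitP => i j ai iN aj ja; rewrite eq_sym; apply: H; lia.
apply/saw_onP; split; first by lia.
move=> i j ai ij jn; have [ia|ia] := eqVneq i a; last by apply: H; lia.
have [ja|ja] := eqVneq j i.+1; first by rewrite ja; apply: mw; lia.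
by rewrite eq_sym; apply: h; lia.
Qed.

(** Cut the chain of bonds from [a] to [n] at [p]: either [p] is an endpoint of a bond, or exactly
    one bond [(i, j)] jumps over it. The induction peels off the first bond on both sides of the
    identity. *)
Lemma saw_on_split w a p n N : (n < N)%N -> (a <= p)%N -> (p <= n)%N -> moving w n ->
 K w a n = K w a p * K w p n +
  \sum_(i < p) \sum_(j < N | (p < j)%N) K w a i * bond w i j * K w j n.
Proof.
move=> nN ap pn mw.
have Kout c e : (e < c)%N -> K w c e = 0 by move=> h; rewrite /saw_on leqNgt h.
have mwp m : (m <= n)%N -> moving w m by move=> mn i im; apply: mw; lia.
move: {2}(p - a)%N (leqnn (p - a)) => f; elim: f a ap => [|f IH] a ap hf.
 have -> : a = p by lia.
 rewrite saw_on_refl mul1r big1 ?addr0// => i _; rewrite big1// => j _.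
 by rewrite Kout ?mul0r.
case: (eqVneq a p) hf => [->|nap] hf.
 rewrite saw_on_refl mul1r big1 ?addr0// => i _; rewrite big1// => j _.
 by rewrite Kout ?mul0r.
have {nap}ap' : (a < p)%N by lia.
have bond0 c : (c <= a)%N -> bond w a c = 0.
 by move=> ca; rewrite /bond lace_small ?addr0; last lia; case: eqP => //; lia.
rewrite (saw_on_bond nN) ?(saw_on_bond (n := p) (N := N))//; try lia; last exact: mwp.
rewrite (bigID (fun c : 'I_N => (c <= p)%N))/=.
have -> : \sum_(c < N | (c <= p)%N) bond w a c * K w c n =
  \sum_(c < N | (c <= p)%N) (bond w a c * (K w c p * K w p n) + bond w a c *
  \sum_(i < p) \sum_(j < N | (p < j)%N) K w c i * bond w i j * K w j n).
 apply: eq_bigr => c cp; have [ca|ac] := leqP c a; first by rewrite bond0 ?mul0r ?addr0.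
 by rewrite -mulrDr -IH//; lia.
rewrite big_split/= -addrA; congr (_ + _).
 rewrite mulr_suml [RHS](bigID (fun c : 'I_N => (c <= p)%N))/=.
 rewrite [X in _ = _ + X]big1 ?addr0; last by move=> c; rewrite -ltnNge => h; rewrite (Kout c p)// mulr0 mul0r.
 by apply: eq_bigr => c _; rewrite mulrA.
rewrite (bigD1 (Ordinal ap'))//= addrC; congr (_ + _).
 rewrite (eq_bigl (fun c : 'I_N => (p < c)%N)); last by move=> c; rewrite ltnNge.
 by apply: eq_bigr => j _; rewrite saw_on_refl mul1r.
under eq_bigr do rewrite mulr_sumr.
rewrite exchange_big/= [LHS](bigD1 (Ordinal ap'))//= [X in X + _]big1 ?add0r; last first.
 move=> c cp; have [ca|ac] := leqP c a; first by rewrite bond0 ?mul0r.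
 by rewrite big1 ?mulr0// => j _; rewrite (Kout c a)// !mul0r.
apply: eq_bigr => i ia.
have [ai|ia'] := ltnP a i; last first.
 have ia'' : (i < a)%N by rewrite ltn_neqAle ia' andbT; move: ia; rewrite -val_eqE.
 rewrite [RHS]big1; last by move=> j _; rewrite Kout ?mul0r.
 rewrite big1// => c _; have [ca|ac] := leqP c a; first by rewrite bond0 ?mul0r.
 by rewrite big1 ?mulr0// => j _; rewrite Kout ?mul0r//; lia.
have ip := ltn_ord i.
rewrite (saw_on_bond (n := i) (N := N)) //; try lia; last by apply: mwp; lia.
under eq_bigr do rewrite mulr_sumr.
rewrite exchange_big/=; apply: eq_bigr => j pj; rewrite !mulr_suml.
rewrite [RHS](bigID (fun c : 'I_N => (c <= p)%N))/= [X in _ = _ + X]big1 ?addr0; last first.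
 by move=> c; rewrite -ltnNge => h; rewrite (Kout c i) ?mulr0 ?mul0r//; have := ltn_ord i; lia.
by apply: eq_bigr => c _; rewrite !mulrA.
Qed.

Lemma saw_on_ext w w' a b : (forall i, (i <= b)%N -> w i = w' i) -> saw_on w a b = saw_on w' a b.
Proof.
move=> H; congr (_ && uniq _); apply/eq_in_map => i; rewrite mem_index_iota => /andP[_ ib].
by apply: H; lia.
Qed.

Lemma first_hit_ext w w' a b c : (forall i, (i <= c)%N -> w i = w' i) ->
 first_hit w a b c = first_hit w' a b c.
Proof.
move=> H; rewrite /first_hit; case: ltnP => //= bc.
have hh x : hits w a b x = hits w' a b x.
 congr (_ \in _); apply/eq_in_map => i; rewrite mem_index_iota => /andP[_ ib]; apply: H; lia.
rewrite (saw_on_ext _ H) hh H//; congr [&& _, _ & _].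
apply: eq_in_all => i; rewrite mem_index_iota => /andP[_ ib]; rewrite hh H//; lia.
Qed.

Lemma lace_rec_ext f w w' a b n : (forall i, (i <= n)%N -> w i = w' i) ->
 lace_rec f w a b n = lace_rec f w' a b n.
Proof.
elim: f a b => [//|f IH] a b H /=; rewrite (first_hit_ext _ _ H); congr (_ - _).
apply: eq_bigr => c _; rewrite IH// (@first_hit_ext w w')// => i ic.
by apply: H; have := ltn_ord c; lia.
Qed.

Lemma lace_ext w w' a b n : (forall i, (i <= n)%N -> w i = w' i) -> lace w a b n = lace w' a b n.
Proof. exact: lace_rec_ext. Qed.

End lace_identity.

Section lace_invariance.
Variables (R : realType) (T T' : eqType).

(** Only equality of sites matters, so an injection of the sites combined with a time shift is
    harmless: this covers restarted walks as well as lattice symmetries. *)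
Lemma saw_on_inj (f : T -> T') (w : nat -> T) s a b : injective f ->
 saw_on (fun i => f (w (s + i)%N)) a b = saw_on w (s + a) (s + b).
Proof.
move=> fi; apply/saw_onP/saw_onP => -[ab H]; split; try lia.
- move=> i j ai ij jb; have := H (i - s)%N (j - s)%N; rewrite !subnKC; try lia.
 by rewrite (inj_eq fi); apply; lia.
- by move=> i j ai ij jb; rewrite (inj_eq fi); apply: H; lia.
Qed.

Lemma first_hit_inj (f : T -> T') (w : nat -> T) s a b c : injective f ->
 first_hit (fun i => f (w (s + i)%N)) a b c = first_hit w (s + a) (s + b) (s + c).
Proof.
move=> fi; rewrite /first_hit ltn_add2l (saw_on_inj _ _ _ _ fi).
have hh x : hits (fun i => f (w (s + i)%N)) a b (f x) = hits w (s + a) (s + b) x.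
 apply/hitsP/hitsP => -[i [ai ib e]]; last first.
  by exists (i - s)%N; rewrite subnKC; [split; [lia|lia|rewrite e]|lia].
 by exists (s + i)%N; split; [lia|lia|exact: fi].
rewrite hh; congr [&& _, _, _ & _]; rewrite /no_hit.
apply/allP/allP => H i; rewrite mem_index_iota => hi.
 by have := H (i - s)%N; rewrite mem_index_iota hh subnKC; [apply; lia|lia].
by rewrite hh; apply: H; rewrite mem_index_iota; lia.
Qed.

Lemma lace_rec_inj (f : T -> T') (w : nat -> T) s k a b n : injective f ->
 lace_rec R k (fun i => f (w (s + i)%N)) a b n = lace_rec R k w (s + a) (s + b) (s + n).
Proof.
move=> fi; elim: k a b => [//|k IH] a b /=; rewrite (first_hit_inj _ _ _ _ _ fi); congr (_ - _).
rewrite -(big_mkord xpredT (fun c => (first_hit w (s + a) (s + b) c)%:R * lace_rec R k w (s + b) c (s + n))).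
rewrite (@big_cat_nat _ _ _ s)//=; last by lia.
rewrite [X in _ = X + _]big_nat_cond [X in _ = X + _]big1 ?add0r; last first.
 by move=> c /andP[/andP[_ cs] _]; rewrite /first_hit ltnNge (_ : (c <= s + b)%N) ?mul0r//; lia.
rewrite -[X in \sum_(X <= _ < _) _]add0n big_addn addKn big_mkord; apply: eq_bigr => c _.
by rewrite (first_hit_inj _ _ _ _ _ fi) IH [(c + s)%N]addnC.
Qed.

Lemma lace_inj (f : T -> T') (w : nat -> T) s a b n : injective f ->
 lace R (fun i => f (w (s + i)%N)) a b n = lace R w (s + a) (s + b) (s + n).
Proof. by move=> fi; rewrite /lace (lace_rec_inj _ _ _ _ _ _ fi); apply: lace_rec_fuel; lia. Qed.

End lace_invariance.

(** * Majorants of the laces by loops *)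

Section lace_majorant.
Variables (R : realType) (T : zmodType).
Implicit Types w : nat -> T.

Definition shiftw (m : nat) w : nat -> T := fun i => w (m + i)%N - w m.

(** At time [m] the pending loop closes at [v]; the next loop must return to an earlier site [w s],
    hence the recentred target [w s - w m]. All avoidance between different stretches is dropped. *)
Fixpoint majorant_rec (f : nat) (v : T) w n : R :=
 if f is f'.+1 then
  (saw_on w 0 n)%:R * (w n == v)%:R +
  \sum_(m < n | (0 < m)%N) (saw_on w 0 m)%:R * (w m == v)%:R *
    \sum_(s < m) majorant_rec f' (w s - w m) (shiftw m w) (n - m)%N
 else 0.

(* Bounds the contribution of the laces whose first bond ends at time [0], at
  the site [v] relative to which the walk [w] is recorded. *)
Definition majorant v w n : R := majorant_rec n v w n.

Lemma majorant_rec_ge0 f v w n : 0 <= majorant_rec f v w n.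
Proof.
elim: f v w n => [//|f IH] v w n /=; apply: addr_ge0; first by rewrite mulr_ge0.
by apply: sumr_ge0 => m _; rewrite !mulr_ge0//; exact: sumr_ge0.
Qed.

Lemma majorant_ge0 v w n : 0 <= majorant v w n.
Proof. exact: majorant_rec_ge0. Qed.

Lemma majorant_rec_fuel f f' v w n : (n <= f)%N -> (n <= f')%N -> (0 < n)%N ->
 majorant_rec f v w n = majorant_rec f' v w n.
Proof.
elim: f f' v w n => [|f IH] [|f'] v w n hf hf' n0 //=; try lia.
congr (_ + _); apply: eq_bigr => m m0; congr (_ * _); apply: eq_bigr => s _.
by apply: IH; have := ltn_ord m; lia.
Qed.

Lemma majorantE v w n : (0 < n)%N -> majorant v w n =
  (saw_on w 0 n)%:R * (w n == v)%:R +
  \sum_(m < n | (0 < m)%N) (saw_on w 0 m)%:R * (w m == v)%:R *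
    \sum_(s < m) majorant (w s - w m) (shiftw m w) (n - m)%N.
Proof.
move=> n0; rewrite /majorant (@majorant_rec_fuel n n.+1)//=; congr (_ + _).
apply: eq_bigr => m m0; congr (_ * _); apply: eq_bigr => s _.
by apply: majorant_rec_fuel; have := ltn_ord m; lia.
Qed.

Lemma majorant_rec_ext f v w w' n : (forall i, (i <= n)%N -> w i = w' i) ->
 majorant_rec f v w n = majorant_rec f v w' n.
Proof.
elim: f v w w' n => [//|f IH] v w w' n H /=; rewrite (saw_on_ext _ H) H//; congr (_ + _).
apply: eq_bigr => m _; have mn := ltn_ord m; rewrite H; last lia.
rewrite (@saw_on_ext _ w w'); last by move=> i im; apply: H; lia.
congr (_ * _); apply: eq_bigr => s _; rewrite H; last by have := ltn_ord s; lia.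
by apply: IH => i hi; rewrite /shiftw !H//; lia.
Qed.

Lemma majorant_ext v w w' n : (forall i, (i <= n)%N -> w i = w' i) ->
 majorant v w n = majorant v w' n.
Proof. exact: majorant_rec_ext. Qed.

Lemma saw_on_shift w m a b : saw_on (shiftw m w) a b = saw_on w (m + a) (m + b).
Proof. exact: (@saw_on_inj _ _ (fun x => x - w m) w m a b (addIr _)). Qed.

Lemma lace_shift w m a b n : lace R (shiftw m w) a b n = lace R w (m + a) (m + b) (m + n).
Proof. exact: (@lace_inj _ _ _ (fun x => x - w m) w m a b n (addIr _)). Qed.

(** Union bound over the time [s] of the past that is hit. *)
Lemma first_hit_le w a b c : (first_hit w a b c)%:R <=
 \sum_(s < b | (a <= s)%N) (b < c)%:R * (saw_on w b c)%:R * (w c == w s)%:R :> R.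
Proof.
case: (boolP (first_hit w a b c)) => [/and4P[bc sc /hitsP[s [as_ sb e]] _]|_]; last first.
 by apply: sumr_ge0 => s _; rewrite !mulr_ge0.
rewrite (bigD1 (Ordinal sb))//= bc sc e eqxx !mulr1 lerDl.
by apply: sumr_ge0 => i _; rewrite !mulr_ge0.
Qed.

(** Absolute values in [laceE] and the union bound for each first return reproduce the recursion of
    [majorant]; most of the proof is reindexing by time shifts. *)
Lemma lace_le_majorant w a b n : (b < n)%N -> `|lace R w a b n| <=
 \sum_(s < b | (a <= s)%N) majorant (w s - w b) (shiftw b w) (n - b)%N.
Proof.
move: {2}(n - b)%N (leqnn (n - b)%N) => f; elim: f a b => [|f IH] a b hf bn; first by lia.
rewrite (laceE _ w a b (leqnn n)); apply: (le_trans (ler_normB _ _)).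
rewrite normrN normr_nat.
have -> : \sum_(s < b | (a <= s)%N) majorant (w s - w b) (shiftw b w) (n - b)%N =
  \sum_(s < b | (a <= s)%N) (b < n)%:R * (saw_on w b n)%:R * (w n == w s)%:R +
  \sum_(c < n) (\sum_(s < b | (a <= s)%N) (b < c)%:R * (saw_on w b c)%:R * (w c == w s)%:R) *
   \sum_(s < c | (b <= s)%N) majorant (w s - w c) (shiftw c w) (n - c)%N.
 rewrite [X in _ = _ + X](eq_bigr _ (fun c _ => mulr_suml _ _ _ _)).
 rewrite [X in _ = _ + X]exchange_big/= -big_split/=; apply: eq_bigr => s _.
 rewrite majorantE; last lia.
 rewrite saw_on_shift addn0 subnKC ?(ltnW bn)// {1}/shiftw subnKC ?(ltnW bn)//.
 rewrite (inj_eq (addIr _)) bn mul1r; congr (_ + _).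
 rewrite -(big_mkord (fun m => 0 < m)%N (fun m => (saw_on (shiftw b w) 0 m)%:R * (shiftw b w m == w s - w b)%:R *
   \sum_(s0 < m) majorant (shiftw b w s0 - shiftw b w m) (shiftw m (shiftw b w)) (n - b - m)%N)).
 rewrite -(big_mkord xpredT (fun c => (b < c)%:R * (saw_on w b c)%:R * (w c == w s)%:R *
   \sum_(i < c | (b <= i)%N) majorant (w i - w c) (shiftw c w) (n - c)%N)).
 rewrite [RHS](@big_cat_nat _ _ _ b)//=; last by lia.
 rewrite [X in _ = X + _]big_nat_cond [X in _ = X + _]big1 ?add0r; last first.
  by move=> c /andP[/andP[_ cb] _]; rewrite ltnNge ltnW//= !mul0r.
 rewrite -[X in \sum_(X <= _ < _) _](add0n b) big_addn [LHS]big_mkcond/=.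
 apply: eq_bigr => m _; case: ltnP => m0; last first.
  by rewrite (_ : (b < m + b)%N = false) ?mul0r//; lia.
 rewrite (_ : (b < m + b)%N = true) ?mul1r; last lia.
 rewrite saw_on_shift addn0 [(b + m)%N]addnC {1}/shiftw [(b + m)%N]addnC (inj_eq (addIr _)).
 congr (_ * _).
 rewrite -(big_mkord xpredT (fun s0 => majorant (shiftw b w s0 - shiftw b w m) (shiftw m (shiftw b w)) (n - b - m)%N)).
 rewrite -(big_mkord (fun i => b <= i)%N (fun i => majorant (w i - w (m + b)%N) (shiftw (m + b) w) (n - (m + b))%N)).
 rewrite [RHS](@big_cat_nat _ _ _ b)//=; last by lia.
 rewrite [X in _ = X + _]big_nat_cond [X in _ = X + _]big1 ?add0r; last first.
  by move=> i /andP[/andP[_ ib] bi]; lia.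
 rewrite -[X in _ = \sum_(X <= _ < _ | _) _](add0n b) big_addn addnK [RHS]big_mkcond/=.
 apply: eq_bigr => i _; rewrite leq_addl.
 have -> : shiftw b w i - shiftw b w m = w (i + b)%N - w (m + b)%N.
  by rewrite /shiftw opprB addrA subrK ![(b + _)%N]addnC.
 have -> : (n - b - m = n - (m + b))%N by lia.
 apply: majorant_ext => j _; rewrite /shiftw opprB addrA subrK.
 by rewrite addnA [(b + m)%N]addnC.
apply: lerD.
 exact: first_hit_le.
apply: (le_trans (ler_norm_sum _ _ _)); apply: ler_sum => c _.
rewrite normrM normr_nat.
case: (boolP (first_hit w a b c)) => fh; last first.
 rewrite mul0r mulr_ge0//; first by apply: sumr_ge0 => s _; rewrite !mulr_ge0.
 by apply: sumr_ge0 => s _; exact: majorant_ge0.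
apply: ler_pM => //; last by move: fh => /andP[bc _]; apply: IH; have := ltn_ord c; lia.
by have := first_hit_le w a b c; rewrite fh.
Qed.

End lace_majorant.

Section finite_convolutions.
Variable R : realType.
Implicit Types f g h : nat -> R.

Lemma double_sum_conv f g N :
 \sum_(n < N) \sum_(m < n) f m * g (n - m)%N =
 \sum_(m < N) f m * \sum_(j < N - m | (0 < j)%N) g j.
Proof.
elim: N => [|N IH]; first by rewrite !big_ord0.
rewrite big_ord_recr/= IH [RHS]big_ord_recr/=.
rewrite subSnn [X in _ + f N * X]big_mkcond big_ord1/= mulr0 addr0 -big_split/=; apply: eq_bigr => m _.
have mN := ltn_ord m.
rewrite subSn; last exact: ltnW.
by rewrite [in RHS]big_mkcond big_ord_recr/= -big_mkcond subn_gt0 mN mulrDr.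
Qed.

Lemma conv_sum_le f g N (F G : R) : (forall n, 0 <= f n) -> (forall n, 0 <= g n) -> 0 <= G ->
 \sum_(s < N) f s <= F -> \sum_(i < N | (0 < i)%N) g i <= G ->
 \sum_(n < N) \sum_(m < n) f m * g (n - m)%N <= F * G.
Proof.
move=> f0 g0 G0 fF gG; rewrite double_sum_conv.
apply: (le_via (\sum_(m < N) f m * G)); last by rewrite -mulr_suml ler_wpM2r.
apply: ler_sum => m _; rewrite ler_wpM2l//; apply: le_trans gG.
have -> : \sum_(i < N | (0 < i)%N) g i = \sum_(0 <= i < N | (0 < i)%N) g i by rewrite big_mkord.
rewrite (@big_cat_nat _ _ _ (N - m))//=; last by rewrite leq_subr.
by rewrite big_mkord lerDl sumr_ge0.
Qed.

(** Truncated generating function of a diagram with three lines. The third line is summed only below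
    [N]: as [m >= 1], its length is [n - m < N], which is what allows induction on the
    truncation. *)
Lemma triple_sum_le f g h N (F G H : R) :
 (forall n, 0 <= f n) -> (forall n, 0 <= g n) -> (forall n, 0 <= h n) ->
 0 <= F -> 0 <= G -> 0 <= H ->
 \sum_(s < N.+1) f s <= F -> \sum_(i < N.+1 | (0 < i)%N) g i <= G ->
 \sum_(j < N | (0 < j)%N) h j <= H ->
 \sum_(n < N.+1 | (0 < n)%N) \sum_(m < n | (0 < m)%N) \sum_(s < m)
  f s * g (m - s)%N * h (n - m)%N <= F * G * H.
Proof.
move=> f0 g0 h0 F0 G0 H0 fF gG hH.
pose q m := \sum_(s < m) f s * g (m - s)%N.
have q0 m : 0 <= q m by apply: sumr_ge0 => s _; rewrite mulr_ge0.
have -> : \sum_(n < N.+1 | (0 < n)%N) \sum_(m < n | (0 < m)%N) \sum_(s < m)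
  f s * g (m - s)%N * h (n - m)%N = \sum_(n < N.+1) \sum_(m < n) q m * h (n - m)%N.
 rewrite big_mkcond; apply: eq_bigr => -[[|n] hn] _ /=; first by rewrite big_ord0.
 rewrite big_mkcond; apply: eq_bigr => -[[|m] hm] _ /=; first by rewrite /q big_ord0 mul0r.
 by rewrite mulr_suml.
rewrite double_sum_conv.
have qFG : \sum_(m < N.+1) q m <= F * G by exact: conv_sum_le.
apply: (le_via (\sum_(m < N.+1) q m * H)); last by rewrite -mulr_suml ler_wpM2r.
apply: ler_sum => -[[|m] hm] _ /=; first by rewrite /q big_ord0 !mul0r.
rewrite ler_wpM2l//; apply: le_trans hH.
have -> : \sum_(i < N | (0 < i)%N) h i = \sum_(0 <= i < N | (0 < i)%N) h i by rewrite big_mkord.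
rewrite (@big_cat_nat _ _ _ (N.+1 - m.+1))//=; last by lia.
by rewrite big_mkord lerDl sumr_ge0.
Qed.

End finite_convolutions.

Section bounded_lace.
Variables (R : realType) (d : nat).
Local Notation Zd := 'rV[int]_d.

Lemma lace_rec_bnd f a b n : exists C : R, forall w : nat -> Zd, `|lace_rec R f w a b n| <= C.
Proof.
elim: f a b => [|f IH] a b; first by exists 0 => w; rewrite normr0.
have /choice[C HC] : forall c : 'I_n, exists C : R, forall w : nat -> Zd, `|lace_rec R f w b c n| <= C.
 by move=> c; exact: IH.
exists (1 + \sum_(c < n) C c) => w /=; apply: (le_trans (ler_normB _ _)).
rewrite normrN; apply: lerD; first by rewrite normr_nat lern1; case: (first_hit _ _ _ _).
apply: (le_trans (ler_norm_sum _ _ _)); apply: ler_sum => c _.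
rewrite normrM normr_nat; apply: le_trans (HC c w).
by rewrite ler_piMl// lern1; case: (first_hit _ _ _ _).
Qed.

Lemma majorant_rec_bnd f n : exists C : R, forall (v : Zd) w, majorant_rec R f v w n <= C.
Proof.
elim: f n => [|f IH] n; first by exists 0.
have /choice[C HC] : forall m : nat, exists C : R, forall (v : Zd) w, majorant_rec R f v w m <= C.
 by move=> m; exact: IH.
have C0 m : 0 <= C m by apply: le_trans (HC m 0 (fun=> 0)); exact: majorant_rec_ge0.
exists (1 + \sum_(m < n) \sum_(s < m) C (n - m)%N) => v w /=; apply: lerD.
 by rewrite -natrM mulnb lern1 leq_b1.
rewrite big_mkcond; apply: ler_sum => m _; case: ifP => _; last by apply: sumr_ge0.
apply: (le_via (\sum_(s < m) majorant_rec R f (w s - w m) (shiftw m w) (n - m))).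
 rewrite -natrM mulnb ler_piMl ?lern1 ?leq_b1//.
 by apply: sumr_ge0 => s _; exact: majorant_rec_ge0.
by apply: ler_sum.
Qed.

End bounded_lace.

(** * Connectivities and diagrams of the self-avoiding walk *)

Section saw_quantities.
Variables (R : realType) (d : nat) (D : 'rV[int]_d -> R).
Local Notation Zd := 'rV[int]_d.
Local Notation E := (expect D).
Hypotheses (D_ge0 : forall x, 0 <= D x)
 (D_summ : summ D)
 (D_sum1 : asum setT D = 1)
 (D_even : forall x, D (- x) = D x).
Implicit Types (ys : seq Zd) (x v p : Zd).

Definition sawf n ys : R := (saw_on (walk ys) 0 n)%:R.
Definition lacef n ys : R := lace R (walk ys) 0 1 n.
Definition csaw n x : R := E n (fun ys => sawf n ys * (pos ys == x)%:R).
Definition ctot n : R := E n (sawf n).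
(** The site [v] is the one to which the first loop returns, so [pos ys - v] is the displacement
    along the whole lace once its first step is put back. *)
Definition amaj (om : Zd -> R) n v : R :=
 E n (fun ys => majorant R v (walk ys) n * om (pos ys - v)).

Lemma sawf_bnd n : bnd (sawf n). Proof. exact: bnd_bool. Qed.

Lemma lacef_bnd n : bnd (lacef n).
Proof. by have [C H] := lace_rec_bnd R d n 0 1 n; exists C => ys; exact: H. Qed.

Lemma majorant_bnd v n : bnd (fun ys => majorant R v (walk ys) n).
Proof.
have [C H] := majorant_rec_bnd R d n n; exists C => ys.
by rewrite ger0_norm ?majorant_ge0//; exact: H.
Qed.

#[local] Hint Resolve sawf_bnd lacef_bnd majorant_bnd : bnd.

Lemma sawf_take m n ys : (n <= m)%N -> sawf n (take m ys) = sawf n ys.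
Proof.
move=> nm; congr (_%:R); congr nat_of_bool; apply: saw_on_ext => i ni.
by rewrite walk_take//; lia.
Qed.

Lemma lacef_take m n ys : (n <= m)%N -> lacef n (take m ys) = lacef n ys.
Proof. by move=> nm; apply: lace_ext => i ni; rewrite walk_take//; lia. Qed.

Lemma shiftw_walk m ys : shiftw m (walk ys) = walk (drop m ys).
Proof. by apply/funext => i; rewrite walk_drop. Qed.

Lemma sawf_drop m n ys : sawf n (drop m ys) = (saw_on (walk ys) m (m + n))%:R.
Proof. by rewrite /sawf -shiftw_walk saw_on_shift addn0. Qed.

Lemma lacef_drop m n ys : lacef n (drop m ys) = lace R (walk ys) m m.+1 (m + n).
Proof. by rewrite /lacef -shiftw_walk lace_shift addn0 addn1. Qed.

Lemma sawf_split s n ys : (s <= n)%N ->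
 sawf n ys <= sawf s (take s ys) * sawf (n - s) (drop s ys).
Proof.
move=> sn; rewrite sawf_take// sawf_drop subnKC// -natrM mulnb ler_nat.
case: (boolP (saw_on _ 0 n)) => // h.
by rewrite !(saw_on_sub h)//.
Qed.

Lemma sawf_ge0 n ys : 0 <= sawf n ys. Proof. by []. Qed.

Lemma csaw_ge0 n x : 0 <= csaw n x.
Proof. by apply: expect_ge0 => // ys _; rewrite mulr_ge0. Qed.

Lemma ctot_ge0 n : 0 <= ctot n.
Proof. by apply: expect_ge0 => // ys _. Qed.

Lemma csaw_le1 n x : csaw n x <= 1.
Proof.
rewrite -(expect1 D_summ D_sum1 n); apply: expect_le => //.
- bounded.
- exact: bnd_cst.
- by move=> ys _; rewrite /sawf -natrM mulnb lern1 leq_b1.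
Qed.

Lemma ctot_le1 n : ctot n <= 1.
Proof.
rewrite -(expect1 D_summ D_sum1 n); apply: expect_le => //.
- exact: sawf_bnd.
- exact: bnd_cst.
- by move=> ys _; rewrite /sawf lern1 leq_b1.
Qed.

Lemma csaw0 x : csaw 0 x = (x == 0)%:R.
Proof. by rewrite /csaw expect0 /sawf saw_on_refl mul1r pos_nil eq_sym. Qed.

Lemma ctot0 : ctot 0 = 1.
Proof. by rewrite /ctot expect0 /sawf saw_on_refl. Qed.

Lemma csaw_summ n : summ (csaw n).
Proof. exact: expect_at_pos_summ (sawf_bnd n). Qed.

Lemma csaw_sum n : asum setT (csaw n) = ctot n.
Proof. exact: expect_at_pos_sum (sawf_bnd n). Qed.

Lemma opp_bij : bijective (fun x : Zd => - x).
Proof. by exists (fun x => - x) => x; rewrite opprK. Qed.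

Lemma pos_opp ys : pos (map (fun x : Zd => - x) ys) = - pos ys.
Proof. by rewrite /pos big_map sumrN. Qed.

Lemma walk_opp ys i : walk (map (fun x : Zd => - x) ys) i = - walk ys i.
Proof. by rewrite /walk -map_take pos_opp. Qed.

Lemma sawf_opp n ys : sawf n (map (fun x => - x) ys) = sawf n ys.
Proof.
rewrite /sawf; have e := walk_opp ys; congr (_%:R); congr nat_of_bool.
rewrite (@saw_on_ext _ _ (fun i => - walk ys (0 + i)%N))//.
exact: (@saw_on_inj _ _ (fun x => - x) (walk ys) 0 0 n (@oppr_inj _)).
Qed.

Lemma lacef_opp n ys : lacef n (map (fun x => - x) ys) = lacef n ys.
Proof.
rewrite /lacef; have e := walk_opp ys.
rewrite (@lace_ext _ _ _ (fun i => - walk ys (0 + i)%N))//.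
exact: (@lace_inj _ _ _ (fun x => - x) (walk ys) 0 0 1 n (@oppr_inj _)).
Qed.

Lemma csaw_even n x : csaw n (- x) = csaw n x.
Proof.
rewrite /csaw -(expect_map n (fun ys => _ * (pos ys == x)%:R) opp_bij D_even).
by apply: eq_expect => ys _; rewrite sawf_opp pos_opp eqr_oppLR.
Qed.

Lemma csaw_conv_le s n x : (s <= n)%N -> csaw n x <= Defs.conv (csaw s) (csaw (n - s)) x.
Proof.
move=> sn; rewrite conv_expect//; try exact: sawf_bnd.
rewrite subnKC//; apply: expect_le => //.
- bounded.
- apply: bndM; last exact: bnd_bool.
 bounded.
- by move=> ys _; rewrite ler_wpM2r// sawf_split.
Qed.

Lemma ctot_submul s n : (s <= n)%N -> ctot n <= ctot s * ctot (n - s).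
Proof.
move=> sn; rewrite -expect_prod_at//; try exact: sawf_bnd.
apply: expect_le => //; first exact: sawf_bnd.
 bounded.
by move=> ys _; exact: sawf_split.
Qed.

Lemma amaj_ge0 om n v : (forall x, 0 <= om x) -> 0 <= amaj om n v.
Proof. by move=> om0; apply: expect_ge0 => // ys _; rewrite mulr_ge0 ?majorant_ge0. Qed.

Lemma amaj_bounded om n : bddf om ->
 bddf (amaj om n).
Proof.
move=> [C HC]; have [M HM] := majorant_rec_bnd R d n n.
exists (M * C) => v; apply: (le_trans (expect_norm D_ge0 D_summ _ _)).
 by apply: bndM; [exact: majorant_bnd|exists C => ys].
have -> : M * C = E n (fun=> M * C * 1) by rewrite expectZ// ?expect1 ?mulr1//; exact: bnd_cst.
apply: expect_le => //.
- by apply: bnd_abs; apply: bndM; [exact: majorant_bnd|exists C => ys].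
- exact: bnd_cst.
- move=> ys _; rewrite mulr1 normrM ler_pM//.
 by rewrite ger0_norm ?majorant_ge0//; exact: HM.
Qed.

(* One step of the diagrammatic recursion: the lines [p] and [v - p] close the
  first loop, and the remaining diagram starts from [p - v]. *)
Lemma amaj_rec (om om1 om2 : Zd -> R) n v : (0 < n)%N ->
 bddf om -> (forall x, 0 <= om x) ->
 bddf om1 -> (forall x, 0 <= om1 x) ->
 bddf om2 -> (forall x, 0 <= om2 x) ->
 (forall x y, om (x + y) <= om1 x + om2 y) ->
 amaj om n v <= csaw n v * om 0 +
 \sum_(m < n | (0 < m)%N) \sum_(s < m)
  \asum_p (csaw s p * csaw (m - s) (v - p) *
   (amaj om1 (n - m) (p - v) + om2 (p - v) * amaj (fun=> 1) (n - m) (p - v))).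
Proof.
move=> n0 bom om0 bom1 om10 bom2 om20 omle.
pose h m p := amaj om1 (n - m) (p - v) + om2 (p - v) * amaj (fun=> 1) (n - m) (p - v).
have hbnd m : bddf (h m).
 have [C1 H1] := amaj_bounded (n - m) bom1; have [C2 H2] := amaj_bounded (n - m) (bddf_cst 1).
 have [C3 H3] := bom2; exists (C1 + C3 * C2) => p.
 apply: (le_trans (ler_normD _ _)); apply: lerD; first exact: H1.
 by rewrite normrM ler_pM.
pose t m s ys := sawf m ys * (walk ys m == v)%:R *
  majorant R (walk ys s - walk ys m) (shiftw m (walk ys)) (n - m) * om (pos ys - v).
have bom' : bnd (fun ys => om (pos ys - v)) by have [C HC] := bom; exists C.
have bl m s : bnd (t m s).
 apply: bndM => //; apply: bndM; first bounded.
 have [M HM] := majorant_rec_bnd R d (n - m) (n - m); exists M => ys.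
 by rewrite ger0_norm ?majorant_ge0//; exact: HM.
have b0 : bnd (fun ys => sawf n ys * (pos ys == v)%:R * om (pos ys - v)).
 bounded.
have -> : amaj om n v = E n (fun ys => sawf n ys * (pos ys == v)%:R * om (pos ys - v) +
  \sum_(m < n | (0 < m)%N) \sum_(s < m) t m s ys).
 apply: eq_expect => ys sys.
 rewrite majorantE// mulrDl -{2}sys walk_size; congr (_ + _).
 by rewrite mulr_suml; apply: eq_bigr => m m0; rewrite mulr_sumr mulr_suml.
rewrite (expectD D_summ) //; last by apply: bnd_sum => m; apply: bnd_sum => s; exact: bl.
apply: lerD.
 rewrite /csaw -(expectZr D_summ); last bounded.
 apply: le_of_eq; apply: eq_expect => ys _.
 by case: eqP => [->|_]; rewrite ?subrr// !mulr0 !mul0r.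
rewrite (expect_sum D_summ) => [|m]; last by apply: bnd_sum => s; exact: bl.
apply: ler_sum => m m0; rewrite (expect_sum D_summ); last by move=> s; exact: bl.
apply: ler_sum => s _.
have mn : (m <= n)%N by exact: ltnW.
have sm : (s <= m)%N by exact: ltnW.
have bh : bnd (fun xs => h m (walk xs s)) by have [C HC] := hbnd m; exists C.
have bsm : bnd (fun xs => sawf s (take s xs) * sawf (m - s) (drop s xs)).
 bounded.
have bsm2 : bnd (fun xs => sawf s (take s xs) * sawf (m - s) (drop s xs) * (pos xs == v)%:R * h m (walk xs s)).
 bounded.
apply: (le_via (E m (fun xs =>
  sawf s (take s xs) * sawf (m - s) (drop s xs) * (pos xs == v)%:R * h m (walk xs s)))).
 rewrite -{1}(subnKC mn) expect_cat//; apply: expect_le => //; first exact: expect_inner_bnd.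
 move=> xs sxs.
 have bm (u : Zd) : bnd (fun zs : seq Zd => majorant R u (walk zs) (n - m)).
  exact: (majorant_bnd u (n - m)).
 have h0 : 0 <= h m (walk xs s) by rewrite addr_ge0 ?mulr_ge0 ?amaj_ge0.
 apply: (le_via (sawf m xs * (pos xs == v)%:R * h m (walk xs s))); last first.
  by rewrite ler_wpM2r// ler_wpM2r// sawf_split.
 have -> : E (n - m) (fun zs => t m s (xs ++ zs)) =
   E (n - m) (fun zs => sawf m xs * (pos xs == v)%:R *
    (majorant R (walk xs s - v) (walk zs) (n - m) * om (pos zs))).
  apply: eq_expect => zs szs; rewrite /t shiftw_walk drop_size_cat//.
  rewrite -(sawf_take (xs ++ zs) (leqnn m)) take_size_cat// {1}/walk take_size_cat//.
  have -> : walk (xs ++ zs) s = walk xs s.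
   by rewrite /walk take_cat sxs (leq_trans (ltn_ord s)).
  have -> : walk (xs ++ zs) m = pos xs by rewrite /walk take_size_cat.
  case: eqP => [e|_]; last by rewrite !mulr0 !mul0r.
  by rewrite pos_cat e [v + _]addrC addrK !mulrA.
 rewrite (expectZ D_summ); last by apply: bndM => //; have [C HC] := bom; exists C.
 apply: ler_wpM2l; first by rewrite mulr_ge0.
 (* The weight is split along [pos zs = (pos zs - u) + u]: the first part is the displacement of the
    remaining diagram, the second lies on the line that closes the loop. *)
 set u := walk xs s - v; rewrite /h -/u /amaj.
 have b1 : bnd (fun zs : seq Zd => majorant R u (walk zs) (n - m) * om1 (pos zs - u)).
  by apply: bndM => //; have [C HC] := bom1; exists C.
 have b2 : bnd (fun zs : seq Zd => majorant R u (walk zs) (n - m) * 1).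
  bounded.
 rewrite -(expectZ D_summ) // -(expectD D_summ) //; last bounded.
 apply: expect_le => //.
 - by apply: bndM => //; have [C HC] := bom; exists C.
 - bounded.
 - move=> zs _; rewrite mulr1 [om2 u * _]mulrC -mulrDr ler_wpM2l ?majorant_ge0//.
  by have := omle (pos zs - u) u; rewrite subrK.
have -> : E m (fun xs => sawf s (take s xs) * sawf (m - s) (drop s xs) * (pos xs == v)%:R * h m (walk xs s)) =
  E s (fun us => sawf s us * (h m (pos us) * csaw (m - s) (v - pos us))).
 rewrite -{1}(subnKC sm) (expect_cat D_summ); last exact: bsm2.
 apply: eq_expect => us sus; rewrite /csaw mulrA -(expectZ D_summ).
  apply: eq_expect => zs _; rewrite take_size_cat// drop_size_cat// /walk take_size_cat// pos_cat.
  have -> : (pos us + pos zs == v) = (pos zs == v - pos us).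
   by rewrite [RHS]eq_sym subr_eq eq_sym addrC.
  by rewrite -/(h m _); ring.
 bounded.
have bf : bddf (fun p => h m p * csaw (m - s) (v - p)).
 have [C HC] := hbnd m; exists (C * 1) => p; rewrite normrM ler_pM//.
 by rewrite ger0_norm ?csaw_ge0 ?csaw_le1.
have [_ <-] := expect_at_pos D_ge0 D_summ (f := fun p => h m p * csaw (m - s) (v - p)) s (sawf_bnd s) bf.
apply: le_of_eq; apply: eq_asum => p.
by rewrite -/(csaw s p) /h; ring.
Qed.

End saw_quantities.
#[export] Hint Resolve sawf_bnd lacef_bnd majorant_bnd : bnd.

Section lattice_sums.
Variables (R : realType) (d : nat).
Local Notation Zd := 'rV[int]_d.

Lemma summ_bounded (f : Zd -> R) : summ f -> bddf f.
Proof.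
move=> sf; exists (\asum_x `|f x|) => x.
by apply: (@asum_ge_term R _ (fun x => `|f x|) x) => //; exact: summ_abs.
Qed.

Lemma summM (f g : Zd -> R) : summ f -> bddf g -> summ (fun x => f x * g x).
Proof. by move=> sf [C HC]; apply: summ_bndM sf. Qed.

Lemma bounded_comp (f : Zd -> R) (e : Zd -> Zd) : bddf f -> bddf (fun x => f (e x)).
Proof. by move=> [C HC]; exists C. Qed.

Lemma bounded_mul (f g : Zd -> R) : bddf f -> bddf g -> bddf (fun x => f x * g x).
Proof. by move=> [C HC] [C' HC']; exists (C * C') => x; rewrite normrM ler_pM. Qed.

Lemma bounded_add (f g : Zd -> R) : bddf f -> bddf g -> bddf (fun x => f x + g x).
Proof. by move=> [C HC] [C' HC']; exists (C + C') => x; apply: (le_trans (ler_normD _ _)); exact: lerD. Qed.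

Lemma sub_bij (v : Zd) : bijective (fun p : Zd => v - p).
Proof. by exists (fun p => v - p) => p; rewrite opprB addrC subrK. Qed.

Lemma add_bij (v : Zd) : bijective (fun p : Zd => p + v).
Proof. by exists (fun p => p - v) => p; rewrite ?addrK ?subrK. Qed.

Lemma asum_shift (f : Zd -> R) v : \asum_(p : Zd) f (p + v) = asum setT f.
Proof. by rewrite [RHS](asum_bij _ (add_bij v)). Qed.

Lemma summ_shift (f : Zd -> R) v : summ f -> summ (fun p : Zd => f (p + v)).
Proof. by move=> /(summ_bij _ (add_bij v)). Qed.

Lemma asum_opp (f : Zd -> R) : \asum_(p : Zd) f (- p) = asum setT f.
Proof. by rewrite [RHS](asum_bij _ (opp_bij d)). Qed.

Lemma asum_sub (f : Zd -> R) v : \asum_(p : Zd) f (v - p) = asum setT f.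
Proof. by rewrite [RHS](asum_bij _ (sub_bij v)). Qed.

Lemma summ_sub (f : Zd -> R) v : summ f -> summ (fun p : Zd => f (v - p)).
Proof. by move=> /(summ_bij _ (sub_bij v)). Qed.

Lemma conv_summ_pair (f g : Zd -> R) : summ f -> summ g ->
 summ (fun p : Zd * Zd => f p.2 * g (p.1 - p.2)).
Proof.
move=> sf sg; apply: (@summ_swap R _ _ (fun y x => f y * g (x - y))).
apply: (@summ_pair R _ _ (fun y x => f y * g (x - y)) (fun y => `|f y| * \asum_x `|g x|)).
- by move=> y; apply: summZ; exact: (summ_shift (- y) sg).
- move=> y; rewrite -(asum_shift (fun x => `|g x|) (- y)) -asumZ; last exact: (summ_shift (- y) (summ_abs sg)).
 by apply: le_of_eq; apply: eq_asum => x; rewrite normrM.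
- by apply: summZr; exact: summ_abs.
Qed.

Lemma conv_summ (f g : Zd -> R) : summ f -> summ g -> summ (Defs.conv f g).
Proof. by move=> sf sg; exact: (summ_pair_sum (conv_summ_pair sf sg)). Qed.

Lemma conv_term_summ (f g : Zd -> R) x : summ f -> summ g -> summ (fun y : Zd => f y * g (x - y)).
Proof. by move=> sf sg; exact: (summ_pair_row x (conv_summ_pair sf sg)). Qed.

Lemma conv_ge0 (f g : Zd -> R) x : (forall x, 0 <= f x) -> (forall x, 0 <= g x) -> 0 <= Defs.conv f g x.
Proof. by move=> f0 g0; apply: asum_ge0 => y; rewrite mulr_ge0. Qed.

End lattice_sums.

(** * Diagram bounds from a small bubble *)

Section two_point.
Variables (R : realType) (d : nat) (D : 'rV[int]_d -> R).
Local Notation Zd := 'rV[int]_d.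
Local Notation E := (expect D).
Hypotheses (D_ge0 : forall x, 0 <= D x)
 (D_summ : summ D)
 (D_sum1 : asum setT D = 1)
 (D_even : forall x, D (- x) = D x).
Local Notation c := (csaw D).

Definition twopt (z : R) x : R := \asum_(n : nat) (c n x * z ^+ n).
(** The walk of length zero is removed. Lines that cannot be trivial carry this factor, and it is
    what makes a small bubble possible. *)
Definition twopt' (z : R) x : R := twopt z x - (x == 0)%:R.

Variable z : R.
Hypotheses (z_gt0 : 0 < z)
 (chi_summ : summ (fun n => ctot D n * z ^+ n)).
Local Notation G := (twopt z).
Local Notation H := (twopt' z).

Let zn_ge0 n : 0 <= z ^+ n. Proof. by rewrite exprn_ge0// ltW. Qed.
Let c_ge0 n x : 0 <= c n x. Proof. exact: csaw_ge0. Qed.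
Let cz_ge0 n x : 0 <= c n x * z ^+ n. Proof. by rewrite mulr_ge0. Qed.

Lemma twopt_summ_pair : summ (fun p : nat * Zd => c p.1 p.2 * z ^+ p.1).
Proof.
apply: (@nneg_summ_pair R _ _ (fun n x => c n x * z ^+ n)) => //.
 by move=> n; apply: summZr; exact: csaw_summ.
apply: eq_summ chi_summ => n; rewrite asumZr ?csaw_sum//; exact: csaw_summ.
Qed.

Let swap_summ := @summ_swap R _ _ (fun n x => c n x * z ^+ n) twopt_summ_pair.

Lemma twopt_term_summ x : summ (fun n => c n x * z ^+ n).
Proof. exact: (summ_pair_row x swap_summ). Qed.

Lemma twopt_summ : summ G.
Proof. exact: (summ_pair_sum swap_summ). Qed.

Lemma twopt_sum : asum setT G = \asum_(n : nat) (ctot D n * z ^+ n).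
Proof.
rewrite /twopt -(@asum_swap R _ _ (fun n x => c n x * z ^+ n) twopt_summ_pair).
apply: eq_asum => n; rewrite asumZr ?csaw_sum//; exact: csaw_summ.
Qed.

Lemma twopt_ge0 x : 0 <= G x.
Proof. exact: asum_ge0. Qed.

Lemma twopt_even x : G (- x) = G x.
Proof. by apply: eq_asum => n; rewrite csaw_even. Qed.

Lemma twopt_part N x : \sum_(n < N) c n x * z ^+ n <= G x.
Proof. by apply: (@nneg_asum_nat_ge R (fun n => c n x * z ^+ n)) => //; exact: twopt_term_summ. Qed.

Lemma twopt'_part N x : \sum_(n < N | (0 < n)%N) c n x * z ^+ n <= H x.
Proof.
rewrite lerBrDr; apply: le_trans (twopt_part N.+1 x).
rewrite [leRHS]big_ord_recl/= expr0 mulr1 csaw0 addrC lerD2l.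
case: N => [|N]; first by rewrite !big_ord0.
rewrite big_mkcond/= big_ord_recl/= add0r [leRHS]big_ord_recr/= lerDl.
by [].
Qed.

Lemma twopt'_ge0 x : 0 <= H x.
Proof. by have := twopt'_part 0 x; rewrite big_ord0. Qed.

Lemma twopt'_summ : summ H.
Proof.
apply: summB; first exact: twopt_summ.
by apply: (@summ_single _ _ _ 0) => x /negbTE ->.
Qed.

Lemma twopt'_even x : H (- x) = H x.
Proof. by rewrite /twopt' twopt_even oppr_eq0. Qed.

Lemma twopt'_le x : H x <= G x.
Proof. by rewrite lerBlDr lerDl. Qed.

Lemma twopt0_ge1 : 1 <= G 0.
Proof. by have := twopt'_ge0 0; rewrite /twopt' eqxx subr_ge0. Qed.

Lemma twoptE x : G x = (x == 0)%:R + H x.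
Proof. by rewrite /twopt' addrC subrK. Qed.

(** One loop followed by a remaining diagram: the factor [z ^+ n] is distributed over the three
    pieces, and the truncated sums are then replaced by full lines. *)
Lemma triple_bound (f g h : nat -> Zd -> R) (F Gg Hh : Zd -> R) N v :
 (forall n x, 0 <= f n x) -> (forall n x, 0 <= g n x) -> (forall n x, 0 <= h n x) ->
 (forall p, 0 <= F p) -> (forall p, 0 <= Gg p) -> (forall p, 0 <= Hh p) ->
 (forall p, \sum_(s < N.+1) f s p * z ^+ s <= F p) ->
 (forall p, \sum_(s < N.+1 | (0 < s)%N) g s p * z ^+ s <= Gg p) ->
 (forall p, \sum_(s < N | (0 < s)%N) h s p * z ^+ s <= Hh p) ->
 summ (fun p => F p * Gg (v - p) * Hh (p - v)) ->
 \sum_(n < N.+1 | (0 < n)%N) (\sum_(m < n | (0 < m)%N) \sum_(s < m)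
  \asum_p (f s p * g (m - s)%N (v - p) * h (n - m)%N (p - v))) * z ^+ n <=
 \asum_p (F p * Gg (v - p) * Hh (p - v)).
Proof.
move=> f0 g0 h0 F0 G0 H0 fF gG hH S.
have term_le (P : pred nat) (u : nat -> Zd -> R) U k p M : (forall n x, 0 <= u n x) ->
  \sum_(s < M | P s) u s p * z ^+ s <= U p -> (k < M)%N -> P k -> u k p * z ^+ k <= U p.
 move=> u0 uU kM Pk; apply: le_trans uU; rewrite (bigD1 (Ordinal kM))//= lerDl.
 by apply: sumr_ge0 => i _; rewrite mulr_ge0.
have S1 n m s : (n < N.+1)%N -> (0 < m)%N -> (m < n)%N -> (s < m)%N ->
  summ (fun p => f s p * g (m - s)%N (v - p) * h (n - m)%N (p - v) * z ^+ n).
 move=> nN m0 mn sm; apply: summ_le S => p.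
 rewrite ger0_norm ?mulr_ge0//.
 have -> : z ^+ n = z ^+ s * z ^+ (m - s) * z ^+ (n - m) by rewrite -!exprD; congr (_ ^+ _); lia.
 rewrite [leLHS](_ : _ = (f s p * z ^+ s) * (g (m - s)%N (v - p) * z ^+ (m - s)) *
   (h (n - m)%N (p - v) * z ^+ (n - m))); last by ring.
 apply: ler_pM; rewrite ?mulr_ge0//.
  apply: ler_pM; rewrite ?mulr_ge0//; first by apply: (term_le xpredT _ _ _ _ N.+1) => //; lia.
  by apply: (term_le (fun s => 0 < s)%N _ _ _ _ N.+1) => //; lia.
 by apply: (term_le (fun s => 0 < s)%N _ _ _ _ N) => //; lia.
pose t (p : Zd) := \sum_(n < N.+1 | (0 < n)%N) \sum_(m < n | (0 < m)%N) \sum_(s < m)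
  (f s p * z ^+ s) * (g (m - s)%N (v - p) * z ^+ (m - s)) * (h (n - m)%N (p - v) * z ^+ (n - m)).
have tle p : t p <= F p * Gg (v - p) * Hh (p - v).
 apply: (@triple_sum_le R (fun s => f s p * z ^+ s) (fun i => g i (v - p) * z ^+ i)
   (fun j => h j (p - v) * z ^+ j)) => // k; by rewrite mulr_ge0.
have t0 p : 0 <= t p.
 by do 3! (apply: sumr_ge0 => ? _); rewrite !mulr_ge0.
rewrite [leLHS](_ : _ = asum setT t); last first.
 have zs (n : nat) (m : 'I_n) (s : 'I_m) : z ^+ n = z ^+ s * z ^+ (m - s) * z ^+ (n - m).
  by rewrite -!exprD; congr (_ ^+ _); have := ltn_ord s; have := ltn_ord m; lia.
 rewrite /t asum_sum => [|n n0]; last first.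
  apply: summ_sum => m m0; apply: summ_sum => s _; apply: eq_summ (S1 n m s _ _ _ _) => // p.
  by rewrite (zs n m s); ring.
 apply: eq_bigr => n n0; rewrite asum_sum => [|m m0]; last first.
  apply: summ_sum => s _; apply: eq_summ (S1 n m s _ _ _ _) => // p.
  by rewrite (zs n m s); ring.
 rewrite mulr_suml; apply: eq_bigr => m m0; rewrite asum_sum => [|s _]; last first.
  apply: eq_summ (S1 n m s _ _ _ _) => // p.
  by rewrite (zs n m s); ring.
 rewrite mulr_suml; apply: eq_bigr => s _; rewrite -asumZr; last first.
  have zn0 : z ^+ n != 0 by rewrite expf_neq0// gt_eqF.
  apply: eq_summ (summZr (z ^+ n)^-1 (S1 n m s _ _ _ _)) => // p.
  by rewrite -mulrA mulfV// mulr1.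
 apply: eq_asum => p.
 by rewrite (zs n m s); ring.
exact: nneg_asum_le.
Qed.

(* [n c_n <= sum_s c_s * c_(n - s)]: differentiating in [z] opens a bubble. *)
Lemma twopt_time_part N x : \sum_(n < N) n%:R * c n x * z ^+ n <= Defs.conv G H x.
Proof.
have sGH : summ (fun p => G p * H (x - p)) by apply: conv_term_summ; [exact: twopt_summ|exact: twopt'_summ].
have S1 n s : (s < n)%N -> summ (fun p => c s p * c (n - s)%N (x - p) * z ^+ n).
 move=> sn; apply: summZr; apply: conv_term_summ; exact: csaw_summ.
apply: (le_via (\sum_(n < N) \sum_(s < n) \asum_p (c s p * c (n - s)%N (x - p) * z ^+ n))).
 apply: ler_sum => n _; rewrite -mulr_natl -mulrA.
 rewrite mulr1 mulr_natl (_ : _ *+ n = \sum_(s < n) c n x * z ^+ n); last first.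
  by rewrite sumr_const card_ord.
 apply: ler_sum => s _.
 rewrite asumZr; last by apply: conv_term_summ; exact: csaw_summ.
 rewrite ler_wpM2r//; apply: csaw_conv_le => //; exact: ltnW.
pose t p := \sum_(n < N) \sum_(s < n) (c s p * z ^+ s) * (c (n - s)%N (x - p) * z ^+ (n - s)).
have tE p : t p = \sum_(n < N) \sum_(s < n) c s p * c (n - s)%N (x - p) * z ^+ n.
 apply: eq_bigr => n _; apply: eq_bigr => s _.
 rewrite -[in z ^+ n](subnKC (ltnW (ltn_ord s))) exprD; ring.
rewrite [leLHS](_ : _ = asum setT t); last first.
 rewrite (eq_asum _ tE) asum_sum => [|n _]; last by apply: summ_sum => s _; exact: S1.
 by apply: eq_bigr => n _; rewrite asum_sum// => s _; exact: S1.
apply: nneg_asum_le => // [p|p]; first by do 2! (apply: sumr_ge0 => ? _); rewrite !mulr_ge0.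
apply: (@conv_sum_le R (fun s => c s p * z ^+ s) (fun i => c i (x - p) * z ^+ i)) => //.
- exact: twopt'_ge0.
- exact: twopt_part.
- exact: twopt'_part.
Qed.

Section small_bubble.
Variable b : R.
Hypotheses (b_ge0 : 0 <= b)
 (b_small : b <= 1 / 8)
 (bubble : forall x, Defs.conv G H x <= b).

Let b2 : b * (2 * b) <= b / 4.
Proof. have : b * b <= b * (1 / 8) by rewrite ler_wpM2l. nra. Qed.
Let b3 : (1 + 2 * b) * (2 * b) <= 2 * b + b / 2.
Proof. have : b * b <= b * (1 / 8) by rewrite ler_wpM2l. nra. Qed.
Let close1 (X Y : R) : X <= b -> Y <= b * (2 * b) -> X + Y <= 2 * b.
Proof. by move=> h1 h2; move: b2 b_ge0; lra. Qed.
Let close2 (X Y : R) : X <= b -> Y <= (1 + 2 * b) * (2 * b) -> X + Y <= 4 * b.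
Proof. by move=> h1 h2; move: b3 b_ge0; lra. Qed.
Let close3 (W X Y : R) : 0 <= W -> X <= b * (2 * (16 * W * b)) -> Y <= 2 * W * (4 * b) -> X + Y <= 16 * W * b.
Proof.
move=> W0 h1 h2; have h3 : b * (2 * (16 * W * b)) <= 4 * (W * b).
 rewrite [leLHS](_ : _ = (16 * W) * (b * (2 * b))); last by ring.
 by apply: le_trans (ler_wpM2l _ b2) _; rewrite//; lra.
have := mulr_ge0 W0 b_ge0; lra.
Qed.
Let G0 := twopt_ge0.
Let H0 := twopt'_ge0.
Let sG := twopt_summ.
Let sH := twopt'_summ.
Let bH := summ_bounded sH.
Let bG := summ_bounded sG.

Lemma conv_twopt_bound (f : Zd -> R) B v : (forall u, 0 <= f u) -> bddf f ->
 (forall u, f u <= B) -> \asum_p (G p * H (v - p) * f (p - v)) <= b * B.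
Proof.
move=> f0 bf fB; have B0 : 0 <= B by apply: le_trans (fB 0).
apply: (le_via (\asum_p (G p * H (v - p) * B))); last first.
 rewrite asumZr; last exact: conv_term_summ.
 by rewrite ler_wpM2r//; exact: bubble.
apply: nneg_asum_le => [p||p]; first by rewrite !mulr_ge0.
 by apply: summZr; exact: conv_term_summ.
by rewrite ler_wpM2l// mulr_ge0.
Qed.

Lemma twopt'_le_bubble x : H x <= b.
Proof.
apply: le_trans (bubble x).
apply: (le_via (G 0 * H (x - 0))); first by rewrite subr0 ler_peMl// twopt0_ge1.
apply: (@asum_ge_term _ _ (fun y => G y * H (x - y))); last exact: conv_term_summ.
by move=> y; rewrite mulr_ge0.
Qed.

Definition agen (om : Zd -> R) N v : R := \sum_(n < N | (0 < n)%N) amaj D om n v * z ^+ n.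

Lemma agen_ge0 om N v : (forall x, 0 <= om x) -> 0 <= agen om N v.
Proof. by move=> om0; apply: sumr_ge0 => n _; rewrite mulr_ge0 ?amaj_ge0. Qed.

Lemma agen_bounded om N : bddf om -> bddf (agen om N).
Proof.
move=> bom; have /choice[C HC] : forall n : 'I_N, exists C : R, forall v, `|amaj D om n v| <= C.
 by move=> n; exact: amaj_bounded.
exists (\sum_(n < N | (0 < n)%N) C n * z ^+ n) => v; apply: (le_trans (ler_norm_sum _ _ _)).
by apply: ler_sum => n _; rewrite normrM (ger0_norm (zn_ge0 n)) ler_wpM2r.
Qed.

Lemma agen_rec om om1 om2 N v : bddf om -> (forall x, 0 <= om x) ->
 bddf om1 -> (forall x, 0 <= om1 x) -> bddf om2 -> (forall x, 0 <= om2 x) ->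
 (forall x y, om (x + y) <= om1 x + om2 y) ->
 agen om N.+1 v <= om 0 * H v +
  \asum_p (G p * H (v - p) * (agen om1 N (p - v) + om2 (p - v) * agen (fun=> 1) N (p - v))).
Proof.
move=> bom om0 bom1 om10 bom2 om20 omle.
pose h n u := amaj D om1 n u + om2 u * amaj D (fun=> 1) n u.
have h0 n u : 0 <= h n u by rewrite addr_ge0 ?mulr_ge0 ?amaj_ge0.
apply: (le_via (\sum_(n < N.+1 | (0 < n)%N) (c n v * om 0) * z ^+ n +
 \sum_(n < N.+1 | (0 < n)%N) (\sum_(m < n | (0 < m)%N) \sum_(s < m)
  \asum_p (c s p * c (m - s)%N (v - p) * h (n - m)%N (p - v))) * z ^+ n)).
 rewrite -big_split/=; apply: ler_sum => n n0; rewrite -mulrDl ler_wpM2r//.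
 exact: amaj_rec.
apply: lerD.
 rewrite [leLHS](_ : _ = om 0 * \sum_(n < N.+1 | (0 < n)%N) c n v * z ^+ n); last first.
  by rewrite mulr_sumr; apply: eq_bigr => n _; ring.
 by rewrite ler_wpM2l// twopt'_part.
apply: (@triple_bound c c h G H (fun u => agen om1 N u + om2 u * agen (fun=> 1) N u)) => //.
- by move=> u; rewrite addr_ge0 ?mulr_ge0 ?agen_ge0.
- by move=> u; exact: twopt_part.
- by move=> u; exact: twopt'_part.
- move=> u; rewrite /agen mulr_sumr -big_split/=; apply: le_of_eq.
 by apply: eq_bigr => n _; rewrite /h; ring.
- apply: summM; first exact: conv_term_summ.
 apply: (@bounded_comp _ _ (fun u => agen om1 N u + om2 u * agen (fun=> 1) N u) (fun p => p - v)).
 apply: bounded_add; first exact: agen_bounded.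
 by apply: bounded_mul => //; apply: agen_bounded; exact: bddf_cst.
Qed.

Local Notation A := (agen (fun=> 1)).
Let A0 N v : 0 <= A N v. Proof. exact: agen_ge0. Qed.
Let bA N : bddf (A N). Proof. by apply: agen_bounded; exact: bddf_cst. Qed.

Lemma agen1_rec N v : A N.+1 v <= H v + \asum_p (G p * H (v - p) * A N (p - v)).
Proof.
have := @agen_rec (fun=> 1) (fun=> 1) (fun=> 0) N v (bddf_cst 1) (fun=> ler01)
 (bddf_cst 1) (fun=> ler01) (bddf_cst 0) (fun=> lexx 0).
rewrite mul1r; under eq_asum do rewrite mul0r addr0; apply => _ _; by rewrite addr0.
Qed.

Lemma agen_nil om v : agen om 0 v = 0. Proof. by rewrite /agen big_ord0. Qed.

(** Induction on the truncation; it closes because [b + b * (2 * b) <= 2 * b], by [b <= 1 / 8]. *)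
Lemma agen1_le N v : A N v <= 2 * b.
Proof.
elim: N v => [|N IH] v; first by rewrite agen_nil mulr_ge0.
apply: (le_trans (agen1_rec N v)).
exact: close1 (twopt'_le_bubble v) (@conv_twopt_bound (A N) (2 * b) v (A0 N) (bA N) IH).
Qed.

(** The diagram closed by one more line [H]. One use of the recursion and the change of variable
    [u = p - v] leave the same diagram times a bubble. *)
Lemma theta_le N : \asum_u (H u * A N u) <= 2 * b.
Proof.
elim: N => [|N IH].
 by rewrite asum_eq0 ?mulr_ge0// => u; rewrite agen_nil mulr0.
have sHA M : summ (fun u => H u * A M u) by exact: summM.
have sHH : summ (fun u => H u * H u) by exact: summM.
pose t v p := H v * (G p * H (v - p) * A N (p - v)).
have t0 v p : 0 <= t v p by rewrite !mulr_ge0.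
have [CA HCA] := bA N.
have st : summ (fun q : Zd * Zd => t q.1 q.2).
 apply: (@summ_le R _ _ (fun q => (G q.2 * H (q.1 - q.2)) * ((\asum_x `|H x|) * CA))).
  move=> [v p] /=; rewrite ger0_norm// /t [leLHS](_ : _ = G p * H (v - p) * (H v * A N (p - v))); last by ring.
  rewrite ler_wpM2l ?mulr_ge0// ler_pM//; last by apply: le_trans (HCA _); exact: ler_norm.
  apply: le_trans (ler_norm _) _; apply: (@asum_ge_term R _ (fun x => `|H x|)) => //; exact: summ_abs.
 by apply: summZr; exact: (conv_summ_pair sG sH).
apply: (le_via (\asum_v (H v * H v) + \asum_v \asum_p t v p)).
 rewrite -asumD//; last exact: (summ_pair_sum st).
 apply: nneg_asum_le => [v||v]; first by rewrite mulr_ge0.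
  by apply: summD => //; exact: (summ_pair_sum st).
 rewrite /t asumZ; last by apply: summM; [exact: conv_term_summ|exact: (bounded_comp (fun p => p - v) (bA N))].
 by rewrite -mulrDr ler_wpM2l// agen1_rec.
have h1 : \asum_v (H v * H v) <= b.
 apply: le_trans (bubble 0); apply: nneg_asum_le => [v||v]; first by rewrite mulr_ge0.
  exact: conv_term_summ.
 by rewrite sub0r twopt'_even ler_wpM2r// twopt'_le.
have h2 : \asum_v \asum_p t v p <= b * (2 * b).
 rewrite (asum_swap st).
 have -> : \asum_p \asum_v t v p = \asum_p \asum_u (G p * (H (p - u) * (H u * A N u))).
  apply: eq_asum => p; rewrite (asum_bij _ (sub_bij p)); apply: eq_asum => u.
  rewrite /t subKr; have -> : p - u - p = - u by rewrite addrC addKr.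
  by rewrite twopt'_even; ring.
 have st2 : summ (fun q : Zd * Zd => G q.1 * (H (q.1 - q.2) * (H q.2 * A N q.2))).
  apply: (@summ_pair R _ _ (fun p u => G p * (H (p - u) * (H u * A N u))) (fun p => G p * (b * \asum_u (H u * A N u)))).
  - move=> p; apply: summZ; apply: eq_summ (summM (sHA N) (bounded_comp (fun u => p - u) bH)) => u; by rewrite mulrC.
  - move=> p; rewrite -!asumZ//; last exact: summZ.
   apply: nneg_asum_le => [u||u]; first exact: normr_ge0.
    by apply: summZ; exact: summZ.
   rewrite ger0_norm ?mulr_ge0// ler_wpM2l// ler_wpM2r ?mulr_ge0//; exact: twopt'_le_bubble.
  - exact: summZr.
 rewrite (asum_swap (f := fun p u => G p * (H (p - u) * (H u * A N u))) st2).
 apply: (le_via (\asum_u (b * (H u * A N u)))); last first.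
  by rewrite asumZ// ler_wpM2l.
 apply: nneg_asum_le => [u||u]; first by apply: asum_ge0 => p; rewrite !mulr_ge0.
  exact: summZ.
 rewrite (eq_asum_to (fun p => (G p * H (u - p)) * (H u * A N u))); last first.
  by move=> p; rewrite -[u - p]opprB twopt'_even; ring.
 rewrite asumZr; last exact: conv_term_summ.
 by rewrite ler_wpM2r ?mulr_ge0//; exact: bubble.
exact: close1.
Qed.

Lemma convGG_le x : \asum_p (G p * G (x - p)) <= 1 + 2 * b.
Proof.
have sd : summ (fun p => G p * (x - p == 0)%:R).
 by apply: (@summ_single _ _ _ x) => p; rewrite subr_eq0 eq_sym => /negbTE ->; rewrite mulr0.
have -> : \asum_p (G p * G (x - p)) = G x + Defs.conv G H x.
 rewrite (eq_asum_to (fun p => G p * (x - p == 0)%:R + G p * H (x - p))); last first.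
  by move=> p; rewrite (twoptE (x - p)) mulrDr.
 rewrite asumD//; last exact: conv_term_summ.
 congr (_ + _); rewrite (@asum_single _ _ _ x).
  by rewrite subrr eqxx mulr1.
 by move=> p; rewrite subr_eq0 eq_sym => /negbTE ->; rewrite mulr0.
have := bubble x; have := twopt'_le_bubble x; rewrite twoptE; case: (x == 0) => /=; lra.
Qed.

(** The line [G] may be trivial here, so the small factor has to come from [agen]. Unfolding it once
    leaves either a bubble, or the convolution of [G] with itself, at most [1 + 2 * b], times the
    diagram of [theta_le]. *)
Lemma gamma_le N v : \asum_p (G p * A N (p - v)) <= 4 * b.
Proof.
case: N => [|N].
 by rewrite asum_eq0 ?mulr_ge0// => u; rewrite agen_nil mulr0.
have sHA M : summ (fun u => H u * A M u) by exact: summM.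
pose t p q := G p * (G q * H (p - v - q) * A N (q - (p - v))).
have t0 p q : 0 <= t p q by rewrite !mulr_ge0.
have [CA HCA] := bA N.
have CA0 : 0 <= CA by apply: le_trans (HCA 0).
have st : summ (fun q : Zd * Zd => t q.1 q.2).
 apply: (@summ_pair R _ _ t (fun p => G p * (b * CA))).
 - move=> p; apply: summZ; apply: summM; first exact: conv_term_summ.
  exact: (bounded_comp (fun q => q - (p - v)) (bA N)).
 - move=> p; rewrite (eq_asum_to (t p)); last by move=> q; rewrite ger0_norm.
  rewrite /t asumZ; last first.
   by apply: summM; [exact: conv_term_summ|exact: (bounded_comp (fun q => q - (p - v)) (bA N))].
  rewrite ler_wpM2l//; apply: conv_twopt_bound => // u.
  by apply: le_trans (HCA u); exact: ler_norm.
 - exact: summZr.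
apply: (le_via (\asum_p (G p * H (p - v)) + \asum_p \asum_q t p q)).
 have s1 : summ (fun p => G p * H (p - v)) by apply: summM => //; exact: (bounded_comp (fun p => p - v) bH).
 rewrite -asumD//; last exact: (summ_pair_sum st).
 apply: nneg_asum_le => [p||p]; first by rewrite mulr_ge0.
  by apply: summD => //; exact: (summ_pair_sum st).
 rewrite /t asumZ; last first.
  by apply: summM; [exact: conv_term_summ|exact: (bounded_comp (fun q => q - (p - v)) (bA N))].
 by rewrite -mulrDr ler_wpM2l// agen1_rec.
have h1 : \asum_p (G p * H (p - v)) <= b.
 rewrite (eq_asum_to (fun p => G p * H (v - p))); first exact: bubble.
 by move=> p; rewrite -[v - p]opprB twopt'_even.
have h2 : \asum_p \asum_q t p q <= (1 + 2 * b) * (2 * b).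
 have -> : \asum_p \asum_q t p q = \asum_p \asum_u (G p * (G (p - (v - u)) * (H u * A N u))).
  apply: eq_asum => p; rewrite (asum_bij _ (add_bij (p - v))); apply: eq_asum => u.
  rewrite /t addrK; have -> : p - v - (u + (p - v)) = - u by rewrite opprD addrCA subrr addr0.
  have -> : u + (p - v) = p - (v - u) by rewrite opprB addrCA.
  by rewrite (twopt'_even u); congr (_ * _); rewrite -mulrA.
 have st2 : summ (fun q : Zd * Zd => G q.1 * (G (q.1 - (v - q.2)) * (H q.2 * A N q.2))).
  have [CG HCG] := bG.
  apply: (@summ_pair R _ _ (fun p u => G p * (G (p - (v - u)) * (H u * A N u)))
    (fun p => G p * (CG * \asum_u (H u * A N u)))).
  - move=> p; apply: summZ.
   have bGc := @bounded_comp _ _ G (fun u => p - (v - u)) bG.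
   by apply: eq_summ (summM (sHA N) bGc) => u; exact: mulrC.
  - move=> p; rewrite -(asumZ CG (sHA N)) -(asumZ (G p) (summZ CG (sHA N))).
   apply: nneg_asum_le => [u||u]; first exact: normr_ge0.
    by apply: summZ; exact: summZ.
   rewrite ger0_norm ?mulr_ge0// ler_wpM2l// ler_wpM2r ?mulr_ge0//.
   by apply: le_trans (HCG _); exact: ler_norm.
  - exact: summZr.
 rewrite (asum_swap (f := fun p u => G p * (G (p - (v - u)) * (H u * A N u))) st2).
 apply: (le_via (\asum_u ((1 + 2 * b) * (H u * A N u)))); last first.
  by rewrite asumZ// ler_wpM2l ?theta_le// addr_ge0// mulr_ge0.
 apply: nneg_asum_le => [u||u]; first by apply: asum_ge0 => p; rewrite !mulr_ge0.
  exact: summZ.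
 rewrite (eq_asum_to (fun p => (G p * G ((v - u) - p)) * (H u * A N u))); last first.
  by move=> p; rewrite -[v - u - p]opprB (twopt_even (p - (v - u))) mulrA.
 rewrite asumZr; last exact: conv_term_summ.
 by rewrite ler_wpM2r ?mulr_ge0//; exact: convGG_le.
exact: close2.
Qed.

(** The weight is either passed on to the remaining diagram or put on the line [H] that closes the
    loop, where [om * H <= W] and [gamma_le] gives [2 * W * (4 * b)]. Passing it on costs
    [b * (2 * (16 * W * b))], at most [4 * W * b], so [16] leaves room. *)
Lemma agen_weight_le om W N v : bddf om -> (forall x, 0 <= om x) -> om 0 = 0 ->
 (forall x, om (- x) = om x) ->
 (forall x y, om (x + y) <= 2 * om x + 2 * om y) -> (forall x, om x * H x <= W) ->
 agen om N v <= 16 * W * b.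
Proof.
move=> bom om0 om00 ome omle omW.
have W0 : 0 <= W by apply: le_trans (omW 0); rewrite mulr_ge0.
elim: N v => [|N IH] v; first by rewrite agen_nil !mulr_ge0.
have bo2 : bddf (fun x => 2 * om x) by apply: bounded_mul => //; exact: bddf_cst.
have o2 x : 0 <= 2 * om x by rewrite mulr_ge0.
apply: (le_trans (@agen_rec om (fun x => 2 * om x) (fun x => 2 * om x) N v bom om0 bo2 o2 bo2 o2 omle)).
rewrite om00 mul0r add0r.
have e2 u : agen (fun x => 2 * om x) N u = 2 * agen om N u.
 rewrite /agen mulr_sumr; apply: eq_bigr => n _; rewrite mulrA; congr (_ * _).
 rewrite /amaj -(expectZ D_summ).
  by apply: eq_expect => ys _; ring.
 by apply: bndM; [exact: majorant_bnd|have [C HC] := bom; exists C].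
have s1 : summ (fun p => G p * H (v - p) * (2 * agen om N (p - v))).
 apply: summM; first exact: conv_term_summ.
 apply: (@bounded_comp _ _ (fun u => 2 * agen om N u) (fun p => p - v)).
 by apply: bounded_mul; [exact: bddf_cst|exact: agen_bounded].
have s2 : summ (fun p => G p * H (v - p) * (2 * om (p - v) * A N (p - v))).
 apply: summM; first exact: conv_term_summ.
 by apply: (@bounded_comp _ _ (fun u => 2 * om u * A N u) (fun p => p - v)); exact: bounded_mul.
rewrite (eq_asum_to (fun p => G p * H (v - p) * (2 * agen om N (p - v)) +
  G p * H (v - p) * (2 * om (p - v) * A N (p - v)))); last first.
 by move=> p; rewrite e2 mulrDr.
rewrite asumD//.
have h1 : \asum_p (G p * H (v - p) * (2 * agen om N (p - v))) <= b * (2 * (16 * W * b)).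
 apply: (@conv_twopt_bound (fun u => 2 * agen om N u)).
 - by move=> u; rewrite mulr_ge0// agen_ge0.
 - by apply: bounded_mul; [exact: bddf_cst|exact: agen_bounded].
 - by move=> u; rewrite ler_wpM2l.
have h2 : \asum_p (G p * H (v - p) * (2 * om (p - v) * A N (p - v))) <= (2 * W) * (4 * b).
 have s3 : summ (fun p => G p * A N (p - v)) by apply: summM => //; exact: (bounded_comp (fun p => p - v) (bA N)).
 apply: (le_via (\asum_p ((2 * W) * (G p * A N (p - v))))); last first.
  by rewrite asumZ// ler_wpM2l ?gamma_le// mulr_ge0.
 apply: nneg_asum_le => [p||p]; first by rewrite !mulr_ge0.
  exact: summZ.
 rewrite -[v - p]opprB twopt'_even.
 rewrite [leLHS](_ : _ = (om (p - v) * H (p - v)) * (2 * (G p * A N (p - v)))); last by ring.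
 rewrite [leRHS](_ : _ = W * (2 * (G p * A N (p - v)))); last by ring.
 by rewrite ler_wpM2r// !mulr_ge0.
exact: close3.
Qed.

(** Leibniz rule in the time: by [n = s + (m - s) + (n - m)] one of the three pieces carries its own
    length. A time-weighted two-point function is bounded by a bubble through [twopt_time_part]. *)
Lemma agen_time_le N v :
 \sum_(n < N | (0 < n)%N) (n%:R * amaj D (fun=> 1) n v) * z ^+ n <= 4 * b.
Proof.
pose a1 n v := amaj D (fun=> 1) n v; pose tc n x := n%:R * c n x; pose ta n v := n%:R * a1 n v.
pose At N v := \sum_(n < N | (0 < n)%N) (n%:R * a1 n v) * z ^+ n.
have a10 n u : 0 <= a1 n u by exact: amaj_ge0.
have tc0 n u : 0 <= tc n u by rewrite mulr_ge0.
have At0 M u : 0 <= At M u by apply: sumr_ge0 => n _; rewrite !mulr_ge0.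
have bAt M : bddf (At M).
 have [C HC] := bA M; exists (M%:R * C) => u; rewrite ger0_norm//.
 apply: (le_via (M%:R * A M u)); last by rewrite ler_wpM2l//; apply: le_trans (HC u); exact: ler_norm.
 rewrite /agen mulr_sumr; apply: ler_sum => n _; rewrite -mulrA ler_wpM2r ?mulr_ge0//.
 by rewrite ler_nat ltnW.
have bb : forall p, \sum_(s < N.+1) tc s p * z ^+ s <= b.
 by move=> p; apply: le_trans (twopt_time_part N.+1 p) _; exact: bubble.
elim: N v {bb} => [|N IH] v; first by rewrite big_ord0 mulr_ge0.
have bb M p : \sum_(s < M) tc s p * z ^+ s <= b.
 by apply: le_trans (twopt_time_part M p) _; exact: bubble.
have bb' M p : \sum_(s < M | (0 < s)%N) tc s p * z ^+ s <= b.
 apply: le_trans (bb M p); rewrite [leRHS](bigID (fun s : 'I_M => (0 < s)%N))/= lerDl.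
 by apply: sumr_ge0 => s _; rewrite mulr_ge0.
pose T (f g h : nat -> Zd -> R) n := \sum_(m < n | (0 < m)%N) \sum_(s < m)
  \asum_p (f s p * g (m - s)%N (v - p) * h (n - m)%N (p - v)).
have rec n : (0 < n)%N -> n%:R * a1 n v <= tc n v +
  (T tc c a1 n + T c tc a1 n + T c c ta n).
 move=> n0; have b1 := @bddf_cst R d 1; have b0 := @bddf_cst R d 0.
 have := @amaj_rec R d D D_ge0 D_summ D_sum1 (fun=> 1) (fun=> 1) (fun=> 0) n v n0 b1 (fun=> ler01) b1 (fun=> ler01) b0 (fun=> lexx 0).
 move=> /(_ ltac:(by move=> _ _; rewrite addr0)) h.
 apply: (le_trans (ler_wpM2l (ler0n _ n) h)); rewrite mulr1 mulrDr lerD2l.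
 rewrite -!big_split/= mulr_sumr; apply: ler_sum => m m0.
 rewrite -!big_split/= mulr_sumr; apply: ler_sum => s _.
 have s1 (f g : Zd -> R) : summ f -> summ g ->
   summ (fun p => f p * g (v - p) * a1 (n - m)%N (p - v)).
  move=> sf sg; apply: summM; first exact: conv_term_summ.
  apply: (@bounded_comp _ _ (a1 (n - m)%N) (fun p => p - v)); exact: (amaj_bounded D_ge0 D_summ D_sum1 (n - m) b1).
 have sc k : summ (c k) by exact: csaw_summ.
 have st k : summ (tc k) by exact: summZ.
 have s3 : summ (fun p => c s p * c (m - s)%N (v - p) * ((n - m)%N%:R * a1 (n - m)%N (p - v))).
  apply: eq_summ (summZ (n - m)%N%:R (s1 _ _ (sc s) (sc (m - s)%N))) => p.
  by rewrite [RHS]mulrCA.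
 rewrite -asumD; [|exact: s1|exact: s1].
 rewrite -asumD; [|by apply: summD; exact: s1|exact: s3].
 rewrite -asumZ; last first.
  by apply: eq_summ (s1 _ _ (sc s) (sc (m - s)%N)) => p; rewrite mul0r addr0.
 apply: le_of_eq; apply: eq_asum => p.
 rewrite mul0r addr0 /tc /ta -/(a1 _ _).
 have -> : n%:R = s%:R + (m - s)%N%:R + (n - m)%N%:R :> R.
  by rewrite -!natrD; congr (_%:R); have := ltn_ord s; have := ltn_ord m; lia.
 by move: (c s p) (c (m - s)%N (v - p)) (a1 (n - m)%N (p - v)) => x y w; ring.
pose S w := \sum_(n < N.+1 | (0 < n)%N) w n * z ^+ n.
apply: (le_via (S (tc^~ v) + (S (T tc c a1) + S (T c tc a1) + S (T c c ta)))).
 rewrite /S -!big_split/=; apply: ler_sum => n n0; rewrite -!mulrDl ler_wpM2r//.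
 exact: rec.
have sHA : summ (fun p => H (v - p) * A N (p - v)).
 by apply: summM; [exact: (summ_sub v sH)|exact: (@bounded_comp _ _ (A N) (fun p => p - v) (bA N))].
have e1 : \asum_p (b * H (v - p) * A N (p - v)) <= b * (2 * b).
 rewrite (eq_asum_to (fun p => b * (H (v - p) * A N (p - v)))); last by move=> p; rewrite mulrA.
 rewrite asumZ// ler_wpM2l//; apply: le_trans (theta_le N).
 rewrite (asum_bij _ (add_bij v)); apply: le_of_eq; apply: eq_asum => u.
 have -> : v - (u + v) = - u by rewrite opprD addrCA subrr addr0.
 by rewrite (twopt'_even u) addrK.
have sGA : summ (fun p => G p * A N (p - v)).
 by apply: summM => //; exact: (@bounded_comp _ _ (A N) (fun p => p - v) (bA N)).
have e2 : \asum_p (G p * b * A N (p - v)) <= b * (4 * b).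
 rewrite (eq_asum_to (fun p => b * (G p * A N (p - v)))); last first.
  by move=> p; rewrite mulrA [b * _]mulrC.
 by rewrite asumZ// ler_wpM2l//; exact: gamma_le.
have e3 : \asum_p (G p * H (v - p) * At N (p - v)) <= b * (4 * b).
 by apply: conv_twopt_bound.
have h1 : S (T tc c a1) <= b * (2 * b).
 apply: le_trans e1; apply: (@triple_bound tc c a1 (fun=> b) H (A N)) => //.
  by move=> p; exact: twopt'_part.
 by apply: eq_summ (summZ b sHA) => p; rewrite mulrA.
have h2 : S (T c tc a1) <= b * (4 * b).
 apply: le_trans e2; apply: (@triple_bound c tc a1 G (fun=> b) (A N)) => //.
  by move=> p; exact: twopt_part.
 by apply: eq_summ (summZ b sGA) => p; rewrite mulrA [b * _]mulrC.
have h3 : S (T c c ta) <= b * (4 * b).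
 apply: le_trans e3; apply: (@triple_bound c c ta G H (At N)) => //.
 - by move=> n x; rewrite mulr_ge0.
 - by move=> p; exact: twopt_part.
 - by move=> p; exact: twopt'_part.
 - apply: summM; first exact: conv_term_summ.
  exact: (@bounded_comp _ _ (At N) (fun p => p - v) (bAt N)).
have h0 : S (tc^~ v) <= b by exact: bb'.
move: h0 h1 h2 h3 b2 b_ge0; move: (S _) (S _) (S _) (S _) => X1 X2 X3 X4; nra.
Qed.

(** The first step [y] is separated: seen from its endpoint, the first loop has to return to
    [- y]. *)
Lemma lacef_le_amaj om n : (1 < n)%N -> bddf om -> (forall x, 0 <= om x) ->
 E n (fun ys => `|lacef R n ys| * om (pos ys)) <=
 \asum_y (D y * amaj D om n.-1 (- y)).
Proof.
case: n => [|n] // n1 bom om0.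
have bo : bnd (fun ys => om (pos ys)) by have [C HC] := bom; exists C.
have bl : bnd (fun ys => `|lacef R n.+1 ys| * om (pos ys)).
 bounded.
have bm y : bnd (fun zs : seq Zd => majorant R (- y) (walk zs) n * om (pos zs - (- y))).
 apply: bndM; [exact: majorant_bnd|by have [C HC] := bom; exists C].
rewrite -addn1 addnC (expect_cat D_summ 1 n bl) addnC addn1/=.
rewrite (expect_one D); apply: nneg_asum_le => [y||y].
- by rewrite mulr_ge0//; apply: expect_ge0 => // zs _; rewrite mulr_ge0.
- have [C HC] := amaj_bounded D_ge0 D_summ D_sum1 n bom.
 by apply: (@summ_bndM _ _ _ _ C) => //.
- rewrite ler_wpM2l//; apply: expect_le => //.
  by have [C HC] := bl; exists C => zs; exact: HC.
 move=> zs szs; rewrite opprK pos_cat pos_cons pos_nil addr0 addrC ler_wpM2r//.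
 apply: le_trans (lace_le_majorant R (walk ([:: y] ++ zs)) 0 n1) _.
 rewrite big_mkcond big_ord1/= subn1/= walk0 sub0r shiftw_walk.
 by rewrite /= drop0 /walk /= take0 pos_cons pos_nil addr0.
Qed.

Lemma lacef_gen_le om N B : bddf om -> (forall x, 0 <= om x) -> (forall M v, agen om M v <= B) ->
 \sum_(n < N | (1 < n)%N) E n (fun ys => `|lacef R n ys| * om (pos ys)) * z ^+ n <= z * B.
Proof.
move=> bom om0 oB.
have sD n : summ (fun y => D y * amaj D om n.-1 (- y)).
 have [C HC] := amaj_bounded D_ge0 D_summ D_sum1 n.-1 bom.
 by apply: (@summ_bndM _ _ _ _ C) => //.
apply: (le_via (\sum_(n < N | (1 < n)%N) (\asum_y (D y * amaj D om n.-1 (- y))) * z ^+ n)).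
 by apply: ler_sum => n n1; rewrite ler_wpM2r//; exact: lacef_le_amaj.
have -> : \sum_(n < N | (1 < n)%N) (\asum_y (D y * amaj D om n.-1 (- y))) * z ^+ n =
  \asum_y (D y * (z * agen om N.-1 (- y))).
 transitivity (\asum_y (\sum_(n < N | (1 < n)%N) D y * amaj D om n.-1 (- y) * z ^+ n)).
  by rewrite asum_sum => [|n n1]; [apply: eq_bigr => n n1; rewrite asumZr|exact: summZr].
 apply: eq_asum => y; case: N => [|N]; first by rewrite big_ord0 /agen big_ord0 !mulr0.
 rewrite big_mkcond big_ord_recl/= add0r -big_mkcond/= !mulr_sumr.
 by apply: eq_bigr => n _; rewrite exprS; ring.
have sDB : summ (fun y => D y * (z * B)) by exact: summZr.
apply: (le_via (\asum_y (D y * (z * B)))); last by rewrite asumZr// D_sum1 mul1r.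
apply: nneg_asum_le => // y; first by rewrite !mulr_ge0 ?agen_ge0// ltW.
by rewrite ler_wpM2l// ler_wpM2l// ltW.
Qed.

Lemma lacef_sum_le N : \sum_(n < N | (1 < n)%N) E n (fun ys => `|lacef R n ys|) * z ^+ n <= z * (2 * b).
Proof.
have := @lacef_gen_le (fun=> 1) N (2 * b) (bddf_cst 1) (fun=> ler01) agen1_le.
by under eq_bigr do under eq_expect do rewrite mulr1.
Qed.

Lemma lacef_weight_le om W N : bddf om -> (forall x, 0 <= om x) -> om 0 = 0 ->
 (forall x, om (- x) = om x) ->
 (forall x y, om (x + y) <= 2 * om x + 2 * om y) -> (forall x, om x * H x <= W) ->
 \sum_(n < N | (1 < n)%N) E n (fun ys => `|lacef R n ys| * om (pos ys)) * z ^+ n <= z * (16 * W * b).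
Proof. by move=> *; apply: lacef_gen_le => // M v; exact: agen_weight_le. Qed.

(** Here [6 * b] is [4 * b] for the time of the later steps plus [2 * b] for the first step. *)
Lemma lacef_time_le N :
 \sum_(n < N | (1 < n)%N) n%:R * E n (fun ys => `|lacef R n ys|) * z ^+ n <= z * (6 * b).
Proof.
have sD n : summ (fun y => D y * amaj D (fun=> 1) n (- y)).
 have [C HC] := amaj_bounded D_ge0 D_summ D_sum1 n (bddf_cst 1).
 by apply: (@summ_bndM _ _ _ _ C) => //.
apply: (le_via (\sum_(n < N | (1 < n)%N) n%:R * (\asum_y (D y * amaj D (fun=> 1) n.-1 (- y))) * z ^+ n)).
 apply: ler_sum => n n1; rewrite ler_wpM2r// ler_wpM2l//.
 have := lacef_le_amaj n1 (bddf_cst 1) (fun=> ler01).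
 by under eq_expect do rewrite mulr1.
pose t N y := \sum_(n < N | (0 < n)%N) (n%:R * amaj D (fun=> 1) n (- y)) * z ^+ n.
have -> : \sum_(n < N | (1 < n)%N) n%:R * (\asum_y (D y * amaj D (fun=> 1) n.-1 (- y))) * z ^+ n =
  \asum_y (D y * (z * (t N.-1 y + agen (fun=> 1) N.-1 (- y)))).
 transitivity (\asum_y (\sum_(n < N | (1 < n)%N) n%:R * (D y * amaj D (fun=> 1) n.-1 (- y)) * z ^+ n)).
  rewrite asum_sum => [|n n1]; last by apply: summZr; exact: summZ.
  by apply: eq_bigr => n n1; rewrite asumZr ?asumZ//; exact: summZ.
 apply: eq_asum => y; rewrite /t; case: N => [|N]; first by rewrite big_ord0 /agen !big_ord0 addr0 !mulr0.
 rewrite big_mkcond big_ord_recl/= add0r -big_mkcond/= -big_split/= !mulr_sumr.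
 apply: eq_bigr => n _; rewrite exprS /bump leq0n add1n -natr1.
 by move: (amaj D (fun=> 1) n (- y)) => u; ring.
have sDB : summ (fun y => D y * (z * (6 * b))) by exact: summZr.
apply: (le_via (\asum_y (D y * (z * (6 * b))))); last by rewrite asumZr// D_sum1 mul1r.
have t0 M y : 0 <= t M y by apply: sumr_ge0 => n _; rewrite !mulr_ge0 ?amaj_ge0.
apply: nneg_asum_le => // y; first by rewrite mulr_ge0// mulr_ge0 ?addr_ge0// ltW.
rewrite ler_wpM2l//; apply: ler_wpM2l; first exact: ltW.
have h1 : t N.-1 y <= 4 * b := agen_time_le N.-1 (- y).
apply: (le_trans (lerD h1 (agen1_le N.-1 (- y)))).
by rewrite -mulrDl ler_wpM2r//; lra.
Qed.

End small_bubble.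

End two_point.

(** * Cosine transforms and second differences *)

Section real_fourier.
Variables (R : realType) (d : nat).
Local Notation Zd := 'rV[int]_d.
Implicit Types (f g : Zd -> R) (k l : 'rV[R]_d) (x y : Zd).

Definition ldot k x : R := dot k (of_lattice R x).

Lemma ldotDr k x y : ldot k (x + y) = ldot k x + ldot k y.
Proof.
rewrite /ldot /dot -big_split/=; apply: eq_bigr => i _.
by rewrite !mxE rmorphD mulrDr.
Qed.

Lemma ldotNr k x : ldot k (- x) = - ldot k x.
Proof. by rewrite /ldot /dot -sumrN; apply: eq_bigr => i _; rewrite !mxE rmorphN mulrN. Qed.

Lemma ldotBr k x y : ldot k (x - y) = ldot k x - ldot k y.
Proof. by rewrite ldotDr ldotNr. Qed.

Lemma ldot0r k : ldot k 0 = 0.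
Proof. by rewrite /ldot /dot big1// => i _; rewrite !mxE mulr0. Qed.

Lemma ldotDl k l x : ldot (k + l) x = ldot k x + ldot l x.
Proof. by rewrite /ldot /dot -big_split/=; apply: eq_bigr => i _; rewrite !mxE mulrDl. Qed.

Lemma ldotNl k x : ldot (- k) x = - ldot k x.
Proof. by rewrite /ldot /dot -sumrN; apply: eq_bigr => i _; rewrite !mxE mulNr. Qed.

Lemma ldotZl a k x : ldot (a *: k) x = a * ldot k x.
Proof. by rewrite /ldot /dot mulr_sumr; apply: eq_bigr => i _; rewrite !mxE mulrA. Qed.

Lemma ldot0l x : ldot 0 x = 0.
Proof. by rewrite /ldot /dot big1// => i _; rewrite !mxE mul0r. Qed.

Definition even_fun f := forall x, f (- x) = f x.

Definition fh f k : R := \asum_x (f x * cos (ldot k x)).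
(** Kept as a single sum, hence nonnegative for [f >= 0]; [gapE] recovers the difference of
    transforms. *)
Definition gap f k : R := \asum_x (f x * (1 - cos (ldot k x))).

Lemma cos_summ f k : summ f -> summ (fun x => f x * cos (ldot k x)).
Proof. by move=> sf; apply: (@summ_bndM _ _ _ _ 1) => // x; exact: cos_max. Qed.

Lemma sin_summ f k : summ f -> summ (fun x => f x * sin (ldot k x)).
Proof. by move=> sf; apply: (@summ_bndM _ _ _ _ 1) => // x; exact: sin_max. Qed.

Lemma onecos_ge0 (t : R) : 0 <= 1 - cos t. Proof. by rewrite subr_ge0 cos_le1. Qed.
Lemma onecos_le2 (t : R) : 1 - cos t <= 2. Proof. by rewrite lerBlDr -lerBlDl; have := cos_geN1 t; lra. Qed.

Lemma gap_summ f k : summ f -> summ (fun x => f x * (1 - cos (ldot k x))).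
Proof.
move=> sf; apply: (@summ_bndM _ _ _ _ 2) => // x.
by rewrite ger0_norm ?onecos_le2.
Qed.

Lemma fh0 f : fh f 0 = asum setT f.
Proof. by apply: eq_asum => x; rewrite ldot0l cos0 mulr1. Qed.

Lemma gapE f k : summ f -> gap f k = fh f 0 - fh f k.
Proof.
move=> sf; rewrite fh0 /gap -asumB//; last exact: cos_summ.
by apply: eq_asum => x; rewrite mulrBr mulr1.
Qed.

Lemma gap_ge0 f k : (forall x, 0 <= f x) -> 0 <= gap f k.
Proof. by move=> f0; apply: asum_ge0 => x; rewrite mulr_ge0. Qed.

Lemma fh_norm_le f k : summ f -> `|fh f k| <= \asum_x `|f x|.
Proof.
move=> sf; apply: asum_norm_le => [|x]; first exact: summ_abs.
by rewrite normrM ler_piMr// cos_max.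
Qed.

Lemma sin_sum0 f k : summ f -> even_fun f -> \asum_x (f x * sin (ldot k x)) = 0.
Proof.
move=> sf ef; have ss := sin_summ k sf.
have : \asum_x (f x * sin (ldot k x)) = - \asum_x (f x * sin (ldot k x)).
 rewrite -{1}(asum_opp (fun x => f x * sin (ldot k x))) -asumN//.
 by apply: eq_asum => x; rewrite ef ldotNr sinN mulrN.
lra.
Qed.

Lemma fh_conv f g k : summ f -> summ g -> even_fun f -> even_fun g ->
 fh (Defs.conv f g) k = fh f k * fh g k.
Proof.
move=> sf sg ef eg.
have S : summ (fun p : Zd * Zd => f p.2 * g (p.1 - p.2) * cos (ldot k p.1)).
 by apply: (@summ_bndM _ _ _ _ 1); [move=> p; exact: cos_max|exact: conv_summ_pair].
rewrite /fh /Defs.conv.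
transitivity (\asum_x \asum_y (f y * g (x - y) * cos (ldot k x))).
 by apply: eq_asum => x; rewrite asumZr//; exact: conv_term_summ.
rewrite (asum_swap (f := fun x y => f y * g (x - y) * cos (ldot k x)) S).
rewrite -asumZr; last exact: cos_summ.
apply: eq_asum => y; rewrite -[LHS](asum_shift _ y).
have s1 : summ (fun x => f y * cos (ldot k y) * (g x * cos (ldot k x))) by apply: summZ; exact: cos_summ.
have s2 : summ (fun x => f y * sin (ldot k y) * (g x * sin (ldot k x))) by apply: summZ; exact: sin_summ.
transitivity (\asum_x (f y * cos (ldot k y) * (g x * cos (ldot k x)) - f y * sin (ldot k y) * (g x * sin (ldot k x)))).
 by apply: eq_asum => x; rewrite addrK ldotDr cosD; ring.
rewrite asumB// !asumZ//; [|exact: sin_summ|exact: cos_summ].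
by rewrite sin_sum0// mulr0 subr0.
Qed.

(** The difference of the two sides is half a sum of two squares. This quasi-subadditivity makes
    [1 - cos] an admissible diagram weight. *)
Lemma onecosD (a b : R) : 1 - cos (a + b) <= 2 * (1 - cos a) + 2 * (1 - cos b).
Proof.
rewrite cosD; have := cos2Dsin2 a; have := cos2Dsin2 b.
move: (cos a) (cos b) (sin a) (sin b) => ca cb sa sb h1 h2.
have e : 2 * (1 - ca) + 2 * (1 - cb) - (1 - (ca * cb - sa * sb)) =
  ((ca + cb - 2) ^+ 2 + (sb - sa) ^+ 2) / 2 +
  (2 - (cb ^+ 2 + sb ^+ 2) - (ca ^+ 2 + sa ^+ 2)) / 2 by field.
by rewrite -subr_ge0 e h1 h2; have := sqr_ge0 (ca + cb - 2); have := sqr_ge0 (sb - sa); lra.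
Qed.

Lemma sin2_le (t : R) : sin t ^+ 2 <= 2 * (1 - cos t).
Proof. by have := sin2cos2 t; have := cos_le1 t; have := cos_geN1 t; nra. Qed.

(** Optimise over [t]: take [t = X / (4 * A)], or a large [t] when [A = 0]. *)
Lemma quad_bound (X A B : R) : 0 <= A -> 0 <= B -> 0 <= X ->
 (forall t, 0 < t -> X <= 2 * t * A + 2 * B / t) -> X ^+ 2 <= 16 * A * B.
Proof.
move=> A0 B0 X0 H; have [->|Xn] := eqVneq X 0.
 by rewrite expr0n/= !mulr_ge0.
have Xp : 0 < X by rewrite lt_def Xn.
have [Az|An] := eqVneq A 0.
 have tp : 0 < (4 * B + 1) / X by apply: divr_gt0 => //; lra.
 have := H _ tp; rewrite Az mulr0 add0r invf_div mulrA => h.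
 have h2 : 2 * B * X / (4 * B + 1) < X.
  by rewrite ltr_pdivrMr; [nra|lra].
 by move: (le_lt_trans h h2); rewrite ltxx.
have Ap : 0 < A by rewrite lt_def An.
have tp : 0 < X / (4 * A) by apply: divr_gt0 => //; lra.
have := H _ tp; rewrite invf_div => h.
have h3 : 2 * (X / (4 * A)) * A = X / 2 by field; rewrite gt_eqF.
rewrite h3 in h.
have : X / 2 <= 2 * B * (4 * A / X) by lra.
rewrite mulrA ler_pdivlMr// => h4.
by rewrite expr2; lra.
Qed.

(* The second difference of [1 / F] at [l], with increments [F(l +- k) - F(l)]
  controlled by the variation [v] at [k] and [u] at [l]. *)
Lemma inv_second_diff (a ap am v u : R) : 0 < a -> 0 < ap -> 0 < am -> 0 <= v -> 0 <= u ->
 `|ap + am - 2 * a| <= 2 * v -> (ap - am) ^+ 2 <= 16 * u * v -> u <= 2 * a ->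
 `|a^-1 - (ap^-1 + am^-1) / 2| <=
  v * (a ^- 2 / 2 + (ap ^- 2 + am ^- 2) * (17 / 4)).
Proof.
move=> a0 ap0 am0 v0 u0 h1 h2 h3.
have ia : a != 0 by rewrite gt_eqF.
have iap : ap != 0 by rewrite gt_eqF.
have iam : am != 0 by rewrite gt_eqF.
set A := a^-1; set P := ap^-1; set M := am^-1.
have A0 : 0 < A by rewrite invr_gt0.
have P0 : 0 < P by rewrite invr_gt0.
have M0 : 0 < M by rewrite invr_gt0.
have e : A - (P + M) / 2 = A / 4 * ((ap + am - 2 * a) * (P + M) - (ap - am) ^+ 2 * (P * M)).
 by rewrite /A /P /M; field; rewrite ?iap ?iam.
rewrite e normrM (ger0_norm (x := A / 4)); last by rewrite divr_ge0// ltW.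
have h4 : `|(ap + am - 2 * a) * (P + M) - (ap - am) ^+ 2 * (P * M)| <=
  2 * v * (P + M) + 16 * u * v * (P * M).
 apply: (le_trans (ler_normB _ _)); apply: lerD.
  rewrite normrM (ger0_norm (x := P + M)); last by rewrite addr_ge0// ltW.
  by rewrite ler_wpM2r// addr_ge0// ltW.
 rewrite normrM !ger0_norm ?sqr_ge0//; last by rewrite mulr_ge0// ltW.
 by rewrite ler_wpM2r// mulr_ge0// ltW.
apply: (le_trans (ler_wpM2l _ h4)); first by rewrite divr_ge0// ltW.
have uA : u * A <= 2 by rewrite /A ler_pdivrMr.
have -> : a ^- 2 = A ^+ 2 by rewrite /A exprVn.
have -> : ap ^- 2 = P ^+ 2 by rewrite /P exprVn.
have -> : am ^- 2 = M ^+ 2 by rewrite /M exprVn.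
rewrite [leLHS](_ : _ = v * (A * (P + M) / 2 + 4 * (u * A) * (P * M))); last by field.
rewrite ler_wpM2l//.
(* Origin of [17 / 4 = 1 / 4 + 4]: the first term is at most [A ^ 2 / 2 + (P ^ 2 + M ^ 2) / 4], and
   [8 P M <= 4 (P ^ 2 + M ^ 2)]. *)
have h5 : 4 * (u * A) * (P * M) <= 8 * (P * M).
 by rewrite ler_wpM2r//; [rewrite mulr_ge0// ltW|lra].
have h6 : 0 <= (P - M) ^+ 2 by rewrite sqr_ge0.
have h7 : 0 <= (A - P) ^+ 2 by rewrite sqr_ge0.
have h8 : 0 <= (A - M) ^+ 2 by rewrite sqr_ge0.
move: h5 h6 h7 h8; rewrite !sqrrB; nra.
Qed.

End real_fourier.

(** * Fourier analysis on finite tori *)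

Section torus_grid.
Variables (R : realType) (d M : nat).
Local Notation Zd := 'rV[int]_d.
Local Notation m := M.+1.
Local Notation J := 'rV['I_m]_d.
Implicit Types (q r x y : Zd) (F : Zd -> R).

Definition freq q : 'rV[R]_d := (2 * pi / m%:R) *: of_lattice R q.
Definition lift_idx (j : J) : Zd := map_mx (fun i => (nat_of_ord i)%:Z) j.
Definition avg F : R := (#|J|%:R)^-1 * \sum_(j : J) F (lift_idx j).
Definition periodic_idx F := forall q r, F (q + m%:Z *: r) = F q.

Lemma freqD q r : freq (q + r) = freq q + freq r.
Proof. by rewrite /freq -scalerDr; congr (_ *: _); apply/matrixP => i j; rewrite !mxE rmorphD. Qed.

Lemma freqN q : freq (- q) = - freq q.
Proof. by rewrite /freq -scalerN; congr (_ *: _); apply/matrixP => i j; rewrite !mxE rmorphN. Qed.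

Lemma freqB q r : freq (q - r) = freq q - freq r.
Proof. by rewrite freqD freqN. Qed.

Lemma freq0 : freq 0 = 0.
Proof. by rewrite /freq (_ : of_lattice R 0 = 0) ?scaler0//; apply/matrixP => i j; rewrite !mxE. Qed.

Lemma cos_2pi_int (t : R) (n : int) : cos (t + n%:~R * (2 * pi)) = cos t.
Proof.
have key (k : nat) (s : R) : cos (s + k%:R * (2 * pi)) = cos s.
 elim: k s => [|k IH] s; first by rewrite mul0r addr0.
 by rewrite -natr1 mulrDl mul1r addrA [2 * pi]mulr_natl cosD2pi -[pi *+ 2]mulr_natl IH.
case: n => n; first exact: key.
by rewrite -(key n.+1 (t + _)) NegzE mulrNz mulNr subrK.
Qed.

Lemma ldot_freq_int q r x : ldot (freq (q + m%:Z *: r)) x =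
 ldot (freq q) x + (\sum_i r 0 i * x 0 i)%:~R * (2 * pi).
Proof.
rewrite freqD ldotDl; congr (_ + _).
rewrite /freq ldotZl /ldot /dot rmorph_sum/= mulr_sumr mulr_suml; apply: eq_bigr => i _.
rewrite !mxE !rmorphM/=; field.
by rewrite nat1r pnatr_eq0.
Qed.

Lemma cos_periodic x : periodic_idx (fun q => cos (ldot (freq q) x)).
Proof. by move=> q r; rewrite ldot_freq_int cos_2pi_int. Qed.

Lemma fh_periodic (f : Zd -> R) : periodic_idx (fun q => fh f (freq q)).
Proof. by move=> q r; apply: eq_asum => x; rewrite cos_periodic. Qed.

Lemma lift_idx_mod (j : J) q :
 exists r, lift_idx (j + \row_i inZp `|modz (q ord0 i) m|) = lift_idx j + q + m%:Z *: r.
Proof.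
exists (\row_i (- divz (q ord0 i) m - ((j ord0 i + `|modz (q ord0 i) m|) %/ m)%N%:Z)).
apply/matrixP => a i; rewrite !mxE (ord1 a) /=.
have m0 : (m%:Z != 0) by [].
have c0 := modz_ge0 (q ord0 i) m0.
have cm : (`|modz (q ord0 i) m| < m)%N.
 by rewrite -ltz_nat gez0_abs// ltz_pmod.
rewrite (modn_small cm); set c := `|modz _ _|%N.
have qE := divz_eq (q ord0 i) m; rewrite {1}qE -[modz (q ord0 i) m]gez0_abs// -/c.
have := divn_eq (j ord0 i + c) m; move: ((j ord0 i + c) %/ m)%N ((j ord0 i + c) %% m)%N => A B e.
have -> : B%:Z = (j ord0 i)%:Z + c%:Z - A%:Z * m%:Z.
 by rewrite -PoszD e PoszD PoszM addrC addKr.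
ring.
Qed.

Lemma avg_shift F q : periodic_idx F -> avg (fun p => F (p + q)) = avg F.
Proof.
move=> pF; congr (_ * _).
pose qb : J := \row_i inZp `|modz (q ord0 i) m|.
rewrite [RHS](reindex_inj (addIr qb)); apply: eq_bigr => j _.
by have [r ->] := lift_idx_mod j q; rewrite pF.
Qed.

Lemma lift_idx_opp (j : J) : exists r, lift_idx (- j) = - lift_idx j + m%:Z *: r.
Proof.
exists (\row_i (if j ord0 i == 0 then 0 else 1)).
apply/matrixP => a i; rewrite !mxE (ord1 a) /=.
have -> : (0 : 'I_1) = ord0 by apply: val_inj.
case: eqP => [->|/eqP h] /=; first by rewrite subn0 modnn mulr0 addr0.
have jm := ltn_ord (j ord0 i).
have j0 : (0 < j ord0 i)%N by rewrite lt0n; apply: contra h => /eqP h; apply/eqP/val_inj.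
rewrite modn_small; last by lia.
by rewrite mulr1 -subzn 1?ltnW// addrC.
Qed.

Lemma avg_opp F : periodic_idx F -> avg (fun p => F (- p)) = avg F.
Proof.
move=> pF; congr (_ * _).
rewrite [RHS](reindex_inj (@oppr_inj _)); apply: eq_bigr => j _.
by have [r ->] := lift_idx_opp j; rewrite pF.
Qed.

Lemma avgD F G : avg (fun q => F q + G q) = avg F + avg G.
Proof. by rewrite /avg big_split mulrDr. Qed.

Lemma avgZ c F : avg (fun q => c * F q) = c * avg F.
Proof. by rewrite /avg -mulr_sumr mulrCA. Qed.

Lemma avgN F : avg (fun q => - F q) = - avg F.
Proof. by rewrite /avg sumrN mulrN. Qed.

Lemma card_J_gt0 : 0 < #|J|%:R :> R.
Proof. by rewrite ltr0n; apply/card_gt0P; exists 0. Qed.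

Lemma avg_cst c : avg (fun=> c) = c.
Proof. by rewrite /avg sumr_const -[c *+ _]mulr_natl mulrA mulVf ?mul1r// gt_eqF// card_J_gt0. Qed.

Lemma avg_le F G : (forall q, F q <= G q) -> avg F <= avg G.
Proof.
move=> h; rewrite /avg ler_wpM2l//; exact: ler_sum.
Qed.

Lemma eq_avg F G : F =1 G -> avg F = avg G.
Proof. by move=> h; congr (_ * _); apply: eq_bigr => j _; rewrite h. Qed.

Lemma avg_norm F : `|avg F| <= avg (fun q => `|F q|).
Proof.
rewrite /avg normrM ger0_norm// ler_wpM2l//.
exact: ler_norm_sum.
Qed.

(** By orthogonality of characters this is the indicator of the sublattice [m Z^d]. *)
Definition Achar x : R := avg (fun q => cos (ldot (freq q) x)).

Lemma Achar0 : Achar 0 = 1.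
Proof. by rewrite -[RHS]avg_cst; apply: eq_avg => q; rewrite ldot0r cos0. Qed.

Lemma sin_periodic x : periodic_idx (fun q => sin (ldot (freq q) x)).
Proof.
move=> q r; rewrite -[LHS]cosBpihalf -[RHS]cosBpihalf ldot_freq_int addrAC.
by rewrite cos_2pi_int.
Qed.

Lemma Achar_cos q x : Achar x * cos (ldot (freq q) x) = Achar x.
Proof.
have S0 : avg (fun q => sin (ldot (freq q) x)) = 0.
 have := avg_opp (sin_periodic x); rewrite (eq_avg (G := fun q => - sin (ldot (freq q) x))); last first.
  by move=> p; rewrite freqN ldotNl sinN.
 by rewrite avgN; lra.
rewrite -[RHS](avg_shift q (cos_periodic x)).
transitivity (cos (ldot (freq q) x) * Achar x - sin (ldot (freq q) x) * avg (fun q => sin (ldot (freq q) x))).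
 by rewrite S0 mulr0 subr0 mulrC.
rewrite -!avgZ -avgN -avgD; apply: eq_avg => p.
by rewrite freqD ldotDl cosD; ring.
Qed.

(** Translating the average by [q] shows that multiplication by [cos (ldot (freq q) x)] leaves
    [Achar x] unchanged. If [Achar x] is not zero, all these cosines equal 1. *)
Lemma Achar01 x : Achar x = 0 \/ Achar x = 1.
Proof.
have [->|An] := eqVneq (Achar x) 0; first by left.
right; rewrite -[RHS]avg_cst; apply: eq_avg => q.
by apply: (mulfI An); rewrite Achar_cos mulr1.
Qed.

Lemma Achar_ge0 x : 0 <= Achar x.
Proof. by case: (Achar01 x) => ->. Qed.

Lemma Achar_le1 x : Achar x <= 1.
Proof. by case: (Achar01 x) => ->. Qed.

Lemma AcharN x : Achar (- x) = Achar x.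
Proof. by apply: eq_avg => q; rewrite ldotNr cosN. Qed.

(** Poisson summation: the average evaluates the periodisation of [f] at [x]. *)
Lemma avg_fh_cos (f : Zd -> R) x : summ f -> even_fun f ->
 avg (fun q => fh f (freq q) * cos (ldot (freq q) x)) = \asum_y (f y * Achar (y - x)).
Proof.
move=> sf ef.
have bA : bddf Achar.
 by exists 1 => y; rewrite ger0_norm ?Achar_ge0 ?Achar_le1.
have s1 : summ (fun y => f y * Achar (y - x)) by apply: summM => //; exact: (@bounded_comp _ _ Achar (fun y => y - x)).
have s2 : summ (fun y => f y * Achar (y + x)) by apply: summM => //; exact: (@bounded_comp _ _ Achar (fun y => y + x)).
have e2 : \asum_y (f y * Achar (y + x)) = \asum_y (f y * Achar (y - x)).
 rewrite -[LHS](asum_opp (fun y => f y * Achar (y + x))); apply: eq_asum => y.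
 by rewrite ef -AcharN opprD opprK.
transitivity (\asum_y (f y * Achar (y - x) / 2 + f y * Achar (y + x) / 2)); last first.
 by rewrite asumD ?asumZr ?e2//; [field|exact: summZr|exact: summZr].
rewrite /avg mulr_sumr.
transitivity (\sum_(j : J) \asum_y (#|J|%:R^-1 * (f y * cos (ldot (freq (lift_idx j)) y) * cos (ldot (freq (lift_idx j)) x)))).
 apply: eq_bigr => j _; rewrite -asumZr; last exact: cos_summ.
 by rewrite asumZ//; apply: summZr; exact: cos_summ.
rewrite -asum_sum; last by move=> j _; apply: summZ; apply: summZr; exact: cos_summ.
apply: eq_asum => y; rewrite -mulr_sumr.
rewrite -[f y * Achar (y - x) / 2]mulrA -[f y * Achar (y + x) / 2]mulrA -mulrDr.
rewrite -mulrDl /Achar -avgD /avg -[_ * _ / 2]mulrA mulrCA; congr (_ * _).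
rewrite mulr_suml mulr_sumr; apply: eq_bigr => j _.
by rewrite ldotBr ldotDr cosB cosD; field.
Qed.

(** For [f >= 0] the periodisation dominates [f x]. This one-sided inversion replaces the Fourier
    integral. *)
Lemma le_avg_fh (f : Zd -> R) x : summ f -> even_fun f -> (forall y, 0 <= f y) ->
 f x <= avg (fun q => `|fh f (freq q)|).
Proof.
move=> sf ef f0.
apply: (le_via (avg (fun q => fh f (freq q) * cos (ldot (freq q) x)))).
 rewrite avg_fh_cos//.
 have h := @asum_ge_term _ _ (fun y => f y * Achar (y - x)) x.
 apply: le_trans (h _ _).
 - by rewrite subrr Achar0 mulr1.
 - by move=> y; rewrite mulr_ge0// Achar_ge0.
 - apply: summM => //; exists 1 => y; by rewrite ger0_norm ?Achar_ge0 ?Achar_le1.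
apply: (le_trans (ler_norm _)); apply: (le_trans (avg_norm _)).
by apply: avg_le => q; rewrite normrM ler_piMr// cos_max.
Qed.

Lemma card_J : #|J| = (m ^ d)%N.
Proof. by rewrite card_mx card_ord mul1n. Qed.

Section infrared.
Variables (phi g : Zd -> R).
Hypotheses (phi_summ : summ phi) (phi_even : even_fun phi)
 (g_summ : summ g) (g_even : even_fun g) (g_ge0 : forall x, 0 <= g x).
Let F k : R := 1 - fh phi k.
Let var k : R := gap (fun x => `|phi x|) k.
Hypotheses (gF : forall k, fh g k * F k = 1)
 (F_gt0 : forall q, 0 < F (freq q))
 (var_le : forall q, var (freq q) <= 2 * F (freq q)).

Let fhg q : fh g (freq q) = (F (freq q))^-1.
Proof. by apply: (mulIf (lt0r_neq0 (F_gt0 q))); rewrite gF mulVf// gt_eqF. Qed.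

Let var_ge0 k : 0 <= var k. Proof. by apply: gap_ge0. Qed.

Let sabs : summ (fun x => `|phi x|). Proof. exact: summ_abs. Qed.

(** The left side, as a function of [x], is nonnegative, and its transform is a second difference of
    [1 / F], so [inv_second_diff] applies at each grid point. Shifting the grid does not change the
    average of [F ^- 2], so the constant is [1 / 2 + 2 * (17 / 4) = 9]. *)
Lemma weight_le_avg q0 x :
 (1 - cos (ldot (freq q0) x)) * g x <= 9 * var (freq q0) * avg (fun q => (F (freq q))^-2).
Proof.
set k := freq q0.
pose w y := (1 - cos (ldot k y)) * g y.
have sw : summ w by apply: eq_summ (gap_summ k g_summ) => y; exact: mulrC.
have ew : even_fun w by move=> y; rewrite /w ldotNr cosN g_even.
have w0 y : 0 <= w y by rewrite mulr_ge0.
apply: le_trans (le_avg_fh x sw ew w0) _.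
have Fp p : 0 < F (freq p + k) by rewrite -freqD.
have Fm p : 0 < F (freq p - k) by rewrite -freqB.
have fhw p : fh w (freq p) = (F (freq p))^-1 - ((F (freq p + k))^-1 + (F (freq p - k))^-1) / 2.
 rewrite -freqD -freqB -!fhg /fh freqD freqB -/k; set l := freq p.
 have h1 := cos_summ l g_summ; have h2 := cos_summ (l + k) g_summ; have h3 := cos_summ (l - k) g_summ.
 rewrite -asumD// -asumZr; last exact: summD.
 rewrite -asumB//; last by apply: summZr; exact: summD.
 by apply: eq_asum => y; rewrite /w !ldotDl ldotNl cosB cosD; field.
have key p (l := freq p) : `|fh w l| <= var k * ((F l)^-2 / 2 + ((F (l + k))^-2 + (F (l - k))^-2) * (17 / 4)).
 rewrite fhw -/l; apply: (@inv_second_diff R (F l) (F (l + k)) (F (l - k)) (var k) (var l) (F_gt0 p) (Fp p) (Fm p) (var_ge0 k) (var_ge0 l) _ _ (var_le p)).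
 - rewrite /F [X in `|X|](_ : _ = 2 * fh phi l - fh phi (l + k) - fh phi (l - k)); last by ring.
  have h1 := cos_summ l phi_summ; have h2 := cos_summ (l + k) phi_summ; have h3 := cos_summ (l - k) phi_summ.
  rewrite /fh -asumZ// -asumB//; last exact: summZ.
  rewrite -asumB//; last by apply: summB => //; exact: summZ.
  have sv : summ (fun y => 2 * (`|phi y| * (1 - cos (ldot k y)))) by apply: summZ; exact: gap_summ.
  rewrite /var /gap -asumZ; last exact: gap_summ.
  apply: asum_norm_le => // y; rewrite !ldotDl ldotNl cosB cosD.
  rewrite [X in `|X|](_ : _ = 2 * (phi y * (1 - cos (ldot k y))) * cos (ldot l y)); last by ring.
  rewrite !normrM (ger0_norm (onecos_ge0 _)) (ger0_norm (x := 2))//.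
  by rewrite ler_piMr ?cos_max// mulr_ge0// mulr_ge0// onecos_ge0.
 - rewrite -real_normK ?num_real//; apply: quad_bound => // t t0.
  rewrite /F [X in `|X|](_ : _ = fh phi (l - k) - fh phi (l + k)); last by ring.
  have h2 := cos_summ (l + k) phi_summ; have h3 := cos_summ (l - k) phi_summ.
  have v1 := gap_summ l sabs; have v2 := gap_summ k sabs.
  rewrite /fh -asumB// /var /gap.
  have -> : 2 * (\asum_y (`|phi y| * (1 - cos (ldot k y)))) / t = 2 / t * (\asum_y (`|phi y| * (1 - cos (ldot k y)))) by rewrite mulrAC.
  rewrite -!asumZ// -asumD; try exact: summZ.
  apply: asum_norm_le => [|y]; first by apply: summD; exact: summZ.
  rewrite !ldotDl ldotNl cosB cosD.
  move: (sin2_le (ldot l y)) (sin2_le (ldot k y)) => sl sk.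
  rewrite [X in `|X|](_ : _ = phi y * (2 * (sin (ldot l y) * sin (ldot k y)))); last by ring.
  rewrite normrM.
  rewrite [leRHS](_ : _ = `|phi y| * (t * (2 * (1 - cos (ldot l y))) + t^-1 * (2 * (1 - cos (ldot k y))))); last by ring.
  rewrite ler_wpM2l//.
  move: (sin (ldot l y)) (sin (ldot k y)) sl sk => a c sl sk.
  apply: (le_via (t * a ^+ 2 + t^-1 * c ^+ 2)); last first.
   by rewrite lerD// ler_wpM2l// ?invr_ge0 ltW.
  have h4 : 0 <= (t * a - c) ^+ 2 by rewrite sqr_ge0.
  have h5 : 0 <= (t * a + c) ^+ 2 by rewrite sqr_ge0.
  have -> : t * a ^+ 2 + t^-1 * c ^+ 2 = (t ^+ 2 * a ^+ 2 + c ^+ 2) / t by field; rewrite gt_eqF.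
  by rewrite ler_pdivlMr// -[X in _ * X](ger0_norm (ltW t0)) -normrM ler_norml; apply/andP; split; nra.
apply: (le_via (avg (fun q => var k * ((F (freq q))^-2 / 2 + ((F (freq (q + q0)))^-2 + (F (freq (q - q0)))^-2) * (17 / 4))))).
 by apply: avg_le => q; rewrite freqD freqB; exact: key.
have pF : periodic_idx (fun q => (F (freq q))^-2) by move=> q r; rewrite /F fh_periodic.
rewrite avgZ avgD -[X in _ * (X + _)](eq_avg (F := fun q => 2^-1 * (F (freq q))^-2)); last by move=> q; rewrite mulrC.
rewrite -[X in _ * (_ + X)](eq_avg (F := fun q => 17 / 4 * ((F (freq (q + q0)))^-2 + (F (freq (q - q0)))^-2))); last by move=> q; rewrite mulrC.
rewrite !avgZ avgD (avg_shift q0 pF) (avg_shift (- q0) pF).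
by move: (avg _) => A; apply: le_of_eq; field.
Qed.

(** Replacing [h] by [z] times [u] convolved with [g] bounds the bubble by a function with transform
    [z * fh u / F ^ 2]. *)
Lemma conv_le_avg (u h : Zd -> R) z x : summ u -> even_fun u -> (forall y, 0 <= u y) ->
 (forall y, 0 <= h y) -> summ h -> 0 <= z ->
 (forall y, h y <= z * Defs.conv u g y) ->
 Defs.conv g h x <= z * avg (fun q => `|fh u (freq q)| * (F (freq q))^-2).
Proof.
move=> su eu u0 h0 sh z0 hu.
have sug : summ (Defs.conv u g) by exact: conv_summ.
have eug : even_fun (Defs.conv u g).
 move=> y; rewrite /Defs.conv -[LHS](asum_opp (fun w => u w * g (- y - w))); apply: eq_asum => w.
 by rewrite eu -opprB g_even opprK addrC.
have ug0 y : 0 <= Defs.conv u g y by exact: conv_ge0.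
have s1 : summ (Defs.conv g (Defs.conv u g)) by exact: conv_summ.
have e1 : even_fun (Defs.conv g (Defs.conv u g)).
 move=> y; rewrite {1}/Defs.conv -[LHS](asum_opp (fun w => g w * Defs.conv u g (- y - w))); apply: eq_asum => w.
 by rewrite g_even -opprB eug opprK addrC.
have p1 y : 0 <= Defs.conv g (Defs.conv u g) y by exact: conv_ge0.
apply: (le_via (z * Defs.conv g (Defs.conv u g) x)).
 move: (Defs.conv u g) sug ug0 hu => v sv v0 hv; rewrite /Defs.conv -asumZ; last exact: conv_term_summ.
 apply: nneg_asum_le => [y||y]; first by rewrite mulr_ge0.
  by apply: summZ; exact: conv_term_summ.
 by rewrite mulrCA ler_wpM2l.
rewrite ler_wpM2l//; apply: le_trans (le_avg_fh x s1 e1 p1) _.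
apply: avg_le => q; rewrite !fh_conv// fhg !normrM mulrCA (ger0_norm (x := _^-1)); last by rewrite invr_ge0 ltW.
by rewrite expr2 invfM.
Qed.

Variables (Delta : Zd -> R) (chi C1 eta : R).
Hypotheses (Delta_ge0 : forall q, 0 <= Delta q)
 (Delta_gt0 : forall j : J, j != 0 -> 0 < Delta (lift_idx j))
 (F_Delta : forall q, Delta q <= 2 * F (freq q))
 (F_chi : forall q, 1 <= chi * F (freq q))
 (chi_le : chi ^+ 2 <= eta * #|J|%:R).

(** Off the zero mode [F] is at least [Delta / 2]. At the zero mode [Delta] vanishes in the
    application and only [F >= 1 / chi] is available; its share, [chi ^ 2] over the number of grid
    points, is at most [eta] on a fine grid. *)
Lemma avg_F_le (u : Zd -> R) : (forall q, 0 <= u q <= 1) ->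
 avg (fun q => u q * (F (freq q))^-2) <= 4 * avg (fun q => u q * (Delta q)^-2) + eta.
Proof.
move=> u01; rewrite -avgZ /avg.
rewrite (bigD1 (0 : J))//= [in leRHS](bigD1 (0 : J))//= !mulrDr.
have F2 q : 0 < F (freq q) ^+ 2 by rewrite exprn_gt0.
have h1 : #|J|%:R^-1 * (u (lift_idx 0) * F (freq (lift_idx 0)) ^- 2) <= eta.
 rewrite ler_pdivrMl ?card_J_gt0// [X in _ <= X]mulrC; apply: le_trans chi_le.
 have /andP[ua ub] := u01 (lift_idx 0).
 apply: (le_via (F (freq (lift_idx 0)) ^- 2)); first by rewrite ler_piMl// invr_ge0 ltW.
 rewrite -[leLHS]mul1r ler_pdivrMr// -exprMn -[leLHS](expr1n _ 2).
 by rewrite lerXn2r ?nnegrE// (le_trans ler01)// F_chi.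
have h2 : 0 <= #|J|%:R^-1 * (4 * (u (lift_idx 0) * Delta (lift_idx 0) ^- 2)).
 have /andP[ua ub] := u01 (lift_idx 0).
 by rewrite !mulr_ge0// invr_ge0 sqr_ge0.
have h3 : #|J|%:R^-1 * (\sum_(i | i != 0) u (lift_idx i) * F (freq (lift_idx i)) ^- 2) <=
  #|J|%:R^-1 * (\sum_(i | i != 0) 4 * (u (lift_idx i) * Delta (lift_idx i) ^- 2)).
 rewrite ler_wpM2l//; apply: ler_sum => j j0.
 have /andP[ua ub] := u01 (lift_idx j).
 rewrite mulrCA ler_wpM2l// -[leLHS]mul1r ler_pdivrMr//.
 have Dp := Delta_gt0 j0.
 rewrite mulrAC ler_pdivlMr ?exprn_gt0// mul1r.
 have -> : 4 * F (freq (lift_idx j)) ^+ 2 = (2 * F (freq (lift_idx j))) ^+ 2 by ring.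
 by rewrite lerXn2r ?nnegrE// ?mulr_ge0// ltW.
by move: h1 h2 h3; move: (_ * (u _ * _)) (_ * (4 * _)) (_ * \sum_(i | _) _) (_ * \sum_(i | _) _) => X1 X2 X3 X4; lra.
Qed.

End infrared.
End torus_grid.

(** * Cauchy products and the convolution equation *)

Section cauchy_product.
Variable R : realType.

Lemma asum_nat_shift (g : nat -> R) m :
 \asum_(n : nat) (if (m <= n)%N then g (n - m)%N else 0) = asum setT g.
Proof.
transitivity (asum [set n | (m <= n)%N] (fun n => g (n - m)%N)).
 rewrite [RHS]asum_mkcond; apply: eq_asum => n; case: ifPn => h; first by rewrite mem_set.
 by rewrite memNset//=; exact/negP.
rewrite (@asum_reindex _ _ _ setT [set n | (m <= n)%N] (fun n => (n + m)%N)).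
 by apply: eq_asum => n /=; rewrite addnK.
split.
- by move=> n _ /=; rewrite leq_addl.
- by move=> n n' _ _ /addIn.
- by move=> n /= mn; exists (n - m)%N => //; rewrite subnK.
Qed.

Lemma summ_nat_shift (g : nat -> R) m : summ g ->
 summ (fun n : nat => if (m <= n)%N then g (n - m)%N else 0).
Proof.
move=> sg; apply: summ_of_abs.
apply: (proj1 (@nneg_summ_nat R _ (\asum_(n : nat) `|g n|) _ _)) => // N.
rewrite (eq_bigr (fun i : 'I_N => if (m <= i)%N then `|g (i - m)%N| else 0)); last first.
 by move=> i _; case: ifP => //; rewrite normr0.
apply: le_trans (nneg_asum_nat_ge (N - m) (fun n => normr_ge0 (g n)) (summ_abs sg)).
rewrite -(big_mkord xpredT (fun i => if (m <= i)%N then `|g (i - m)%N| else 0)).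
have [Nm|mN] := leqP N m.
 rewrite big_nat big1 ?sumr_ge0// => i /andP[_ iN].
 by rewrite leqNgt (leq_trans iN).
rewrite (@big_cat_nat _ _ _ m)//=; last exact: ltnW.
rewrite [X in X + _]big_nat [X in X + _]big1 ?add0r; last first.
 by move=> i /andP[_ im]; rewrite leqNgt im.
rewrite -{1}[m]add0n big_addn big_mkord; apply: le_of_eq.
by apply: eq_bigr => i _; rewrite leq_addl addnK.
Qed.

Lemma cauchy_asum (h g : nat -> R) : summ h -> summ g ->
 summ (fun n => \sum_(m < n.+1) h m * g (n - m)%N) /\
 \asum_(n : nat) (\sum_(m < n.+1) h m * g (n - m)%N) = asum setT h * asum setT g.
Proof.
move=> sh sg; pose t n m := if (m <= n)%N then h m * g (n - m)%N else 0.
have tE n : \sum_(m < n.+1) h m * g (n - m)%N = \asum_(m : nat) t n m.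
 rewrite (@asum_seq _ _ (t n) (iota 0 n.+1)) ?iota_uniq//; last first.
  by move=> m; rewrite mem_iota/= add0n ltnS /t => /negbTE ->.
 rewrite -[iota 0 n.+1]/(index_iota 0 n.+1) big_mkord; apply: eq_bigr => m _.
 by rewrite /t -ltnS ltn_ord.
have st : summ (fun p : nat * nat => t p.2 p.1).
 apply: (@summ_pair R _ _ (fun m n => t n m) (fun m => `|h m| * \asum_(n : nat) `|g n|)).
 - move=> m; apply: eq_summ (summZ (h m) (summ_nat_shift m sg)) => n.
  by rewrite /t; case: ifP => //; rewrite mulr0.
 - move=> m; rewrite -(asum_nat_shift (fun n => `|g n|) m) -asumZ; last exact: (summ_nat_shift m (summ_abs sg)).
  apply: le_of_eq; apply: eq_asum => n.
  by rewrite /t; case: ifP => _; rewrite ?normrM// normr0 mulr0.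
 - by apply: summZr; exact: summ_abs.
have st' : summ (fun p : nat * nat => t p.1 p.2) := summ_swap (f := fun m n => t n m) st.
split; first by apply: eq_summ (summ_pair_sum st') => n; rewrite tE.
rewrite (eq_asum _ tE) (asum_swap st') -asumZr//; apply: eq_asum => m.
rewrite -(asum_nat_shift g m) -asumZ; last exact: summ_nat_shift.
by apply: eq_asum => n; rewrite /t; case: ifP => //; rewrite mulr0.
Qed.

End cauchy_product.

Section lace_expansion.
Variables (R : realType) (d : nat) (D : 'rV[int]_d -> R).
Local Notation Zd := 'rV[int]_d.
Local Notation E := (expect D).
Hypotheses (D_ge0 : forall x, 0 <= D x)
 (D_summ : summ D)
 (D_sum1 : asum setT D = 1)
 (D_even : forall x, D (- x) = D x)
 (D_zero : D 0 = 0).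
Local Notation opps := (map (fun x : Zd => - x)).
Implicit Types (phi psi : seq Zd -> R) (ys : seq Zd) (k : 'rV[R]_d).

(** A walk with a zero step has weight zero because [D 0 = 0], so it suffices to compare the
    functionals on moving walks. *)
Lemma eq_expect_moving n phi psi :
 (forall ys, size ys = n -> (forall y, y \in ys -> y != 0) -> phi ys = psi ys) ->
 E n phi = E n psi.
Proof.
move=> H; apply: eq_asum => ys; case: (boolP (0 \in tval ys)) => h.
 suff -> : step_weight D ys = 0 by rewrite !mul0r.
 by rewrite /step_weight; apply/eqP; rewrite prodf_seq_eq0; apply/hasP; exists 0 => //=; rewrite D_zero.
rewrite H// ?size_tuple// => y yy; apply: contra h => /eqP <-; exact: yy.
Qed.

Lemma walk_moving ys : (forall y, y \in ys -> y != 0) -> moving (walk ys) (size ys).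
Proof.
move=> H i iy; rewrite walkS// eq_sym -subr_eq0 addrC addKr.
by apply: H; rewrite mem_nth.
Qed.

Definition sym phi := forall ys, phi (opps ys) = phi ys.
Definition antisym phi := forall ys, phi (opps ys) = - phi ys.

(** Reversing the sign of every step preserves the weight and changes the sign of [th]. *)
Lemma expect_sin0 n phi th : bnd phi -> sym phi -> antisym th ->
 E n (fun ys => phi ys * sin (th ys)) = 0.
Proof.
move=> bp sp ath; have : E n (fun ys => phi ys * sin (th ys)) = - E n (fun ys => phi ys * sin (th ys)).
 rewrite -{1}(expect_map n _ (opp_bij d) D_even) -(expectN D_summ); last first.
  bounded.
 by apply: eq_expect => ys _; rewrite sp ath sinN mulrN.
lra.
Qed.

(* By symmetry the phases of independent pieces factorise without sine terms. *)
Lemma expect_cos_prod a n phi psi th th' : (a <= n)%N -> bnd phi -> bnd psi ->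
 sym phi -> sym psi -> antisym th -> antisym th' ->
 E n (fun ys => phi (take a ys) * psi (drop a ys) * cos (th (take a ys) + th' (drop a ys))) =
 E a (fun ys => phi ys * cos (th ys)) * E (n - a) (fun ys => psi ys * cos (th' ys)).
Proof.
move=> an bp bq sp sq ath ath'.
have b1 : bnd (fun ys => phi ys * cos (th ys)) by bounded.
have b2 : bnd (fun ys => psi ys * cos (th' ys)) by bounded.
have b3 : bnd (fun ys => phi ys * sin (th ys)) by bounded.
have b4 : bnd (fun ys => psi ys * sin (th' ys)) by bounded.
have e : forall ys, phi (take a ys) * psi (drop a ys) * cos (th (take a ys) + th' (drop a ys)) =
  (phi (take a ys) * cos (th (take a ys))) * (psi (drop a ys) * cos (th' (drop a ys))) -
  (phi (take a ys) * sin (th (take a ys))) * (psi (drop a ys) * sin (th' (drop a ys))).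
 by move=> ys; rewrite cosD; ring.
rewrite (eq_expect D (fun ys _ => e ys)) (expectB D_summ).
- rewrite (expect_prod_at D_summ an b1 b2) (expect_prod_at D_summ an b3 b4).
 by rewrite expect_sin0// mul0r subr0.
- bounded.
- bounded.
Qed.

Definition chat n k : R := E n (fun ys => sawf R n ys * cos (ldot k (pos ys))).
Definition lhat n k : R := E n (fun ys => lacef R n ys * cos (ldot k (pos ys))).
Definition Dhat k : R := fh D k.

Lemma antisym_ldot k : antisym (fun ys => ldot k (pos ys)).
Proof. by move=> ys; rewrite pos_opp ldotNr. Qed.

Lemma lacef_small n ys : (n <= 1)%N -> lacef R n ys = 0.
Proof. by move=> h; rewrite /lacef lace_small. Qed.

Lemma lhat_small n k : (n <= 1)%N -> lhat n k = 0.
Proof.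
move=> h; rewrite /lhat /expect -(asum0 R (n.-tuple Zd)); apply: eq_asum => ys.
by rewrite lacef_small// mul0r mulr0.
Qed.

Lemma sawf_recursion n ys : size ys = n.+1 -> (forall y, y \in ys -> y != 0) ->
 sawf R n.+1 ys = sawf R n (drop 1 ys) +
 \sum_(m < n.+2) lacef R m (take m ys) * sawf R (n.+1 - m) (drop m ys).
Proof.
move=> sys H; have mw := walk_moving H; rewrite sys in mw.
rewrite /sawf (saw_on_bond R (ltnSn n.+1) (ltn0Sn n) mw).
under eq_bigr do rewrite mulrDl.
rewrite big_split/=; congr (_ + _).
 rewrite (bigD1 (Ordinal (isT : (1 < n.+2)%N)))//= mul1r big1 ?addr0; last first.
  by move=> c; rewrite -val_eqE /= => /negbTE ->; rewrite mul0r.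
 by rewrite -[RHS]/(sawf R n (drop 1 ys)) sawf_drop.
apply: eq_bigr => m _; have mn := ltn_ord m; rewrite -[X in _ = _ * X]/(sawf R _ _) sawf_drop.
by rewrite lacef_take// subnKC//; lia.
Qed.

Lemma chat_recursion n k : chat n.+1 k = Dhat k * chat n k +
 \sum_(m < n.+2) lhat m k * chat (n.+1 - m) k.
Proof.
have bs m : bnd (sawf R m : seq Zd -> R) by exact: sawf_bnd.
have bl m : bnd (lacef R m : seq Zd -> R) by exact: lacef_bnd.
have ss m : sym (sawf R m) by move=> ys; rewrite sawf_opp.
have sl m : sym (lacef R m) by move=> ys; rewrite lacef_opp.
have ak := antisym_ldot k.
have cosE a ys : cos (ldot k (pos ys)) = cos (ldot k (pos (take a ys)) + ldot k (pos (drop a ys))).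
 by rewrite -ldotDr -pos_cat cat_take_drop.
have b1 : bnd (fun ys => 1 * sawf R n (drop 1 ys) * cos (ldot k (pos ys))).
 bounded.
have b2 (m : nat) : bnd (fun ys => lacef R m (take m ys) * sawf R (n.+1 - m) (drop m ys) * cos (ldot k (pos ys))).
 bounded.
transitivity (E n.+1 (fun ys => 1 * sawf R n (drop 1 ys) * cos (ldot k (pos ys)) +
  \sum_(m < n.+2) lacef R m (take m ys) * sawf R (n.+1 - m) (drop m ys) * cos (ldot k (pos ys)))).
 by apply: eq_expect_moving => ys sys mv; rewrite sawf_recursion// mulrDl mul1r mulr_suml.
rewrite (expectD D_summ)//; last by apply: bnd_sum => m; exact: b2.
congr (_ + _).
 transitivity (E n.+1 (fun ys => 1 * sawf R n (drop 1 ys) * cos (ldot k (pos (take 1 ys)) + ldot k (pos (drop 1 ys))))).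
  by apply: eq_expect => ys _; rewrite -cosE.
 rewrite (@expect_cos_prod 1 n.+1 (fun=> 1) (sawf R n) (fun ys => ldot k (pos ys)) (fun ys => ldot k (pos ys)))//; last exact: bnd_cst.
 rewrite subn1/=; congr (_ * _); rewrite expect_one; apply: eq_asum => y.
 by rewrite mul1r pos_cons pos_nil addr0.
rewrite (expect_sum D_summ)//; apply: eq_bigr => m _.
rewrite -(@expect_cos_prod m n.+1 (lacef R m) (sawf R _) (fun ys => ldot k (pos ys)) (fun ys => ldot k (pos ys)))//; last by have := ltn_ord m; lia.
by apply: eq_expect => ys _; rewrite -cosE.
Qed.

Lemma chat_fh n k : fh (csaw D n) k = chat n k.
Proof.
have [|_] := @expect_at_pos R d D D_ge0 D_summ n (sawf R n) (fun x => cos (ldot k x)) (sawf_bnd R d n).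
 by exists 1 => x; exact: cos_max.
by move=> h; exact: h.
Qed.

Definition pin n x : R := E n (fun ys => lacef R n ys * (pos ys == x)%:R).
Definition ltot n : R := E n (fun ys => `|lacef R n ys|).

Lemma ltot_ge0 n : 0 <= ltot n. Proof. by apply: expect_ge0. Qed.

Lemma pin_fh n k : fh (pin n) k = lhat n k.
Proof.
have [|_] := @expect_at_pos R d D D_ge0 D_summ n (lacef R n) (fun x => cos (ldot k x)) (lacef_bnd R d n).
 by exists 1 => x; exact: cos_max.
by move=> h; exact: h.
Qed.

Lemma pin_even n x : pin n (- x) = pin n x.
Proof.
rewrite /pin -(expect_map n (fun ys => _ * (pos ys == x)%:R) (opp_bij d) D_even).
by apply: eq_expect => ys _; rewrite lacef_opp pos_opp eqr_oppLR.
Qed.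

Lemma pin_summ n : summ (pin n).
Proof. exact: expect_at_pos_summ (lacef_bnd R d n). Qed.

Lemma pin_abs_le n x : `|pin n x| <= E n (fun ys => `|lacef R n ys| * (pos ys == x)%:R).
Proof.
have bp : bnd (fun ys => lacef R n ys * (pos ys == x)%:R) by bounded.
apply: (le_trans (expect_norm D_ge0 D_summ n bp)).
apply: le_of_eq; apply: eq_expect => ys _.
by rewrite normrM normr_nat.
Qed.

Lemma pin_weight_le n (om : Zd -> R) : bddf om -> (forall x, 0 <= om x) ->
 \asum_x (`|pin n x| * om x) <= E n (fun ys => `|lacef R n ys| * om (pos ys)).
Proof.
move=> bom om0; have bl : bnd (fun ys => `|lacef R n ys|) by bounded.
have [s <-] := expect_at_pos D_ge0 D_summ n bl bom.
apply: nneg_asum_le => [x||x] //; first by rewrite mulr_ge0.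
by rewrite ler_wpM2r// pin_abs_le.
Qed.

Lemma pin_abs_sum_le n : \asum_x `|pin n x| <= ltot n.
Proof.
have := @pin_weight_le n (fun=> 1) (bddf_cst 1) (fun=> ler01).
under eq_asum do rewrite mulr1; move/le_trans; apply.
by apply: le_of_eq; apply: eq_expect => ys _; rewrite mulr1.
Qed.

Section generating.
Variable z : R.
Hypotheses (z_gt0 : 0 < z)
 (chi_summ : summ (fun n => ctot D n * z ^+ n))
 (l_summ : summ (fun n => ltot n * z ^+ n)).
Let zn_ge0 n : 0 <= z ^+ n. Proof. by rewrite exprn_ge0// ltW. Qed.

Definition Pigen x : R := \asum_(n : nat) (pin n x * z ^+ n).
Definition phigen x : R := z * D x + Pigen x.

Lemma pin_summ_pair : summ (fun p : nat * Zd => pin p.1 p.2 * z ^+ p.1).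
Proof.
apply: (@summ_pair R _ _ (fun n x => pin n x * z ^+ n) (fun n => ltot n * z ^+ n)) => //.
 by move=> n; apply: summZr; exact: pin_summ.
move=> n; rewrite (eq_asum_to (fun x => `|pin n x| * z ^+ n)); last first.
 by move=> x; rewrite normrM (ger0_norm (zn_ge0 n)).
rewrite asumZr; last by apply: summ_abs; exact: pin_summ.
by rewrite ler_wpM2r// pin_abs_sum_le.
Qed.

Let pin_swap := @summ_swap R _ _ (fun n x => pin n x * z ^+ n) pin_summ_pair.

Lemma Pigen_summ : summ Pigen. Proof. exact: (summ_pair_sum pin_swap). Qed.

Lemma Pigen_term_summ x : summ (fun n => pin n x * z ^+ n).
Proof. exact: (summ_pair_row x pin_swap). Qed.

Lemma phigen_summ : summ phigen.
Proof. by apply: summD; [exact: summZ|exact: Pigen_summ]. Qed.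

Lemma Pigen_even : even_fun Pigen.
Proof. by move=> x; apply: eq_asum => n; rewrite pin_even. Qed.

Lemma phigen_even : even_fun phigen.
Proof. by move=> x; rewrite /phigen D_even Pigen_even. Qed.

Lemma lhat_le n k : `|lhat n k| <= ltot n.
Proof.
have bp : bnd (fun ys => lacef R n ys * cos (ldot k (pos ys))) by bounded.
apply: (le_trans (expect_norm D_ge0 D_summ n bp)); apply: expect_le => //.
- exact: bnd_abs.
- bounded.
- by move=> ys _; rewrite normrM ler_piMr// cos_max.
Qed.

Lemma chat_le n k : `|chat n k| <= ctot D n.
Proof.
have bp : bnd (fun ys => sawf R n ys * cos (ldot k (pos ys))) by bounded.
apply: (le_trans (expect_norm D_ge0 D_summ n bp)); apply: expect_le => //.
- exact: bnd_abs.
- exact: sawf_bnd.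
- by move=> ys _; rewrite normrM normr_nat ler_piMr// cos_max.
Qed.

Lemma lhat_summ k : summ (fun n => lhat n k * z ^+ n).
Proof.
by apply: summ_le l_summ => n; rewrite normrM (ger0_norm (zn_ge0 n)) ler_wpM2r// lhat_le.
Qed.

Lemma chat_summ k : summ (fun n => chat n k * z ^+ n).
Proof.
by apply: summ_le chi_summ => n; rewrite normrM (ger0_norm (zn_ge0 n)) ler_wpM2r// chat_le.
Qed.

Lemma Pigen_fh k : fh Pigen k = \asum_(n : nat) (lhat n k * z ^+ n).
Proof.
have S : summ (fun p : nat * Zd => pin p.1 p.2 * z ^+ p.1 * cos (ldot k p.2)).
 by apply: (@summ_bndM _ _ _ _ 1); [move=> p; exact: cos_max|exact: pin_summ_pair].
transitivity (\asum_x \asum_(n : nat) (pin n x * z ^+ n * cos (ldot k x))).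
 by apply: eq_asum => x; rewrite asumZr//; exact: Pigen_term_summ.
rewrite -(asum_swap (f := fun n x => pin n x * z ^+ n * cos (ldot k x)) S); apply: eq_asum => n.
rewrite -pin_fh /fh -asumZr; last by apply: cos_summ; exact: pin_summ.
by apply: eq_asum => x; rewrite mulrAC.
Qed.

Lemma phigen_fh k : fh phigen k = z * Dhat k + \asum_(n : nat) (lhat n k * z ^+ n).
Proof.
rewrite -Pigen_fh /Dhat /fh -asumZ; last exact: cos_summ.
rewrite -asumD; [|by apply: summZ; exact: cos_summ|by apply: cos_summ; exact: Pigen_summ].
by apply: eq_asum => x; rewrite /phigen mulrDl mulrA.
Qed.

Lemma twopt_fh k : fh (twopt D z) k = \asum_(n : nat) (chat n k * z ^+ n).
Proof.
have sp := twopt_summ_pair D_ge0 D_summ z_gt0 chi_summ.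
have S : summ (fun p : nat * Zd => csaw D p.1 p.2 * z ^+ p.1 * cos (ldot k p.2)).
 by apply: (@summ_bndM _ _ _ _ 1); [move=> p; exact: cos_max|exact: sp].
transitivity (\asum_x \asum_(n : nat) (csaw D n x * z ^+ n * cos (ldot k x))).
 apply: eq_asum => x; rewrite asumZr//; exact: twopt_term_summ.
rewrite -(asum_swap (f := fun n x => csaw D n x * z ^+ n * cos (ldot k x)) S); apply: eq_asum => n.
rewrite -chat_fh /fh -asumZr; last by apply: cos_summ; exact: csaw_summ.
by apply: eq_asum => x; rewrite mulrAC.
Qed.

Lemma chat0 k : chat 0 k = 1.
Proof. by rewrite /chat expect0 /sawf saw_on_refl pos_nil ldot0r cos0 mulr1. Qed.

(** The Ornstein-Zernike equation: the recursion for [chat] times [z ^+ n], summed over [n], is a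
    Cauchy product, and the sums satisfy [g = 1 + h * g]. *)
Lemma ozeqn k : fh (twopt D z) k * (1 - fh phigen k) = 1.
Proof.
pose h n := ((n == 1%N)%:R * Dhat k + lhat n k) * z ^+ n.
pose g n := chat n k * z ^+ n.
have sg : summ g := chat_summ k.
have s1 : summ (fun n : nat => (n == 1%N)%:R * Dhat k * z ^+ n).
 by apply: (@summ_single _ _ _ 1%N) => n /negbTE ->; rewrite !mul0r.
have sh : summ h by apply: eq_summ (summD s1 (lhat_summ k)) => n; rewrite -mulrDl.
have -> : fh phigen k = asum setT h.
 rewrite phigen_fh; transitivity (\asum_(n : nat) ((n == 1%N)%:R * Dhat k * z ^+ n + lhat n k * z ^+ n)).
  rewrite asumD//; last exact: lhat_summ.
  congr (_ + _); rewrite (@asum_single _ _ (fun n : nat => (n == 1%N)%:R * Dhat k * z ^+ n) 1%N).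
   by rewrite eqxx mul1r expr1 mulrC.
  by move=> n /negbTE ->; rewrite !mul0r.
 by apply: eq_asum => n; rewrite -mulrDl.
rewrite twopt_fh -/g.
have rec n : g n = (n == 0%N)%:R + \sum_(m < n.+1) h m * g (n - m)%N.
 case: n => [|n].
  have h0 : h 0%N = 0 by rewrite /h lhat_small// mul0r addr0 mul0r.
  by rewrite big_ord1 h0 mul0r addr0 /g chat0 mul1r expr0.
 rewrite add0r /g chat_recursion mulrDl.
 have -> : \sum_(m < n.+2) h m * (chat (n.+1 - m) k * z ^+ (n.+1 - m)) =
  \sum_(m < n.+2) ((m == 1%N :> nat)%:R * Dhat k * chat (n.+1 - m) k * z ^+ n.+1 + lhat m k * chat (n.+1 - m) k * z ^+ n.+1).
  apply: eq_bigr => m _; rewrite /h.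
  have -> : z ^+ n.+1 = z ^+ m * z ^+ (n.+1 - m) by rewrite -exprD subnKC// -ltnS ltn_ord.
  by ring.
 rewrite big_split/= mulr_suml; congr (_ + _).
 rewrite (bigD1 (Ordinal (isT : (1 < n.+2)%N)))//= mul1r subn1 big1 ?addr0//.
 by move=> c; rewrite -val_eqE /= => /negbTE ->; rewrite !mul0r.
have [sc ec] := cauchy_asum sh sg.
have : asum setT g = 1 + asum setT h * asum setT g.
 rewrite -ec {1}(_ : g = fun n => (n == 0%N)%:R + \sum_(m < n.+1) h m * g (n - m)%N); last exact/funext.
 rewrite asumD//; last by apply: (@summ_single _ _ _ 0%N) => n /negbTE ->.
 by congr (_ + _); rewrite (@asum_single _ _ _ 0%N)// => n /negbTE ->.
by move=> e; rewrite mulrBr mulr1 {1}e; ring.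
Qed.

(** The hypothesis concerns truncated sums of expectations, the form that the diagrams deliver;
    Fubini turns it into a bound on a sum over sites. *)
Lemma Pigen_weight_le (om : Zd -> R) B : bddf om -> (forall x, 0 <= om x) ->
 (forall N, \sum_(n < N | (1 < n)%N) E n (fun ys => `|lacef R n ys| * om (pos ys)) * z ^+ n <= B) ->
 \asum_x (`|Pigen x| * om x) <= B.
Proof.
move=> bom om0 H; have [C HC] := bom.
have sp := pin_summ_pair.
have sa : summ (fun p : nat * Zd => `|pin p.1 p.2| * z ^+ p.1 * om p.2).
 apply: (@summ_bndM _ _ _ _ C); first by move=> p; exact: HC.
 apply: eq_summ (summ_abs sp) => p; by rewrite normrM (ger0_norm (zn_ge0 _)).
have sa' := @summ_swap R _ _ (fun n x => `|pin n x| * z ^+ n * om x) sa.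
apply: (le_via (\asum_x \asum_(n : nat) (`|pin n x| * z ^+ n * om x))).
 apply: nneg_asum_le => [x||x]; [by rewrite mulr_ge0|exact: (summ_pair_sum sa')|].
 have st : summ (fun n => `|pin n x| * z ^+ n).
  apply: eq_summ (summ_abs (Pigen_term_summ x)) => n; by rewrite normrM (ger0_norm (zn_ge0 _)).
 rewrite asumZr// ler_wpM2r//; apply: asum_norm_le => // n.
 by rewrite normrM (ger0_norm (zn_ge0 _)).
rewrite -(asum_swap (f := fun n x => `|pin n x| * z ^+ n * om x) sa).
pose L n := E n (fun ys => `|lacef R n ys| * om (pos ys)) * z ^+ n.
have L0 n : 0 <= L n by rewrite mulr_ge0// expect_ge0// => ys _; rewrite mulr_ge0.
have Lsm n : (n <= 1)%N -> L n = 0.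
 move=> h; rewrite /L (_ : E n _ = 0) ?mul0r//.
 rewrite /expect -(asum0 R (n.-tuple Zd)); apply: eq_asum => ys.
 by rewrite lacef_small// normr0 mul0r mulr0.
have HL N : \sum_(n < N) L n <= B.
 apply: le_trans (H N); rewrite (bigID (fun n : 'I_N => (1 < n)%N))/= [X in _ + X]big1 ?addr0//.
 by move=> n; rewrite -leqNgt => /Lsm.
have [sL LB] := nneg_summ_nat L0 HL.
apply: le_trans LB; apply: nneg_asum_le => // n; first by apply: asum_ge0 => x; rewrite !mulr_ge0.
rewrite (eq_asum_to (fun x => `|pin n x| * om x * z ^+ n)); last by move=> x; rewrite mulrAC.
rewrite asumZr; last by apply: (@summ_bndM _ _ _ _ C) => //; apply: summ_abs; exact: pin_summ.
by rewrite ler_wpM2r// pin_weight_le.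
Qed.

End generating.
End lace_expansion.

(** * Lipschitz dependence on the fugacity *)

Section power_series.
Variable R : realType.

Lemma summ_geometric (t : R) : 0 <= t -> t < 1 -> summ (fun n : nat => t ^+ n).
Proof.
move=> t0 t1; apply: (proj1 (@nneg_summ_nat R _ (1 - t)^-1 _ _)) => [n|n].
 exact: exprn_ge0.
rewrite -[leRHS]mul1r ler_pdivlMr; last by rewrite subr_gt0.
have h : (1 - t) * (\sum_(i < n) t ^+ i) = 1 - t ^+ n.
 by rewrite -opprB mulNr -subrX1 opprB.
by rewrite mulrC h gerBl exprn_ge0.
Qed.

(** Convexity of the power: the chord over [[t, u]] is no steeper than the chord over [[t, s]]. *)
Lemma pow_diff_le (t u s : R) n : 0 <= t -> t <= u -> u <= s -> t < s ->
 u ^+ n - t ^+ n <= (u - t) / (s - t) * s ^+ n.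
Proof.
move=> t0 tu us ts; have u0 : 0 <= u by apply: le_trans tu.
have s0 : 0 <= s by apply: le_trans us.
have st : 0 < s - t by rewrite subr_gt0.
apply: (le_via ((u - t) / (s - t) * (s ^+ n - t ^+ n))); last first.
 by rewrite ler_wpM2l ?gerBl ?exprn_ge0// divr_ge0// ?subr_ge0// ltW.
rewrite subrXX [X in _ <= _ * X]subrXX mulrA divfK ?gt_eqF// ler_wpM2l ?subr_ge0//.
apply: ler_sum => i _; rewrite ler_wpM2r ?exprn_ge0//.
by rewrite lerXn2r ?nnegrE.
Qed.

Lemma summ_pow_le (P : nat -> R) (t s : R) : (forall n, 0 <= P n) -> 0 <= t -> t <= s ->
 summ (fun n => P n * s ^+ n) -> summ (fun n => P n * t ^+ n).
Proof.
move=> P0 t0 ts; apply: summ_le => n; rewrite ger0_norm ?mulr_ge0 ?exprn_ge0//.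
by rewrite ler_wpM2l// lerXn2r ?nnegrE// (le_trans t0).
Qed.

Lemma power_series_lip (P : nat -> R) (t u s : R) : (forall n, 0 <= P n) ->
 summ (fun n => P n * s ^+ n) -> 0 <= t -> t <= u -> u <= s -> t < s ->
 \asum_(n : nat) (P n * (u ^+ n - t ^+ n)) <= (u - t) / (s - t) * \asum_(n : nat) (P n * s ^+ n).
Proof.
move=> P0 sP t0 tu us ts.
have u0 : 0 <= u by apply: le_trans tu.
rewrite -asumZ//; apply: nneg_asum_le => [n||n].
- by rewrite mulr_ge0// subr_ge0 lerXn2r ?nnegrE.
- exact: summZ.
- by rewrite mulrCA ler_wpM2l// pow_diff_le.
Qed.

(** Bernoulli's inequality for [Z / s = 1 + (Z - s) / s]: a polynomial factor is paid for by a
    larger radius. *)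
Lemma nat_mul_pow_le (s Z : R) n : 0 < s -> s < Z -> n%:R * s ^+ n <= (s / (Z - s)) * Z ^+ n.
Proof.
move=> s0 sZ; have Zs : 0 < Z - s by rewrite subr_gt0.
rewrite mulrAC ler_pdivlMr// mulrAC.
have : 1 + n%:R * ((Z - s) / s) <= (Z / s) ^+ n.
 elim: n => [|n IH]; first by rewrite mul0r addr0 expr0.
 rewrite exprS; apply: (le_via (Z / s * (1 + n%:R * ((Z - s) / s)))).
  have x0 : 0 <= (Z - s) / s by rewrite divr_ge0// ltW.
  have -> : Z / s = 1 + (Z - s) / s by field; rewrite gt_eqF.
  rewrite -natr1; move: x0; move: ((Z - s) / s) => x x0.
  have : 0 <= n%:R * x * x by rewrite !mulr_ge0.
  by nra.
 by rewrite ler_wpM2l// divr_ge0// ltW// (lt_trans s0).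
rewrite expr_div_n ler_pdivlMr ?exprn_gt0// => h.
have h2 : n%:R * (Z - s) * s ^+ n <= s * Z ^+ n.
 apply: (le_via (s * ((1 + n%:R * ((Z - s) / s)) * s ^+ n))); last by rewrite ler_wpM2l// ltW.
 have -> : s * ((1 + n%:R * ((Z - s) / s)) * s ^+ n) = s * s ^+ n + n%:R * (Z - s) * s ^+ n.
  by field; rewrite gt_eqF.
 by rewrite lerDr mulr_ge0 ?exprn_ge0// ltW.
exact: h2.
Qed.

Lemma onecosD_weight (a b s : R) : 0 < s ->
 1 - cos (a + b) <= (1 + s) * (1 - cos a) + (1 + s^-1) * (1 - cos b).
Proof.
move=> s0; rewrite cosD; have := cos2Dsin2 a; have := cos2Dsin2 b.
move: (cos a) (cos b) (sin a) (sin b) => ca cb sa sb h1 h2.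
have e : (1 + s) * (1 - ca) + (1 + s^-1) * (1 - cb) - (1 - (ca * cb - sa * sb)) =
  ((s * ca + cb - s - 1) ^+ 2 + (sb - s * sa) ^+ 2) / (2 * s) +
  ((1 - (cb ^+ 2 + sb ^+ 2)) + s ^+ 2 * (1 - (ca ^+ 2 + sa ^+ 2))) / (2 * s).
 by field; rewrite gt_eqF.
rewrite -subr_ge0 e h1 h2 !subrr mulr0 addr0 mul0r addr0.
by rewrite divr_ge0 ?addr_ge0 ?sqr_ge0// mulr_ge0// ltW.
Qed.

(** Adding a term to [n] others with the weight [s = 1 / n] in [onecosD_weight] keeps the factor
    linear in the number of terms; equal weights would make it exponential. *)
Lemma onecos_sum (T : Type) (r : seq T) (a : T -> R) :
 1 - cos (\sum_(i <- r) a i) <= (size r)%:R * \sum_(i <- r) (1 - cos (a i)).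
Proof.
elim: r => [|i r IH]; first by rewrite !big_nil cos0 subrr mulr0.
rewrite !big_cons /=; case: r IH => [|j r] IH.
 by rewrite !big_nil !addr0 mul1r.
set n := size (j :: r) in IH *; have n0 : 0 < n%:R :> R by rewrite ltr0n.
rewrite [a i + _]addrC; apply: (le_trans (onecosD_weight _ _ (s := n%:R^-1) _)); first by rewrite invr_gt0.
apply: (le_via ((1 + n%:R^-1) * (n%:R * \sum_(i <- j :: r) (1 - cos (a i))) + (1 + n%:R^-1^-1) * (1 - cos (a i)))).
 by rewrite lerD2r ler_wpM2l// addr_ge0// invr_ge0 ler0n.
rewrite invrK -/n [in leRHS]/= -natr1; apply: le_of_eq.
by field; rewrite gt_eqF.
Qed.

End power_series.

Section lipschitz.
Variables (R : realType) (d : nat) (D : 'rV[int]_d -> R).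
Local Notation Zd := 'rV[int]_d.
Local Notation E := (expect D).
Hypotheses (D_ge0 : forall x, 0 <= D x)
 (D_summ : summ D)
 (D_sum1 : asum setT D = 1)
 (D_even : forall x, D (- x) = D x).

Definition chi_summable (z : R) := summ (fun n => ctot D n * z ^+ n).
Definition chi (z : R) : R := \asum_(n : nat) (ctot D n * z ^+ n).

Lemma ctot_ge0' n : 0 <= ctot D n. Proof. exact: ctot_ge0. Qed.

Lemma chi_summable_le s t : 0 <= t -> t <= s -> chi_summable s -> chi_summable t.
Proof. by move=> t0 ts; apply: summ_pow_le => // n; exact: ctot_ge0. Qed.

Lemma chi_summable_lt1 t : 0 <= t -> t < 1 -> chi_summable t.
Proof.
move=> t0 t1; apply: summ_le (summ_geometric t0 t1) => n.
rewrite ger0_norm ?mulr_ge0 ?exprn_ge0 ?ctot_ge0'// ler_piMl ?exprn_ge0//.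
exact: ctot_le1.
Qed.

Definition split_tot n : R := \sum_(i < n.+1) ctot D i * ctot D (n - i)%N.

Lemma split_tot_ge0 n : 0 <= split_tot n.
Proof. by apply: sumr_ge0 => i _; rewrite mulr_ge0 ?ctot_ge0'. Qed.

Lemma split_tot_summ Z : 0 <= Z -> chi_summable Z -> summ (fun n => split_tot n * Z ^+ n).
Proof.
move=> Z0 sZ; have [h _] := cauchy_asum sZ sZ; apply: eq_summ h => n.
rewrite /split_tot mulr_suml; apply: eq_bigr => i _.
have -> : Z ^+ n = Z ^+ i * Z ^+ (n - i) by rewrite -exprD subnKC// -ltnS.
by ring.
Qed.

(** In [split_tot n.-1] the two self-avoiding pieces before and after the weighted step are summed;
    the factor [n] is the loss in [onecos_sum]. *)
Definition var_coef n : R := n%:R * split_tot n.-1.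

Lemma var_coef_ge0 n : 0 <= var_coef n.
Proof. by rewrite mulr_ge0 ?split_tot_ge0. Qed.

Lemma var_coef_summ s Z : 0 < s -> s < Z -> chi_summable Z -> summ (fun n => var_coef n * s ^+ n).
Proof.
move=> s0 sZ cZ; have Z0 : 0 < Z by apply: lt_trans sZ.
have Zs : 0 <= s / (Z - s) by rewrite divr_ge0 ?subr_ge0 ?ltW.
have S := summ_nat_shift 1 (split_tot_summ (ltW Z0) cZ).
apply: summ_le (summZ (s / (Z - s) * Z) S) => n.
rewrite ger0_norm; last by rewrite mulr_ge0 ?var_coef_ge0// exprn_ge0// ltW.
case: n => [|n]; first by rewrite /var_coef mul0r mul0r mulr0.
rewrite /= subn1/= /var_coef mulrAC [leRHS](_ : _ = (s / (Z - s) * Z ^+ n.+1) * split_tot n); last by rewrite exprS; ring.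
by rewrite ler_wpM2r ?split_tot_ge0// nat_mul_pow_le.
Qed.

Lemma sawf_split3 i n (ys : seq Zd) : (i < n)%N ->
 sawf R n ys <= sawf R i (take i ys) * sawf R (n - i.+1) (drop i.+1 ys).
Proof.
move=> im; rewrite sawf_take// sawf_drop subnKC// -natrM mulnb ler_nat.
case: (boolP (saw_on _ 0 n)) => // h.
by rewrite !(saw_on_sub h)//; lia.
Qed.

(* Each of the [n] steps is weighted in turn, and [1 - cos] of a sum of [n]
  terms is at most [n] times the sum of the [1 - cos]. *)
Lemma csaw_weight_le n k x : (1 - cos (ldot k x)) * csaw D n x <= var_coef n * gap D k.
Proof.
have bs m : bnd (sawf R m : seq Zd -> R) by exact: sawf_bnd.
have bo : bnd (fun ys => 1 - cos (ldot k (pos ys))) by bounded.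
have bw i : bnd (fun ys => sawf R i (take i ys) * sawf R (n - i.+1) (drop i.+1 ys) * (1 - cos (ldot k ys`_i))).
 apply: bndM; last bounded.
 bounded.
apply: (le_via (E n (fun ys => sawf R n ys * (1 - cos (ldot k (pos ys)))))).
 rewrite /csaw -(expectZ D_summ); last bounded.
 apply: expect_le => //; [apply: bndM; [exact: bnd_cst|apply: bndM => //; exact: bnd_bool]|exact: bndM|].
 move=> ys _; rewrite mulrC; case: eqP => [->|_]; first by rewrite mulr1.
 by rewrite mulr0 mul0r mulr_ge0// onecos_ge0.
apply: (le_via (E n (fun ys => n%:R * \sum_(i < n) sawf R i (take i ys) * sawf R (n - i.+1) (drop i.+1 ys) * (1 - cos (ldot k ys`_i))))).
 apply: expect_le => //; [exact: bndM|apply: bndM; [exact: bnd_cst|by apply: bnd_sum => i; exact: bw]|].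
 move=> ys sys; apply: (le_via (sawf R n ys * (n%:R * \sum_(i < n) (1 - cos (ldot k ys`_i))))).
  rewrite ler_wpM2l//.
  have -> : ldot k (pos ys) = \sum_(i <- iota 0 n) ldot k ys`_i.
   rewrite -sys /pos (big_nth 0) /index_iota subn0 /ldot.
   elim: (iota 0 (size ys)) => [|i r IH]; first by rewrite !big_nil -/(ldot k 0) ldot0r.
   by rewrite !big_cons -IH -/(ldot _ _) ldotDr.
  have := onecos_sum (iota 0 n) (fun i => ldot k ys`_i); rewrite size_iota.
  have -> : \sum_(i <- iota 0 n) (1 - cos (ldot k ys`_i)) = \sum_(i < n) (1 - cos (ldot k ys`_i)).
   by rewrite -(big_mkord xpredT (fun i => 1 - cos (ldot k ys`_i))) /index_iota subn0.
  by [].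
 rewrite mulrCA ler_wpM2l// mulr_sumr; apply: ler_sum => i _.
 by rewrite ler_wpM2r ?onecos_ge0// sawf_split3.
rewrite (expectZ D_summ); last by apply: bnd_sum => i; exact: bw.
rewrite /var_coef -mulrA ler_wpM2l// (expect_sum D_summ); last by move=> i; exact: bw.
rewrite /split_tot; case: n bw => [|n] bw; first by rewrite big_ord0 mulr_ge0 ?gap_ge0// sumr_ge0// => i _; rewrite mulr_ge0 ?ctot_ge0'.
rewrite /= mulr_suml; apply: ler_sum => i _.
have im := ltn_ord i.
have b1 : bnd (fun zs : seq Zd => (1 - cos (ldot k zs`_0)) * sawf R (n - i) (drop 1 zs)).
 bounded.
apply: le_of_eq.
transitivity (E n.+1 (fun ys => sawf R i (take i ys) * ((1 - cos (ldot k (drop i ys)`_0)) * sawf R (n - i) (drop 1 (drop i ys))))).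
 by apply: eq_expect => ys _; rewrite drop_drop add1n nth_drop addn0 subSS; ring.
have in1 : (i <= n.+1)%N by apply: ltnW.
rewrite (@expect_prod_at _ _ _ D_summ i n.+1 (sawf R i) (fun zs => (1 - cos (ldot k zs`_0)) * sawf R (n - i) (drop 1 zs)))//.
rewrite -[E i _]/(ctot D i) -mulrA [ctot D _ * gap D k]mulrC; congr (_ * _).
have -> : (n.+1 - i = 1 + (n - i))%N by rewrite subSn// -ltnS.
transitivity (E (1 + (n - i)) (fun zs => (1 - cos (ldot k (take 1 zs)`_0)) * sawf R (n - i) (drop 1 zs))).
 by apply: eq_expect => -[|z zs] szs //=; rewrite take0.
rewrite (@expect_prod _ _ _ D_summ 1 (n - i) (fun us => 1 - cos (ldot k us`_0)) (sawf R (n - i)))//; last first.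
 bounded.
by rewrite expect_one.
Qed.

Lemma twopt_le_chi t x : 0 < t -> chi_summable t -> twopt D t x <= chi t.
Proof.
move=> t0 ct; rewrite /chi -(twopt_sum D_ge0 D_summ t0 ct).
by apply: asum_ge_term; [move=> y; exact: twopt_ge0|exact: twopt_summ].
Qed.

Lemma twopt_mono t u x : 0 < t -> t <= u -> chi_summable u -> twopt D t x <= twopt D u x.
Proof.
move=> t0 tu cu; have u0 : 0 < u by apply: lt_le_trans tu.
apply: nneg_asum_le => [n||n]; first by rewrite mulr_ge0 ?exprn_ge0 ?csaw_ge0 ?ltW.
 exact: twopt_term_summ.
rewrite ler_wpM2l ?csaw_ge0// lerXn2r// nnegrE; exact: ltW.
Qed.

Section moduli.
Variables (u s Z : R).
Hypotheses (u_gt0 : 0 < u) (us : u < s) (sZ : s < Z) (cZ : chi_summable Z).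

Let s_gt0 : 0 < s. Proof. exact: lt_trans us. Qed.
Let cs : chi_summable s. Proof. apply: chi_summable_le cZ; exact: ltW. Qed.

Lemma chi_lip t t' : 0 < t -> t <= t' -> t' <= u -> chi t' - chi t <= (t' - t) / (s - u) * chi s.
Proof.
move=> t0 tt' t'u; have ts : t < s by apply: le_lt_trans us; apply: le_trans t'u.
have t's : t' <= s by apply: le_trans t'u _; exact: ltW.
have c1 : chi_summable t' by apply: chi_summable_le cs; rewrite // (le_trans (ltW t0)).
have c0 : chi_summable t by apply: chi_summable_le c1; rewrite // ltW.
have -> : chi t' - chi t = \asum_(n : nat) (ctot D n * (t' ^+ n - t ^+ n)).
 by rewrite -asumB//; apply: eq_asum => n; rewrite mulrBr.
apply: (le_trans (power_series_lip ctot_ge0' cs (ltW t0) tt' t's ts)).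
apply: ler_wpM2r; first by apply: asum_ge0 => n; rewrite mulr_ge0 ?ctot_ge0'// exprn_ge0// ltW.
rewrite ler_wpM2l ?subr_ge0// lef_pV2 ?posrE ?subr_gt0//.
by rewrite lerD2l lerN2 (le_trans tt').
Qed.

(** The constant is the same for all [k] and [x], with [gap D k] factored out, so one step size
    works for the whole family of bootstrap conditions. Passing from [Z] to [s] makes [var_coef],
    with its polynomial factor, summable; passing from [s] to [u] bounds the difference
    quotients. *)
Lemma weight_lip : exists2 C : R, 0 <= C & forall t t' k x, 0 < t -> t <= t' -> t' <= u ->
 (1 - cos (ldot k x)) * twopt' D t' x <= (1 - cos (ldot k x)) * twopt' D t x + C * (t' - t) * gap D k.
Proof.
have sv := var_coef_summ s_gt0 sZ cZ.
have V0 : 0 <= \asum_(n : nat) (var_coef n * s ^+ n) by apply: asum_ge0 => n; rewrite mulr_ge0 ?var_coef_ge0 ?exprn_ge0 ?ltW.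
exists ((s - u)^-1 * \asum_(n : nat) (var_coef n * s ^+ n)).
 by rewrite mulr_ge0// invr_ge0 subr_ge0 ltW.
move=> t t' k x t0 tt' t'u; have ts : t < s by apply: le_lt_trans us; apply: le_trans t'u.
have t's : t' <= s by apply: le_trans t'u _; exact: ltW.
have t'0 : 0 < t' by apply: lt_le_trans tt'.
have c1 : chi_summable t' by apply: chi_summable_le cs => //; exact: ltW.
have c0 : chi_summable t by apply: chi_summable_le c1 => //; exact: ltW.
rewrite -lerBlDl -mulrBr.
have -> : twopt' D t' x - twopt' D t x = \asum_(n : nat) (csaw D n x * (t' ^+ n - t ^+ n)).
 rewrite /twopt' opprB addrA subrK -asumB; [|exact: twopt_term_summ|exact: twopt_term_summ].
 by apply: eq_asum => n; rewrite mulrBr.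
have sd : summ (fun n : nat => csaw D n x * (t' ^+ n - t ^+ n)).
 by apply: eq_summ (summB (twopt_term_summ D_ge0 D_summ t'0 c1 x) (twopt_term_summ D_ge0 D_summ t0 c0 x)) => n; rewrite mulrBr.
rewrite -asumZ//.
have sv' : summ (fun n => var_coef n * (t' ^+ n - t ^+ n)).
 have h1 := summ_pow_le var_coef_ge0 (ltW t'0) t's sv.
 have h0 := summ_pow_le var_coef_ge0 (ltW t0) (ltW ts) sv.
 by apply: eq_summ (summB h1 h0) => n; rewrite mulrBr.
have pd n : 0 <= t' ^+ n - t ^+ n by rewrite subr_ge0 lerXn2r ?nnegrE// ltW.
apply: (le_via (\asum_(n : nat) (var_coef n * (t' ^+ n - t ^+ n) * gap D k))).
 apply: asum_le => [||n]; [exact: summZ|exact: summZr|].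
 by rewrite mulrA [leRHS]mulrAC ler_wpM2r// csaw_weight_le.
rewrite asumZr// ler_wpM2r ?gap_ge0//.
apply: (le_trans (power_series_lip var_coef_ge0 sv (ltW t0) tt' t's ts)).
rewrite [leRHS](_ : _ = (t' - t) / (s - u) * \asum_(n : nat) (var_coef n * s ^+ n)); last by ring.
rewrite ler_wpM2r// ler_wpM2l ?subr_ge0// lef_pV2 ?posrE ?subr_gt0//.
by rewrite lerD2l lerN2 (le_trans tt').
Qed.

Let eq_le (a b : R) : a = b -> a <= b. Proof. by move=> ->. Qed.

Lemma bubble_lip : exists2 C : R, 0 <= C & forall t t' x, 0 < t -> t <= t' -> t' <= u ->
 Defs.conv (twopt D t') (twopt' D t') x <= Defs.conv (twopt D t) (twopt' D t) x + C * (t' - t).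
Proof.
have chis0 : 0 <= chi s by apply: asum_ge0 => n; rewrite mulr_ge0 ?ctot_ge0' ?exprn_ge0 ?ltW.
exists (2 * chi s * (chi s / (s - u))).
 by rewrite !mulr_ge0// invr_ge0 subr_ge0 ltW.
move=> t t' x t0 tt' t'u; have ts : t < s by apply: le_lt_trans us; apply: le_trans t'u.
have t's : t' <= s by apply: le_trans t'u _; exact: ltW.
have t'0 : 0 < t' by apply: lt_le_trans tt'.
have c1 : chi_summable t' by apply: chi_summable_le cs => //; exact: ltW.
have c0 : chi_summable t by apply: chi_summable_le c1 => //; exact: ltW.
set G := twopt D t; set G' := twopt D t'; set H := twopt' D t; set H' := twopt' D t'.
have sG : summ G by exact: twopt_summ. have sG' : summ G' by exact: twopt_summ.
have sH : summ H by exact: twopt'_summ. have sH' : summ H' by exact: twopt'_summ.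
have GG' y : G y <= G' y by exact: twopt_mono.
have G0 y : 0 <= G y by exact: twopt_ge0.
have H0 y : 0 <= H' y by exact: twopt'_ge0.
have HH y : H' y - H y = G' y - G y by rewrite /H' /H /twopt' opprB addrA subrK.
have Hc y : H' y <= chi s.
 apply: le_trans (twopt'_le _ _ _) _; apply: le_trans (twopt_mono _ t'0 t's cs) _.
 exact: twopt_le_chi.
have Gc y : G y <= chi s.
 by apply: le_trans (twopt_mono _ t0 (ltW ts) cs) _; exact: twopt_le_chi.
have sd : summ (fun y : Zd => G' y - G y) by exact: summB.
have dchi : \asum_(y : Zd) (G' y - G y) = chi t' - chi t.
 by rewrite asumB// /G /G' !twopt_sum.
have d1 : chi t' - chi t <= (t' - t) / (s - u) * chi s by exact: chi_lip.
have dchi' : \asum_(y : Zd) (G' y - G y) <= chi t' - chi t by rewrite dchi.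
have hsub : \asum_(y : Zd) (G' (x - y) - G (x - y)) <= chi t' - chi t.
 exact: (le_trans (eq_le (asum_sub (fun y : Zd => G' y - G y) x)) dchi').
rewrite -lerBlDl /Defs.conv -asumB; try exact: conv_term_summ.
have s1 : summ (fun y => (G' y - G y) * chi s) by exact: summZr.
have s2 : summ (fun y : Zd => chi s * (G' (x - y) - G (x - y))) by apply: summZ; exact: (summ_sub x sd).
apply: (le_via (\asum_y ((G' y - G y) * chi s + chi s * (G' (x - y) - G (x - y))))).
 apply: asum_le => [||y]; [by apply: summB; exact: conv_term_summ|exact: summD|].
 rewrite [leLHS](_ : _ = (G' y - G y) * H' (x - y) + G y * (H' (x - y) - H (x - y))); last by ring.
 by rewrite HH; apply: lerD; [rewrite ler_wpM2l// subr_ge0|rewrite ler_wpM2r// subr_ge0].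
rewrite asumD// asumZr// asumZ; last exact: (summ_sub x sd).
have fin : (chi t' - chi t) * chi s + chi s * (chi t' - chi t) <= 2 * chi s * (chi s / (s - u)) * (t' - t).
 rewrite [leRHS](_ : _ = chi s * ((t' - t) / (s - u) * chi s) + chi s * ((t' - t) / (s - u) * chi s)); last by ring.
 by rewrite mulrC lerD// ler_wpM2l.
exact: le_trans (lerD (ler_wpM2r chis0 dchi') (ler_wpM2l chis0 hsub)) fin.
Qed.

End moduli.
End lipschitz.

(** * Infrared bound and bootstrap *)

Section bootstrap.
Variables (R : realType) (d : nat) (D : 'rV[int]_d -> R).
Local Notation Zd := 'rV[int]_d.
Local Notation E := (expect D).
Hypotheses (D_ge0 : forall x, 0 <= D x)
 (D_summ : summ D)
 (D_sum1 : asum setT D = 1)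
 (D_even : forall x, D (- x) = D x)
 (D_zero : D 0 = 0).

(** The number [K] makes the grid as fine as the zero mode requires; the divisibility keeps every
    frequency of a prescribed grid [P] on the grid [M]. *)
Definition infrared (C1 eta : R) := forall K P : nat, exists M, [/\ (P.+1 %| M.+1)%N, (K <= M)%N,
 forall j : 'rV['I_M.+1]_d, j != 0 -> 0 < gap D (freq R M (lift_idx j)),
 avg M (fun q => (gap D (freq R M q))^-2) <= C1 &
 avg M (fun q => `|fh D (freq R M q)| * (gap D (freq R M q))^-2) <= eta].

Variables C1 eta : R.
Hypotheses (C1_ge0 : 0 <= C1) (eta_gt0 : 0 < eta) (d_gt0 : (0 < d)%N)
 (IR : infrared C1 eta).

Lemma freq_refine P M q : (P.+1 %| M.+1)%N ->
 freq R P q = freq R M ((M.+1 %/ P.+1)%N%:Z *: q) :> 'rV[R]_d.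
Proof.
move=> /dvdnP[c ec]; apply/matrixP => i j; rewrite !mxE /= intrM ec mulnK// natrM invfM.
have cn : (c%:R : R) != 0 by rewrite pnatr_eq0; apply: contra_eq_neq ec => ->; rewrite mul0n.
have -> : (c%:Z)%:~R = c%:R :> R by [].
rewrite -!mulrA; congr (2 * (pi * _)).
by rewrite [P.+1%:R^-1 * (c%:R * _)]mulrCA mulKf.
Qed.

Lemma gap_freq0 P q : gap D (freq R P q) = 0 -> forall x, cos (ldot (freq R P q) x) = 1.
Proof.
have [M [PM _ Dp _ _]] := IR 0 P.
rewrite (freq_refine _ PM); move: (_ *: q) => q' g0 x.
have [r er] := lift_idx_mod (0 : 'rV['I_M.+1]_d) q'.
move: er; move: (_ + \row_i _) => j0 er.
have l0 : lift_idx (0 : 'rV['I_M.+1]_d) = 0 by apply/matrixP => i j; rewrite !mxE.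
move: er; rewrite l0 add0r => er.
rewrite -(@cos_periodic R d M x q' r) -er.
have [->|jn] := eqVneq j0 0; first by rewrite l0 freq0 ldot0l cos0.
have := Dp _ jn; suff -> : gap D (freq R M (lift_idx j0)) = 0 by rewrite ltxx.
by rewrite -g0 er; apply: eq_asum => y; rewrite (@cos_periodic R d M y q' r).
Qed.

Lemma gap_eq0 (f : Zd -> R) P q : gap D (freq R P q) = 0 -> gap f (freq R P q) = 0.
Proof.
move=> /gap_freq0 h; rewrite -(asum0 R Zd); apply: eq_asum => x.
by rewrite h subrr mulr0.
Qed.

(** Here [27 = 9 * 3]: the [9] of [weight_le_avg] and the bound [3 * gap D] on the variation of
    [phi]; [4 * C1 + 1] bounds the average of [F ^- 2] through [avg_F_le]. *)
Definition W1 : R := 27 * (4 * C1 + 1).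

(** For the bubble the average carries the small factor from [fh D], which gives
    [z * (4 * eta + eta)] with [z <= 2]. The weights have no such factor, and their constant [W1] is
    bounded but not small. *)
Lemma infrared_core (phi g h : Zd -> R) (z f0 : R) :
 summ phi -> even_fun phi -> summ g -> even_fun g -> (forall x, 0 <= g x) ->
 (forall k, fh g k * (1 - fh phi k) = 1) -> 0 < f0 ->
 (forall P q, f0 <= 1 - fh phi (freq R P q)) ->
 (forall P q, gap D (freq R P q) <= 2 * (1 - fh phi (freq R P q))) ->
 (forall P q, gap (fun x => `|phi x|) (freq R P q) <= 3 * gap D (freq R P q)) ->
 (forall P q, gap (fun x => `|phi x|) (freq R P q) <= 2 * (1 - fh phi (freq R P q))) ->
 (forall x, 0 <= h x) -> summ h -> 0 <= z -> z <= 2 ->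
 (forall y, h y <= z * Defs.conv D g y) ->
 (forall x, Defs.conv g h x <= 10 * eta) /\
 (forall P q x, (1 - cos (ldot (freq R P q) x)) * g x <= W1 * gap D (freq R P q)).
Proof.
move=> sphi ephi sg eg g0 gF f0p f0F DF v3 v2 h0 sh z0 z2 hz.
(* Allowance for the zero mode: the cap [eta] serves the bubble, the cap [1] the average without the
   factor from [fh D]. *)
pose e := Num.min eta 1.
have e0 : 0 < e by rewrite lt_min eta_gt0 ltr01.
have ee : e <= eta by rewrite ge_min lexx.
have e1 : e <= 1 by rewrite ge_min lexx orbT.
have Fp M q : 0 < 1 - fh phi (freq R M q) by apply: lt_le_trans (f0F _ _).
have Dabs k : 0 <= `|fh D k| <= 1.
 rewrite normr_ge0; apply: le_trans (fh_norm_le k D_summ) _.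
 by rewrite -D_sum1; apply: le_of_eq; apply: eq_asum => x; rewrite ger0_norm.
have pick P : exists M, [/\ (P.+1 %| M.+1)%N,
  avg M (fun q => `|fh D (freq R M q)| * (1 - fh phi (freq R M q))^-2) <= 5 * eta &
  avg M (fun q => (1 - fh phi (freq R M q))^-2) <= 4 * C1 + 1].
 (* The grid depends on [f0], hence on the distance to criticality; the resulting bounds do not. *)
 have [M [PM KM Dp a1 a2]] := IR (Num.bound (f0^-1 ^+ 2 / e)) P.
 have chile : f0^-1 ^+ 2 <= e * #|{: 'rV['I_M.+1]_d}|%:R.
  rewrite -ler_pdivrMl// mulrC; apply: (le_trans (ltW (archi_boundP _))).
   by rewrite divr_ge0 ?sqr_ge0// ltW.
  rewrite ler_nat card_J; apply: (leq_trans KM); apply: (leq_trans (leqnSn M)).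
  by rewrite -(prednK d_gt0) expnS leq_pmulr// expn_gt0.
 have AF := @avg_F_le R d M phi (Fp M) (fun q => gap D (freq R M q)) f0^-1 e
  (fun q => gap_ge0 _ D_ge0) Dp (DF M) _ chile.
 exists M; split => //.
 - have := AF _ (fun q => `|fh D (freq R M q)|) (fun q => Dabs _).
  move=> /(_ (fun q => _)) H; apply: le_trans (H _) _.
   by move=> q; rewrite mulrC ler_pdivlMr// mul1r.
  by lra.
 - have := AF _ (fun q => 1) (fun q => _).
  rewrite (@eq_avg R d M (fun q => 1 * _) (fun q => (1 - fh phi (freq R M q))^-2)); last by move=> q; rewrite mul1r.
  rewrite (@eq_avg R d M (fun q => 1 * _) (fun q => (gap D (freq R M q))^-2)); last by move=> q; rewrite mul1r.
  move=> H; apply: (le_via (4 * avg M (fun q => (gap D (freq R M q))^-2) + e)).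
   by apply: H => q; [rewrite mulrC ler_pdivlMr// mul1r|rewrite ler01 lexx].
  by clear H; lra.
split=> [x|P q x].
- have [M [_ aM _]] := pick 0.
 have := @conv_le_avg R d M phi g sg eg g0 gF (Fp M) D h z x D_summ D_even D_ge0 h0 sh z0 hz.
 move=> H; apply: le_trans H _.
 apply: (le_via (z * (5 * eta))); first by rewrite ler_wpM2l.
 by have := ler_wpM2r (ltW eta_gt0) z2; lra.
- have [M [PM _ aM]] := pick P.
 rewrite (freq_refine _ PM); move: (_ *: q) => q'.
 have := @weight_le_avg R d M phi g sphi sg eg g0 gF (Fp M) (v2 M) q' x.
 move=> H; apply: le_trans H _.
 have Dg : 0 <= gap D (freq R M q') by exact: gap_ge0.
 have vg : 0 <= gap (fun x => `|phi x|) (freq R M q') by exact: gap_ge0.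
 apply: (le_via (9 * gap (fun x => `|phi x|) (freq R M q') * (4 * C1 + 1))).
  by rewrite ler_wpM2l// mulr_ge0.
 have C0 : 0 <= 4 * C1 + 1 by rewrite addr_ge0// mulr_ge0.
 by have := ler_wpM2r C0 (v3 M q'); rewrite /W1; lra.
Qed.

Lemma csaw1_le x : csaw D 1 x <= D x.
Proof.
rewrite /csaw expect_one; apply: (le_via (\asum_y (D y * (y == x)%:R))).
 apply: nneg_asum_le => [y||y]; first by rewrite !mulr_ge0.
  by apply: (@summ_single _ _ _ x) => y /negbTE ->; rewrite mulr0.
 rewrite /pos big_seq1 ler_wpM2l// /sawf.
 by case: (saw_on _ _ _); rewrite ?mul1r// mul0r.
by rewrite (@asum_single _ _ _ x) ?eqxx ?mulr1// => y /negbTE ->; rewrite mulr0.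
Qed.

(** The avoidance between the first step and the rest of the walk is dropped. *)
Lemma twopt'_le_conv t x : 0 < t -> chi_summable D t ->
 twopt' D t x <= t * Defs.conv D (twopt D t) x.
Proof.
move=> t0 ct; rewrite /twopt' lerBlDr.
have sG := twopt_summ D_ge0 D_summ t0 ct.
have G0 := twopt_ge0 D_ge0 t0.
have cv0 : 0 <= t * Defs.conv D (twopt D t) x by apply: mulr_ge0; [exact: ltW|exact: conv_ge0].
have c0 n : 0 <= csaw D n x * t ^+ n by rewrite mulr_ge0 ?csaw_ge0// exprn_ge0// ltW.
apply: (proj2 (nneg_summ_nat (C := t * Defs.conv D (twopt D t) x + (x == 0)%:R) c0 _)).
case=> [|N]; first by rewrite big_ord0 addr_ge0.
rewrite big_ord_recl expr0 mulr1 csaw0 addrC lerD2r.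
apply: (le_via (t * \sum_(n < N) Defs.conv D (csaw D n) x * t ^+ n)).
 rewrite mulr_sumr; apply: ler_sum => n _.
 rewrite /= /bump /= add1n exprS mulrCA ler_wpM2l ?(ltW t0)// ler_wpM2r ?exprn_ge0 ?(ltW t0)//.
 apply: (le_trans (@csaw_conv_le _ _ _ D_ge0 D_summ D_sum1 1 n.+1 x _)) => //.
 rewrite subSS subn0; apply: nneg_asum_le => [y||y].
 - by rewrite mulr_ge0 ?csaw_ge0.
 - by apply: conv_term_summ => //; exact: csaw_summ.
 - by rewrite ler_wpM2r ?csaw_ge0// csaw1_le.
rewrite ler_wpM2l ?(ltW t0)//.
have st n : summ (fun y : Zd => D y * csaw D n (x - y)).
 by apply: conv_term_summ => //; exact: csaw_summ.
rewrite (eq_bigr (fun n : 'I_N => asum setT (fun y : Zd => D y * csaw D n (x - y) * t ^+ n))); last first.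
 by move=> n _; rewrite asumZr.
rewrite -(@asum_sum _ _ 'I_N _ xpredT (fun (n : 'I_N) (y : Zd) => D y * csaw D n (x - y) * t ^+ n)); last first.
 by move=> n _; exact: summZr.
apply: nneg_asum_le => [y||y].
- by apply: sumr_ge0 => n _; rewrite !mulr_ge0 ?csaw_ge0// exprn_ge0// ltW.
- by apply: conv_term_summ.
- rewrite (eq_bigr (fun n : 'I_N => D y * (csaw D n (x - y) * t ^+ n))); last by move=> n _; rewrite mulrA.
 by rewrite -mulr_sumr ler_wpM2l//; exact: twopt_part.
Qed.

(** The second condition is tested at rational frequencies, those that occur on finite grids. *)
Definition good (t c : R) :=
 (forall x, Defs.conv (twopt D t) (twopt' D t) x <= c * (10 * eta)) /\
 (forall P q x, (1 - cos (ldot (freq R P q) x)) * twopt' D t x <= c * W1 * gap D (freq R P q)).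

Hypotheses (eta1 : 20 * eta <= 1 / 8)
 (eta2 : 64 * (2 * W1) * (20 * eta) <= 1).

Let W1_gt0 : 0 < W1. Proof. by rewrite /W1 mulr_gt0// ltr_wpDl// mulr_ge0. Qed.

Lemma ltot_small n : (n <= 1)%N -> ltot D n = 0.
Proof.
move=> h; rewrite /ltot /expect -(asum0 R (n.-tuple Zd)); apply: eq_asum => ys.
by rewrite lacef_small// normr0 mulr0.
Qed.

Lemma ltot_summ_le t b : 0 < t -> chi_summable D t -> 0 <= b -> b <= 1 / 8 ->
 (forall x, Defs.conv (twopt D t) (twopt' D t) x <= b) ->
 summ (fun n => ltot D n * t ^+ n) /\ \asum_(n : nat) (ltot D n * t ^+ n) <= t * (2 * b).
Proof.
move=> t0 ct b0 b8 bb; apply: nneg_summ_nat => [n|N].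
 by rewrite mulr_ge0 ?ltot_ge0// exprn_ge0// ltW.
apply: le_trans (lacef_sum_le D_ge0 D_summ D_sum1 t0 ct b0 b8 bb N).
rewrite (bigID (fun n : 'I_N => (1 < n)%N))/= [X in _ + X]big1 ?addr0//.
by move=> n; rewrite -leqNgt => /ltot_small ->; rewrite mul0r.
Qed.

Section one_step.
Variable t : R.
Hypotheses (t_gt0 : 0 < t) (ct : chi_summable D t) (gt2 : good t 2).
Let b : R := 20 * eta.
Let b0 : 0 <= b. Proof. by rewrite mulr_ge0// ltW. Qed.
Let bub x : Defs.conv (twopt D t) (twopt' D t) x <= b.
Proof. by apply: le_trans (proj1 gt2 x) _; rewrite /b; lra. Qed.
Let ls : summ (fun n => ltot D n * t ^+ n).
Proof. by case: (ltot_summ_le t_gt0 ct b0 eta1 bub). Qed.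

(** The weight [(1 - cos) / gap D] turns the second bootstrap condition into [om * H <= 2 * W1], and
    [eta2] makes the factor [16 * (2 * W1) * b] at most [1 / 4]. Frequencies with zero gap are
    covered by [gap_eq0]. *)
Lemma gap_Pigen_le P q : gap (fun x => `|Pigen D t x|) (freq R P q) <= t / 4 * gap D (freq R P q).
Proof.
have := @gap_ge0 R d D (freq R P q) D_ge0; rewrite le_eqVlt => /orP[/eqP e|Dp].
 by rewrite gap_eq0// -e mulr0.
pose om (x : Zd) := (1 - cos (ldot (freq R P q) x)) / gap D (freq R P q).
have Di : 0 <= (gap D (freq R P q))^-1 by rewrite invr_ge0 ltW.
have om0 x : 0 <= om x by rewrite mulr_ge0 ?onecos_ge0.
have bom : bddf om.
 by exists (2 / gap D (freq R P q)) => x; rewrite ger0_norm// ler_wpM2r// onecos_le2.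
have HB : forall N, \sum_(n < N | (1 < n)%N) E n (fun ys => `|lacef R n ys| * om (pos ys)) * t ^+ n <= t * (16 * (2 * W1) * b).
 move=> N; apply: (lacef_weight_le D_ge0 D_summ D_sum1 D_even t_gt0 ct b0 eta1 bub N bom om0).
 - by rewrite /om ldot0r cos0 subrr mul0r.
 - by move=> x; rewrite /om ldotNr cosN.
 - by move=> x y; rewrite /om ldotDr 2!mulrA -mulrDl ler_wpM2r// onecosD.
 - by move=> x; rewrite /om mulrAC ler_pdivrMr//; exact: (proj2 gt2).
have := Pigen_weight_le D_ge0 D_summ t_gt0 ls bom om0 HB.
have -> : \asum_x (`|Pigen D t x| * om x) = gap (fun x => `|Pigen D t x|) (freq R P q) / gap D (freq R P q).
 rewrite /gap -asumZr; first by apply: eq_asum => x; rewrite /om mulrA.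
 by apply: gap_summ; apply: summ_abs; exact: Pigen_summ.
rewrite ler_pdivrMr// => H; apply: le_trans H _; rewrite ler_wpM2r ?(ltW Dp)//.
rewrite ler_wpM2l ?(ltW t_gt0)// /b.
by move: eta2; lra.
Qed.

(** Bounds that are too weak by a factor 2 already make the lace part a small perturbation of
    [t * D]; then [F] is comparable with [gap D], and the infrared bound returns the sharp
    constants. Positivity of [F] at frequency 0 reads [1 - t + t / 4 > 0], whence [t <= 4 / 3]. *)
Lemma good_improve : good t 1 /\ t <= 4 / 3.
Proof.
have [_ lb] := ltot_summ_le t_gt0 ct b0 eta1 bub.
have sP := Pigen_summ D_ge0 D_summ t_gt0 ls.
have sphi := phigen_summ D_ge0 D_summ t_gt0 ls.
have oz := ozeqn D_ge0 D_summ D_even D_zero t_gt0 ct ls.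
have G0 := twopt_ge0 D_ge0 t_gt0.
pose F0 := 1 - fh (phigen D t) 0.
have F0p : 0 < F0.
 have := oz 0; rewrite -/F0 fh0 => e.
 have g0 : 0 <= asum setT (twopt D t) by apply: asum_ge0.
 rewrite ltNge; apply/negP => h; have := mulr_ge0_le0 g0 h; rewrite e; lra.
have F0E : F0 = 1 - t - fh (Pigen D t) 0.
 by rewrite /F0 phigen_fh// Pigen_fh// /Dhat fh0 D_sum1; ring.
have Pi0 : `|fh (Pigen D t) 0| <= t * (2 * b).
 apply: le_trans lb; rewrite Pigen_fh//; apply: asum_norm_le => // n.
 by rewrite normrM (ger0_norm (x := t ^+ n)) ?exprn_ge0 ?(ltW t_gt0)// ler_wpM2r ?exprn_ge0 ?(ltW t_gt0)// lhat_le.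
have tb : t * (2 * b) <= t / 4.
 rewrite ler_wpM2l ?(ltW t_gt0)// /b.
 by move: eta1; lra.
move: Pi0; rewrite ler_norml => /andP[Pi1 Pi2].
have FE k : 1 - fh (phigen D t) k = F0 + t * gap D k + gap (Pigen D t) k.
 have e : gap (phigen D t) k = t * gap D k + gap (Pigen D t) k.
  have := asumD (summZ t (gap_summ k D_summ)) (gap_summ k sP).
  rewrite (asumZ _ (gap_summ k D_summ)) => <-.
  by apply: eq_asum => x; rewrite /phigen; ring.
 by have := gapE k sphi; rewrite e /F0; lra.
have gP k : `|gap (Pigen D t) k| <= gap (fun x => `|Pigen D t x|) k.
 apply: asum_norm_le => [|x]; first by apply: gap_summ; exact: summ_abs.
 by rewrite normrM (ger0_norm (onecos_ge0 _)).
have D2 k : gap D k <= 2.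
 apply: (le_via (2 * asum setT D)); last by rewrite D_sum1 mulr1.
 rewrite -asumZ//; apply: asum_le => [||x].
 - exact: gap_summ.
 - exact: summZ.
 - by rewrite mulrC ler_wpM2r// onecos_le2.
have vle k : gap (fun x => `|phigen D t x|) k <= t * gap D k + gap (fun x => `|Pigen D t x|) k.
 have sa := summ_abs sP.
 have := asumD (summZ t (gap_summ k D_summ)) (gap_summ k sa).
 rewrite (asumZ _ (gap_summ k D_summ)) => <-.
 apply: asum_le => [||x].
 - by apply: gap_summ; exact: summ_abs.
 - by apply: summD; [apply: summZ|]; exact: gap_summ.
 - rewrite mulrA -mulrDl ler_wpM2r ?onecos_ge0// /phigen.
  apply: le_trans (ler_normD _ _) _; rewrite lerD2r ger0_norm//.
  by apply: mulr_ge0 => //; exact: ltW.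
have t43 : t <= 4 / 3 by lra.
split=> //.
have key : [/\ forall P q, F0 <= 1 - fh (phigen D t) (freq R P q),
  forall P q, gap D (freq R P q) <= 2 * (1 - fh (phigen D t) (freq R P q)),
  forall P q, gap (fun x => `|phigen D t x|) (freq R P q) <= 3 * gap D (freq R P q) &
  forall P q, gap (fun x => `|phigen D t x|) (freq R P q) <= 2 * (1 - fh (phigen D t) (freq R P q))].
 suff main P q : [/\ F0 <= 1 - fh (phigen D t) (freq R P q),
  gap D (freq R P q) <= 2 * (1 - fh (phigen D t) (freq R P q)),
  gap (fun x => `|phigen D t x|) (freq R P q) <= 3 * gap D (freq R P q) &
  gap (fun x => `|phigen D t x|) (freq R P q) <= 2 * (1 - fh (phigen D t) (freq R P q))].
  by split=> P q; case: (main P q).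
 rewrite FE; have := gap_Pigen_le P q; have := vle (freq R P q); have := gP (freq R P q).
 have := D2 (freq R P q); have := @gap_ge0 R d D (freq R P q) D_ge0.
 rewrite ler_norml => + + /andP[].
 move: (gap D _) (gap (Pigen D t) _) (gap (fun x => `|Pigen D t x|) _) (gap (fun x => `|phigen D t x|) _).
 move=> x1 x2 x3 x4 h0 h2 h3 h4 h5 h6.
 have h7 : t * x1 <= 4 / 3 * x1 by rewrite ler_wpM2r.
 have h8 : 0 <= t * x1 by rewrite mulr_ge0 ?(ltW t_gt0).
 have h9 : t * x1 <= t * 2 by rewrite ler_wpM2l ?(ltW t_gt0).
 split; try lra.
 (* Two regimes for [gap D <= 2 * F]. If [t >= 2 / 3], then [3 / 4 * t * gap D] suffices; for
    smaller [t] the mass [F0 >= 1 - 5 / 4 * t] compensates, using [gap D <= 2]. *)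
 case: (leP (2 / 3) t) => ht; first by have := ler_wpM2r h0 ht; lra.
 have : 0 <= (2 / 3 - t) * (2 - x1) by apply: mulr_ge0; rewrite subr_ge0//; exact: ltW.
 by lra.
case: key => k1 k2 k3 k4.
have t2 : t <= 2 by lra.
have [c1 c2] := @infrared_core (phigen D t) (twopt D t) (twopt' D t) t F0 sphi (phigen_even D_even t)
 (twopt_summ D_ge0 D_summ t_gt0 ct) (twopt_even D_even t) G0 oz F0p k1 k2 k3 k4
 (twopt'_ge0 D_ge0 D_summ t_gt0 ct) (twopt'_summ D_ge0 D_summ t_gt0 ct) (ltW t_gt0)
 t2 (fun y => twopt'_le_conv y t_gt0 ct).
split=> [x|P q x]; rewrite mul1r//.
by apply: le_trans (c2 P q x); rewrite ler_wpM2l ?onecos_ge0// twopt'_le.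
Qed.

End one_step.

(** For small [t] the crude bound [ctot D n <= 1] makes both quantities of order [t]. The radii
    [1 / 3 < 1 / 2] are arbitrary choices below 1. *)
Lemma good_start : exists2 t0 : R, 0 < t0 & forall t, 0 < t -> t <= t0 -> good t 1.
Proof.
have sh0 : (0 : R) < 1 / 3 by lra. have s12 : (1 / 3 : R) < 1 / 2 by lra.
have c12 : chi_summable D (1 / 2) by apply: chi_summable_lt1 => //; lra.
have sv := var_coef_summ D_ge0 sh0 s12 c12.
set s : R := 1 / 3 in sh0 s12 sv.
pose V := \asum_(n : nat) (var_coef D n * s ^+ n).
have V0 : 0 <= V by apply: asum_ge0 => n; rewrite mulr_ge0 ?var_coef_ge0// exprn_ge0// ltW.
exists (Num.min s (Num.min (eta) (s * W1 / (V + 1)))).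
 by rewrite !lt_min sh0 eta_gt0/=; apply: divr_gt0; [exact: mulr_gt0|exact: ltr_wpDl].
move=> t t0; rewrite !le_min => /and3P[ts te tV].
have t1 : t < 1 by apply: le_lt_trans ts _; rewrite /s; lra.
have ct : chi_summable D t by apply: chi_summable_lt1 => //; exact: ltW.
have G0 := twopt_ge0 D_ge0 t0.
have H0 := twopt'_ge0 D_ge0 D_summ t0 ct.
have sG := twopt_summ D_ge0 D_summ t0 ct.
have sH := twopt'_summ D_ge0 D_summ t0 ct.
have chi_le : chi D t <= 1 + 3 / 2 * t.
 have tn n : 0 <= ctot D n * t ^+ n by rewrite mulr_ge0 ?ctot_ge0// exprn_ge0// ltW.
 have := @nneg_summ_nat R _ (1 + 3 / 2 * t) tn; case=> // n.
 apply: (le_via (\sum_(i < n) t ^+ i)).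
  by apply: ler_sum => i _; rewrite ler_piMl ?exprn_ge0 ?(ltW t0)// ctot_le1.
 have h : (1 - t) * (\sum_(i < n) t ^+ i) = 1 - t ^+ n.
  by rewrite -opprB mulNr -subrX1 opprB.
 have h' : 0 <= t ^+ n by rewrite exprn_ge0// ltW.
 have S0 : 0 <= \sum_(i < n) t ^+ i by apply: sumr_ge0 => i _; rewrite exprn_ge0// ltW.
 have hs : t <= 1 / 3 by exact: ts.
 rewrite -(ler_pM2l (x := 1 - t)) ?subr_gt0// h.
 by nra.
split=> [x|P q x].
- have Hs : asum setT (twopt' D t) <= 3 / 2 * t.
  rewrite /twopt' asumB//; last by apply: (@summ_single _ _ _ 0) => y /negbTE ->.
  rewrite (twopt_sum D_ge0 D_summ t0 ct) (@asum_single _ _ (fun y => (y == 0)%:R) 0); last by move=> y /negbTE ->.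
  by rewrite eqxx lerBlDr addrC; exact: chi_le.
 have G2 y : twopt D t y <= 2.
  apply: (le_trans (twopt_le_chi D_ge0 D_summ y t0 ct)); apply: (le_trans chi_le).
  by move: ts; rewrite /s; lra.
 apply: (le_via (\asum_(y : Zd) (2 * twopt' D t (x - y)))).
  apply: nneg_asum_le => [y||y]; first by rewrite mulr_ge0.
   by apply: summZ; exact: summ_sub.
  by rewrite ler_wpM2r.
 rewrite asumZ; last exact: summ_sub.
 rewrite (asum_sub (twopt' D t) x); by lra.
- have wn n : var_coef D n * t ^+ n <= t / s * (var_coef D n * s ^+ n).
  case: n => [|n]; first by rewrite /var_coef !mul0r mulr0.
  rewrite mulrCA ler_wpM2l ?var_coef_ge0// !exprS mulrA divfK ?gt_eqF// ler_wpM2l ?(ltW t0)//.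
  by rewrite lerXn2r// nnegrE ltW.
 have sv0 : summ (fun n => t / s * (var_coef D n * s ^+ n)) by exact: summZ.
 have Dg := @gap_ge0 R d D (freq R P q) D_ge0.
 apply: (le_via ((1 - cos (ldot (freq R P q) x)) * twopt D t x)).
  by rewrite ler_wpM2l ?onecos_ge0// twopt'_le.
 rewrite /twopt -asumZ; last exact: twopt_term_summ.
 apply: (le_via (\asum_(n : nat) (t / s * (var_coef D n * s ^+ n) * gap D (freq R P q)))).
  apply: nneg_asum_le => [n||n].
  - by rewrite !mulr_ge0 ?onecos_ge0 ?csaw_ge0// exprn_ge0// ltW.
  - exact: summZr.
  - rewrite mulrA; apply: le_trans (ler_wpM2r _ (csaw_weight_le D_ge0 D_summ n (freq R P q) x)) _.
    by rewrite exprn_ge0// ltW.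
   by rewrite mulrAC ler_wpM2r.
 rewrite asumZr// ler_wpM2r// mul1r asumZ// -/V.
 move: tV; rewrite ler_pdivlMr ?ltr_wpDl// => tV.
 rewrite mulrAC ler_pdivrMr// mulrC [leRHS]mulrC; apply: le_trans tV.
 by rewrite mulrC ler_wpM2l ?(ltW t0)// lerDl.
Qed.

(** A discrete continuity argument: up to [u] both quantities are Lipschitz, so a step of size [de]
    worsens the constant 1 to at most 2, and [good_improve] restores 1. Induction on the number of
    steps reaches [u]. *)
Theorem good_all Z u : 0 < u -> u < Z -> chi_summable D Z -> good u 1 /\ u <= 4 / 3.
Proof.
move=> u0 uZ cZ; have [t0 t00 Hs] := good_start.
suff gu : good u 1.
 split=> //; have cu : chi_summable D u by apply: chi_summable_le cZ => //; exact: ltW.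
 have g2 : good u 2.
  case: gu => g1 g2; split=> [x|P q x].
   by apply: le_trans (g1 x) _; rewrite ler_wpM2r ?mulr_ge0 ?(ltW eta_gt0)// ler1n.
  by apply: le_trans (g2 P q x) _; rewrite ler_wpM2r ?gap_ge0// ler_wpM2r ?(ltW W1_gt0)// ler1n.
 by have [] := good_improve u0 cu g2.
pose s := (u + Z) / 2.
have us : u < s by rewrite /s; lra. have sZ : s < Z by rewrite /s; lra.
have [Cb Cb0 Hb] := bubble_lip D_ge0 D_summ u0 us sZ cZ.
have [Cw Cw0 Hw] := weight_lip D_ge0 D_summ u0 us sZ cZ.
pose de := Num.min (10 * eta / (Cb + 1)) (W1 / (Cw + 1)).
have de0 : 0 < de.
 rewrite lt_min; apply/andP; split; apply: divr_gt0.
 - exact: mulr_gt0.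
 - exact: ltr_wpDl.
 - exact: W1_gt0.
 - exact: ltr_wpDl.
suff main n t : 0 < t -> t <= u -> t <= t0 + n%:R * de -> good t 1.
 apply: (main (Num.bound (u / de))) => //.
 rewrite ler_wpDl ?(ltW t00)// -ler_pdivrMr//; apply: ltW.
 by apply: archi_boundP; rewrite divr_ge0 ?ltW.
elim: n t => [|n IH] t tp tu tn; first by apply: Hs => //; move: tn; rewrite mul0r addr0.
have [h|h] := leP t t0; first exact: Hs.
have ct : chi_summable D t.
 by apply: chi_summable_le cZ => //; [exact: ltW|exact: le_trans tu (ltW uZ)].
pose t' := Num.max t0 (t - de).
have t'p : 0 < t' by rewrite lt_max t00.
have t't : t' <= t by rewrite ge_max (ltW h)/= gerBl ltW.
have gt' : good t' 1.
 apply: IH => //; first exact: le_trans tu.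
 rewrite ge_max; apply/andP; split; first by rewrite lerDl mulr_ge0 ?ler0n ?(ltW de0).
 rewrite lerBlDr; apply: (le_trans tn).
 by rewrite -natr1 mulrDl mul1r addrA.
have td : t - t' <= de by rewrite lerBlDr -lerBlDl le_max lexx orbT.
have [] // := @good_improve t tp ct.
case: gt' => g1 g2; split=> [x|P q x].
- apply: (le_trans (Hb t' t x t'p t't tu)); have := g1 x.
 have hb : Cb * (t - t') <= 10 * eta.
  have d1 : de <= 10 * eta / (Cb + 1) by rewrite ge_min lexx.
  have := le_trans td d1; rewrite ler_pdivlMr ?ltr_wpDl// => hh.
  apply: le_trans hh; rewrite mulrC ler_wpM2l ?subr_ge0// lerDl//.
 by move: hb; move: (Cb * _) (10 * eta) (Defs.conv _ _ _) => a1 a2 a3; lra.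
- apply: (le_trans (Hw t' t (freq R P q) x t'p t't tu)); have := g2 P q x.
 have Dg := @gap_ge0 R d D (freq R P q) D_ge0.
 have hb : Cw * (t - t') * gap D (freq R P q) <= W1 * gap D (freq R P q).
  rewrite ler_wpM2r//.
  have d1 : de <= W1 / (Cw + 1) by rewrite ge_min lexx orbT.
  have := le_trans td d1; rewrite ler_pdivlMr ?ltr_wpDl// => hh.
  apply: le_trans hh; rewrite mulrC ler_wpM2l ?subr_ge0// lerDl//.
 move=> h1; apply: le_trans (lerD h1 hb) _.
 by rewrite mul1r -[leRHS]mulrA [leRHS]mulr_natl mulr2n.
Qed.

End bootstrap.

(** * A perturbed renewal equation *)

Section volterra.
Variable R : realType.

Lemma summ_nat_tail (f : nat -> R) (e : R) : summ f -> 0 < e -> exists J, forall m, (J <= m)%N ->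
 \sum_(J <= j < m) `|f j| <= e /\ `|asum setT f - \sum_(j < J) f j| <= e.
Proof.
move=> sf e0; have sa := summ_abs sf.
have /cvg_eps /(_ e e0)[J HJ] := asum_nat_cvg sa.
have part m : (J <= m)%N -> \sum_(J <= j < m) `|f j| <= e.
 move=> Jm; have := HJ J (leqnn J); rewrite ler_norml => /andP[h _].
 have := nneg_asum_nat_ge m (fun n => normr_ge0 (f n)) sa.
 rewrite -(big_mkord xpredT (fun j => `|f j|)) (big_cat_nat (n := J))//= big_mkord; lra.
exists J => m Jm; split; first exact: part.
apply: (@cvg_le_bound R (fun m => `|\sum_(j < m) f j - \sum_(j < J) f j| - (m < J)%:R * `|\sum_(j < m) f j - \sum_(j < J) f j|)).
 rewrite -[X in _ --> X]subr0; apply: cvgB.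
  by apply: cvg_norm; apply: cvgB; [exact: asum_nat_cvg|exact: cvg_cst].
 apply/cvg_eps => e' e'0; exists J => p Jp.
 by rewrite ltnNge Jp mul0r subr0 normr0 ltW.
move=> p; have [pJ|Jp] := ltnP p J; first by rewrite mul1r subrr ltW.
rewrite mul0r subr0 -(big_mkord xpredT f) (big_cat_nat (n := J))//= big_mkord addrAC subrr add0r.
exact: le_trans (ler_norm_sum _ _ _) (part p Jp).
Qed.

(** The kernel is cut at [J]: near terms use that [v] is close to [a], far terms that the tail of
    [g] is small. *)
Lemma conv_approx (f g v : nat -> R) a V de e J m : (forall i, `|f i| <= g i) -> summ g ->
 (forall i, `|v i| <= V) -> `|a| <= V -> (J <= m.+1)%N ->
 (forall j, (j < J)%N -> `|v (m - j)%N - a| <= de) -> 0 <= de ->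
 \sum_(J <= j < m.+1) g j <= e -> `|asum setT f - \sum_(j < J) f j| <= e ->
 `|\sum_(j < m.+1) f j * v (m - j)%N - asum setT f * a| <= asum setT g * de + 2 * V * e.
Proof.
move=> fg sg vV aV Jm va de0 t1 t2.
have g0 i : 0 <= g i by apply: le_trans (fg i).
rewrite -(big_mkord xpredT (fun j => f j * v (m - j)%N)) (big_cat_nat (n := J))//= big_mkord.
rewrite [X in `|X|](_ : _ = \sum_(j < J) f j * (v (m - j)%N - a) + (- (asum setT f - \sum_(j < J) f j) * a + \sum_(J <= j < m.+1) f j * v (m - j)%N)); last first.
 under [X in _ = X + _]eq_bigr do rewrite mulrBr.
 by rewrite sumrB -mulr_suml; ring.
have V0 : 0 <= V by apply: le_trans aV.
apply: (le_trans (ler_normD _ _)); apply: lerD.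
 apply: (le_trans (ler_norm_sum _ _ _)).
 apply: (le_via (\sum_(j < J) g j * de)).
  by apply: ler_sum => j _; rewrite normrM ler_pM// va.
 by rewrite -mulr_suml ler_wpM2r// nneg_asum_nat_ge.
apply: (le_trans (ler_normD _ _)).
rewrite (_ : 2 * V * e = e * V + e * V); last by ring.
apply: lerD; first by rewrite normrM normrN ler_pM.
apply: (le_trans (ler_norm_sum _ _ _)).
apply: (le_via (\sum_(J <= j < m.+1) g j * V)).
 by apply: ler_sum => j _; rewrite normrM ler_pM.
by rewrite -mulr_suml ler_wpM2r.
Qed.

(** Each pass through the inequality halves the excess over [4 * e]: one [e] for the inhomogeneity,
    one for the kernel beyond [J], and half of the previous bound. The threshold [M'] is common to
    all [u], which gives uniformity in the parameter [n] below. *)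
Lemma volterra (tp : nat -> R) (U e : R) M : (forall j, 0 <= tp j) -> summ tp ->
 asum setT tp <= 1 / 2 -> 0 <= U -> 0 < e ->
 exists M', forall u : nat -> R, (forall m, 0 <= u m <= U) ->
  (forall m, (M <= m)%N -> u m <= e + \sum_(j < m) tp j * u (m - j.+1)%N) ->
  forall m, (M' <= m)%N -> u m <= 5 * e.
Proof.
move=> tp0 stp t12 U0 e0.
have U1 : 0 < U + 1 by rewrite ltr_wpDl.
have [J HJ] := summ_nat_tail stp (divr_gt0 e0 U1).
have tail m : (J <= m)%N -> \sum_(J <= j < m) tp j * U <= e.
 move=> Jm; rewrite -mulr_suml.
 have [h _] := HJ m Jm; rewrite -(@divfK _ (U + 1) _ e) ?gt_eqF//.
 apply: ler_pM => //; first by apply: sumr_ge0.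
  by apply: le_trans h; apply: ler_sum => j _; exact: ler_norm.
 by rewrite lerDl.
suff [k hk] : exists k, U / 2 ^+ k <= e.
 suff {hk} [M' H] : exists M', forall u : nat -> R, (forall m, 0 <= u m <= U) ->
  (forall m, (M <= m)%N -> u m <= e + \sum_(j < m) tp j * u (m - j.+1)%N) ->
  forall m, (M' <= m)%N -> u m <= 4 * e + U / 2 ^+ k.
  by exists M' => u hu1 hu2 m hm; have := H u hu1 hu2 m hm; lra.
 elim: k => [|k [M' IH]].
  exists 0%N => u hu _ m _; have /andP[_ h] := hu m.
  by rewrite expr0 divr1; apply: le_trans h _; lra.
 exists (maxn M (M' + J).+1) => u hu1 hu2 m; rewrite geq_max => /andP[Mm M'm].
 apply: (le_trans (hu2 m Mm)).
 rewrite -(big_mkord xpredT (fun j => tp j * u (m - j.+1)%N)) (big_cat_nat (n := J))//=; last by lia.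
 rewrite big_mkord.
 have h1 : \sum_(J <= j < m) tp j * u (m - j.+1)%N <= e.
  apply: le_trans (tail m _); last by lia.
  by apply: ler_sum => j _; rewrite ler_wpM2l//; have /andP[] := hu1 (m - j.+1)%N.
 have h2 : \sum_(j < J) tp j * u (m - j.+1)%N <= 1 / 2 * (4 * e + U / 2 ^+ k).
  apply: (le_via (\sum_(j < J) tp j * (4 * e + U / 2 ^+ k))).
   apply: ler_sum => j _; rewrite ler_wpM2l//; apply: IH => //.
   by have := ltn_ord j; lia.
  rewrite -mulr_suml ler_wpM2r//; first by rewrite addr_ge0 ?mulr_ge0 ?invr_ge0 ?exprn_ge0 ?(ltW e0).
  by apply: le_trans t12; exact: nneg_asum_nat_ge.
 rewrite exprS invfM mulrCA; move: (U / 2 ^+ k) h2 => q h2; lra.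
exists (Num.bound (U / e)); rewrite ler_pdivrMr ?exprn_gt0// mulrC -ler_pdivrMr//.
apply: (le_trans (ltW (archi_boundP _))); first by rewrite divr_ge0// ltW.
rewrite -natrX ler_nat ltnW// ; exact: ltn_expl.
Qed.

End volterra.

Lemma index_arith M J m : (M + J < m)%N -> (J <= m.+2)%N /\
 forall j, (j < J)%N -> (M <= m.+1 - j)%N /\ (j <= m)%N.
Proof. by move=> h; split=> [|j jJ]; [|split]; lia. Qed.

Section renewal.
Variables (R : realType) (w : nat -> R) (e x : nat -> nat -> R) (g : nat -> R) (B s : R).
Hypotheses (w0 : w 0%N = 0) (w_summ : summ w) (w_sum1 : asum setT w = 1).
Definition rtail j : R := \asum_(i : nat) w (i + j.+1)%N.
Local Notation tau := rtail.
Hypotheses (tau_summ : summ tau) (tau_small : \asum_(j : nat) `|tau j.+1| <= 1 / 2)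
 (e0 : forall n, e n 0%N = 0)
 (e_le : forall n i, n%:R * `|e n i| <= g i) (g_summ : summ g)
 (e_ge0 : forall n, 0 <= asum setT (e n))
 (e_cvg : n%:R * asum setT (e n) @[n --> \oo] --> s)
 (x0 : forall n, x n 0%N = 1)
 (xS : forall n m, x n m.+1 = \sum_(i < m.+2) (w i - e n i) * x n (m.+1 - i)%N)
 (x_le : forall n m, `|x n m| <= B).

Let w_shift_summ j : summ (fun i => w (i + j)%N).
Proof.
elim: j => [|j [C HC]]; first by apply: eq_summ w_summ => i; rewrite addn0.
exists C => q uq; apply: (le_trans _ (HC (map S q) _)).
 by rewrite big_map; apply: ler_sum => i _; rewrite addSnnS.
by rewrite map_inj_uniq// => a b [].
Qed.

Lemma asum_nat_recl (f : nat -> R) : summ f -> summ (fun i => f i.+1) ->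
 asum setT f = f 0%N + \asum_(i : nat) f i.+1.
Proof.
move=> sf sf1.
have h1 : \sum_(i < n.+1) f i @[n --> \oo] --> asum setT f.
 by have := asum_nat_cvg sf; rewrite -(cvg_shiftS (fun n => \sum_(i < n) f i)).
have h2 : \sum_(i < n.+1) f i @[n --> \oo] --> f 0%N + \asum_(i : nat) f i.+1.
 rewrite (_ : (fun n => _) = (fun n => f 0%N + \sum_(i < n) f i.+1)); last first.
  by apply/funext => n; rewrite big_ord_recl.
 apply: cvgD; first exact: cvg_cst.
 exact: (asum_nat_cvg sf1).
by rewrite -(cvg_lim (@Rhausdorff R) h1) (cvg_lim (@Rhausdorff R) h2).
Qed.

Lemma rtail_diff j : tau j = w j.+1 + tau j.+1.
Proof.
rewrite /rtail asum_nat_recl ?add0n//.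
- by congr (_ + _); apply: eq_asum => i; rewrite addSnnS.
- by have := w_shift_summ j.+2; apply: eq_summ => i; rewrite addSnnS.
Qed.

Lemma rtail0 : tau 0 = 1.
Proof.
rewrite -w_sum1 [in RHS]asum_nat_recl// ?w0 ?add0r.
 by apply: eq_asum => i; rewrite addn1.
by apply: eq_summ (w_shift_summ 1) => i; rewrite addn1.
Qed.

Let S : R := asum setT tau.
Let tau1_summ : summ (fun j => tau j.+1).
Proof.
case: tau_summ => C HC; exists C => q uq; apply: (le_trans _ (HC (map succn q) _)).
 by rewrite big_map.
by rewrite map_inj_uniq// => a b [].
Qed.

Let S_bnd : 1 / 2 <= S <= 3 / 2.
Proof.
rewrite /S asum_nat_recl// rtail0.
have := ler_norm_asum tau1_summ => h; have := le_trans h tau_small.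
by rewrite ler_norml => /andP[]; lra.
Qed.

Let A := S^-1.
Let S_gt0 : 0 < S. Proof. by case/andP: S_bnd; lra. Qed.
Let A_gt0 : 0 < A. Proof. by rewrite invr_gt0. Qed.
Let A_le2 : A <= 2.
Proof.
rewrite /A -[leLHS]mul1r ler_pdivrMr//.
by case/andP: S_bnd; lra.
Qed.

Let Tabs : R := \asum_(j : nat) `|tau j|.
Let Tabs_le : Tabs <= 3 / 2.
Proof.
rewrite /Tabs asum_nat_recl; [|exact: summ_abs|exact: summ_abs tau1_summ].
by rewrite rtail0 normr1; have := tau_small; lra.
Qed.

(** For [e = 0] this convolution with the tails of [w] is constant in [m], by summation by parts in
    the renewal equation. The perturbation changes it by at most a multiple of [1 / n] per step. *)
Let y n m : R := \sum_(j < m.+1) tau j * x n (m - j)%N.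

Lemma y_diff n m : y n m.+1 - y n m = - \sum_(i < m.+2) e n i * x n (m.+1 - i)%N.
Proof.
rewrite /y big_ord_recl rtail0 mul1r subn0 xS.
rewrite [\sum_(i < m.+2) (w i - e n i) * _]big_ord_recl w0 e0 subrr mul0r add0r.
rewrite [in RHS]big_ord_recl e0 mul0r add0r.
rewrite -addrA -sumrB -big_split -sumrN/=; apply: eq_bigr => j _.
by rewrite /bump /= add1n subSS (rtail_diff j); ring.
Qed.

Let Cg := asum setT g.
Let g_ge0 i : 0 <= g i.
Proof. by apply: le_trans (e_le 0 i); rewrite mul0r. Qed.
Let Cg_ge0 : 0 <= Cg. Proof. exact: asum_ge0. Qed.
Let B_ge1 : 1 <= B. Proof. by have := x_le 0 0; rewrite x0 normr1. Qed.
Let B_ge0 : 0 <= B. Proof. exact: le_trans B_ge1. Qed.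

Let e_le' n i : (0 < n)%N -> `|e n i| <= g i / n%:R.
Proof. by move=> n0; rewrite ler_pdivlMr ?ltr0n// mulrC. Qed.

Let y_step n m : (0 < n)%N -> `|y n m.+1 - y n m| <= B * Cg / n%:R.
Proof.
move=> n0; rewrite y_diff normrN; apply: (le_trans (ler_norm_sum _ _ _)).
apply: (le_via (\sum_(i < m.+2) g i * (B / n%:R))).
 apply: ler_sum => i _; rewrite normrM.
 by rewrite mulrCA [leRHS]mulrC ler_pM// ?e_le'// mulrC.
rewrite -mulr_suml [leRHS](_ : _ = Cg * (B / n%:R)); last by ring.
rewrite ler_wpM2r ?divr_ge0//.
exact: nneg_asum_nat_ge.
Qed.

Let y_lip n m j : (0 < n)%N -> `|y n (m + j)%N - y n m| <= j%:R * (B * Cg / n%:R).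
Proof.
move=> n0; elim: j => [|j IH]; first by rewrite addn0 subrr normr0 mul0r.
rewrite addnS -natr1 mulrDl mul1r [leRHS]addrC.
apply: (le_trans _ (lerD (y_step (m + j) n0) IH)).
by apply: le_trans (ler_normD _ _); rewrite addrA subrK.
Qed.

Let y_le n m : `|y n m| <= 2 * B.
Proof.
apply: (le_trans (ler_norm_sum _ _ _)).
apply: (le_via (\sum_(j < m.+1) `|tau j| * B)).
 by apply: ler_sum => j _; rewrite normrM ler_wpM2l.
rewrite -mulr_suml ler_wpM2r//; apply: (le_via Tabs).
 by apply: (@nneg_asum_nat_ge _ (fun j => `|tau j|)) => //; exact: summ_abs.
by have := Tabs_le; lra.
Qed.

Let inv_small (c ep : R) : 0 <= c -> 0 < ep -> exists N, forall n, (N <= n)%N -> (0 < n)%N /\ c / n%:R <= ep.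
Proof.
move=> c0 ep0; exists (Num.bound (c / ep)).+1 => n Nn; split; first exact: leq_ltn_trans Nn.
have n0 : 0 < n%:R :> R by rewrite ltr0n; exact: leq_ltn_trans Nn.
rewrite ler_pdivrMr// mulrC -ler_pdivrMr//; apply: (le_trans (ltW (archi_boundP _))).
 by rewrite divr_ge0// ltW.
by rewrite ler_nat; exact: ltnW.
Qed.

(** Up to an error, [x - A * y] satisfies a homogeneous equation with kernel [- tau j.+1], of total
    mass at most [1 / 2], and [volterra] applies. The error is small because [A * S = 1] and, for
    large [n], [y] is nearly constant over a window of length [J]. *)
Lemma x_near_y ep : 0 < ep -> exists M N, forall n, (N <= n)%N -> forall m, (M <= m)%N ->
 `|x n m - A * y n m| <= ep.
Proof.
move=> ep0; pose ep1 := ep / 5; have ep10 : 0 < ep1 by rewrite divr_gt0.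
pose de := ep1 / 6; have de0 : 0 < de by rewrite divr_gt0.
pose ep2 := ep1 / (16 * B + 1).
have B16 : 0 < 16 * B + 1 by rewrite ltr_wpDl// mulr_ge0.
have ep20 : 0 < ep2 by rewrite divr_gt0.
have [J HJ] := summ_nat_tail tau_summ ep20.
have [N HN] := @inv_small (J%:R * (B * Cg)) de (mulr_ge0 (ler0n _ _) (mulr_ge0 B_ge0 Cg_ge0)) de0.
have B5 : 0 <= 5 * B by rewrite mulr_ge0.
have [M' HV] := @volterra R (fun j => `|tau j.+1|) (5 * B) ep1 J (fun j => normr_ge0 _)
  (summ_abs tau1_summ) tau_small B5 ep10.
exists M', N => n Nn m Mm.
have [n0 Jn] := HN n Nn.
have -> : ep = 5 * ep1 by rewrite /ep1; field.
apply: (HV (fun m => `|x n m - A * y n m|)) => // {Mm}m; last first.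
 move=> Jm.
 have [t1 t2] := HJ m.+1 (leqW Jm).
 have va j : (j < J)%N -> `|y n (m - j)%N - y n m| <= de.
  move=> jJ.
  have jm : (j <= m)%N by apply: leq_trans Jm; exact: ltnW.
  rewrite distrC -{1}(subnK jm); apply: le_trans (y_lip _ _ n0) _; apply: le_trans Jn.
  by rewrite mulrA ler_wpM2r ?invr_ge0 ?ler0n// ler_wpM2r ?mulr_ge0// ler_nat ltnW.
 have := @conv_approx R tau (fun j => `|tau j|) (y n) (y n m) (2 * B) de ep2 J m
  (fun i => lexx _) (summ_abs tau_summ) (y_le n) (y_le n m) (leqW Jm) va (ltW de0) t1 t2.
 rewrite -/S -/Tabs => hy.
 have idt : x n m - A * y n m = - (\sum_(j < m) tau j.+1 * (x n (m - j.+1)%N - A * y n (m - j.+1)%N))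
   - A * (\sum_(j < m.+1) tau j * y n (m - j)%N - S * y n m).
  have AS : A * S = 1 by rewrite mulVf// gt_eqF.
  have e1 : \sum_(j < m.+1) tau j * (x n (m - j)%N - A * y n (m - j)%N) =
    y n m - A * \sum_(j < m.+1) tau j * y n (m - j)%N.
   rewrite mulr_sumr /y -sumrB; apply: eq_bigr => j _; ring.
  rewrite big_ord_recl rtail0 mul1r subn0 in e1.
  have -> : x n m - A * y n m = y n m - A * (\sum_(j < m.+1) tau j * y n (m - j)%N) -
   \sum_(i < m) tau (lift ord0 i) * (x n (m - lift ord0 i)%N - A * y n (m - lift ord0 i)%N).
   by rewrite -e1 addrK.
  have -> : A * (\sum_(j < m.+1) tau j * y n (m - j)%N - S * y n m) =
   A * (\sum_(j < m.+1) tau j * y n (m - j)%N) - y n m by rewrite mulrBr mulrA AS mul1r.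
  by rewrite opprB addrC.
 rewrite idt; apply: (le_trans (ler_normD _ _)); rewrite !normrN addrC; apply: lerD.
  rewrite normrM (ger0_norm (ltW A_gt0)).
  apply: (le_via (2 * (3 / 2 * de + 2 * (2 * B) * ep2))).
   apply: ler_pM => //; first exact: ltW.
   by apply: le_trans hy _; rewrite lerD2r ler_wpM2r// ltW.
  have : 16 * B * ep2 <= ep1.
   rewrite /ep2 mulrCA -[leRHS]mulr1 ler_wpM2l ?(ltW ep10)// ler_pdivrMr// mul1r; lra.
  rewrite /de; lra.
 apply: (le_trans (ler_norm_sum _ _ _)); apply: ler_sum => j _; by rewrite normrM.
rewrite normr_ge0/=; apply: le_trans (ler_normD _ _) _.
have h1 := x_le n m; have h2 := y_le n m.
rewrite normrN normrM (ger0_norm (ltW A_gt0)).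
have := ler_pM (ltW A_gt0) (normr_ge0 (y n m)) A_le2 h2; lra.
Qed.

(** In [y_diff] the values of [x] near time [m] are replaced by [A * y n m], so one step multiplies
    [y] by [1 - A * asum setT (e n)]. *)
Lemma y_recursion ep : 0 < ep -> exists M N, forall n, (N <= n)%N -> forall m, (M <= m)%N ->
 `|y n m.+1 - (1 - A * asum setT (e n)) * y n m| <= ep / n%:R.
Proof.
move=> ep0.
pose de := ep / (2 * (Cg + 1)).
have Cg1 : 0 < Cg + 1 by rewrite ltr_wpDl.
have de0 : 0 < de by rewrite divr_gt0// mulr_gt0.
pose ep2 := ep / (20 * B + 1).
have B16 : 0 < 20 * B + 1 by rewrite ltr_wpDl// mulr_ge0.
have ep20 : 0 < ep2 by rewrite divr_gt0.
have [J HJ] := summ_nat_tail g_summ ep20.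
have de20 : 0 < de / 4 by rewrite divr_gt0.
have [N HN] := @inv_small (J%:R * (B * Cg)) (de / 4) (mulr_ge0 (ler0n _ _) (mulr_ge0 B_ge0 Cg_ge0)) de20.
have [M1 [N1 Hxy]] := x_near_y (divr_gt0 de0 (ltac:(by []) : 0 < 2 :> R)).
exists (M1 + J).+1, (maxn N N1) => n; rewrite geq_max => /andP[Nn N1n] m Mm.
have [n0 Jn] := HN n Nn.
have nR : 0 < n%:R :> R by rewrite ltr0n.
have sgn : summ (fun i => g i / n%:R) by exact: summZr.
have sen : summ (e n) by apply: summ_le sgn => i; exact: e_le'.
have [Jm idx] := index_arith Mm.
have [t1 _] := HJ m.+2 Jm.
have tail1 : \sum_(J <= j < m.+2) g j / n%:R <= ep2 / n%:R.
 rewrite -mulr_suml ler_wpM2r ?invr_ge0 ?(ltW nR)//; apply: le_trans t1.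
 by apply: ler_sum => j _; exact: ler_norm.
have tail2 : `|asum setT (e n) - \sum_(j < J) e n j| <= ep2 / n%:R.
 have := @asum_norm_le R nat (fun j => if (j < J)%N then 0 else e n j) (fun j => if (j < J)%N then 0 else g j / n%:R).
 have c1 : summ (fun j => if (j < J)%N then 0 else g j / n%:R).
  apply: summ_le sgn => j; case: ifP => _; first by rewrite normr0 divr_ge0// ltW.
  by rewrite ger0_norm// divr_ge0// ltW.
 have c2 : summ (fun j => if (j < J)%N then e n j else 0).
  by apply: summ_le sgn => j; case: ifP => _; rewrite ?normr0 ?e_le'// divr_ge0// ltW.
 have c3 : summ (fun j => if (j < J)%N then g j else 0).
  by apply: summ_le g_summ => j; case: ifP => _; rewrite ?normr0// ger0_norm.
 have cut (f : nat -> R) : \asum_(j : nat) (if (j < J)%N then f j else 0) = \sum_(j < J) f j.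
  rewrite (@asum_seq _ _ _ (index_iota 0 J)) ?iota_uniq//.
   by rewrite -(big_mkord xpredT) big_seq [RHS]big_seq; apply: eq_bigr => j; rewrite mem_index_iota => /andP[_ ->].
  by move=> j; rewrite mem_index_iota/= => /negbTE ->.
 move=> /(_ c1) h.
 rewrite -cut -asumB//.
 apply: (le_trans (y := `|\asum_(j : nat) (if (j < J)%N then 0 else e n j)|)).
  by apply: le_of_eq; congr `|_|; apply: eq_asum => j; case: ifP; rewrite ?subrr ?subr0.
 apply: (le_trans (h _)).
  by move=> j; case: ifP => _; rewrite ?normr0// e_le'.
 rewrite (eq_asum_to (fun j => (g j - (if (j < J)%N then g j else 0)) / n%:R)); last first.
  by move=> j; case: ifP; rewrite ?subrr ?mul0r ?subr0.
 rewrite asumZr; last exact: summB.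
 rewrite ler_wpM2r ?invr_ge0 ?(ltW nR)// asumB// cut.
 by have [_ t2] := HJ m.+2 Jm; apply: le_trans t2; exact: ler_norm.
have a_le : `|A * y n m| <= 4 * B.
 rewrite normrM (ger0_norm (ltW A_gt0)).
 by have := ler_pM (ltW A_gt0) (normr_ge0 (y n m)) A_le2 (y_le n m); lra.
have xB i : `|x n i| <= 4 * B by apply: le_trans (x_le n i) _; have := B_ge0; lra.
have va j : (j < J)%N -> `|x n (m.+1 - j)%N - A * y n m| <= de.
 move=> jJ.
 have [h0 _] := idx j jJ; have h1 := Hxy n N1n (m.+1 - j)%N h0.
 have h2 : `|y n (m.+1 - j)%N - y n m| <= de / 4.
  case: j jJ {h0 h1} => [|j] jJ.
   rewrite subn0 -addn1; apply: (le_trans (y_lip _ _ n0)); apply: le_trans Jn.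
   by rewrite mulrA ler_wpM2r ?invr_ge0 ?(ltW nR)// ler_wpM2r ?mulr_ge0// ler_nat.
  have [_ jm] := idx j (ltnW jJ).
  rewrite subSS distrC -{1}(subnK jm); apply: le_trans (y_lip _ _ n0) _; apply: le_trans Jn.
  rewrite mulrA ler_wpM2r ?invr_ge0 ?(ltW nR)// ler_wpM2r ?mulr_ge0// ler_nat.
  by apply: leq_trans jJ; exact: leqW.
 have -> : x n (m.+1 - j)%N - A * y n m = (x n (m.+1 - j)%N - A * y n (m.+1 - j)%N) + A * (y n (m.+1 - j)%N - y n m) by ring.
 apply: (le_trans (ler_normD _ _)); rewrite normrM (ger0_norm (ltW A_gt0)).
 by have := ler_pM (ltW A_gt0) (normr_ge0 _) A_le2 h2; move: h1; lra.
have hx := @conv_approx R (e n) (fun i => g i / n%:R) (x n) (A * y n m) (4 * B) de (ep2 / n%:R) J m.+1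
 (fun i => e_le' i n0) sgn xB a_le Jm va (ltW de0) tail1 tail2.
have -> : y n m.+1 - (1 - A * asum setT (e n)) * y n m =
 - (\sum_(j < m.+2) e n j * x n (m.+1 - j)%N - asum setT (e n) * (A * y n m)).
 by have := y_diff n m => hd; rewrite opprB -[X in _ = _ - X]opprK -hd; ring.
rewrite normrN; apply: (le_trans hx); rewrite asumZr// -/Cg.
rewrite [leLHS](_ : _ = (Cg * de + 2 * (4 * B) * ep2) / n%:R); last by ring.
rewrite ler_wpM2r ?invr_ge0 ?(ltW nR)//.
have h1 : Cg * de <= ep / 2.
 rewrite /de mulrA ler_pdivrMr ?mulr_gt0//.
 have -> : ep / 2 * (2 * (Cg + 1)) = ep * (Cg + 1) by field.
 by have := ep0; move: Cg => c; nra.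
have h2 : 2 * (4 * B) * ep2 <= ep / 2.
 rewrite (_ : 2 * (4 * B) * ep2 = 2 * (4 * B) * ep / (20 * B + 1)); last by rewrite /ep2; ring.
 rewrite ler_pdivrMr//.
 by have := ep0; have := B_ge0; move: B => c; nra.
by move: h1 h2; move: (Cg * de) (2 * (4 * B) * ep2) => u1 u2; lra.
Qed.

(** The exponential satisfies the same one-step recursion up to a small multiple of [1 / n], and at
    most [n] steps are made. Errors do not grow: the multiplier lies in [[0, 1]], since the
    perturbation has a nonnegative sum. *)
Lemma y_limit ep : 0 < ep -> exists M N, forall n, (N <= n)%N -> forall m, (M <= m <= n)%N ->
 `|y n m - expR (- (A * s * m%:R / n%:R))| <= ep.
Proof.
move=> ep0.
have s0 : 0 <= s.
 have := @cvg_le_bound R (fun n => - (n%:R * asum setT (e n))) (- s) 0.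
 by rewrite oppr_le0; apply => [|n]; [exact: cvgN|rewrite oppr_le0 mulr_ge0].
pose r := A * s; have r0 : 0 <= r by rewrite mulr_ge0// ltW.
have ep40 : 0 < ep / 4 by rewrite divr_gt0.
have [M1 [N1 H1]] := y_recursion ep40.
have /cvg_eps /(_ (ep / 8) ltac:(by rewrite divr_gt0))[N2 H2] := e_cvg.
have /cvg_eps /(_ 1 ltac:(by []))[N3 H3] := e_cvg.
have [N4 H4] := @inv_small (r ^+ 2) (ep / 4) (sqr_ge0 _) ep40.
have s1 : 0 <= 2 * (s + 1) by rewrite mulr_ge0// addr_ge0.
have [N5 H5] := @inv_small (2 * (s + 1)) 1 s1 ltr01.
have [N6 H6] := @inv_small (M1%:R * (B * Cg) + r * M1%:R) (ep / 4) (addr_ge0 (mulr_ge0 (ler0n _ _) (mulr_ge0 B_ge0 Cg_ge0)) (mulr_ge0 r0 (ler0n _ _))) ep40.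
exists M1, (maxn (maxn (maxn N1 N2) (maxn N3 N4)) (maxn N5 N6)) => n.
rewrite !geq_max => /andP[/andP[/andP[h1 h2] /andP[h3 h4]] /andP[h5 h6]] m /andP[Mm mn].
have [n0 k4] := H4 n h4; have [_ k5] := H5 n h5; have [_ k6] := H6 n h6.
have nR : 0 < n%:R :> R by rewrite ltr0n.
pose v i := expR (- (r * i%:R / n%:R)) : R.
have v01 i : 0 <= v i <= 1.
 rewrite expR_ge0/= -expR0 ler_expR oppr_le0 divr_ge0// ?(ltW nR)//.
 by rewrite mulr_ge0.
set E := asum setT (e n).
have AE0 : 0 <= A * E by rewrite mulr_ge0 ?(ltW A_gt0)// e_ge0.
have AE1 : A * E <= 1.
 have : E <= (s + 1) / n%:R.
  by rewrite ler_pdivlMr// mulrC; have := H3 n h3; rewrite -/E ler_norml => /andP[_]; lra.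
 move=> hE; have := ler_pM (ltW A_gt0) (e_ge0 n) A_le2 hE.
 by rewrite mulrA in k5 *; move=> h; exact: le_trans h k5.
have vS i : `|v i.+1 - (1 - A * E) * v i| <= ep / 2 / n%:R.
 have -> : v i.+1 = expR (- (r / n%:R)) * v i.
  by rewrite /v -expRD -natr1; congr expR; ring.
 rewrite -mulrBl normrM; have /andP[v0 v1] := v01 i.
 rewrite (ger0_norm v0).
 apply: (le_via `|expR (- (r / n%:R)) - (1 - A * E)|); first by rewrite ler_piMr.
 set t := r / n%:R; have t0 : 0 <= t by rewrite divr_ge0// ltW.
 have l1 : 1 - t <= expR (- t) by exact: expR_ge1Dx.
 have l2 : expR (- t) <= 1 - t + t ^+ 2.
  rewrite expRN; have ht : 1 + t <= expR t by exact: expR_ge1Dx.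
  have t1 : 0 < 1 + t by rewrite ltr_wpDr.
  apply: (le_via (1 + t)^-1); first by rewrite lef_pV2// posrE expR_gt0.
  rewrite -[leLHS]mul1r ler_pdivrMr//; have := mulr_ge0 t0 (sqr_ge0 t); nra.
 have l3 : t ^+ 2 <= ep / 4 / n%:R.
  rewrite /t expr_div_n expr2 -(ler_pM2r nR) divfK ?gt_eqF//.
  rewrite -[n%:R ^+ 2]/(n%:R * n%:R) invfM mulrA divfK ?gt_eqF//.
 have l4 : `|t - A * E| <= ep / 4 / n%:R.
  have -> : t - A * E = - (A * (n%:R * E - s) / n%:R) by rewrite /t /r; field; rewrite gt_eqF.
  rewrite normrN normrM normfV (ger0_norm (ltW nR)) ler_wpM2r ?invr_ge0 ?(ltW nR)//.
  rewrite normrM (ger0_norm (ltW A_gt0)).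
  by have := ler_pM (ltW A_gt0) (normr_ge0 _) A_le2 (H2 n h2); lra.
 have -> : ep / 2 / n%:R = ep / 4 / n%:R + ep / 4 / n%:R by field; rewrite gt_eqF.
 by move: l4; rewrite !ler_norml => /andP[]; move: (ep / 4 / _) l3 => q l3; lra.
have start : `|y n M1 - v M1| <= ep / 4.
 have y0 : y n 0 = 1 by rewrite /y big_ord1 rtail0 x0 mulr1.
 have := y_lip 0 M1 n0; rewrite add0n y0 => hy.
 have : `|1 - v M1| <= r * M1%:R / n%:R.
  have /andP[v0 v1] := v01 M1.
  rewrite ger0_norm ?subr_ge0// lerBlDr -lerBlDl.
  exact: expR_ge1Dx.
 move=> hv; apply: le_trans k6; rewrite mulrDl.
 have -> : y n M1 - v M1 = (y n M1 - 1) + (1 - v M1) by ring.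
 by apply: (le_trans (ler_normD _ _)); apply: lerD => //; rewrite -mulrA.
suff main j : (M1 + j <= n)%N -> `|y n (M1 + j)%N - v (M1 + j)%N| <= ep / 4 + j%:R * (3 * ep / 4 / n%:R).
 have := main (m - M1)%N; rewrite subnKC// => /(_ mn) h; apply: (le_trans h).
 have : (m - M1)%:R * (3 * ep / 4 / n%:R) <= 3 * ep / 4.
  rewrite mulrCA -[leRHS]mulr1 ler_wpM2l//; first by rewrite divr_ge0// mulr_ge0// ltW.
  by rewrite ler_pdivrMr// mul1r ler_nat (leq_trans (leq_subr _ _)).
 by lra.
elim: j => [|j IH] jn; first by rewrite addn0 mul0r addr0.
have jn' : (M1 + j <= n)%N by apply: ltnW; rewrite addnS in jn.
have {}IH := IH jn'.
have := H1 n h1 (M1 + j)%N (leq_addr _ _); have := vS (M1 + j)%N; rewrite -/E addnS.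
set q := 1 - A * E => g1 g2.
have q1 : `|q| <= 1 by rewrite /q ger0_norm ?subr_ge0// gerBl.
have -> : y n (M1 + j).+1 - v (M1 + j).+1 = (y n (M1 + j).+1 - q * y n (M1 + j)%N) + q * (y n (M1 + j)%N - v (M1 + j)%N)
 - (v (M1 + j).+1 - q * v (M1 + j)%N) by ring.
apply: (le_trans (ler_normB _ _)); have := ler_normD (y n (M1 + j).+1 - q * y n (M1 + j)%N) (q * (y n (M1 + j)%N - v (M1 + j)%N)).
rewrite normrM; have : `|q| * `|y n (M1 + j)%N - v (M1 + j)%N| <= `|y n (M1 + j)%N - v (M1 + j)%N| by rewrite ler_piMl.
have -> : ep / 4 + j.+1%:R * (3 * ep / 4 / n%:R) = ep / 4 + j%:R * (3 * ep / 4 / n%:R) + ep / 2 / n%:R + ep / 4 / n%:R.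
 by rewrite -natr1; field; rewrite gt_eqF.
move: g1 g2 IH; lra.
Qed.

Theorem renewal_limit ep : 0 < ep -> exists M N, forall n, (N <= n)%N -> forall m, (M <= m <= n)%N ->
 `|x n m - A * expR (- (A * s * m%:R / n%:R))| <= ep.
Proof.
move=> ep0; have [M1 [N1 H1]] := x_near_y (divr_gt0 ep0 (ltac:(by []) : 0 < 2 :> R)).
have [M2 [N2 H2]] := y_limit (divr_gt0 ep0 (ltac:(by []) : 0 < 4 :> R)).
exists (maxn M1 M2), (maxn N1 N2) => n; rewrite geq_max => /andP[n1 n2] m.
rewrite geq_max => /andP[/andP[m1 m2] mn].
have h1 := H1 n n1 m m1; have h2 := H2 n n2 m; rewrite m2 mn in h2; have {}h2 := h2 isT.
move: h2; set v := expR _ => h2.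
have -> : x n m - A * v = (x n m - A * y n m) + A * (y n m - v) by ring.
apply: (le_trans (ler_normD _ _)); rewrite normrM (ger0_norm (ltW A_gt0)).
by have := ler_pM (ltW A_gt0) (normr_ge0 _) A_le2 h2; lra.
Qed.

End renewal.

(** * Domination and passage to the critical point *)

Section generalities.
Variable R : realType.

Fixpoint maxf (f : nat -> R) K : R := if K is K'.+1 then Num.max (f K') (maxf f K') else 0.

Lemma maxf_ge0 f K : 0 <= maxf f K.
Proof. by elim: K => [|K IH] //=; rewrite le_max IH orbT. Qed.

Lemma maxf_ge f K n : (n < K)%N -> f n <= maxf f K.
Proof.
elim: K => [|K IH] //=; rewrite ltnS leq_eqVlt => /orP[/eqP->|/IH h]; first by rewrite le_max lexx.
by rewrite le_max h orbT.
Qed.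

Lemma maxf_le f K C : 0 <= C -> (forall n, (n < K)%N -> f n <= C) -> maxf f K <= C.
Proof.
move=> C0; elim: K => [|K IH] //= H; rewrite ge_max H//=.
by apply: IH => n nK; exact: H (leqW nK).
Qed.

Lemma maxf_mono f K K' : (K <= K')%N -> maxf f K <= maxf f K'.
Proof.
move=> KK; apply: maxf_le; first exact: maxf_ge0.
by move=> n nK; apply: maxf_ge; exact: leq_trans KK.
Qed.

(** The candidate is the supremum over [n]. On a finite list one common [K] nearly attains all the
    suprema, so its sums inherit the bound on the running maxima. *)
Lemma dominated_by_max (I : choiceType) (f : nat -> I -> R) (C : R) : (forall n i, 0 <= f n i) ->
 (forall K s, uniq s -> \sum_(i <- s) maxf (f^~ i) K <= C) ->
 exists2 g : I -> R, summ g & forall n i, f n i <= g i.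
Proof.
move=> f0 H; pose g i := sup (range (f^~ i)).
have ub i : ubound (range (f^~ i)) C.
 move=> _ [n _ <-]; have := H n.+1 [:: i] isT; rewrite big_seq1.
 by apply: le_trans; exact: maxf_ge.
have hs i : has_sup (range (f^~ i)).
 by split; [exists (f 0%N i), 0%N|exists C].
have fg n i : f n i <= g i.
 by apply: ub_le_sup; [exists C|exists n].
exists g => //; apply: (@summ_bound _ _ _ C) => s us.
apply/ler_addgt0Pr => e e0.
pose e1 := e / (size s).+1%:R; have e' : 0 < e1 by rewrite divr_gt0.
have [K HK] : exists K, forall i, i \in s -> g i <= maxf (f^~ i) K + e1.
 elim: (s) => [|i s' [K IH]]; first by exists 0%N.
 have [_ [n _ <-] hn] := sup_adherent e' (hs i).
 exists (maxn K n.+1) => j; rewrite inE => /orP[/eqP->|/IH h].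
  rewrite -lerBlDr; apply: le_trans (ltW hn) _.
  by apply: (@maxf_ge (f^~ i)); rewrite leq_max leqnn orbT.
 by apply: le_trans h _; rewrite lerD2r; apply: maxf_mono; rewrite leq_maxl.
apply: (le_via (\sum_(i <- s) (maxf (f^~ i) K + e1))).
 rewrite big_seq [leRHS]big_seq; apply: ler_sum => i si.
 by rewrite ger0_norm ?HK//; apply: le_trans (fg 0%N i).
rewrite big_split/= lerD ?H// big_const_seq count_predT iter_addr_0 -[_ *+ _]mulr_natr.
by rewrite /e1 mulrAC ler_pdivrMr// ler_wpM2l ?(ltW e0)// ler_nat.
Qed.

Lemma bernoulli_le n (del : R) : del <= 1 -> 1 - n%:R * del <= (1 - del) ^+ n.
Proof.
move=> d1; have d1' : 0 <= 1 - del by rewrite subr_ge0.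
elim: n => [|n IH]; first by rewrite mul0r subr0 expr0.
rewrite exprS; apply: (le_trans _ (ler_wpM2l d1' IH)).
rewrite -natr1; have := mulr_ge0 (ler0n R n) (sqr_ge0 del); nra.
Qed.

Lemma maxf_cases f K : maxf f K = 0 \/ exists2 n, (n < K)%N & maxf f K = f n.
Proof.
elim: K => [|K IH] /=; first by left.
case: (leP (f K) (maxf f K)) => _; last by right; exists K.
by case: IH => [->|[n nK ->]]; [left|right; exists n => //; exact: leqW].
Qed.

Lemma tail_pair sh (v : nat -> R) : summ (fun i => i%:R * `|v i|) ->
 summ (fun p : nat * nat => if (p.2 + sh < p.1)%N then v p.1 else 0) /\
 forall i, \asum_(j : nat) (if (j + sh < i)%N then v i else 0) = (i - sh)%:R * v i.
Proof.
move=> sv; have row (u : nat -> R) i : \asum_(j : nat) (if (j + sh < i)%N then u i else 0) = (i - sh)%:R * u i.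
 rewrite (@asum_seq _ _ _ (iota 0 (i - sh))) ?iota_uniq//; last first.
  by move=> j; rewrite mem_iota/= add0n ltn_subRL addnC => /negbTE ->.
 rewrite big_seq (eq_bigr (fun=> u i)); last first.
  by move=> j; rewrite mem_iota/= add0n ltn_subRL addnC => ->.
 by rewrite -big_seq big_const_seq count_predT size_iota iter_addr_0 mulr_natl.
split; last exact: row.
apply: (@summ_pair _ _ _ (fun i j : nat => if (j + sh < i)%N then v i else 0) (fun i : nat => i%:R * `|v i|)) => //.
- move=> i; apply: (@summ_seq _ _ _ (iota 0 (i - sh))) => j.
 by rewrite mem_iota/= add0n ltn_subRL addnC => /negbTE ->.
- move=> i; rewrite (eq_asum_to (fun j : nat => if (j + sh < i)%N then `|v i| else 0)); last first.
  by move=> j; case: ifP => //; rewrite normr0.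
 by rewrite (row (fun i => `|v i|)) ler_wpM2r// ler_nat leq_subr.
Qed.

Lemma rtailE (w : nat -> R) j : rtail w j = \asum_(i : nat) (if (j < i)%N then w i else 0).
Proof.
rewrite /rtail -(asum_nat_shift (fun i => w (i + j.+1)%N) j.+1); apply: eq_asum => i.
by case: ifP => // h; rewrite subnK.
Qed.

(** Fubini over the pairs [j < i]: the index [i] is counted [i] times, and [i - 1] times when the
    first tail is left out. *)
Lemma rtail_sum (w : nat -> R) : summ (fun i => i%:R * `|w i|) ->
 [/\ summ (rtail w), asum setT (rtail w) = \asum_(i : nat) (i%:R * w i) &
  \asum_(j : nat) `|rtail w j.+1| <= \asum_(i : nat) ((i - 1)%:R * `|w i|)].
Proof.
move=> sw; have [s0 r0] := tail_pair 0 sw.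
have s0' : summ (fun p : nat * nat => (fun i j : nat => if (j < i)%N then w i else 0) p.1 p.2).
 by apply: eq_summ s0 => p; rewrite addn0.
have rE j : rtail w j = \asum_(i : nat) (if (j < i)%N then w i else 0) by exact: rtailE.
split.
- have := summ_pair_sum (@summ_swap R nat nat (fun i j : nat => if (j < i)%N then w i else 0) s0'); apply: eq_summ => j /=; by rewrite rE.
- rewrite (eq_asum _ rE) -(@asum_swap R nat nat (fun i j : nat => if (j < i)%N then w i else 0) s0'); apply: eq_asum => i.
 by have := r0 i; rewrite subn0 => <-; apply: eq_asum => j; rewrite addn0.
have sw1 : summ (fun i => i%:R * `| `|w i| |) by apply: eq_summ sw => i; rewrite normr_id.
have [s1 r1] := tail_pair 1 sw1.
have s1' : summ (fun p : nat * nat => (fun i j : nat => if (j.+1 < i)%N then `|w i| else 0) p.1 p.2).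
 by apply: eq_summ s1 => p; rewrite addn1.
rewrite -[leRHS](_ : \asum_(i : nat) \asum_(j : nat) (if (j.+1 < i)%N then `|w i| else 0) = _); last first.
 by apply: eq_asum => i; rewrite -r1; apply: eq_asum => j; rewrite addn1.
rewrite (@asum_swap R nat nat (fun i j : nat => if (j.+1 < i)%N then `|w i| else 0) s1'); apply: nneg_asum_le => [//||j]; first exact: (summ_pair_sum (@summ_swap R nat nat (fun i j : nat => if (j.+1 < i)%N then `|w i| else 0) s1')).
rewrite rE; apply: asum_norm_le => [|i].
 exact: (summ_pair_row j (@summ_swap R nat nat (fun i j : nat => if (j.+1 < i)%N then `|w i| else 0) s1')).
by case: ifP => //; rewrite normr0.
Qed.

(** Explicit continuity of a finite sum: Bernoulli's [1 - n * del <= (1 - del) ^ n] compares the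
    values at [z * (1 - del)] and at [z]. *)
Lemma pow_limit (a : nat -> R) N (C z : R) : 0 < z -> (forall n, 0 <= a n) ->
 (forall u, 0 < u -> u < z -> \sum_(n < N) a n * u ^+ n <= C) -> \sum_(n < N) a n * z ^+ n <= C.
Proof.
move=> z0 a0 H; pose S := \sum_(n < N) a n * z ^+ n; rewrite -/S.
have S0 : 0 <= S by apply: sumr_ge0 => n _; rewrite mulr_ge0// exprn_ge0// ltW.
have NS0 : 0 < N%:R * S + 1 by rewrite ltr_wpDl// mulr_ge0.
apply/ler_addgt0Pr => e e0.
pose del := Num.min (1 / 2) (e / (N%:R * S + 1)).
have d0 : 0 < del by rewrite lt_min !divr_gt0.
have d1 : del <= 1 / 2 by rewrite ge_min lexx.
have d1' : 0 < 1 - del by lra.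
have bern n := @bernoulli_le n del (ltac:(lra) : del <= 1).
have := H (z * (1 - del)) (mulr_gt0 z0 d1').
rewrite gtr_pMr// => /(_ ltac:(by rewrite ltrBlDr ltrDl)) h.
have : S - N%:R * del * S <= C.
 apply: le_trans h; rewrite /S mulr_sumr -sumrB; apply: ler_sum => n _.
 rewrite exprMn [a n * (_ * _)]mulrA [leLHS](_ : _ = (1 - N%:R * del) * (a n * z ^+ n)); last by ring.
 rewrite [leRHS]mulrC ler_wpM2r//.
  by rewrite mulr_ge0// exprn_ge0// ltW.
 apply: le_trans (bern n); rewrite lerD2l lerN2 ler_wpM2r ?(ltW d0)// ler_nat ltnW//.
have : N%:R * del * S <= e.
 have d2 : del <= e / (N%:R * S + 1) by rewrite ge_min lexx orbT.
 move: d2; rewrite ler_pdivlMr// => d2; apply: le_trans d2.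
 by rewrite mulrAC mulrC ler_wpM2l ?(ltW d0)// lerDl.
by move: (_ * S) => q; lra.
Qed.

End generalities.

Section rational_density.
Variables (R : realType) (d : nat).
Local Notation Zd := 'rV[int]_d.

(** Leads from the rational frequencies of the bootstrap to arbitrary ones. *)
Lemma freq_dense (k : 'rV[R]_d) : exists q : nat -> Zd, forall x,
 ldot (freq R P (q P)) x @[P --> \oo] --> ldot k x.
Proof.
pose q (P : nat) : Zd := \row_i Num.floor (k 0 i * P.+1%:R / (2 * pi)).
have p0 : 0 < 2 * pi :> R by rewrite mulr_gt0// pi_gt0.
have comp P i : `|freq R P (q P) 0 i - k 0 i| <= 2 * pi / P.+1%:R.
 rewrite !mxE; set t := k 0 i * P.+1%:R / (2 * pi).
 have -> : k 0 i = 2 * pi / P.+1%:R * t.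
  have := lt0r_neq0 p0; have : P.+1%:R != 0 :> R by rewrite pnatr_eq0.
  rewrite /t; move: (P.+1%:R) (2 * pi) => p c pn cn; field; by rewrite pn cn.
 have c0 : 0 < 2 * pi / P.+1%:R :> R by rewrite divr_gt0.
 rewrite -mulrBr normrM (ger0_norm (ltW c0)) ler_piMr ?(ltW c0)//.
 have := floor_le t; have := floorD1_gt t; rewrite intrD => h1 h2.
 rewrite ler_norml; lra.
exists q => x; apply/cvg_eps => e e0.
pose S : R := \sum_i `|(x 0 i)%:~R|.
have S0 : 0 <= S by apply: sumr_ge0.
exists (Num.bound (2 * pi * S / e)) => P hP.
apply: (le_via (2 * pi / P.+1%:R * S)).
 rewrite /ldot /dot -sumrB /S mulr_sumr; apply: (le_trans (ler_norm_sum _ _ _)); apply: ler_sum => i _.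
 rewrite -mulrBl normrM [of_lattice R x 0 i]mxE; apply: ler_wpM2r => //; exact: comp.
rewrite mulrAC ler_pdivrMr// [e * _]mulrC -ler_pdivrMr//.
apply: (le_trans (ltW (archi_boundP _))); first by rewrite !mulr_ge0 ?invr_ge0 ?(ltW e0)// pi_ge0.
by rewrite ler_nat leqW.
Qed.

Lemma cos_ldot_cvg (k : nat -> 'rV[R]_d) l x : ldot (k P) x @[P --> \oo] --> ldot l x ->
 1 - cos (ldot (k P) x) @[P --> \oo] --> 1 - cos (ldot l x).
Proof.
move=> h; apply: cvgB; first exact: cvg_cst.
exact: (cvg_comp _ _ h (@continuous_cos R _)).
Qed.

Lemma gap_cvg (f : Zd -> R) (k : nat -> 'rV[R]_d) l : summ f ->
 (forall x, ldot (k P) x @[P --> \oo] --> ldot l x) ->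
 gap f (k P) @[P --> \oo] --> gap f l.
Proof.
move=> sf h; apply: (asum_dominated (g := fun x => `|f x| * 2)).
- by apply: summZr; exact: summ_abs.
- by move=> n x; rewrite normrM (ger0_norm (onecos_ge0 _)) ler_wpM2l// onecos_le2.
- move=> x; apply: cvgM; first exact: cvg_cst.
 exact: cos_ldot_cvg.
Qed.

End rational_density.

Lemma cvg_ge0 (R : realType) (u : nat -> R) (l : R) : u n @[n --> \oo] --> l ->
 (forall n, 0 <= u n) -> 0 <= l.
Proof.
move=> /cvg_eps H u0; apply/ler_addgt0Pr => e e0; have [n0 h] := H e e0.
have := h n0 (leqnn _); rewrite ler_distlC => /andP[h1 _].
by have := u0 n0; lra.
Qed.

(** * The critical point *)

Section critical.
Variables (R : realType) (d : nat) (D : 'rV[int]_d -> R).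
Local Notation Zd := 'rV[int]_d.
Local Notation E := (expect D).
Hypotheses (D_ge0 : forall x, 0 <= D x)
 (D_summ : summ D)
 (D_sum1 : asum setT D = 1)
 (D_even : forall x, D (- x) = D x)
 (D_zero : D 0 = 0).
Variables C1 eta : R.
Hypotheses (C1_ge0 : 0 <= C1) (eta_gt0 : 0 < eta) (d_gt0 : (0 < d)%N)
 (IR : infrared D C1 eta).
Local Notation W := (W1 C1).
Hypotheses (eta1 : 20 * eta <= 1 / 8)
 (eta2 : 64 * (2 * W) * (20 * eta) <= 1).

Definition zcrit : R := sup [set z | 0 <= z /\ chi_summable D z].
Local Notation zc := zcrit.

Let W_gt0 : 0 < W. Proof. by rewrite /W1 mulr_gt0// ltr_wpDl// mulr_ge0. Qed.

Let good_u := @good_all R d D D_ge0 D_summ D_sum1 D_even D_zero C1 eta C1_ge0 eta_gt0 d_gt0 IR eta1 eta2.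

Let half_summable : chi_summable D (1 / 2).
Proof. by apply: chi_summable_lt1 => //; lra. Qed.

Let chi_ub : ubound [set z | 0 <= z /\ chi_summable D z] (4 / 3).
Proof.
move=> z [z0 cz]; rewrite leNgt; apply/negP => zb.
have zm : (4 / 3 + z) / 2 < z by lra.
have z1 : 0 < (4 / 3 + z) / 2 by lra.
by have [_] := good_u z1 zm cz; lra.
Qed.

Let chi_has_sup : has_sup [set z | 0 <= z /\ chi_summable D z].
Proof. split; [exists (1 / 2); split => //; lra|by exists (4 / 3)]. Qed.

Lemma zcrit_le : zc <= 4 / 3.
Proof. by apply: ge_sup; [case: chi_has_sup|exact: chi_ub]. Qed.

Lemma zcrit_gt0 : 0 < zc.
Proof.
apply: (@lt_le_trans _ _ (1 / 2)); first by lra.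
by apply: ub_le_sup; [exists (4 / 3)|split=> //; lra].
Qed.

Lemma below_zcrit u : u < zc -> exists2 Z, u < Z & chi_summable D Z.
Proof.
move=> uz; have e0 : 0 < zc - u by rewrite subr_gt0.
have [Z [Z0 cZ] hZ] := sup_adherent e0 chi_has_sup.
by exists Z => //; move: hZ; rewrite -/zcrit; lra.
Qed.

Lemma chi_below u : 0 <= u -> u < zc -> chi_summable D u.
Proof. by move=> u0 /below_zcrit[Z uZ cZ]; apply: chi_summable_le cZ => //; exact: ltW. Qed.

Lemma chi_above z : zc < z -> ~ chi_summable D z.
Proof.
move=> zz cz; have : z <= zc.
 apply: ub_le_sup; first by exists (4 / 3).
 by split=> //; apply: le_trans (ltW zz); exact: ltW zcrit_gt0.
by rewrite leNgt zz.
Qed.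

Lemma good_below u : 0 < u -> u < zc -> good D C1 eta u 1.
Proof. by move=> u0 /below_zcrit[Z uZ cZ]; case: (good_u u0 uZ cZ). Qed.

Let b : R := 10 * eta.
Let b0 : 0 <= b. Proof. by rewrite mulr_ge0// ltW. Qed.
Let b8 : b <= 1 / 8. Proof. by rewrite /b; move: eta1 eta_gt0; lra. Qed.

Let bub u : 0 < u -> u < zc -> forall x, Defs.conv (twopt D u) (twopt' D u) x <= b.
Proof. by move=> u0 uz x; have [h _] := good_below u0 uz; have := h x; rewrite mul1r. Qed.

Lemma weight_real u k x : 0 < u -> u < zc -> (1 - cos (ldot k x)) * twopt' D u x <= W * gap D k.
Proof.
move=> u0 uz; have [_ h] := good_below u0 uz.
have [q hq] := freq_dense k.
have c1 : (1 - cos (ldot (freq R P (q P)) x)) * twopt' D u x - W * gap D (freq R P (q P)) @[P --> \oo]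
  --> (1 - cos (ldot k x)) * twopt' D u x - W * gap D k.
 apply: cvgB; apply: cvgM; try exact: cvg_cst.
  exact: (cos_ldot_cvg (hq x)).
 exact: gap_cvg.
rewrite -subr_le0; apply: (cvg_le_bound c1) => P.
by rewrite subr_le0; have := h P (q P) x; rewrite mul1r.
Qed.

Lemma ltot_time_crit N : \sum_(n < N) n%:R * ltot D n * zc ^+ n <= zc * (6 * b).
Proof.
apply: (@pow_limit R (fun n => n%:R * ltot D n) N) => //; first exact: zcrit_gt0.
 by move=> n; rewrite mulr_ge0// ltot_ge0.
move=> u u0 uz; apply: (le_via (u * (6 * b))); last first.
 by rewrite ler_wpM2r ?mulr_ge0// ltW.
apply: le_trans (lacef_time_le D_ge0 D_summ D_sum1 D_even u0 (chi_below (ltW u0) uz) b0 b8 (bub u0 uz) N).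
rewrite (bigID (fun n : 'I_N => (1 < n)%N))/= [X in _ + X]big1 ?addr0//.
by move=> n; rewrite -leqNgt => /(ltot_small D) ->; rewrite mulr0 mul0r.
Qed.

Lemma lweight_crit (om : Zd -> R) (V : R) N : bddf om -> (forall x, 0 <= om x) -> om 0 = 0 ->
 (forall x, om (- x) = om x) -> (forall x y, om (x + y) <= 2 * om x + 2 * om y) -> 0 <= V ->
 (forall u x, 0 < u -> u < zc -> om x * twopt' D u x <= V) ->
 \sum_(n < N) E n (fun ys => `|lacef R n ys| * om (pos ys)) * zc ^+ n <= zc * (16 * V * b).
Proof.
move=> bom om0 omz ome omD V0 oV; apply: (@pow_limit R (fun n => E n (fun ys => `|lacef R n ys| * om (pos ys))) N) => //; first exact: zcrit_gt0.
 by move=> n; apply: expect_ge0 => // ys _; rewrite mulr_ge0.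
move=> u u0 uz; apply: (le_via (u * (16 * V * b))); last first.
 by rewrite ler_wpM2r ?mulr_ge0// ltW.
have := @lacef_weight_le R d D D_ge0 D_summ D_sum1 D_even u u0 (chi_below (ltW u0) uz) b b0 b8 (bub u0 uz) om V N bom om0 omz ome omD (fun x => oV u x u0 uz).
apply: le_trans.
rewrite (bigID (fun n : 'I_N => (1 < n)%N))/= [X in _ + X]big1 ?addr0//.
move=> n; rewrite -leqNgt => h.
rewrite (_ : E n _ = 0) ?mul0r// /expect -(asum0 R (n.-tuple Zd)); apply: eq_asum => ys.
by rewrite lacef_small// normr0 mul0r mulr0.
Qed.

Lemma ltot_crit : summ (fun n => n%:R * ltot D n * zc ^+ n) /\
 \asum_(n : nat) (n%:R * ltot D n * zc ^+ n) <= 1 / 2.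
Proof.
have t0 n : 0 <= n%:R * ltot D n * zc ^+ n.
 by rewrite !mulr_ge0 ?ltot_ge0 ?exprn_ge0 ?(ltW zcrit_gt0).
have [s le] := nneg_summ_nat t0 ltot_time_crit.
split=> //; apply: le_trans le _; rewrite /b; have := zcrit_le; move: eta1 eta_gt0.
by move=> h1 h2 h3; have := ler_wpM2r (ltW h2) h3; lra.
Qed.

Lemma ltot_summ : summ (fun n => ltot D n * zc ^+ n).
Proof.
have zn n : 0 <= zc ^+ n by rewrite exprn_ge0// ltW// zcrit_gt0.
apply: summ_le (proj1 ltot_crit) => n; rewrite ger0_norm ?mulr_ge0 ?ltot_ge0//.
rewrite ler_wpM2r//; case: n => [|n]; first by rewrite ltot_small// mulr0.
by rewrite ler_peMl ?ltot_ge0// ler1n.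
Qed.

(** Submultiplicativity bounds the terms beyond [n] by [a] times a shorter partial sum, so
    [S N <= S n + a * S N] with [a < 1]. *)
Lemma submult_summable n z : 0 < z -> ctot D n * z ^+ n < 1 -> chi_summable D z.
Proof.
move=> z0; set a := _ * _ => a1.
have zn m : 0 <= z ^+ m by rewrite exprn_ge0// ltW.
have t0 m : 0 <= ctot D m * z ^+ m by rewrite mulr_ge0// ctot_ge0.
have a0 : 0 <= a := t0 n.
pose S N := \sum_(j < N) ctot D j * z ^+ j.
have S0 N : 0 <= S N by apply: sumr_ge0.
have Smono N M : (N <= M)%N -> S N <= S M.
 move=> NM; rewrite /S -!(big_mkord xpredT (fun j => ctot D j * z ^+ j)) [leRHS](big_cat_nat (n := N))//= lerDl.
 by apply: sumr_ge0.
apply: (proj1 (@nneg_summ_nat R _ (S n / (1 - a)) t0 _)) => N.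
rewrite ler_pdivlMr ?subr_gt0// mulrBr mulr1 lerBlDr -/(S N).
have [Nn|nN] := leqP N n.
 by apply: (le_trans (Smono _ _ Nn)); rewrite lerDl mulr_ge0.
rewrite -(subnKC (ltnW nN)); set M := (N - n)%N.
rewrite {1}/S big_split_ord/= -/(S n) lerD2l.
apply: (le_via (S M * a)); last by rewrite ler_wpM2r// Smono// leq_addl.
rewrite /S mulr_suml; apply: ler_sum => j _.
apply: (le_via (ctot D n * ctot D j * z ^+ (n + j))).
 rewrite ler_wpM2r//; have := ctot_submul D_ge0 D_summ (leq_addr j n).
 by rewrite addKn.
by rewrite exprD /a; apply: le_of_eq; ring.
Qed.

(** If it failed for some [n], it would fail at a slightly larger [z] as well, and there the
    susceptibility would converge by [submult_summable]. *)
Lemma ctot_zcrit_ge1 n : 1 <= ctot D n * zc ^+ n.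
Proof.
case: n => [|n]; first by rewrite ctot0 expr0 mulr1.
rewrite leNgt; apply/negP; set a := _ * _ => a1.
have a0 : 0 <= a by rewrite mulr_ge0 ?ctot_ge0// exprn_ge0// ltW// zcrit_gt0.
pose e := (1 - a) / (2 * n.+1%:R).
have n0 : 0 < n.+1%:R :> R by [].
have e0 : 0 < e by rewrite divr_gt0 ?subr_gt0// mulr_gt0.
have ne : n.+1%:R * e = (1 - a) / 2.
 by rewrite /e; have := lt0r_neq0 n0; move: (n.+1%:R) => p pn; field.
have e1 : e <= 1 / 2.
 have : 1 * e <= n.+1%:R * e by rewrite ler_wpM2r ?(ltW e0)// ler1n.
 by rewrite ne mul1r; lra.
have e1' : 0 < 1 - e by lra.
have zz : zc < zc / (1 - e).
 by rewrite ltr_pdivlMr// gtr_pMr ?zcrit_gt0// ltrBlDr ltrDl.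
apply: (chi_above zz); apply: (@submult_summable n.+1).
 by apply: lt_trans zz; exact: zcrit_gt0.
rewrite expr_div_n mulrA -/a ltr_pdivrMr ?exprn_gt0// mul1r.
have e2 : e <= 1 by lra.
by apply: lt_le_trans (bernoulli_le n.+1 e2); rewrite ne; lra.
Qed.

Lemma lhat_sum_summ k : summ (fun n => lhat D n k * zc ^+ n).
Proof.
apply: summ_le ltot_summ => n; rewrite normrM (ger0_norm (x := zc ^+ n)).
 by rewrite ler_wpM2r ?lhat_le// exprn_ge0// ltW// zcrit_gt0.
by rewrite exprn_ge0// ltW// zcrit_gt0.
Qed.

(** Below the critical point the mass [Fu] is [1 / chi u], and [chi] diverges because each of its
    terms tends to at least 1. The time moment of the laces gives continuity of the lace sum up to
    the endpoint. *)
Lemma critical_equation : zc + \asum_(n : nat) (lhat D n 0 * zc ^+ n) = 1.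
Proof.
pose F := 1 - zc - \asum_(n : nat) (lhat D n 0 * zc ^+ n).
suff : `|F| <= 0 by rewrite normr_le0 => /eqP; rewrite /F; lra.
have zn m : 0 <= zc ^+ m by rewrite exprn_ge0// ltW// zcrit_gt0.
apply/ler_addgt0Pr => e e0; rewrite add0r.
pose N := (Num.bound (4 / e)).+1.
have N0 : 0 < N%:R :> R by [].
have N4 : 4 / e <= N%:R.
 by apply: (le_trans (ltW (archi_boundP _))); rewrite ?divr_ge0 ?(ltW e0)// ler_nat.
(* Chosen so that, by Bernoulli, each of the first [N] terms of [chi] is still at least [1 / 2] at
   [u = zc * (1 - s)]. *)
pose s := Num.min (1 / (2 * N%:R)) (e / 4).
have s0 : 0 < s by rewrite lt_min !divr_gt0// mulr_gt0.
have sN : N%:R * s <= 1 / 2.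
 have : s <= 1 / (2 * N%:R) by rewrite ge_min lexx.
 by rewrite ler_pdivlMr ?mulr_gt0//; lra.
have se : s <= e / 4 by rewrite ge_min lexx orbT.
have s1 : s <= 1 / 2.
 apply: le_trans sN; rewrite ler_peMl ?(ltW s0)// ler1n//.
have t0 : 0 < 1 - s by lra.
pose u := zc * (1 - s).
have u0 : 0 < u by rewrite mulr_gt0// zcrit_gt0.
have uz : u < zc by rewrite gtr_pMr ?zcrit_gt0// ltrBlDr ltrDl.
have cu := chi_below (ltW u0) uz.
have lu : summ (fun n => ltot D n * u ^+ n).
 by apply: (@summ_pow_le R (ltot D) u zc) => //; [exact: ltot_ge0|exact: ltW|exact: ltW|exact: ltot_summ].
have lhu : summ (fun n => lhat D n 0 * u ^+ n).
 apply: summ_le lu => n; rewrite normrM (ger0_norm (x := u ^+ n)) ?exprn_ge0 ?(ltW u0)//.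
 by rewrite ler_wpM2r ?lhat_le// exprn_ge0// ltW.
pose Fu := 1 - u - \asum_(n : nat) (lhat D n 0 * u ^+ n).
have oz : chi D u * Fu = 1.
 have := ozeqn D_ge0 D_summ D_even D_zero u0 cu lu 0.
 rewrite fh0 (twopt_sum D_ge0 D_summ u0 cu) (phigen_fh D_ge0 D_summ u0 lu) /Dhat fh0 D_sum1 mulr1.
 by rewrite opprD addrA.
have chiN : N%:R / 2 <= chi D u.
 have tu n : 0 <= ctot D n * u ^+ n by rewrite mulr_ge0 ?ctot_ge0// exprn_ge0// ltW.
 apply: (le_trans _ (nneg_asum_nat_ge N tu cu)).
 apply: (le_via (\sum_(n < N) (1 / 2 : R))).
  by rewrite sumr_const card_ord -[_ *+ N]mulr_natr; lra.
 apply: ler_sum => n _; rewrite /u exprMn mulrA.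
 have s1' : s <= 1 by lra.
 apply: (le_via (1 * (1 - n%:R * s))).
  rewrite mul1r; have : n%:R * s <= N%:R * s by rewrite ler_wpM2r ?(ltW s0)// ler_nat ltnW.
  by lra.
 have nn : 0 <= 1 - n%:R * s.
  have : n%:R * s <= N%:R * s by rewrite ler_wpM2r ?(ltW s0)// ler_nat ltnW.
  by lra.
 by apply: ler_pM => //; [exact: ctot_zcrit_ge1|exact: bernoulli_le].
have chi0 : 0 < chi D u by apply: lt_le_trans chiN; rewrite divr_gt0.
have FuE : Fu = (chi D u)^-1 by apply: (mulfI (lt0r_neq0 chi0)); rewrite oz mulfV// gt_eqF.
have Fu0 : 0 <= Fu by rewrite FuE invr_ge0 ltW.
have Fue : Fu <= e / 2.
 rewrite FuE; apply: (le_via (2 / N%:R)).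
  by rewrite -[2 / _]invf_div lef_pV2 ?posrE// divr_gt0.
 by rewrite ler_pdivrMr// mulrAC ler_pdivlMr//; move: N4; rewrite ler_pdivrMr//; lra.
have diff : `|F - Fu| <= 2 * s.
 have -> : F - Fu = - (zc * s) - \asum_(n : nat) (lhat D n 0 * (zc ^+ n - u ^+ n)).
  rewrite (@eq_asum _ _ _ (fun n : nat => lhat D n 0 * (zc ^+ n - u ^+ n)) (fun n => lhat D n 0 * zc ^+ n - lhat D n 0 * u ^+ n)); last by move=> n; rewrite mulrBr.
  by rewrite asumB//; [rewrite /F /Fu /u; ring|exact: lhat_sum_summ].
 apply: (le_trans (ler_normB _ _)); rewrite normrN ger0_norm; last by rewrite mulr_ge0 ?(ltW s0)// ltW// zcrit_gt0.
 have h1 : zc * s <= 4 / 3 * s by rewrite ler_wpM2r ?zcrit_le// ltW.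
 have h2 : `|\asum_(n : nat) (lhat D n 0 * (zc ^+ n - u ^+ n))| <= s * (1 / 2).
  have [sl ll] := ltot_crit.
  apply: (le_via (s * \asum_(n : nat) (n%:R * ltot D n * zc ^+ n))); last by rewrite ler_wpM2l// ltW.
  rewrite -asumZ//; apply: asum_norm_le => [|n]; first exact: summZ.
  have ud : 0 <= zc ^+ n - u ^+ n by rewrite subr_ge0 lerXn2r// ?nnegrE ltW// zcrit_gt0.
  rewrite normrM (ger0_norm ud); apply: (le_via (ltot D n * (zc ^+ n * (n%:R * s)))).
   apply: ler_pM => //; first exact: lhat_le.
   rewrite /u exprMn -[X in X - _]mulr1 -mulrBr ler_wpM2l//.
   have s1' : s <= 1 by lra.
   by have := bernoulli_le n s1'; lra.
  by apply: le_of_eq; ring.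
 by move: h1 h2; lra.
have -> : F = Fu + (F - Fu) by ring.
apply: (le_trans (ler_normD _ _)); rewrite (ger0_norm Fu0); lra.
Qed.

Let zc0 : 0 < zc := zcrit_gt0.
Let zn0 n : 0 <= zc ^+ n. Proof. by rewrite exprn_ge0// ltW. Qed.

Definition wcrit (i : nat) : R := (i == 1%N)%:R * zc + lhat D i 0 * zc ^+ i.

Lemma wcrit0 : wcrit 0 = 0.
Proof. by rewrite /wcrit lhat_small// !mul0r addr0. Qed.

Lemma wcrit_time n : n%:R * `|wcrit n| <= (n == 1%N)%:R * zc + n%:R * ltot D n * zc ^+ n.
Proof.
have h : n%:R * `|lhat D n 0 * zc ^+ n| <= n%:R * ltot D n * zc ^+ n.
 by rewrite normrM (ger0_norm (zn0 n)) mulrA ler_wpM2r// ler_wpM2l// lhat_le.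
rewrite /wcrit; have [->|n1] := eqVneq n 1%N; last by rewrite !mul0r !add0r.
by rewrite lhat_small// mul0r addr0 !mul1r ger0_norm ?(ltW zc0)// lerDl !mulr_ge0// ltot_ge0.
Qed.

Let single_summ (c : R) : summ (fun i : nat => (i == 1%N)%:R * c).
Proof. by apply: (@summ_single _ _ _ 1%N) => i /negbTE ->; rewrite mul0r. Qed.

Let single_asum (c : R) : \asum_(i : nat) ((i == 1%N)%:R * c) = c.
Proof. by rewrite (@asum_single _ _ _ 1%N) ?eqxx ?mul1r// => i /negbTE ->; rewrite mul0r. Qed.

Lemma wcrit_time_summ : summ (fun n => n%:R * `|wcrit n|).
Proof.
apply: summ_le (summD (single_summ zc) (proj1 ltot_crit)) => n.
by rewrite ger0_norm ?mulr_ge0// wcrit_time.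
Qed.

Lemma wcrit_summ : summ wcrit.
Proof. by apply: summD; [exact: single_summ|exact: lhat_sum_summ]. Qed.

Lemma wcrit_sum1 : asum setT wcrit = 1.
Proof. by rewrite asumD ?single_asum; [exact: critical_equation|exact: single_summ|exact: lhat_sum_summ]. Qed.

Lemma wcrit_tail : summ (rtail wcrit) /\ \asum_(j : nat) `|rtail wcrit j.+1| <= 1 / 2.
Proof.
have [s _ h] := rtail_sum wcrit_time_summ; split=> //; apply: (le_trans h).
have [sl ll] := ltot_crit; apply: le_trans ll; apply: nneg_asum_le => // n.
case: n => [|[|n]]; rewrite ?mul0r ?mulr_ge0 ?ltot_ge0//.
rewrite subSS subn0; apply: (le_via (n.+2%:R * `|wcrit n.+2|)).
 by rewrite ler_wpM2r// ler_nat.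
by have := wcrit_time n.+2; rewrite mul0r add0r.
Qed.

(** The bracket is the mean of the renewal weights [wcrit], which sum to 1 by [critical_equation];
    the renewal theorem has its inverse as limit. *)
Definition Acrit : R := (zc + \asum_(n : nat) (n%:R * lhat D n 0 * zc ^+ n))^-1.

Lemma AcritE : Acrit = (asum setT (rtail wcrit))^-1.
Proof.
have [_ -> _] := rtail_sum wcrit_time_summ; congr (_^-1).
rewrite -[X in X + _]single_asum -asumD.
- apply: eq_asum => n; rewrite /wcrit mulrDr !mulrA; congr (_ + _).
 by case: (eqVneq n 1%N) => [->|_]; rewrite ?mul1r// mulr0 !mul0r.
- exact: single_summ.
- apply: summ_le (proj1 ltot_crit) => n; rewrite !normrM (ger0_norm (zn0 n)) ger0_norm//.
 by rewrite ler_wpM2r// ler_wpM2l// lhat_le.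
Qed.

Lemma chat_step k m : chat D m.+1 k * zc ^+ m.+1 =
 \sum_(i < m.+2) ((i == 1%N :> nat)%:R * (zc * Dhat D k) + lhat D i k * zc ^+ i) * (chat D (m.+1 - i) k * zc ^+ (m.+1 - i)).
Proof.
rewrite (chat_recursion D_summ D_even D_zero) mulrDl.
under [RHS]eq_bigr do rewrite mulrDl.
rewrite big_split/=; congr (_ + _).
 rewrite 2!big_ord_recl big1 /= => [|i _]; last by rewrite !mul0r.
 by rewrite !mul0r add0r mul1r addr0 /bump /= addn0 subSS subn0 exprS; ring.
rewrite mulr_suml; apply: eq_bigr => i _.
rewrite mulrACA -exprD subnKC//.
by rewrite -ltnS.
Qed.

(** The conserved quantity of the unperturbed equation equals 1, and the later tails have mass at
    most [1 / 2], so strong induction closes with [1 + 2 / 2 = 2]. *)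
Lemma ctot_zcrit_le2 m : ctot D m * zc ^+ m <= 2.
Proof.
have c0 n : chat D n 0 = ctot D n.
 by rewrite /chat /ctot; apply: eq_expect => ys _; rewrite ldot0l cos0 mulr1.
pose x n := ctot D n * zc ^+ n.
have xS n : x n.+1 = \sum_(i < n.+2) (wcrit i - 0) * x (n.+1 - i)%N.
 rewrite /x -!c0 chat_step; apply: eq_bigr => i _.
 by rewrite subr0 c0 /Dhat fh0 D_sum1 mulr1.
have y1 n : \sum_(j < n.+1) rtail wcrit j * x (n - j)%N = 1.
 elim: n => [|n IH].
  by rewrite big_ord1 rtail0 ?wcrit0 ?wcrit_sum1//; [rewrite /x ctot0 expr0 !mulr1|exact: wcrit_summ].
 have := @y_diff R wcrit (fun _ _ => 0) (fun _ => x) wcrit0 wcrit_summ wcrit_sum1 (fun _ => erefl) (fun _ => xS) 0 n.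
 rewrite IH [X in _ = - X]big1 => [|i _]; last by rewrite mul0r.
 by rewrite oppr0 => /eqP; rewrite subr_eq0 => /eqP.
have [st t2] := wcrit_tail.
have st1 : summ (fun j => `|rtail wcrit j.+1|).
 case: st => C HC; exists C => q uq; apply: (le_trans _ (HC (map succn q) _)).
  by rewrite big_map; apply: ler_sum => i _; rewrite normr_id.
 by rewrite map_inj_uniq// => a c [].
rewrite -/(x m); elim/ltn_ind: m => m IH.
have := y1 m; rewrite big_ord_recl rtail0 ?wcrit0 ?wcrit_sum1 ?mul1r ?subn0//; last exact: wcrit_summ.
move=> e; have -> : x m = 1 - \sum_(i < m) rtail wcrit (lift ord0 i) * x (m - lift ord0 i)%N by rewrite -e addrK.
have : `|\sum_(i < m) rtail wcrit (lift ord0 i) * x (m - lift ord0 i)%N| <= 1 / 2 * 2.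
 apply: (le_trans (ler_norm_sum _ _ _)).
 apply: (le_via (\sum_(i < m) `|rtail wcrit i.+1| * 2)).
  apply: ler_sum => i _; rewrite normrM /= /bump /= add1n ler_wpM2l// ger0_norm.
   apply: IH; rewrite ltn_subLR ?ltn_ord// addSn ltnS leq_addl//.
  by rewrite mulr_ge0// ctot_ge0.
 rewrite -mulr_suml ler_wpM2r//; apply: le_trans t2.
 exact: (@nneg_asum_nat_ge _ (fun j => `|rtail wcrit j.+1|)).
by rewrite ler_norml => /andP[]; lra.
Qed.

Let bom1 (c : R) k : bddf (fun x : Zd => c * (1 - cos (ldot k x))).
Proof. by exists (`|c| * 2) => x; rewrite normrM ler_wpM2l// ger0_norm ?onecos_ge0// onecos_le2. Qed.

(** Makes the total perturbation [zc * gap D k + gap (Pigen D zc) k] nonnegative, as the renewal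
    theorem requires. *)
Lemma gap_Pigen_crit k : `|gap (Pigen D zc) k| <= zc * gap D k.
Proof.
have ls := ltot_summ.
have Dg : 0 <= gap D k by exact: gap_ge0.
have sP := Pigen_summ D_ge0 D_summ zc0 ls.
apply: (le_via (\asum_x (`|Pigen D zc x| * (1 - cos (ldot k x))))).
 apply: asum_norm_le => [|x]; first by apply: gap_summ; exact: summ_abs.
 by rewrite normrM (ger0_norm (onecos_ge0 _)).
have bo : bddf (fun x : Zd => 1 - cos (ldot k x)).
 by exists 2 => x; rewrite ger0_norm ?onecos_ge0// onecos_le2.
apply: (le_trans (@Pigen_weight_le R d D D_ge0 D_summ zc zc0 ls _ (zc * (16 * (W * gap D k) * b)) bo (fun x => onecos_ge0 _) _)).
 move=> N; have H := @lweight_crit (fun x : Zd => 1 - cos (ldot k x)) (W * gap D k) N bo (fun x => onecos_ge0 _).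
 apply: (le_trans _ (H _ _ _ _ _)).
 - rewrite [leRHS](bigID (fun n : 'I_N => (1 < n)%N))/= lerDl.
  apply: sumr_ge0 => n _; rewrite mulr_ge0//; apply: expect_ge0 => // ys _; rewrite mulr_ge0// onecos_ge0//.
 - by rewrite ldot0r cos0 subrr.
 - by move=> x; rewrite ldotNr cosN.
 - by move=> x y; rewrite ldotDr onecosD.
 - by rewrite mulr_ge0// ltW.
 - by move=> u x u0 uz; exact: weight_real.
rewrite ler_wpM2l ?(ltW zc0)//.
have : 16 * W * b <= 1 by rewrite /b; move: eta2; have := mulr_ge0 (ltW W_gt0) (ltW eta_gt0); lra.
by move=> h; have := ler_wpM2r Dg h; lra.
Qed.

Section one_point.
Variables (k : nat -> 'rV[R]_d) (Cs s0 : R) (F : Zd -> R).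
Hypotheses (k_gap : forall n, n%:R * gap D (k n) <= Cs)
 (k_cvg : n%:R * gap D (k n) @[n --> \oo] --> s0)
 (k_ptwise : forall x, n%:R * (1 - cos (ldot (k n) x)) @[n --> \oo] --> F x).

Let om n x : R := n%:R * (1 - cos (ldot (k n) x)).
Let om_ge0 n x : 0 <= om n x. Proof. by rewrite mulr_ge0// onecos_ge0. Qed.
(** All weights with [n < K] at once: a maximum of functions with
    [om (x + y) <= 2 * om x + 2 * om y] has the same property, and its product with the two-point
    function is still at most [W * Cs]. The resulting bound [B0] is independent of [K]. *)
Let OM K x : R := maxf (fun n => om n x) K.
Let OM_ge0 K x : 0 <= OM K x. Proof. exact: maxf_ge0. Qed.
Let Cs_ge0 : 0 <= Cs. Proof. by apply: le_trans (k_gap 0); rewrite mul0r. Qed.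

Let OM_bdd K : bddf (OM K).
Proof.
exists (K%:R * 2) => x; rewrite ger0_norm//; apply: maxf_le => [|n nK]; first by rewrite mulr_ge0.
by apply: ler_pM => //; rewrite ?onecos_ge0 ?onecos_le2// ler_nat ltnW.
Qed.

Let om_bdd n : bddf (om n). Proof. exact: bom1. Qed.

Let B0 : R := zc * (16 * (W * Cs) * b).

Let OM_lweight K N : \sum_(n < N) E n (fun ys => `|lacef R n ys| * OM K (pos ys)) * zc ^+ n <= B0.
Proof.
apply: lweight_crit => //.
- by apply/eqP; rewrite eq_le OM_ge0 andbT; apply: maxf_le => // n _; rewrite /om ldot0r cos0 subrr mulr0.
- by move=> x; rewrite /OM; congr (maxf _ K); apply/funext => n; rewrite /om ldotNr cosN.
- move=> x y; apply: maxf_le => [|n nK]; first by rewrite addr_ge0// mulr_ge0.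
 apply: (le_via (2 * om n x + 2 * om n y)).
  rewrite /om ldotDr; have := ler_wpM2l (ler0n R n) (onecosD (ldot (k n) x) (ldot (k n) y)); lra.
 by rewrite lerD// ler_wpM2l// (@maxf_ge _ (fun n => om n _)).
- by rewrite mulr_ge0// ltW.
- move=> u x u0 uz; rewrite /OM; have [->|[n nK ->]] := maxf_cases (fun n => om n x) K.
  by rewrite mul0r mulr_ge0// ltW.
 rewrite /om -mulrA; apply: (le_via (n%:R * (W * gap D (k n)))).
  by rewrite ler_wpM2l// weight_real.
 by rewrite mulrCA ler_wpM2l// ltW.
Qed.

Let e n (i : nat) : R := (i == 1%N)%:R * (zc * gap D (k n)) + (lhat D i 0 - lhat D i (k n)) * zc ^+ i.

Let f n i : R := E i (fun ys => `|lacef R i ys| * om n (pos ys)) * zc ^+ i.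

Let bE i (o : Zd -> R) : bddf o -> bnd (fun ys => `|lacef R i ys| * o (pos ys)).
Proof.
case=> C HC; apply: bndM; first bounded.
by exists C => ys; exact: HC.
Qed.

Let f_dom : exists2 g : nat -> R, summ g & forall n i, f n i <= g i.
Proof.
apply: (@dominated_by_max R nat f B0) => [n i|K s us].
 by rewrite mulr_ge0//; apply: expect_ge0 => // ys _; rewrite mulr_ge0.
pose h i := E i (fun ys => `|lacef R i ys| * OM K (pos ys)) * zc ^+ i.
have h0 i : 0 <= h i by rewrite mulr_ge0//; apply: expect_ge0 => // ys _; rewrite mulr_ge0.
have [sh lh] := nneg_summ_nat h0 (OM_lweight K).
apply: (le_via (\sum_(i <- s) h i)); last by apply: le_trans lh; exact: sum_finite_le_asum.
apply: ler_sum => i _; apply: maxf_le => // n nK; rewrite ler_wpM2r//.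
apply: expect_le => //; try exact: bE.
by move=> ys _; rewrite ler_wpM2l// (@maxf_ge _ (fun n => om n _)).
Qed.

Let e_f n i : n%:R * `|e n i| <= (i == 1%N)%:R * (zc * Cs) + f n i.
Proof.
have Dg : 0 <= gap D (k n) by exact: gap_ge0.
apply: (le_via (n%:R * ((i == 1%N)%:R * (zc * gap D (k n)) + `|lhat D i 0 - lhat D i (k n)| * zc ^+ i))).
 rewrite ler_wpM2l//; apply: (le_trans (ler_normD _ _)).
 rewrite normrM [X in _ + X]normrM (ger0_norm (zn0 i)) lerD2r.
 by rewrite !ger0_norm// mulr_ge0// ltW.
rewrite mulrDr; apply: lerD.
 by rewrite mulrCA ler_wpM2l// mulrCA ler_wpM2l// ltW.
rewrite mulrA ler_wpM2r//.
have bl : bnd (fun ys : seq Zd => lacef R i ys) by exact: lacef_bnd.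
have bc l : bnd (fun ys : seq Zd => lacef R i ys * cos (ldot l (pos ys))).
 bounded.
rewrite /lhat -(expectB D_summ); try exact: bc.
apply: (le_via (n%:R * E i (fun ys => `|lacef R i ys * cos (ldot 0 (pos ys)) - lacef R i ys * cos (ldot (k n) (pos ys))|))).
 by rewrite ler_wpM2l//; apply: expect_norm => //; apply: bndB; exact: bc.
rewrite -(expectZ D_summ); last bounded.
apply: expect_le => //.
- bounded.
- exact: bE.
- move=> ys _; rewrite ldot0l cos0 -mulrBr normrM (ger0_norm (onecos_ge0 _)).
 by rewrite mulrCA.
Qed.

Let sP : summ (Pigen D zc). Proof. exact: (Pigen_summ D_ge0 D_summ zc0 ltot_summ). Qed.

Let e_sum n : summ (e n) /\ asum setT (e n) = zc * gap D (k n) + gap (Pigen D zc) (k n).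
Proof.
have sl : summ (fun i => (lhat D i 0 - lhat D i (k n)) * zc ^+ i).
 apply: eq_summ (summB (lhat_sum_summ 0) (lhat_sum_summ (k n))) => i; by rewrite mulrBl.
split; first by apply: summD => //; exact: single_summ.
apply: (etrans (asumD (single_summ (zc * gap D (k n))) sl)); rewrite single_asum.
rewrite (gapE (k n) sP) !(Pigen_fh D_ge0 D_summ zc0 ltot_summ) -asumB; try exact: lhat_sum_summ.
by congr (_ + _); apply: eq_asum => i; rewrite mulrBl.
Qed.

Let Pi_dom : exists2 g : Zd -> R, summ g & forall n x, `|Pigen D zc x| * om n x <= g x.
Proof.
apply: (@dominated_by_max R Zd (fun n x => `|Pigen D zc x| * om n x) B0) => [n x|K s us].
 by rewrite mulr_ge0.
apply: (le_via (\sum_(x <- s) `|Pigen D zc x| * OM K x)).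
 apply: ler_sum => x _; apply: maxf_le => [|n nK]; first by rewrite mulr_ge0.
 by rewrite ler_wpM2l// (@maxf_ge _ (fun n => om n _)).
have [C HC] := OM_bdd K.
apply: (le_via (\asum_x (`|Pigen D zc x| * OM K x))).
 apply: sum_finite_le_asum => //; first by move=> x; rewrite mulr_ge0.
 by apply: (@summ_bndM _ _ _ _ C) => //; exact: summ_abs.
apply: Pigen_weight_le => //; first exact: ltot_summ.
move=> N; apply: le_trans (OM_lweight K N).
rewrite [leRHS](bigID (fun n : 'I_N => (1 < n)%N))/= lerDl.
by apply: sumr_ge0 => n _; rewrite mulr_ge0//; apply: expect_ge0 => // ys _; rewrite mulr_ge0.
Qed.

(** For [alpha > 2] the limit weight is quadratic, and this is the finiteness of the second moment
    of the laces. It follows from the domination that is uniform in [n]. *)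
Lemma Pigen_limit_summ : summ (fun x => Pigen D zc x * F x).
Proof.
have [gP sgP Pg] := Pi_dom; apply: summ_le sgP => x.
have h : `|Pigen D zc x| * om n x @[n --> \oo] --> `|Pigen D zc x| * F x.
 by apply: cvgM; [exact: cvg_cst|exact: k_ptwise].
have F0 : 0 <= F x.
 by apply: (@cvg_ge0 R (fun n => om n x)); [exact: k_ptwise|].
rewrite normrM (ger0_norm F0); exact: (@cvg_le_bound R _ _ _ h).
Qed.

Let rate_cvg : n%:R * asum setT (e n) @[n --> \oo] --> zc * s0 + \asum_x (Pigen D zc x * F x).
Proof.
rewrite (_ : (fun n => _) = (fun n => zc * (n%:R * gap D (k n)) + \asum_x (Pigen D zc x * om n x))); last first.
 apply/funext => n; have [_ ->] := e_sum n; rewrite mulrDr mulrCA; congr (_ + _).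
 by rewrite /gap -asumZ; [apply: eq_asum => x; rewrite mulrCA|exact: gap_summ].
apply: cvgD; first by apply: cvgM; [exact: cvg_cst|exact: k_cvg].
have [gP sgP Pg] := Pi_dom.
apply: (asum_dominated (g := gP)) => // [n x|x].
 by rewrite normrM (ger0_norm (om_ge0 _ _)).
by apply: cvgM; [exact: cvg_cst|exact: k_ptwise].
Qed.

Lemma rate_ge0 : 0 <= zc * s0 + \asum_x (Pigen D zc x * F x).
Proof.
apply: (@cvg_ge0 R (fun n => n%:R * asum setT (e n))); [exact: rate_cvg|move=> n]; rewrite mulr_ge0//; have [_ ->] := e_sum n.
by have := gap_Pigen_crit (k n); rewrite ler_norml => /andP[]; lra.
Qed.

Theorem one_point : forall ep, 0 < ep -> exists M N, forall n, (N <= n)%N -> forall m, (M <= m <= n)%N ->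
 `|chat D m (k n) * zc ^+ m - Acrit * expR (- (Acrit * (zc * s0 + \asum_x (Pigen D zc x * F x)) * m%:R / n%:R))| <= ep.
Proof.
have [g0 sg0 fg0] := f_dom.
have [st t2] := wcrit_tail.
have Ecvg := rate_cvg.
rewrite AcritE.
apply: (@renewal_limit R wcrit e (fun n m => chat D m (k n) * zc ^+ m) (fun i => (i == 1%N)%:R * (zc * Cs) + g0 i) 2) => //.
- exact: wcrit0.
- exact: wcrit_summ.
- exact: wcrit_sum1.
- by move=> n; rewrite /e !lhat_small// subrr !mul0r addr0.
- by move=> n i; apply: le_trans (e_f n i) _; rewrite lerD2l.
- by apply: summD => //; exact: single_summ.
- move=> n; have [_ ->] := e_sum n; have := gap_Pigen_crit (k n); rewrite ler_norml => /andP[]; lra.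
- by move=> n; rewrite chat0 expr0 mulr1.
- move=> n m; rewrite chat_step; apply: eq_bigr => i _; congr (_ * _).
 rewrite /wcrit /e (gapE (k n) D_summ) fh0 D_sum1 /Dhat; ring.
- move=> n m; rewrite normrM (ger0_norm (zn0 m)); apply: le_trans (ctot_zcrit_le2 m).
 by rewrite ler_wpM2r// chat_le.
Qed.

End one_point.
End critical.

(** * Several times *)

Section boxes.
Variable R : realType.

Lemma box_cut (F : nat -> nat -> R) J p q : (J <= p)%N -> (J <= q)%N ->
 \sum_(a < p) \sum_(b < q) (if (a < J)%N && (b < J)%N then F a b else 0) =
 \sum_(a < J) \sum_(b < J) F a b.
Proof.
move=> Jp Jq; rewrite [RHS](big_ord_widen p (fun a => \sum_(b < J) F a b) Jp) [RHS]big_mkcond/=.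
apply: eq_bigr => a _; case: (a < J)%N => /=; last by rewrite big1.
by rewrite [RHS](big_ord_widen q (fun b => F a b) Jq) [RHS]big_mkcond.
Qed.

Lemma box_diff (F G : nat -> nat -> R) J p q : (J <= p)%N -> (J <= q)%N ->
 (forall a b, (a < p)%N -> (b < q)%N -> `|F a b| <= G a b) ->
 `|\sum_(a < p) \sum_(b < q) F a b - \sum_(a < J) \sum_(b < J) F a b| <=
 \sum_(a < p) \sum_(b < q) G a b - \sum_(a < J) \sum_(b < J) G a b.
Proof.
move=> Jp Jq FG; rewrite -!(box_cut _ Jp Jq) -!sumrB.
apply: (le_trans (ler_norm_sum _ _ _)); apply: ler_sum => a _.
rewrite -!sumrB; apply: (le_trans (ler_norm_sum _ _ _)); apply: ler_sum => b _.
by case: ifP => _; rewrite ?subrr ?normr0// !subr0 FG.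
Qed.

Lemma box_flat (f : nat * nat -> R) p q :
 \sum_(a < p) \sum_(b < q) f (a : nat, b : nat) =
 \sum_(c <- [seq (a, b) | a <- index_iota 0 p, b <- index_iota 0 q]) f c.
Proof.
rewrite big_allpairs -(big_mkord xpredT (fun a => \sum_(b < q) f (a, b : nat))).
by apply: eq_bigr => a _; rewrite big_mkord.
Qed.

Lemma box_le_asum (G : nat * nat -> R) p q : (forall c, 0 <= G c) -> summ G ->
 \sum_(a < p) \sum_(b < q) G (a : nat, b : nat) <= asum setT G.
Proof.
move=> G0 sG.
rewrite box_flat.
apply: sum_finite_le_asum => //.
by apply: allpairs_uniq => [||[a b] [a' b'] _ _ [-> ->]]//; exact: iota_uniq.
Qed.

Lemma box_asum (G : nat * nat -> R) e : (forall c, 0 <= G c) -> summ G -> 0 < e ->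
 exists J, asum setT G - e <= \sum_(a < J) \sum_(b < J) G (a : nat, b : nat).
Proof.
move=> G0 sG e0; have [s us Hs] := asum_tail_le sG e0.
pose J := (\max_(c <- s) (maxn c.1 c.2)).+1; exists J.
have := Hs G (fun c => lexx _); rewrite ler_norml => /andP[_ h].
apply: (le_via (\sum_(c <- s) G c)); first by rewrite lerBlDr -lerBlDl.
rewrite box_flat.
apply: ler_sum_subseq => //.
 by apply: allpairs_uniq => [||[a b] [a' b'] _ _ [-> ->]]//; exact: iota_uniq.
move=> [a b] cs; apply/allpairsPdep; exists a, b.
have hm : (maxn a b < J)%N.
 by rewrite ltnS; apply: (@leq_bigmax_seq _ s xpredT (fun c : nat * nat => maxn c.1 c.2) (a, b)).
split=> //; rewrite mem_index_iota/=; apply: leq_ltn_trans hm; [exact: leq_maxl|exact: leq_maxr].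
Qed.

Lemma box_asum_diff (F G : nat * nat -> R) J : summ G -> (forall c, `|F c| <= G c) ->
 `|asum setT F - \sum_(a < J) \sum_(b < J) F (a : nat, b : nat)| <=
 asum setT G - \sum_(a < J) \sum_(b < J) G (a : nat, b : nat).
Proof.
move=> sG FG; have sF : summ F by exact: summ_le sG.
have cut (f : nat * nat -> R) : summ f -> summ (fun c => if (c.1 < J)%N && (c.2 < J)%N then f c else 0) /\
  \asum_(c : nat * nat) (if (c.1 < J)%N && (c.2 < J)%N then f c else 0) = \sum_(a < J) \sum_(b < J) f (a : nat, b : nat).
 move=> sf; split.
  apply: summ_le (summ_abs sf) => c; case: ifP => _ //; by rewrite normr0.
 rewrite box_flat.
 rewrite (@asum_seq _ _ _ [seq (a, b) | a <- index_iota 0 J, b <- index_iota 0 J]).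
 - rewrite big_seq [RHS]big_seq; apply: eq_bigr => c /allpairsPdep[a [b []]].
  by rewrite !mem_index_iota/= => ha hb ->; rewrite /= ha hb.
 - by apply: allpairs_uniq => [||[a b] [a' b'] _ _ [-> ->]]//; exact: iota_uniq.
 - move=> [a b] /= h; case: ifP => // /andP[ha hb]; case/negP: h.
  by apply/allpairsPdep; exists a, b; rewrite !mem_index_iota.
have [cF eF] := cut F sF; have [cG eG] := cut G sG.
rewrite -eF -eG -!asumB//; apply: asum_norm_le => [|c]; first exact: summB.
by case: ifP => _; rewrite ?subrr ?normr0// !subr0.
Qed.

Lemma eventually_all (P : nat -> nat -> Prop) J : (forall a, exists N, forall n, (N <= n)%N -> P a n) ->
 exists N, forall n, (N <= n)%N -> forall a, (a < J)%N -> P a n.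
Proof.
move=> H; elim: J => [|J [N IH]]; first by exists 0%N.
have [N' HN'] := H J; exists (maxn N N') => n; rewrite geq_max => /andP[h h'] a.
by rewrite ltnS leq_eqVlt => /orP[/eqP->|]; [exact: HN'|exact: IH].
Qed.

Lemma prod3_diff (x1 x2 x3 y1 y2 y3 e : R) : `|x1| <= 2 -> `|x2| <= 2 -> `|y2| <= 2 -> `|y3| <= 2 -> `|x3| <= 2 ->
 `|x1 - y1| <= e -> `|x2 - y2| <= e -> `|x3 - y3| <= e ->
 `|x1 * x2 * x3 - y1 * y2 * y3| <= 12 * e.
Proof.
move=> a1 a2 b2 b3 a3 d1 d2 d3.
have -> : x1 * x2 * x3 - y1 * y2 * y3 = x1 * x2 * (x3 - y3) + x1 * (x2 - y2) * y3 + (x1 - y1) * y2 * y3 by ring.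
have e0 : 0 <= e by apply: le_trans d1.
have h (u v w : R) a b c : `|u| <= a -> `|v| <= b -> `|w| <= c -> `|u * v * w| <= a * b * c.
 by move=> hu hv hw; rewrite !normrM ler_pM ?mulr_ge0// ler_pM.
have h1 := h _ _ _ _ _ _ a1 a2 d3; have h2 := h _ _ _ _ _ _ a1 d2 b3; have h3 := h _ _ _ _ _ _ d1 b2 b3.
apply: (le_trans (ler_normD _ _)); have := ler_normD (x1 * x2 * (x3 - y3)) (x1 * (x2 - y2) * y3).
by move: h1 h2 h3; lra.
Qed.

End boxes.

Section multi_time.
Variables (R : realType) (d : nat) (D : 'rV[int]_d -> R).
Local Notation Zd := 'rV[int]_d.
Local Notation E := (expect D).
Hypotheses (D_ge0 : forall x, 0 <= D x)
 (D_summ : summ D)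
 (D_sum1 : asum setT D = 1)
 (D_even : forall x, D (- x) = D x)
 (D_zero : D 0 = 0).
Implicit Types (l : seq (nat * 'rV[R]_d)) (ys : seq Zd).

Definition tmax l : nat := sumn (unzip1 l).
(** Frequencies are attached to consecutive blocks of steps; a list of block lengths with
    frequencies suits induction on the number of times. *)
Fixpoint phase l ys : R := if l is (g, k) :: l' then ldot k (pos (take g ys)) + phase l' (drop g ys) else 0.
Definition multi l : R := E (tmax l) (fun ys => sawf R (tmax l) ys * cos (phase l ys)).
(** The weight of a lace bond straddling a time point, where the frequency changes from [k] to
    [k']. *)
Definition pairhat a b k k' : R :=
 E (a + b) (fun ys => lacef R (a + b) ys * cos (ldot k (pos (take a ys)) + ldot k' (pos (drop a ys)))).

Let bs m : bnd (sawf R m : seq Zd -> R). Proof. exact: sawf_bnd. Qed.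
Let bl m : bnd (lacef R m : seq Zd -> R). Proof. exact: lacef_bnd. Qed.
Let ss m : sym (sawf R m : seq Zd -> R). Proof. by move=> ys; rewrite sawf_opp. Qed.
Let sl m : sym (lacef R m : seq Zd -> R). Proof. by move=> ys; rewrite lacef_opp. Qed.

Lemma phase_antisym l : antisym (phase l).
Proof.
elim: l => [|[g k] l IH] ys /=; first by rewrite oppr0.
by rewrite -map_take -map_drop IH pos_opp ldotNr opprD.
Qed.

Lemma multi_le l : `|multi l| <= ctot D (tmax l).
Proof.
have bp : bnd (fun ys => sawf R (tmax l) ys * cos (phase l ys)) by bounded.
apply: (le_trans (expect_norm D_ge0 D_summ _ bp)); apply: expect_le => //.
- exact: bnd_abs.
- by move=> ys _; rewrite normrM ger0_norm// ler_piMr ?cos_max.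
Qed.

Lemma pairhat_le a b k k' : `|pairhat a b k k'| <= ltot D (a + b).
Proof.
have bp : bnd (fun ys => lacef R (a + b) ys * cos (ldot k (pos (take a ys)) + ldot k' (pos (drop a ys)))) by bounded.
apply: (le_trans (expect_norm D_ge0 D_summ _ bp)); apply: expect_le => //.
- exact: bnd_abs.
- exact: bnd_abs.
- by move=> ys _; rewrite normrM ler_piMr ?cos_max.
Qed.

Lemma multi1 g k : multi [:: (g, k)] = chat D g k.
Proof.
rewrite /multi /tmax /= addn0; apply: eq_expect => ys sys.
by rewrite addr0 take_oversize ?sys.
Qed.

Definition bond_term l i j : R := E (tmax l) (fun ys =>
 sawf R i (take i ys) * (lacef R (j - i) (take (j - i) (drop i ys)) * sawf R (tmax l - j) (drop j ys)) * cos (phase l ys)).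

Let bond_bnd l i j : bnd (fun ys =>
 sawf R i (take i ys) * (lacef R (j - i) (take (j - i) (drop i ys)) * sawf R (tmax l - j) (drop j ys)) * cos (phase l ys)).
Proof.
apply: bndM; last exact: bnd_cos.
apply: bndM; first exact: (bnd_comp (take i) (bs i)).
apply: bndM; last exact: (bnd_comp (drop j) (bs _)).
exact: (bnd_comp (fun ys => take (j - i) (drop i ys)) (bl _)).
Qed.

(** This is [saw_on_split] at the first time [p]. Without a straddling bond the two parts are
    independent, and their phases factorise by symmetry. *)
Lemma multi_cons p k l : multi ((p, k) :: l) = chat D p k * multi l +
 \sum_(i < p) \sum_(j < (p + tmax l).+1 | (p < j)%N) bond_term ((p, k) :: l) i j.
Proof.
set l0 := (p, k) :: l; set T := tmax l0.
have TE : T = (p + tmax l)%N by [].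
have b1 : bnd (fun ys => sawf R p (take p ys) * sawf R (T - p) (drop p ys) * cos (phase l0 ys)).
 apply: bndM; last exact: bnd_cos.
 bounded.
transitivity (E T (fun ys => sawf R p (take p ys) * sawf R (T - p) (drop p ys) * cos (phase l0 ys) +
 \sum_(i < p) \sum_(j < T.+1 | (p < j)%N)
  (sawf R i (take i ys) * (lacef R (j - i) (take (j - i) (drop i ys)) * sawf R (T - j) (drop j ys)) * cos (phase l0 ys)))).
 apply: eq_expect_moving => // ys sys mv.
 have mw := walk_moving mv; rewrite sys in mw.
 have pT : (p <= T)%N by rewrite TE leq_addr.
 rewrite [sawf R T ys](saw_on_split R (ltnSn T) (leq0n p) pT mw) mulrDl; congr (_ + _).
  by rewrite sawf_take// sawf_drop subnKC.
 rewrite mulr_suml; apply: eq_bigr => i _; have ip := ltn_ord i.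
 rewrite mulr_suml; apply: eq_bigr => j pj; have jT := ltn_ord j; congr (_ * _).
 have ij : (i <= j)%N by apply: ltnW; exact: ltn_trans pj.
 rewrite -mulrA sawf_take// lacef_take// sawf_drop lacef_drop !subnKC//.
 by rewrite /bond gtn_eqF ?add0r//; exact: leq_ltn_trans pj.
rewrite (expectD D_summ)//; last by apply: bnd_sum => i; apply: bnd_sum => j; exact: bond_bnd.
congr (_ + _).
 rewrite (_ : T - p = tmax l)%N; last by rewrite TE addKn.
 rewrite (@expect_cos_prod _ _ _ D_summ D_even p T (sawf R p) (sawf R (tmax l)) (fun ys => ldot k (pos ys)) (phase l))//.
 - by rewrite TE addKn.
 - by rewrite TE leq_addr.
 - by move=> ys; rewrite pos_opp ldotNr.
 - exact: phase_antisym.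
rewrite (expect_sum D_summ); last by move=> i; apply: bnd_sum => j; exact: bond_bnd.
by apply: eq_bigr => i _; rewrite (expect_sum D_summ)// => j; exact: bond_bnd.
Qed.

Lemma bond_term_le l i j : (i <= j)%N -> (j <= tmax l)%N ->
 `|bond_term l i j| <= ctot D i * ltot D (j - i) * ctot D (tmax l - j).
Proof.
move=> ij jT; set T := tmax l.
apply: (le_trans (expect_norm D_ge0 D_summ _ (bond_bnd l i j))).
have b3 : bnd (fun zs : seq Zd => `|lacef R (j - i) (take (j - i) zs)| * sawf R (T - j) (drop (j - i) zs)).
 bounded.
apply: (le_via (E T (fun ys => sawf R i (take i ys) *
  (fun zs => `|lacef R (j - i) (take (j - i) zs)| * sawf R (T - j) (drop (j - i) zs)) (drop i ys)))).
 apply: expect_le => //.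
 - bounded.
 - by apply: bndM; [exact: (bnd_comp (take i) (bs i))|exact: (bnd_comp (drop i) b3)].
 - move=> ys _; rewrite drop_drop subnK// !normrM !(ger0_norm (sawf_ge0 _ _ _)) ler_piMr ?cos_max//.
  by rewrite !mulr_ge0.
rewrite (@expect_prod_at _ _ _ D_summ i T (sawf R i) (fun zs => `|lacef R (j - i) (take (j - i) zs)| * sawf R (T - j) (drop (j - i) zs)) (leq_trans ij jT) (bs i) b3).
rewrite (@expect_prod_at _ _ _ D_summ (j - i) (T - i) (fun zs => `|lacef R (j - i) zs|) (sawf R (T - j)))//; last 2 first.
- by rewrite leq_sub2r.
- exact: bnd_abs.
by rewrite (_ : T - i - (j - i) = T - j)%N ?mulrA//; lia.
Qed.

(** A bond that ends inside the second block leaves that block shortened, so the last factor is a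
    [multi] with one block less. *)
Lemma bond_termE p k g k' l i j : (i <= p)%N -> (p <= j)%N -> (j <= p + g)%N ->
 bond_term ((p, k) :: (g, k') :: l) i j =
 chat D i k * pairhat (p - i) (j - p) k k' * multi ((g - (j - p), k')%N :: l).
Proof.
move=> ip pj jg; rewrite /bond_term; set T := tmax _.
have TE : T = (p + (g + tmax l))%N by [].
have ij : (i <= j)%N by exact: leq_trans pj.
have jT : (j <= T)%N by rewrite TE addnA (leq_trans jg)// leq_addr.
pose l2 := ((g - (j - p))%N, k') :: l; rewrite -/l2.
have l2E : tmax l2 = (T - j)%N.
 by rewrite TE -[tmax l2]/(g - (j - p) + tmax l)%N; move: (tmax l) pj jg => q; clear; lia.
pose th2 (zs : seq Zd) := ldot k (pos (take (p - i) zs)) + ldot k' (pos (drop (p - i) zs)).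
have a2 : antisym th2 by move=> zs; rewrite /th2 -map_take -map_drop !pos_opp !ldotNr opprD.
have a1 kk : antisym (fun ys => ldot kk (pos ys)) by move=> ys; rewrite pos_opp ldotNr.
pose psi (zs : seq Zd) := lacef R (j - i) (take (j - i) zs) * sawf R (T - j) (drop (j - i) zs).
pose th (zs : seq Zd) := th2 (take (j - i) zs) + phase l2 (drop (j - i) zs).
have bpsi : bnd psi by apply: bndM; [exact: (bnd_comp (take _) (bl _))|exact: (bnd_comp (drop _) (bs _))].
have spsi : sym psi by move=> zs; rewrite /psi -map_take -map_drop lacef_opp sawf_opp.
have ath : antisym th.
 by move=> zs; rewrite /th -map_take -map_drop a2 (phase_antisym l2) [RHS]opprD.
transitivity (E T (fun ys => sawf R i (take i ys) * psi (drop i ys) * cos (ldot k (pos (take i ys)) + th (drop i ys)))).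
 apply: eq_expect => ys sys; rewrite /psi drop_drop subnK//; congr (_ * cos _).
 rewrite /th /th2 /= [drop (j - i) (drop i ys)]drop_drop subnK//.
 rewrite -[take (p - i) (take _ _)](_ : take (p - i) (drop i ys) = _); last first.
  by rewrite take_takel// leq_sub2r.
 have -> : take p ys = take i ys ++ take (p - i) (drop i ys).
  by rewrite -{1}(subnKC ip) takeD.
 have -> : drop (p - i) (take (j - i) (drop i ys)) = take (j - p) (drop p ys).
  have -> : drop p ys = drop (p - i) (drop i ys) by rewrite drop_drop subnK.
  rewrite [RHS]take_drop (_ : j - p + (p - i) = j - i)%N//.
  by move: ip pj; clear; lia.
 have -> : take g (drop p ys) = take (j - p) (drop p ys) ++ take (g - (j - p)) (drop j ys).
  rewrite -{1}(_ : (j - p + (g - (j - p)))%N = g); last by lia.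
  by rewrite takeD drop_drop subnK.
 rewrite !drop_drop (_ : g - (j - p) + j = g + p)%N; last by lia.
 by rewrite !pos_cat !ldotDr; ring.
rewrite (@expect_cos_prod _ _ _ D_summ D_even i T (sawf R i) psi (fun ys => ldot k (pos ys)) th)//; last exact: leq_trans jT.
rewrite -mulrA; congr (_ * _).
rewrite /psi /th (@expect_cos_prod _ _ _ D_summ D_even (j - i) (T - i) (lacef R (j - i)) (sawf R (T - j)) th2 (phase l2))//; last 2 first.
- by rewrite leq_sub2r.
- exact: phase_antisym.
congr (_ * _).
 by rewrite /pairhat (_ : (p - i + (j - p))%N = (j - i)%N)//; lia.
by rewrite /multi l2E (_ : T - i - (j - i) = T - j)%N//; lia.
Qed.

Lemma pairhat_cvg a b (k k' : nat -> 'rV[R]_d) :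
 (forall x, ldot (k n) x @[n --> \oo] --> (0 : R)) -> (forall x, ldot (k' n) x @[n --> \oo] --> (0 : R)) ->
 pairhat a b (k n) (k' n) @[n --> \oo] --> lhat D (a + b) 0.
Proof.
move=> k0 k'0; have [C HC] := bl (a + b); rewrite /pairhat /lhat /expect.
apply: (asum_dominated (g := fun ys : (a + b).-tuple Zd => step_weight D ys * C)).
- by apply: summZr; exact: step_weight_summ.
- move=> n ys; rewrite normrM ger0_norm ?step_weight_ge0// ler_wpM2l ?step_weight_ge0//.
 by rewrite normrM; apply: le_trans (HC ys); rewrite ler_piMr ?cos_max.
- move=> ys; apply: cvgM; first exact: cvg_cst.
 apply: cvgM; first exact: cvg_cst.
 rewrite ldot0l -[X in cos X](addr0 0).
 have h : ldot (k n) (pos (take a ys)) + ldot (k' n) (pos (drop a ys)) @[n --> \oo] --> (0 + 0 : R).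
  by apply: cvgD; [exact: k0|exact: k'0].
 exact: (cvg_comp _ _ h (@continuous_cos R _)).
Qed.

(** Bonds are reindexed by their reach [a.+1] and [b.+1] to either side of the time point; for fixed
    reach their weights converge. *)
Lemma multi_cons_shift p k l : multi ((p, k) :: l) = chat D p k * multi l +
 \sum_(a < p) \sum_(b < tmax l) bond_term ((p, k) :: l) (p - a.+1) (p + b.+1).
Proof.
rewrite multi_cons; congr (_ + _).
rewrite (reindex_inj rev_ord_inj); apply: eq_bigr => a _ /=.
rewrite -addSn big_mkcond big_split_ord/= big1 ?add0r => [|j _].
 by apply: eq_bigr => b _; rewrite ltn_addr// addSnnS.
by rewrite ltnNge -ltnS ltn_ord.
Qed.

Section limit.
Variables z A : R.
Hypotheses (z_gt0 : 0 < z) (A_ge0 : 0 <= A) (A_le2 : A <= 2)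
 (ctot_le2 : forall m, ctot D m * z ^+ m <= 2)
 (ltot_time : summ (fun m => m%:R * ltot D m * z ^+ m))
 (ltot_time_le : \asum_(m : nat) (m%:R * ltot D m * z ^+ m) <= 1 / 2)
 (crit_eq : z + \asum_(m : nat) (lhat D m 0 * z ^+ m) = 1)
 (A_eq : A = (z + \asum_(m : nat) (m%:R * lhat D m 0 * z ^+ m))^-1).

Let zn0 n : 0 <= z ^+ n. Proof. by rewrite exprn_ge0// ltW. Qed.
Let lam m := ltot D m * z ^+ m.
Let pib m := lhat D m 0 * z ^+ m.
Let ltot_ge0' m : 0 <= ltot D m. Proof. by apply: expect_ge0 => // ys _. Qed.
Let lam_ge0 m : 0 <= lam m. Proof. by rewrite mulr_ge0. Qed.
Let pib_lam m : `|pib m| <= lam m.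
Proof. by rewrite normrM (ger0_norm (zn0 m)) ler_wpM2r// lhat_le. Qed.
Let lam_time : summ (fun m => m%:R * `|lam m|).
Proof. by apply: eq_summ ltot_time => m; rewrite ger0_norm// mulrA. Qed.
Let pib_time : summ (fun m => m%:R * `|pib m|).
Proof. by apply: summ_le lam_time => m; rewrite ger0_norm ?mulr_ge0// ler_wpM2l// (ger0_norm (lam_ge0 m)). Qed.
Let lam0 : lam 0 = 0. Proof. by rewrite /lam ltot_small// mul0r. Qed.
Let lam_le m : lam m <= 2.
Proof.
apply: (le_via (1 / 2)); last by lra.
apply: le_trans ltot_time_le; apply: (le_trans (y := m%:R * ltot D m * z ^+ m)); last first.
 by apply: (@asum_ge_term _ _ (fun m : nat => m%:R * ltot D m * z ^+ m)) => // n; rewrite !mulr_ge0.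
case: m => [|m]; first by rewrite lam0 !mul0r.
by rewrite -mulrA -/(lam m.+1) ler_peMl// ler1n.
Qed.

(** A bond of length [m] can straddle a given time point in [m - 1] ways. *)
Lemma pair_shift (w : nat -> R) : summ (fun m => m%:R * `|w m|) ->
 summ (fun c : nat * nat => w (c.1 + c.2).+2) /\
 \asum_(c : nat * nat) w (c.1 + c.2).+2 = \asum_(i : nat) ((i - 1)%:R * w i).
Proof.
move=> sw.
have sh (v : nat -> R) j : \asum_(i : nat) (if (j + 1 < i)%N then v i else 0) = \asum_(i : nat) v (i + j).+2.
 rewrite -(asum_nat_shift (fun i => v (i + j).+2) j.+2); apply: eq_asum => i.
 by rewrite addn1; case: ifP => // h; congr v; lia.
have ssh (v : nat -> R) j : summ (fun m => m%:R * `|v m|) -> summ (fun i => v (i + j).+2).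
 move=> [C HC]; exists C => q uq.
 apply: (le_trans _ (HC (map (fun i => (i + j).+2) q) _)); last first.
  by rewrite map_inj_uniq// => a b []; exact: addIn.
 rewrite big_map; apply: ler_sum => i _.
 by rewrite normrM normr_id ger0_norm// ler_peMl// ler1n.
have sa : summ (fun m => m%:R * `| `|w m| |) by apply: eq_summ sw => m; rewrite normr_id.
have sp : summ (fun c : nat * nat => w (c.2 + c.1).+2).
 apply: summ_of_abs.
 apply: (@nneg_summ_pair _ _ _ (fun b a : nat => `|w (a + b).+2|)) => [//|b|].
  by apply: summ_abs; exact: ssh.
 have [s1 _] := tail_pair 1 sa.
 have := summ_pair_sum (@summ_swap R nat nat (fun i j : nat => if (j + 1 < i)%N then `|w i| else 0) s1).
 by apply: eq_summ => b; rewrite /= (sh (fun i => `|w i|)).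
have [s1 r1] := tail_pair 1 sw.
split.
 by apply: eq_summ sp => c; rewrite addnC.
rewrite (eq_asum_to (fun c : nat * nat => w (c.2 + c.1).+2)); last by move=> c; rewrite addnC.
rewrite (asum_pair sp) /=.
rewrite (eq_asum_to (fun b : nat => \asum_(i : nat) (if (b + 1 < i)%N then w i else 0))); last by move=> b; rewrite sh.
rewrite -(@asum_swap R nat nat (fun i j : nat => if (j + 1 < i)%N then w i else 0) s1).
by apply: eq_asum => i; rewrite r1.
Qed.

Let pib2 c : R := pib (c.1 + c.2).+2.
Let lam2 c : R := lam (c.1 + c.2).+2.
Let lam2_summ : summ (fun c : nat * nat => lam2 c). Proof. exact: (proj1 (pair_shift lam_time)). Qed.

(** By the critical equation [1 + sum (m - 1) pi_m] equals [z + sum m pi_m], the inverse of [A];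
    here [pi_m] contains the factor [z ^ m]. *)
Lemma pib2_sum : A * (1 + asum setT pib2) = 1.
Proof.
have [_ e] := pair_shift pib_time.
have s1 : summ (fun m => m%:R * pib m) by apply: summ_of_abs; apply: eq_summ pib_time => m; rewrite [RHS]normrM (ger0_norm (ler0n R m)).
have s2 : summ pib.
 apply: summ_le lam_time => m; rewrite (ger0_norm (lam_ge0 m)); apply: (le_trans (pib_lam m)).
 by case: m => [|m]; [rewrite lam0 mulr0|rewrite ler_peMl// ler1n].
have e1 : 1 + asum setT pib2 = z + \asum_(m : nat) (m%:R * lhat D m 0 * z ^+ m).
 rewrite /pib2 e -{1}crit_eq -addrA; congr (_ + _).
 rewrite -asumD//; last first.
  apply: summ_le pib_time => m; rewrite normrM ger0_norm// ler_wpM2r// ler_nat leq_subr//.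
 apply: eq_asum => -[|m]; first by rewrite lhat_small// !mul0r addr0.
 by rewrite subSS subn0 -natr1 /pib; ring.
rewrite A_eq -e1 mulVf//.
have : A * (1 + asum setT pib2) != 0 \/ 1 + asum setT pib2 != 0.
 right.
 have : `|asum setT pib2| <= 1 / 2.
  rewrite /pib2 e; apply: le_trans ltot_time_le; apply: asum_norm_le => // m.
  rewrite normrM ger0_norm// -mulrA; apply: ler_pM => //; first by rewrite ler_nat leq_subr.
 by rewrite ler_norml => /andP[h1 h2]; rewrite gt_eqF//; lra.
case=> // h; apply: contra_neq h => ->; by rewrite mulr0.
Qed.

Definition norm_multi l : R := multi l * z ^+ tmax l.
Local Notation Q := norm_multi.
Let pc m k : R := chat D m k * z ^+ m.

Let pc_le m k : `|pc m k| <= 2.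
Proof.
rewrite normrM (ger0_norm (zn0 m)); apply: le_trans (ctot_le2 m).
by rewrite ler_wpM2r// chat_le.
Qed.

Let Q_le l : `|Q l| <= 2.
Proof.
rewrite normrM (ger0_norm (zn0 _)); apply: le_trans (ctot_le2 (tmax l)).
by rewrite ler_wpM2r// multi_le.
Qed.

Let Y p k l a b : R := bond_term ((p, k) :: l) (p - a.+1) (p + b.+1) * z ^+ (p + tmax l).

Let Y_le p k l a b : (a < p)%N -> (b < tmax l)%N -> `|Y p k l a b| <= 4 * lam2 (a, b).
Proof.
move=> ap bT; rewrite /Y normrM (ger0_norm (zn0 _)).
have h := @bond_term_le ((p, k) :: l) (p - a.+1) (p + b.+1).
have i1 : (p - a.+1 <= p + b.+1)%N by lia.
have i2 : (p + b.+1 <= tmax ((p, k) :: l))%N by rewrite /tmax /= -/(tmax l) leq_add2l.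
apply: (le_trans (ler_wpM2r (zn0 _) (h i1 i2))).
have -> : (p + b.+1 - (p - a.+1) = (a + b).+2)%N by lia.
have -> : (tmax ((p, k) :: l) - (p + b.+1) = tmax l - b.+1)%N by rewrite /tmax /= -/(tmax l) subnDl.
have -> : (p + tmax l = (p - a.+1) + (a + b).+2 + (tmax l - b.+1))%N by lia.
rewrite !exprD.
have -> : ctot D (p - a.+1) * ltot D (a + b).+2 * ctot D (tmax l - b.+1) *
 (z ^+ (p - a.+1) * z ^+ (a + b).+2 * z ^+ (tmax l - b.+1)) =
 (ctot D (p - a.+1) * z ^+ (p - a.+1)) * (ctot D (tmax l - b.+1) * z ^+ (tmax l - b.+1)) * lam2 (a, b).
 by rewrite /lam2 /lam /=; ring.
rewrite ler_wpM2r ?lam_ge0//.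
have p1 m : 0 <= ctot D m * z ^+ m by rewrite mulr_ge0// ctot_ge0.
by have := ler_pM (p1 _) (p1 _) (ctot_le2 (p - a.+1)) (ctot_le2 (tmax l - b.+1)); lra.
Qed.

Let YE p k g k' l a b : (a < p)%N -> (b < g)%N -> Y p k ((g, k') :: l) a b =
 pc (p - a.+1) k * (pairhat a.+1 b.+1 k k' * z ^+ (a + b).+2) * Q ((g - b.+1, k')%N :: l).
Proof.
move=> ap bg; rewrite /Y bond_termE; [|lia|lia|lia].
have -> : (p - (p - a.+1) = a.+1)%N by lia.
have -> : (p + b.+1 - p = b.+1)%N by lia.
have -> : (p + tmax ((g, k') :: l) = (p - a.+1) + (a + b).+2 + tmax ((g - b.+1, k')%N :: l))%N.
 by rewrite /tmax /=; lia.
rewrite /pc /norm_multi; move: (tmax _) (multi _) (pairhat _ _ _ _) (chat _ _ _) (a + b).+2 => e1 e2 e3 e4 e5.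
by rewrite 2!exprD; ring.
Qed.

Fixpoint wsum (ths : seq R) (gs : seq nat) : R :=
 if ths is th :: ths' then if gs is g :: gs' then th * g%:R + wsum ths' gs' else 0 else 0.

Lemma wsum_ge0 ths gs : all (fun t => 0 <= t) ths -> 0 <= wsum ths gs.
Proof.
elim: ths gs => [|th ths IH] [|g gs] //= /andP[h1 h2].
by rewrite addr_ge0 ?IH// mulr_ge0.
Qed.

(** Uniform over all block lengths that are at least [M] and have total at most [n]; this later
    absorbs every admissible choice of [g]. *)
Definition conv_to (ks : seq (nat -> 'rV[R]_d)) (ths : seq R) : Prop :=
 forall ep, 0 < ep -> exists M N, forall n, (N <= n)%N -> forall gs, size gs = size ks ->
  all (leq M) gs -> (sumn gs <= n)%N ->
  `|Q (zip gs [seq k n | k <- ks]) - A * expR (- (wsum ths gs / n%:R))| <= ep.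

Lemma expN_lip (s t : R) : 0 <= s -> s <= t -> `|expR (- s) - expR (- t)| <= t - s.
Proof.
move=> s0 st; rewrite ger0_norm ?subr_ge0 ?ler_expR ?lerN2//.
have -> : expR (- t) = expR (- s) * expR (- (t - s)) by rewrite -expRD; congr expR; ring.
rewrite -[X in X - _]mulr1 -mulrBr.
have e1 : expR (- s) <= 1 by rewrite -expR0 ler_expR oppr_le0.
have h : 1 - expR (- (t - s)) <= t - s.
 by have := expR_ge1Dx (- (t - s)); lra.
have h0 : 0 <= 1 - expR (- (t - s)) by rewrite subr_ge0 -[leRHS]expR0 ler_expR oppr_le0 subr_ge0.
by apply: le_trans h; rewrite ler_piMl.
Qed.

Lemma expN01 (s : R) : 0 <= s -> 0 <= A * expR (- s) <= 2.
Proof.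
move=> s0; have e1 : expR (- s) <= 1 by rewrite -expR0 ler_expR oppr_le0.
have e0 := expR_ge0 (- s); rewrite mulr_ge0//=.
by have := ler_pM A_ge0 e0 A_le2 e1; lra.
Qed.

Lemma total_zip gs (ks : seq 'rV[R]_d) : size gs = size ks -> tmax (zip gs ks) = sumn gs.
Proof. by move=> h; rewrite /tmax unzip1_zip// h. Qed.

(** Bonds reaching beyond [J] contribute little by summability. Inside the box all three factors
    converge, and shortening a block by at most [J] steps changes its limit by a multiple of
    [J / n]. The main terms add up to [A * v1 * (A * v2) * (1 + asum setT pib2)], which is
    [A * (v1 * v2)] by [pib2_sum]. *)
Lemma conv_to_cons k1 k2 ks th1 th2 ths :
 (forall x, ldot (k1 n) x @[n --> \oo] --> (0 : R)) -> (forall x, ldot (k2 n) x @[n --> \oo] --> (0 : R)) ->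
 0 <= th1 -> 0 <= th2 -> all (fun t => 0 <= t) ths ->
 conv_to [:: k1] [:: th1] -> conv_to (k2 :: ks) (th2 :: ths) ->
 conv_to (k1 :: k2 :: ks) (th1 :: th2 :: ths).
Proof.
move=> k10 k20 t1 t2 ts H1 H2 ep ep0.
have d10 : 0 < ep / 16 by rewrite divr_gt0.
have lam20 c : 0 <= lam2 c by exact: lam_ge0.
have [J HJ] := box_asum lam20 lam2_summ d10.
(* There are [1 + J ^ 2] products, each with error [12 * de], so with this constant they cost
   [ep / 2]; the tails cost [4 * (ep / 16)] twice. *)
pose c0 : R := 24 * (1 + J%:R * J%:R).
have c00 : 0 < c0 by rewrite mulr_gt0// ltr_wpDr// mulr_ge0.
pose de := ep / c0; have de0 : 0 < de by rewrite divr_gt0.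
have de20 : 0 < de / 2 by rewrite divr_gt0.
have [M1 [N1 h1]] := H1 _ de20.
have [M2 [N2 h2]] := H2 _ de20.
have [N3 h3] : exists N, forall n, (N <= n)%N -> forall a, (a < J)%N -> forall b, (b < J)%N ->
  `|pairhat a.+1 b.+1 (k1 n) (k2 n) * z ^+ (a + b).+2 - pib (a + b).+2| <= de.
 apply: (@eventually_all (fun a n => forall b, (b < J)%N -> _)) => a.
 apply: (@eventually_all (fun b n => `|pairhat a.+1 b.+1 (k1 n) (k2 n) * z ^+ (a + b).+2 - pib (a + b).+2| <= de)) => b.
 have /cvg_eps/(_ de de0) // : pairhat a.+1 b.+1 (k1 n) (k2 n) * z ^+ (a + b).+2 @[n --> \oo] --> pib (a + b).+2.
 rewrite /pib; apply: cvgM; last exact: cvg_cst.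
 by have := pairhat_cvg (a := a.+1) (b := b.+1) k10 k20; rewrite addSn addnS.
pose c1 := 2 * (th1 + th2) * J%:R.
have c10 : 0 <= c1 by rewrite !mulr_ge0// addr_ge0.
exists (maxn (maxn M1 M2) 1 + J)%N, (maxn (maxn N1 N2) (maxn N3 (Num.bound (c1 / (de / 2))).+1)) => n.
rewrite !geq_max => /andP[/andP[n1 n2] /andP[n3 n4]] [|p [|g gs]]// [sgs] /and3P[Mp Mg Mgs] sn.
have nR : 0 < n%:R :> R by rewrite ltr0n; exact: leq_ltn_trans n4.
have shift_small : c1 / n%:R <= de / 2.
 rewrite ler_pdivrMr// mulrC -ler_pdivrMr//; apply: (le_trans (ltW (archi_boundP _))).
  by rewrite divr_ge0// ltW.
 by rewrite ler_nat ltnW.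
have mM : (maxn (maxn M1 M2) 1 <= maxn (maxn M1 M2) 1 + J)%N by exact: leq_addr.
have M1p : (M1 + J <= p)%N by apply: leq_trans Mp; rewrite leq_add2r !leq_max leqnn.
have M2g : (M2 + J <= g)%N by apply: leq_trans Mg; rewrite leq_add2r !leq_max leqnn orbT.
have M2gs : all (leq M2) gs.
 by apply: sub_all Mgs => i; apply: leq_trans; rewrite (leq_trans _ mM)// !leq_max leqnn orbT.
have Jp : (J <= p)%N by apply: leq_trans M1p; rewrite leq_addl.
have Jg : (J <= g)%N by apply: leq_trans M2g; rewrite leq_addl.
move: sn => /= sn.
set l := zip gs [seq k n | k <- ks].
have sl' : size gs = size [seq k n | k <- ks] by rewrite size_map.
have tl : tmax l = sumn gs by exact: total_zip.
have Tl : tmax ((g, k2 n) :: l) = (g + sumn gs)%N by rewrite -tl.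
pose v1 := expR (- (th1 * p%:R / n%:R)); pose S2 := th2 * g%:R + wsum ths gs; pose v2 := expR (- (S2 / n%:R)).
have s1 : 0 <= th1 * p%:R / n%:R by rewrite divr_ge0// mulr_ge0.
have S20 : 0 <= S2 by rewrite addr_ge0 ?wsum_ge0// mulr_ge0.
have s2 : 0 <= S2 / n%:R by rewrite divr_ge0.
have -> : expR (- ((th1 * p%:R + (th2 * g%:R + wsum ths gs)) / n%:R)) = v1 * v2.
 by rewrite /v1 /v2 -expRD; congr expR; rewrite /S2; ring.
have b1 := expN01 s1; have b2 := expN01 s2.
rewrite -/v1 in b1; rewrite -/v2 in b2.
have near X S S' c : `|X - A * expR (- (S' / n%:R))| <= de / 2 -> 0 <= S' -> 0 <= c -> S = S' + c ->
  c <= (th1 + th2) * J%:R -> `|X - A * expR (- (S / n%:R))| <= de.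
 move=> hh S'0 c_ge0 -> hm.
 have hx : `|expR (- (S' / n%:R)) - expR (- ((S' + c) / n%:R))| <= de / 4.
  apply: (le_trans (expN_lip _ _)); first by rewrite divr_ge0.
   by rewrite ler_wpM2r ?invr_ge0 ?(ltW nR)// lerDl.
  rewrite -mulrBl addrAC subrr add0r.
  have := ler_wpM2r (ltW (divr_gt0 ltr01 nR)) hm; rewrite !mul1r => hm'.
  by move: shift_small hm'; rewrite /c1; move: (n%:R^-1) => q; lra.
 rewrite -(subrK (A * expR (- (S' / n%:R))) X) -addrA -mulrBr.
 apply: (le_trans (ler_normD _ _)); rewrite normrM (ger0_norm A_ge0).
 by have := ler_pM A_ge0 (normr_ge0 _) A_le2 hx; move: hh; lra.
have near1 a : (a <= J)%N -> `|pc (p - a) (k1 n) - A * v1| <= de.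
 move=> aJ; have ap : (a <= p)%N by exact: leq_trans aJ Jp.
 have := h1 n n1 [:: (p - a)%N] erefl; rewrite /= andbT addn0.
 have i1 : (M1 <= p - a)%N by move: M1p aJ ap; clear; lia.
 have i2 : (p - a <= n)%N by move: sn; clear; lia.
 move=> /(_ i1 i2); rewrite /norm_multi multi1 addr0 [tmax _]/= /tmax /= addn0 => hh.
 apply: (near _ _ _ (th1 * a%:R)) hh _ _ _ _; rewrite ?mulr_ge0//; first by rewrite natrB//; ring.
 by rewrite ler_pM// ?ler_nat// lerDl.
have near2 b : (b <= J)%N -> `|Q ((g - b, k2 n)%N :: l) - A * v2| <= de.
 move=> bJ; have bg : (b <= g)%N by exact: leq_trans bJ Jg.
 have := h2 n n2 ((g - b)%N :: gs); rewrite /= sgs => /(_ erefl).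
 have i1 : (M2 <= g - b)%N by move: M2g bJ bg; clear; lia.
 have i2 : (g - b + sumn gs <= n)%N by move: sn; clear; lia.
 rewrite i1 M2gs => /(_ isT i2) hh.
 apply: (near _ _ _ (th2 * b%:R)) hh _ _ _ _; rewrite ?addr_ge0 ?wsum_ge0 ?mulr_ge0//.
  by rewrite /S2 natrB//; ring.
 by rewrite ler_pM// ?ler_nat// lerDr.
have n1' := near1 0%N isT; have n2' := near2 0%N isT; rewrite !subn0 in n1' n2'.
rewrite /norm_multi multi_cons_shift mulrDl.
have -> : tmax [:: (p, k1 n), (g, k2 n) & l] = (p + tmax ((g, k2 n) :: l))%N by [].
rewrite {1}exprD mulrACA -/(pc _ _) -/(Q _).
set T2 := tmax _.
rewrite mulr_suml; under [X in _ + X - _]eq_bigr do rewrite mulr_suml.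
rewrite -/(\sum_(a < p) \sum_(b < T2) Y p (k1 n) ((g, k2 n) :: l) (nat_of_ord a) (nat_of_ord b)).
pose Yn a b := Y p (k1 n) ((g, k2 n) :: l) a b.
rewrite -/(\sum_(a < p) \sum_(b < T2) Yn (nat_of_ord a) (nat_of_ord b)).
have JT : (J <= T2)%N by rewrite /T2 Tl (leq_trans Jg)// leq_addr.
have e3 : `|\sum_(a < p) \sum_(b < T2) Yn a b - \sum_(a < J) \sum_(b < J) Yn a b| <= 4 * (ep / 16).
 have := @box_diff R Yn (fun a b => 4 * lam2 (a, b)) J p T2 Jp JT (fun a b ha hb => Y_le _ ha hb).
 move=> hb; apply: (le_trans hb).
 have pull q r : \sum_(a < q) \sum_(b < r) 4 * lam2 (a : nat, b : nat) = 4 * \sum_(a < q) \sum_(b < r) lam2 (a : nat, b : nat).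
  by rewrite mulr_sumr; apply: eq_bigr => a _; rewrite mulr_sumr.
 rewrite !pull -mulrBr ler_wpM2l//; have := box_le_asum p T2 lam20 lam2_summ; move: HJ; lra.
have e4 : `|asum setT pib2 - \sum_(a < J) \sum_(b < J) pib2 (a : nat, b : nat)| <= ep / 16.
 have := @box_asum_diff R (fun c => pib2 c) (fun c => lam2 c) J lam2_summ (fun c => pib_lam _).
 by move=> hb; apply: (le_trans hb); move: HJ; lra.
have e1 : `|pc p (k1 n) * Q ((g, k2 n) :: l) - A * v1 * (A * v2)| <= 12 * de.
 have := @prod3_diff R (pc p (k1 n)) (Q ((g, k2 n) :: l)) 1 (A * v1) (A * v2) 1 de (pc_le _ _) (Q_le _).
 rewrite !mulr1; apply=> //.
 - by rewrite ger0_norm; case/andP: b2.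
 - by rewrite normr1 ler1n.
 - by rewrite normr1 ler1n.
 - by rewrite subrr normr0 ltW.
have e2 : `|\sum_(a < J) \sum_(b < J) Yn a b - A * v1 * (A * v2) * \sum_(a < J) \sum_(b < J) pib2 (a : nat, b : nat)| <= J%:R * J%:R * (12 * de).
 rewrite mulr_sumr -sumrB; apply: (le_trans (ler_norm_sum _ _ _)).
 apply: (le_via (\sum_(a < J) J%:R * (12 * de))); last first.
  by rewrite sumr_const card_ord -[_ *+ J]mulr_natl mulrA.
 apply: ler_sum => a _; have aJ := ltn_ord a.
 rewrite mulr_sumr -sumrB; apply: (le_trans (ler_norm_sum _ _ _)).
 apply: (le_via (\sum_(b < J) 12 * de)); last by rewrite sumr_const card_ord -[_ *+ J]mulr_natl.
 apply: ler_sum => b _; have bJ := ltn_ord b.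
 rewrite /Yn YE; [|exact: leq_trans aJ Jp|exact: leq_trans bJ Jg].
 have -> : A * v1 * (A * v2) * pib2 (a : nat, b : nat) = A * v1 * pib (a + b).+2 * (A * v2) by rewrite /pib2 /=; ring.
 have ab : (a.+1 + b.+1 = (a + b).+2)%N by rewrite addSn addnS.
 apply: prod3_diff.
 - exact: pc_le.
 - rewrite normrM (ger0_norm (zn0 _)); apply: le_trans (lam_le (a + b).+2).
  by rewrite ler_wpM2r// -ab; exact: pairhat_le.
 - by apply: le_trans (pib_lam _) (lam_le _).
 - by rewrite ger0_norm; case/andP: b2.
 - exact: Q_le.
 - exact: near1.
 - exact: h3.
 - exact: near2.
have AA : A * (v1 * v2) = A * v1 * (A * v2) * (1 + asum setT pib2).
 have -> : A * v1 * (A * v2) * (1 + asum setT pib2) =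
  A * (v1 * v2) * (A * (1 + asum setT pib2)) by ring.
 by rewrite pib2_sum mulr1.
rewrite AA; move: (asum setT _) e4 => Pa e4.
set bP := \sum_(a < J) \sum_(b < J) pib2 _ in e2 e4.
set bY := \sum_(a < J) \sum_(b < J) Yn a b in e2 e3.
set SY := \sum_(a < p) _ in e3 *.
set X := pc _ _ * _ in e1 *.
set V := A * v1 * (A * v2) in e1 e2 *.
have V4 : `|V| <= 4.
 rewrite /V normrM; case/andP: b1 => l1 u1; case/andP: b2 => l2 u2.
 by rewrite !ger0_norm//; have := ler_pM l1 l2 u1 u2; lra.
have e5 : `|V * (Pa - bP)| <= 4 * (ep / 16) by rewrite normrM ler_pM.
have -> : X + SY - V * (1 + Pa) = (X - V) + (SY - bY) + (bY - V * bP) - V * (Pa - bP) by ring.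
have dE : 12 * de * (1 + J%:R * J%:R) = ep / 2.
 by rewrite /de /c0; have := lt0r_neq0 c00; rewrite /c0; move: (J%:R * J%:R) => q qn; field; move: qn; rewrite mulf_eq0 negb_or => /andP[].
move: e1 e2 e3 e5; move: (X - V) (SY - bY) (bY - V * bP) (V * (Pa - bP)) => q1 q2 q3 q4 f1 f3 f2 f4.
apply: (le_trans (ler_normB _ _)); have g1 := ler_normD (q1 + q2) q3; have g2 := ler_normD q1 q2.
by move: dE f1 f2 f3 f4 g1 g2; move: (J%:R * J%:R) => q; lra.
Qed.

Theorem conv_to_all (kt : seq ((nat -> 'rV[R]_d) * R)) : kt != [::] ->
 (forall i, (i < size kt)%N -> let c := nth (fun=> 0, 0) kt i in
   [/\ 0 <= c.2, forall x, ldot (c.1 n) x @[n --> \oo] --> (0 : R) & conv_to [:: c.1] [:: c.2]]) ->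
 conv_to (unzip1 kt) (unzip2 kt).
Proof.
move=> kt0; elim: kt kt0 => [//|[k1 t1] [|[k2 t2] kt] IH] _ H; first by case: (H 0%N isT).
have [c1 c2 c3] := H 0%N isT; have [c4 c5 c6] := H 1%N isT.
apply: conv_to_cons => //.
 apply/(all_nthP 0) => i; rewrite size_map => ik.
 by have [] := H i.+2 ik; rewrite /= (nth_map (fun=> 0, 0)).
by apply: IH => // i ik; exact: (H i.+1 ik).
Qed.

End limit.
End multi_time.

(** * Elementary power sums, product sums and cosine bounds *)

Section power_sums.
Variable R : realType.

Lemma powR_neg_bernoulli (u be : R) : 0 <= u -> u < 1 -> 0 <= be -> 1 + be * u <= (1 - u) `^ (- be).
Proof.
move=> u0 u1 be0; have v0 : 0 < 1 - u by rewrite subr_gt0.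
rewrite /powR gt_eqF//; apply: le_trans (expR_ge1Dx _) _; rewrite ler_expR.
rewrite mulNr -mulrN ler_wpM2l// lerNr.
rewrite -ler_expR lnK ?posrE//; exact: expR_ge1Dx.
Qed.

Lemma powR_le_exp (u p : R) : 0 <= u -> u < 1 -> 0 <= p -> (1 - u) `^ p <= expR (- (p * u)).
Proof.
move=> u0 u1 p0; have v0 : 0 < 1 - u by rewrite subr_gt0.
rewrite /powR gt_eqF// ler_expR -mulrN ler_wpM2l//.
rewrite -ler_expR lnK ?posrE//; exact: expR_ge1Dx.
Qed.

(** Telescoping: by a Bernoulli inequality each term is at most a multiple of [L] times the decrease
    of [w m = (1 + m / L) ^ (- be)]. *)
Lemma sum_tail_power (L be : R) K : 1 <= L -> 0 < be ->
 \sum_(m < K) (Num.max 1 (m.+1%:R / L)) `^ (- (1 + be)) <= 2 `^ (1 + be) / be * L.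
Proof.
move=> L1 be0; have L0 : 0 < L by apply: lt_le_trans L1.
pose w (m : nat) : R := (1 + m%:R / L) `^ (- be).
have y0 m : 0 < 1 + m%:R / L by rewrite ltr_wpDr// divr_ge0// ltW.
have step m : (Num.max 1 (m.+1%:R / L)) `^ (- (1 + be)) <= 2 `^ (1 + be) / be * L * (w m - w m.+1).
 set y := 1 + m.+1%:R / L.
 have yp : 0 < y by exact: y0.
 set u := (L * y)^-1.
 have Ly : 1 < L * y by rewrite /y mulrDr mulr1 mulrCA mulfV ?gt_eqF// mulr1 -natr1; have := ler0n R m; lra.
 have u0 : 0 <= u by rewrite invr_ge0 ltW// (lt_trans ltr01).
 have u1 : u < 1 by rewrite invf_lt1// (lt_trans ltr01).
 have wm : w m = w m.+1 * (1 - u) `^ (- be).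
  rewrite /w -/y -powRM ?(ltW yp)//; last by rewrite subr_ge0 ltW.
  congr (_ `^ _); rewrite /u /y mulrBr mulr1 invfM mulrCA mulfV ?gt_eqF ?y0// mulr1 -natr1; field; exact: lt0r_neq0.
 have w0 : 0 <= w m.+1 by exact: powR_ge0.
 have h1 : w m.+1 * (be * u) <= w m - w m.+1.
  rewrite wm -[X in _ - X]mulr1 -mulrBr ler_wpM2l//.
  by have := powR_neg_bernoulli u0 u1 (ltW be0); lra.
 have M1 : 1 <= Num.max 1 (m.+1%:R / L) by rewrite le_max lexx.
 have M0 : 0 < Num.max 1 (m.+1%:R / L) by apply: lt_le_trans M1.
 have yM : y <= 2 * Num.max 1 (m.+1%:R / L).
  have : m.+1%:R / L <= Num.max 1 (m.+1%:R / L) by rewrite le_max lexx orbT.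
  by rewrite /y; lra.
 have b0 : 0 <= 1 + be by rewrite addr_ge0// ltW.
 have h2 : (Num.max 1 (m.+1%:R / L)) `^ (- (1 + be)) <= 2 `^ (1 + be) * y `^ (- (1 + be)).
  rewrite !powRN -[leLHS]mul1r ler_pdivrMr ?powR_gt0// mulrAC ler_pdivlMr ?powR_gt0// mul1r.
  rewrite -powRM ?(ltW M0)//.
  by rewrite ge0_ler_powR ?nnegrE ?(ltW yp)// mulr_ge0// ltW.
 apply: (le_trans h2).
 have -> : y `^ (- (1 + be)) = L / be * (w m.+1 * (be * u)).
  have yn : y != 0 by rewrite gt_eqF.
  rewrite /w -/y /u invfM opprD powRD ?yn ?implybT// powR_inv1 ?(ltW yp)//.
  by move: (y `^ (- be)) => q; field; rewrite !gt_eqF.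
 have -> : 2 `^ (1 + be) / be * L * (w m - w m.+1) = 2 `^ (1 + be) * (L / be * (w m - w m.+1)) by ring.
 rewrite ler_wpM2l ?powR_ge0// ler_wpM2l// divr_ge0// ltW//.
apply: (le_via (\sum_(m < K) 2 `^ (1 + be) / be * L * (w m - w m.+1))).
 by apply: ler_sum => m _; exact: step.
rewrite -mulr_sumr -[leRHS]mulr1 ler_wpM2l//.
 by rewrite mulr_ge0 ?(ltW L0)// divr_ge0 ?powR_ge0// ltW.
have -> : \sum_(m < K) (w m - w m.+1) = w 0%N - w K.
 elim: K => [|K IH]; first by rewrite big_ord0 subrr.
 by rewrite big_ord_recr/= IH; ring.
have -> : w 0%N = 1 by rewrite /w mul0r addr0 powR1.
by rewrite gerBl powR_ge0.
Qed.

(** Comparison with the increments of the power [1 - ga]; the minimum of [J] and [la] records where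
    the truncated sum stops growing. *)
Lemma sum_neg_power (ga la : R) J : 0 <= ga -> ga < 1 -> 0 < la ->
 \sum_(j < J) (if j.+1%:R < la then j.+1%:R `^ (- ga) else 0) <= 2 / (1 - ga) * la `^ (1 - ga).
Proof.
move=> g0 g1 l0; set p := 1 - ga; have p0 : 0 < p by rewrite subr_gt0.
have p1 : p <= 1 by rewrite gerBl.
suff main : \sum_(j < J) (if j.+1%:R < la then j.+1%:R `^ (- ga) else 0) <= 2 / p * (Num.min J%:R la) `^ p.
 apply: (le_trans main); rewrite ler_wpM2l ?divr_ge0 ?(ltW p0)//.
 by rewrite ge0_ler_powR ?nnegrE ?(ltW p0) ?(ltW l0) ?le_min ?ler0n ?ge_min ?lexx ?orbT ?(ltW l0)//.
elim: J => [|J IH]; first by rewrite big_ord0 mulr_ge0 ?powR_ge0// divr_ge0// ltW.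
rewrite big_ord_recr/=.
have mono : (Num.min J%:R la) `^ p <= (Num.min J.+1%:R la) `^ p.
 rewrite ge0_ler_powR ?nnegrE ?(ltW p0) ?le_min ?ler0n ?(ltW l0)//.
 by rewrite !ge_min lexx orbT ler_nat leqnSn.
case: ifP => hJ; last first.
 by rewrite addr0; apply: (le_trans IH); rewrite ler_wpM2l ?divr_ge0 ?(ltW p0).
have J1 : 0 < J.+1%:R :> R by [].
have hJ' : J%:R <= la by apply: ltW; apply: le_lt_trans hJ; rewrite ler_nat.
rewrite (min_l hJ') in IH; rewrite (min_l (ltW hJ)).
set u : R := J.+1%:R^-1.
have u0 : 0 <= u by rewrite invr_ge0.
have key : J.+1%:R `^ (- ga) <= 2 / p * (J.+1%:R `^ p - J%:R `^ p).
 have e1 : J.+1%:R `^ (- ga) = J.+1%:R `^ p * u.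
  have Jn : J.+1%:R != 0 :> R by rewrite pnatr_eq0.
  have -> : - ga = p - 1 by rewrite /p; ring.
  by rewrite powRB ?Jn ?implybT// powRr1 ?ler0n.
 have h2 : J%:R `^ p <= J.+1%:R `^ p * (1 - p * u / 2).
  case: J {IH hJ mono hJ'} J1 @u u0 e1 => [|J] J1 u u0 e1.
   by rewrite powR0 ?gt_eqF// mulr_ge0 ?powR_ge0// /u invr1; lra.
  have u1 : u < 1 by rewrite /u invf_lt1// ltr1n.
  have -> : J.+1%:R = J.+2%:R * (1 - u) :> R by rewrite mulrBr mulr1 /u mulfV// -[J.+2%:R]natr1 addrK.
  rewrite powRM ?ler0n ?subr_ge0 ?(ltW u1)// ler_wpM2l ?powR_ge0//.
  apply: (le_trans (powR_le_exp u0 u1 (ltW p0))).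
  set t := p * u; have t0 : 0 <= t by rewrite mulr_ge0// ltW.
  have t1 : t <= 1 by apply: mulr_ile1 => //; apply: ltW.
  rewrite expRN; have ht : 1 + t <= expR t by exact: expR_ge1Dx.
  apply: (le_via (1 + t)^-1); first by rewrite lef_pV2// posrE ?expR_gt0// ltr_wpDr.
  by rewrite -[leLHS]mul1r ler_pdivrMr ?ltr_wpDr//; nra.
 rewrite e1 mulrBr -[X in _ <= X]mulrBr.
 have : J.+1%:R `^ p * (p * u / 2) <= J.+1%:R `^ p - J%:R `^ p by move: h2; rewrite mulrBr mulr1; lra.
 move=> h3; have := ler_wpM2l (divr_ge0 (ler0n R 2) (ltW p0)) h3; apply: le_trans.
 by apply: le_of_eq; move: (J.+1%:R `^ p) => q; field; exact: lt0r_neq0.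
by move: IH key; rewrite mulrBr; lra.
Qed.

End power_sums.

Section product_sums.
Variables (R : realType) (d : nat).
Local Notation Zd := 'rV[int]_d.

Definition shifted_point (a : int) (N : nat) (f : {ffun 'I_d -> 'I_N}) : Zd := \row_i (a + (f i : nat)%:Z).

Lemma shifted_point_inj a N : injective (@shifted_point a N).
Proof.
move=> f g /rowP H; apply/ffunP => i; have := H i; rewrite !mxE => /addrI [h].
exact: val_inj.
Qed.

(** A finite set of lattice points lies in a cube, over which the sum of products is a product of
    sums. *)
Lemma prod_sum_le (phi : int -> R) (C : R) (s : seq Zd) : (forall x, 0 <= phi x) -> uniq s ->
 (forall K : nat, \sum_(j < (2 * K).+1) phi ((j : nat)%:Z - K%:Z) <= C) ->
 \sum_(y <- s) \prod_i phi (y 0 i) <= C ^+ d.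
Proof.
move=> p0 us H.
pose K : nat := \max_(y <- s) \max_i `|y 0%R i|%N.
have sK y i : y \in s -> (`|y 0%R i| <= K)%N.
 move=> ys; apply: leq_trans (@leq_bigmax_seq _ s xpredT (fun y : Zd => \max_i `|y 0%R i|%N) y ys isT).
 exact: (leq_bigmax i).
pose X := @shifted_point (- K%:Z) (2 * K).+1.
apply: (le_via (\sum_(y <- map X (enum {ffun 'I_d -> 'I_(2 * K).+1})) \prod_i phi (y 0 i))).
 apply: ler_sum_subseq => //.
 - by move=> y; apply: prodr_ge0.
 - by rewrite map_inj_uniq ?enum_uniq//; exact: shifted_point_inj.
 - move=> y ys; apply/mapP.
  exists [ffun i => inord (absz (y 0 i + K%:Z)%R)]; first by rewrite mem_enum.
  apply/rowP => i; rewrite !mxE ffunE; have := sK y i ys; move: (y 0 i) K {X sK} => u K hu.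
  by rewrite inordK; lia.
rewrite big_map big_enum/=.
rewrite (eq_bigr (fun f : {ffun 'I_d -> 'I_(2 * K).+1} => \prod_i phi ((f i : nat)%:Z - K%:Z))); last first.
 by move=> f _; apply: eq_bigr => i _; rewrite mxE addrC.
rewrite -(bigA_distr_bigA (fun (i : 'I_d) (j : 'I_(2 * K).+1) => phi ((j : nat)%:Z - K%:Z)))/=.
rewrite prodr_const card_ord lerXn2r ?nnegrE//; [exact: sumr_ge0| |exact: H].
by apply: le_trans (H 0%N); apply: sumr_ge0.
Qed.

Lemma sym_sum (f : nat -> R) K :
 \sum_(j < (2 * K).+1) f `|(j : nat)%:Z - K%:Z|%N = f 0%N + 2 * \sum_(m < K) f m.+1.
Proof.
have -> : ((2 * K).+1 = K.+1 + K)%N by lia.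
rewrite big_split_ord/= [X in X + _](_ : _ = f 0%N + \sum_(m < K) f m.+1).
 rewrite [X in _ + X](_ : _ = \sum_(m < K) f m.+1); first by ring.
 by apply: eq_bigr => m _; congr f; lia.
rewrite (reindex_inj rev_ord_inj) big_ord_recl/=; congr (_ + _); first by congr f; lia.
by apply: eq_bigr => m _; congr f; have := ltn_ord m; rewrite /bump /=; lia.
Qed.

Lemma grid_prod_sum M (G : nat -> R) :
 \sum_(j : 'rV['I_M.+1]_d) \prod_i G (j 0 i) = (\sum_(q < M.+1) G q) ^+ d.
Proof.
rewrite -[in RHS](card_ord d) -prodr_const (bigA_distr_bigA (fun (i : 'I_d) (j : 'I_M.+1) => G j))/=.
pose e (f : {ffun 'I_d -> 'I_M.+1}) : 'rV['I_M.+1]_d := \row_i f i.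
rewrite (reindex e); first by apply: eq_bigr => f _; apply: eq_bigr => i _; rewrite mxE.
exists (fun j : 'rV['I_M.+1]_d => [ffun i => j 0 i]) => [f _|j _]; first by apply/ffunP => i; rewrite ffunE mxE.
by apply/rowP => i; rewrite mxE ffunE.
Qed.

End product_sums.

Section cosine_bounds.
Variable R : realType.

Lemma onecos_double (u : R) : 1 - cos (u *+ 2) <= 4 * (1 - cos u).
Proof. by rewrite cos_mulr2n; have := cos_le1 u; have := cos_geN1 u; nra. Qed.

(** Clear for [u >= pi / 2], where the cosine is at most 0. A smaller [u] is doubled until it gets
    there; each doubling multiplies the left side by 4 and [1 - cos u] by at most 4. *)
Lemma onecos_lower (u : R) : 0 <= u -> u <= pi -> u ^+ 2 / pi ^+ 2 <= 1 - cos u.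
Proof.
have pi0 := pi_gt0 R.
have base (v : R) : pi / 2 <= v -> v <= pi -> v ^+ 2 / pi ^+ 2 <= 1 - cos v.
 move=> v1 v2; apply: (le_via 1).
  rewrite ler_pdivrMr ?exprn_gt0// mul1r lerXn2r ?nnegrE ?(ltW pi0)//.
  by apply: le_trans v1; rewrite divr_ge0// ltW.
 rewrite lerDl oppr_ge0 -(subrK (pi / 2) v) cosDpihalf oppr_le0.
 by apply: sin_ge0_pi; rewrite subr_ge0 v1/=; lra.
suff main j (v : R) : 0 <= v -> v <= pi -> pi <= v * 2 ^+ j.+1 -> v ^+ 2 / pi ^+ 2 <= 1 - cos v.
 move=> u0 u1; have [->|un] := eqVneq u 0; first by rewrite expr0n/= mul0r cos0 subrr.
 have up : 0 < u by rewrite lt_neqAle eq_sym un.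
 apply: (main (Num.bound (pi / u))) => //; rewrite mulrC -ler_pdivrMr//.
 apply: (le_trans (ltW (archi_boundP _))); first by rewrite divr_ge0// ltW.
 rewrite -natrX ler_nat; apply: ltnW; apply: leq_trans (ltn_expl _ (isT : 1 < 2)%N) _.
 by rewrite leq_exp2l.
elim: j v => [|j IH] v v0 v1 v2.
 by apply: base => //; rewrite ler_pdivrMr//; rewrite expr1 in v2.
have [h|h] := leP (pi / 2) v; first exact: base.
have := onecos_double v; have := IH (v *+ 2); rewrite mulrn_wge0// => /(_ isT).
have -> : v *+ 2 <= pi by rewrite -mulr_natr; lra.
rewrite -[v *+ 2]mulr_natr -[v * 2%:R * _]mulrA -exprS v2 => /(_ isT isT).
rewrite exprMn mulrAC; move: (v ^+ 2 / pi ^+ 2) (cos (v * 2)) (cos v) => q x y; lra.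
Qed.

Lemma cos_eq1_small (u : R) : 0 < u -> u < 2 * pi -> cos u < 1.
Proof.
move=> u0 u1; have -> : u = (u / 2) *+ 2 by rewrite -mulr_natr divfK.
have s0 : 0 < sin (u / 2) by apply: sin_gt0_pi; apply/andP; split; lra.
by rewrite cos_mulr2n cos2sin2; have := exprn_gt0 2 s0; lra.
Qed.

End cosine_bounds.

Section cube_bound.
Variables (R : realType) (d : nat) (D : 'rV[int]_d -> R).
Hypotheses (D_ge0 : forall x, 0 <= D x) (D_summ : summ D).

Lemma sum_cube_le (F : 'rV[int]_d -> R) (w : R) (a : int) n : (forall x, 0 <= F x) -> summ F ->
 (forall f : {ffun 'I_d -> 'I_n}, w / n%:R ^+ d <= F (shifted_point a f)) -> (0 < n)%N ->
 w <= asum setT F.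
Proof.
move=> F0 sF H n0.
have := @sum_finite_le_asum _ _ F (map (@shifted_point d a n) (enum {ffun 'I_d -> 'I_n})) F0 sF.
rewrite map_inj_uniq ?enum_uniq; last exact: shifted_point_inj.
rewrite big_map big_enum => /(_ isT); apply: le_trans.
apply: (le_via (\sum_(f : {ffun 'I_d -> 'I_n}) w / n%:R ^+ d)); last by apply: ler_sum => f _; exact: H.
rewrite sumr_const -[leRHS]mulr_natr (_ : #|_| = (n ^ d)%N); last by rewrite -[LHS]/(#|{: {ffun 'I_d -> 'I_n}}|) card_ffun !card_ord.
by rewrite natrX divfK// expf_neq0// pnatr_eq0 -lt0n.
Qed.

(* Compare the phases at the two ends of a translation by [t] in direction [i]
  inside the cube. *)
Lemma gap_ge_cube (w : R) n t (i : 'I_d) (k : 'rV[R]_d) : 0 <= w -> (t <= n)%N -> (0 < n)%N ->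
 (forall x : 'rV[int]_d, (forall j, n%:Z < x 0 j <= (3 * n)%N%:Z) -> w / n%:R ^+ d <= D x) ->
 w / 4 * (1 - cos (t%:R * k 0 i)) <= gap D k.
Proof.
move=> w0 tn n0 H.
pose u : 'rV[int]_d := t%:Z *: delta_mx 0 i.
have ku : ldot k u = t%:R * k 0 i.
 rewrite /ldot /dot (bigD1 i)//= big1 ?addr0; last first.
  by move=> j ji; rewrite !mxE (negPf ji) andbF mulr0 mulr0.
 by rewrite !mxE !eqxx mulr1 mulrC.
pose F x := D x * (1 - cos (ldot k x)).
have F0 x : 0 <= F x by rewrite mulr_ge0 ?onecos_ge0.
have sF : summ F by exact: gap_summ.
have sF' : summ (fun x => F (x + u)).
 apply/(@summ_bij _ _ _ (fun x : 'rV[int]_d => x + u) F) => //.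
 by exists (fun x => x - u) => x; [rewrite addrK|rewrite subrK].
have e : asum setT (fun x => F (x + u)) = gap D k.
 symmetry; rewrite /gap -/F; apply: (@asum_bij _ _ _ (fun x : 'rV[int]_d => x + u) F).
 by exists (fun x => x - u) => x; [rewrite addrK|rewrite subrK].
have key : w * (1 - cos (t%:R * k 0 i)) <= asum setT (fun x => 2 * F x + 2 * F (x + u)).
 apply: (@sum_cube_le _ _ (n%:Z + 1) n) => //.
 - by move=> x; rewrite addr_ge0// mulr_ge0.
 - by apply: summD; apply: summZ.
 move=> f; set x := shifted_point _ _.
 have xj j : n%:Z < x 0 j <= (2 * n)%N%:Z by rewrite mxE; have := ltn_ord (f j); lia.
 have Dx : w / n%:R ^+ d <= D x by apply: H => j; have := xj j; lia.
 have Dxu : w / n%:R ^+ d <= D (x + u).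
  apply: H => j; rewrite !mxE; have := xj j; rewrite /x mxE eqxx /=.
  by case: (j == i); rewrite ?mulr1 ?mulr0; lia.
 have q0 : 0 <= w / n%:R ^+ d by rewrite divr_ge0 ?exprn_ge0.
 rewrite mulrAC; apply: (le_via (w / n%:R ^+ d * (2 * (1 - cos (ldot k x)) + 2 * (1 - cos (ldot k (x + u)))))).
  rewrite ler_wpM2l// -ku (_ : ldot k u = ldot k (x + u) + ldot k (- x)); last by rewrite -ldotDr addrAC subrr add0r.
  by apply: (le_trans (onecosD _ _)); rewrite ldotNr cosN addrC.
 rewrite mulrDr /F; move: (onecos_ge0 (ldot k x)) (onecos_ge0 (ldot k (x + u))).
 move: (1 - cos _) (1 - cos _) => p q p0 q0'.
 by apply: lerD; rewrite mulrCA ler_wpM2l// ler_wpM2r.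
move: key; rewrite asumD ?asumZ//; [|exact: summZ|exact: summZ].
rewrite e -[asum setT F]/(gap D k); lra.
Qed.

End cube_bound.

(** * The step profile and its infrared bound *)

Section profile.
Variables (R : realType) (d : nat) (alpha : R) (h : 'rV[R]_d -> R).
Hypotheses (alpha_gt0 : 0 < alpha) (d_gt0 : (0 < d)%N) (hP : step_profile alpha h).
Local Notation Zd := 'rV[int]_d.

Lemma coord_le_enorm (x : 'rV[R]_d) i : `|x 0 i| <= enorm x.
Proof.
rewrite -sqrtr_sqr ler_wsqrtr// /dot (bigD1 i)//= expr2 lerDl sumr_ge0// => j _.
by rewrite -expr2 sqr_ge0.
Qed.

Lemma enorm_le (x : 'rV[R]_d) s : (forall i, `|x 0 i| <= s) -> enorm x <= d%:R * s.
Proof.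
move=> H; have s0 : 0 <= s by apply: le_trans (H (Ordinal d_gt0)).
rewrite -[leRHS]ger0_norm ?mulr_ge0// -sqrtr_sqr ler_wsqrtr//.
apply: (le_via (\sum_(i < d) s ^+ 2)).
 apply: ler_sum => i _; rewrite -expr2 -real_normK ?num_real// lerXn2r ?nnegrE//; exact: H.
rewrite sumr_const card_ord -[leLHS]mulr_natl exprMn ler_wpM2r ?sqr_ge0// -natrX ler_nat.
by rewrite -[X in (X <= _)%N]expn1 leq_pexp2l.
Qed.

(** The reflections in all the coordinates compose to the central symmetry. *)
Lemma h_even x : h (- x) = h x.
Proof.
pose rs (s : seq 'I_d) := foldr (@Defs.reflect R d) x s.
have hs s : h (rs s) = h x by elim: s => //= i s IH; rewrite (profile_reflect hP).
rewrite -(hs (enum 'I_d)); congr h; apply/rowP => j; rewrite mxE.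
have rsE s : uniq s -> rs s 0 j = if j \in s then - x 0 j else x 0 j.
 elim: s => //= i s IH /andP[si us]; rewrite mxE in_cons IH//.
 by case: eqP => [->|]//=; rewrite (negPf si).
by rewrite rsE ?enum_uniq// mem_enum.
Qed.

Lemma profile_upper : exists C r : R, [/\ 0 < C, 1 <= r &
 forall x, h x <= C * (Num.max r (enorm x)) `^ (- (d%:R + alpha))].
Proof.
have [c c0 ht] := profile_tail hP; have [M hM] := profile_bounded hP.
have [r0 hr] := ht (1 / 2) ltac:(by rewrite divr_gt0).
have p0 : 0 <= d%:R + alpha by rewrite addr_ge0// ltW.
pose r := Num.max 1 r0; have r1 : 1 <= r by rewrite le_max lexx.
have rp : 0 < r by apply: lt_le_trans r1.
have M0 : 0 <= M by apply: le_trans (hM 0); exact: profile_ge0 hP 0.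
exists (2 * c + M * r `^ (d%:R + alpha)), r; split => //.
 by rewrite ltr_wpDr ?mulr_gt0// mulr_ge0 ?powR_ge0.
move=> x; have [h1|h1] := leP (enorm x) r.
 rewrite mulrDl -[leLHS]add0r lerD//; first by rewrite !mulr_ge0 ?powR_ge0// ltW.
 by rewrite powRN -mulrA mulfV ?mulr1// gt_eqF// powR_gt0.
rewrite mulrDl -[leLHS]addr0 lerD//; last by rewrite !mulr_ge0 ?powR_ge0.
have h2 : r0 < enorm x by apply: le_lt_trans h1; rewrite le_max lexx orbT.
have ep : 0 < enorm x by exact: lt_trans h1.
have w0 : 0 < c * enorm x `^ (- d%:R - alpha) by rewrite mulr_gt0// powR_gt0.
have := hr x h2; rewrite ltr_norml => /andP[_].
rewrite ltrBlDr ltr_pdivrMr// opprD; move: (c * _) w0 (mulrA 2 c (enorm x `^ (- d%:R - alpha))) => w w0 <-; lra.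
Qed.

Lemma profile_lower : exists c r : R, [/\ 0 < c, 1 <= r &
 forall x, r < enorm x -> c * enorm x `^ (- (d%:R + alpha)) <= h x].
Proof.
have [c c0 ht] := profile_tail hP.
have [r0 hr] := ht (1 / 2) ltac:(by rewrite divr_gt0).
exists (c / 2), (Num.max 1 r0); split; [by rewrite divr_gt0|by rewrite le_max lexx|].
move=> x; rewrite gt_max => /andP[h1 h2].
have ep : 0 < enorm x by exact: lt_trans h1.
have w0 : 0 < c * enorm x `^ (- d%:R - alpha) by rewrite mulr_gt0// powR_gt0.
have := hr x h2; rewrite ltr_norml => /andP[+ _].
rewrite ltrBrDr ltr_pdivlMr// opprD (mulrAC c); move: (c * _) w0 => w w0; lra.
Qed.

Definition hL (L : R) (x : Zd) : R := h (L^-1 *: of_lattice R x).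
Definition ZL (L : R) : R := asum setT (hL L).

Lemma hL_ge0 L x : 0 <= hL L x. Proof. exact: profile_ge0 hP _. Qed.

Lemma step_distE L x : step_dist h L x = hL L x / ZL L. Proof. by []. Qed.

(** The norm dominates every coordinate, so the decay exponent [d + alpha] can be shared as
    [1 + alpha / d] per coordinate; the sum factorises into one-dimensional sums of order [L]. *)
Lemma ZL_upper : exists2 C : R, 0 < C & forall L, 1 <= L -> summ (hL L) /\ ZL L <= C * L ^+ d.
Proof.
have [C [r [C0 r1 hu]]] := profile_upper.
have dn : d%:R != 0 :> R by rewrite pnatr_eq0 -lt0n.
have dp : 0 < d%:R :> R by rewrite ltr0n.
pose be := alpha / d%:R; have be0 : 0 < be by rewrite divr_gt0.
pose B := 1 + 2 * (2 `^ (1 + be) / be).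
have B0 : 0 < B by rewrite ltr_wpDr// mulr_ge0// divr_ge0 ?powR_ge0// ltW.
exists (C * B ^+ d); first by rewrite mulr_gt0// exprn_gt0.
move=> L L1; have L0 : 0 < L by apply: lt_le_trans L1.
pose phi (z : int) : R := (Num.max 1 (`|z|%N%:R / L)) `^ (- (1 + be)).
have phi0 z : 0 <= phi z by exact: powR_ge0.
have hphi x : hL L x <= C * \prod_i phi (x 0 i).
 apply: (le_trans (hu _)); rewrite ler_pM2l//.
 set y := _ *: _; set s := Num.max r _.
 have s1 : 1 <= s by rewrite le_max r1.
 have -> : s `^ (- (d%:R + alpha)) = \prod_(i < d) s `^ (- (1 + be)).
  rewrite prodr_const card_ord -powR_mulrn ?powR_ge0// -powRrM; congr (_ `^ _).
  by rewrite mulNr mulrDl mul1r /be divfK.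
 apply: ler_prod => i _; rewrite powR_ge0/= /phi !powRN.
 have m1 : 1 <= Num.max 1 (`|x 0%R i|%N%:R / L) by rewrite le_max lexx.
 rewrite lef_pV2 ?posrE ?powR_gt0 ?(lt_le_trans ltr01)//.
 rewrite ge0_ler_powR ?nnegrE ?addr_ge0 ?(ltW be0) ?(le_trans ler01)//.
 rewrite ge_max s1/= le_max; apply/orP; right; apply: le_trans (coord_le_enorm y i).
 by rewrite !mxE normrM ger0_norm ?invr_ge0 ?(ltW L0)// mulrC -intr_norm -abszE.
have bnd (s : seq Zd) : uniq s -> \sum_(x <- s) hL L x <= C * B ^+ d * L ^+ d.
 move=> us; apply: (le_via (C * \sum_(x <- s) \prod_i phi (x 0 i))).
  by rewrite mulr_sumr; apply: ler_sum => x _; exact: hphi.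
 rewrite -mulrA ler_pM2l// -exprMn; apply: prod_sum_le => // K.
 rewrite (sym_sum (fun m => (Num.max 1 (m%:R / L)) `^ (- (1 + be)))) mul0r max_l// powR1.
 have := sum_tail_power K L1 be0; rewrite /B; move: (2 `^ _ / be) => q; lra.
split; last by apply: asum_le_bound => //; move=> x; exact: hL_ge0.
exists (C * B ^+ d * L ^+ d) => s us; apply: le_trans (bnd s us).
by apply: ler_sum => x _; rewrite ger0_norm ?hL_ge0.
Qed.

(* The tail lower bound on the cubes [(n, 3n]^d] with [n >= r L]. *)
Lemma hL_cube : exists c r : R, [/\ 0 < c, 1 <= r & forall L n, 1 <= L -> r * L <= n%:R ->
 forall x : Zd, (forall j, n%:Z < x 0 j <= (3 * n)%N%:Z) -> c * (n%:R / L) `^ (- (d%:R + alpha)) <= hL L x].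
Proof.
have [c [r [c0 r1 hl]]] := profile_lower.
have p0 : 0 <= d%:R + alpha by rewrite addr_ge0// ltW.
have k0 : 0 < d%:R * 3 :> R by rewrite mulr_gt0// ltr0n.
exists (c * (d%:R * 3) `^ (- (d%:R + alpha))), r; split => //; first by rewrite mulr_gt0// powR_gt0.
move=> L n L1 nL x xj; have L0 : 0 < L by apply: lt_le_trans L1.
set y := L^-1 *: of_lattice R x.
have yE i : y 0 i = (x 0 i)%:~R / L by rewrite !mxE mulrC.
have s0 : 0 < n%:R / L by rewrite divr_gt0//; apply: lt_le_trans nL; rewrite mulr_gt0// (lt_le_trans ltr01).
have ylow : n%:R / L < enorm y.
 apply: lt_le_trans (coord_le_enorm y (Ordinal d_gt0)); rewrite yE.
 have /andP[h1 _] := xj (Ordinal d_gt0).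
 have h2 : n%:R < (x 0 (Ordinal d_gt0))%:~R :> R by rewrite -[n%:R]/((n%:Z)%:~R) ltr_int.
 rewrite ger0_norm; first by rewrite ltr_pM2r ?invr_gt0.
 by rewrite divr_ge0 ?(ltW L0)// (le_trans _ (ltW h2)).
have yup : enorm y <= d%:R * 3 * (n%:R / L).
 rewrite -mulrA; apply: enorm_le => i; rewrite yE.
 have /andP[h1 h3] := xj i.
 have h2 : 0 <= (x 0 i)%:~R :> R by rewrite ler0z ltW// (le_lt_trans _ h1).
 rewrite ger0_norm ?divr_ge0 ?(ltW L0)// mulrA ler_pM2r ?invr_gt0//.
 by rewrite -natrM -[X in _ <= X]/(((3 * n)%N%:Z)%:~R) ler_int.
apply: le_trans (hl y _); last by apply: le_lt_trans ylow; rewrite ler_pdivlMr.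
rewrite -mulrA ler_pM2l// -powRM ?(ltW k0) ?(ltW s0)// !powRN.
have y0 : 0 < enorm y by exact: lt_trans ylow.
have b0 : 0 < d%:R * 3 * (n%:R / L) by exact: mulr_gt0.
rewrite lef_pV2; [|rewrite posrE; exact: powR_gt0..].
by apply: ge0_ler_powR; rewrite ?nnegrE ?(ltW y0) ?(ltW b0).
Qed.

Lemma ceil_scale (r L : R) : 1 <= r -> 1 <= L -> exists n : nat,
 [/\ r * L <= n%:R, n%:R <= 2 * r * L & (0 < n)%N].
Proof.
move=> r1 L1; have rL : 1 <= r * L by apply: mulr_ege1.
have rl0 : 0 <= r * L by exact: le_trans rL.
exists (Num.truncn (r * L)).+1; have /andP[h1 h2] := truncn_itv rl0.
split => //; first exact: ltW.
by rewrite -natr1; move: h1 rL; rewrite -mulrA; lra.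
Qed.

Lemma ZL_lower : exists2 c : R, 0 < c & forall L, 1 <= L -> c * L ^+ d <= ZL L.
Proof.
have [c [r [c0 r1 hc]]] := hL_cube; have [C C0 hC] := ZL_upper.
have p0 : 0 <= d%:R + alpha by rewrite addr_ge0// ltW.
have r0 : 0 < r by apply: lt_le_trans r1.
exists (c * (2 * r) `^ (- (d%:R + alpha))); first by rewrite mulr_gt0// powR_gt0// mulr_gt0.
move=> L L1; have L0 : 0 < L by apply: lt_le_trans L1.
have [n [n1 n2 n3]] := ceil_scale r1 L1; have [sh _] := hC L L1.
have np : 0 < n%:R :> R by rewrite ltr0n.
apply: (le_via (c * (2 * r) `^ (- (d%:R + alpha)) * n%:R ^+ d)).
 rewrite ler_wpM2l ?mulr_ge0 ?powR_ge0 ?(ltW c0)// lerXn2r ?nnegrE ?(ltW L0)//.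
 by apply: le_trans n1; rewrite ler_peMl// ltW.
apply: (@sum_cube_le _ _ _ _ (n%:Z + 1) n) => //; first exact: hL_ge0.
move=> f; rewrite mulfK ?expf_neq0 ?gt_eqF//; apply: le_trans (hc L n L1 n1 _ _).
 rewrite ler_pM2l// !powRN lef_pV2 ?posrE ?powR_gt0 ?divr_gt0 ?mulr_gt0//.
 by rewrite ge0_ler_powR ?nnegrE ?divr_ge0 ?mulr_ge0 ?(ltW L0) ?(ltW r0)// ler_pdivrMr.
by move=> j; rewrite mxE; move: (f j) => -[q hq] /=; move: hq; clear; lia.
Qed.

Lemma ZL_gt0 L : 1 <= L -> 0 < ZL L.
Proof.
move=> L1; have [c c0 hc] := ZL_lower; apply: lt_le_trans (hc L L1).
by rewrite mulr_gt0// exprn_gt0// (lt_le_trans ltr01).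
Qed.

Lemma step_dist_ge0 L x : 1 <= L -> 0 <= step_dist h L x.
Proof. by move=> L1; rewrite step_distE divr_ge0 ?hL_ge0// ltW// ZL_gt0. Qed.

Lemma step_dist_summ L : 1 <= L -> summ (step_dist h L).
Proof.
move=> L1; have [C C0 hC] := ZL_upper; have [sh _] := hC L L1; exact: summZr sh.
Qed.

Lemma step_dist_sum1 L : 1 <= L -> asum setT (step_dist h L) = 1.
Proof.
move=> L1; have [C C0 hC] := ZL_upper; have [sh _] := hC L L1.
rewrite (eq_asum_to (fun x => hL L x * (ZL L)^-1))// asumZr// mulfV// gt_eqF//; exact: ZL_gt0.
Qed.

Lemma step_dist_even L x : step_dist h L (- x) = step_dist h L x.
Proof.
rewrite !step_distE /hL (_ : of_lattice R (- x) = - of_lattice R x) ?scalerN ?h_even//.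
by apply/rowP => i; rewrite !mxE mulrNz.
Qed.

Lemma step_dist_sup : exists2 B : R, 0 < B & forall L x, 1 <= L -> step_dist h L x <= B / L.
Proof.
have [c c0 hc] := ZL_lower; have [M hM] := profile_bounded hP.
have M0 : 0 <= M by apply: le_trans (hM 0); exact: profile_ge0 hP 0.
exists ((M + 1) / c); first by rewrite divr_gt0// ltr_wpDl.
move=> L x L1; have L0 : 0 < L by apply: lt_le_trans L1.
have Z0 := ZL_gt0 L1; rewrite step_distE ler_pdivrMr//.
apply: (le_via ((M + 1) / c / L * (c * L ^+ d))); last first.
 by rewrite ler_wpM2l ?hc// !divr_ge0 ?(ltW c0) ?(ltW L0)// addr_ge0.
have -> : (M + 1) / c / L * (c * L ^+ d) = (M + 1) * L ^+ d.-1.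
 by rewrite -[in LHS](prednK d_gt0) exprS; field; rewrite !gt_eqF.
have := exprn_ege1 d.-1 L1; have := hM (L^-1 *: of_lattice R x); rewrite -/(hL L x); nra.
Qed.

Lemma step_dist_cube : exists c r : R, [/\ 0 < c, 1 <= r & forall L n, 1 <= L -> r * L <= n%:R -> (0 < n)%N ->
 forall x : Zd, (forall j, n%:Z < x 0 j <= (3 * n)%N%:Z) -> c * (n%:R / L) `^ (- alpha) / n%:R ^+ d <= step_dist h L x].
Proof.
have [c [r [c0 r1 hc]]] := hL_cube; have [C C0 hC] := ZL_upper.
exists (c / C), r; split => //; first by rewrite divr_gt0.
move=> L n L1 nL n0 x xj; have L0 : 0 < L by apply: lt_le_trans L1.
have [sh ZC] := hC L L1; have Z0 := ZL_gt0 L1.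
have np : 0 < n%:R :> R by rewrite ltr0n.
have s0 : 0 < n%:R / L by rewrite divr_gt0.
rewrite step_distE ler_pdivlMr//.
apply: (le_via (c / C * (n%:R / L) `^ (- alpha) / n%:R ^+ d * (C * L ^+ d))).
 by rewrite ler_wpM2l// !mulr_ge0 ?powR_ge0 ?invr_ge0 ?exprn_ge0 ?(ltW c0) ?(ltW C0)// ltW.
apply: le_trans (hc L n L1 nL x xj).
have sn : n%:R / L != 0 by rewrite gt_eqF.
rewrite opprD powRD ?sn ?implybT//.
rewrite [_ `^ (- d%:R)]powRN powR_mulrn ?(ltW s0)// expr_div_n invf_div.
apply: le_of_eq.
by move: (_ `^ (- alpha)) => q; field; rewrite !expf_neq0 ?gt_eqF.
Qed.

End profile.

Section profile_infrared.
Variables (R : realType) (d : nat) (alpha : R) (h : 'rV[R]_d -> R).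
Hypotheses (alpha_gt0 : 0 < alpha) (d_gt0 : (0 < d)%N) (hP : step_profile alpha h)
 (dim : 2 * Num.min alpha 2 < d%:R).
Local Notation Zd := 'rV[int]_d.
Let a : R := Num.min alpha 2.

Lemma a_gt0 : 0 < a. Proof. by rewrite /a lt_min alpha_gt0/=. Qed.

(** Translating by [t], the integer part of [pi / th], brings the phase to order one. If [t] is at
    most of order [L], the cube at scale [L] gives a constant. Beyond that, the heavy tail for
    [alpha < 2] supplies the cube at scale [t], while for [alpha >= 2] a translation of order [L]
    gives the square of [L * th]. *)
Lemma gap_lower : exists2 c : R, 0 < c & forall L (k : 'rV[R]_d) i th, 1 <= L -> 0 < th -> th <= pi ->
 (forall t : nat, cos (t%:R * k 0 i) = cos (t%:R * th)) ->
 c * Num.min 1 ((L * th) `^ a) <= gap (step_dist h L) k.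
Proof.
have [c [r [c0 r1 hc]]] := step_dist_cube alpha_gt0 d_gt0 hP.
have pi0 := pi_gt0 R; have r0 : 0 < r by apply: lt_le_trans r1.
pose A := c / 4 * (2 * r) `^ (- alpha).
have A0 : 0 < A by rewrite mulr_gt0 ?divr_gt0 ?powR_gt0 ?mulr_gt0.
pose B := c / 16 * pi `^ (- alpha).
have B0 : 0 < B by rewrite mulr_gt0 ?divr_gt0 ?powR_gt0.
(* One constant for each of the three cases. *)
pose e := Num.min (Num.min (A / 4) B) (A / pi ^+ 2).
have e0 : 0 < e by rewrite !lt_min B0 !divr_gt0// exprn_gt0.
exists e => // L k i th L1 th0 thpi ck.
have L0 : 0 < L by apply: lt_le_trans L1.
have Lth0 : 0 < L * th by rewrite mulr_gt0.
have [n0 [n1 n2 n3]] := ceil_scale r1 L1.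
have cube n t : r * L <= n%:R -> (t <= n)%N -> (0 < n)%N ->
  c / 4 * (n%:R / L) `^ (- alpha) * (1 - cos (t%:R * th)) <= gap (step_dist h L) k.
 move=> hn tn np; rewrite -ck -[c / 4 * _]mulrAC.
 apply: (@gap_ge_cube _ _ _ _ _ (c * (n%:R / L) `^ (- alpha)) n) => //.
 - by move=> x; exact: step_dist_ge0 hP _ _ L1.
 - exact: step_dist_summ hP _ L1.
 - by rewrite mulr_ge0 ?powR_ge0 ?(ltW c0).
 - exact: hc.
have Le1 : forall x : R, Num.min 1 x <= 1 by move=> x; rewrite ge_min lexx.
have m0 : 0 <= Num.min 1 ((L * th) `^ a) by rewrite le_min ler01 powR_ge0.
have An0 : A <= c / 4 * (n0%:R / L) `^ (- alpha).
 have n0p : 0 < n0%:R :> R by rewrite ltr0n.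
 have p0 : 0 < n0%:R / L by rewrite divr_gt0.
 rewrite ler_pM2l ?divr_gt0// !powRN lef_pV2 ?posrE ?powR_gt0 ?p0 ?mulr_gt0//.
 rewrite ge0_ler_powR ?nnegrE ?(ltW p0) ?(ltW alpha_gt0) ?mulr_ge0 ?(ltW r0)//.
 by rewrite ler_pdivrMr.
pose t := Num.truncn (pi / th).
have pt1 : 1 <= pi / th by rewrite ler_pdivlMr ?mul1r.
have /andP[t1 t2] := truncn_itv (le_trans ler01 pt1); rewrite -/t in t1 t2.
have tgt0 : (0 < t)%N by rewrite /t -[leqLHS]/(1%N) -(@truncn1 R) le_truncn.
have tth1 : t%:R * th <= pi by rewrite -ler_pdivlMr.
have tth2 : pi / 2 <= t%:R * th.
 move: t2; rewrite ltr_pdivrMr// -natr1 mulrDl mul1r => t2.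
 have : th <= t%:R * th by rewrite ler_peMl ?(ltW th0)// ler1n.
 lra.
have quarter : 1 / 4 <= 1 - cos (t%:R * th).
 apply: le_trans (onecos_lower _ tth1); last by apply: le_trans tth2; rewrite divr_ge0// ltW.
 rewrite ler_pdivlMr ?exprn_gt0//.
 have -> : 1 / 4 * pi ^+ 2 = (pi / 2) ^+ 2 :> R by field.
 by rewrite lerXn2r ?nnegrE ?divr_ge0 ?(ltW pi0)//; apply: le_trans tth2; rewrite divr_ge0// ltW.
have [tn|nt] := leqP t n0.
 apply: le_trans (cube n0 t n1 tn n3).
 apply: (le_via (A / 4)).
  apply: (le_via (e * 1)); first by rewrite ler_pM2l.
  by rewrite mulr1 /e !ge_min lexx.
 rewrite [A / 4](_ : _ = A * (1 / 4)); last by rewrite mul1r.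
 by apply: ler_pM; rewrite ?(ltW A0) ?divr_ge0.
have n0t : n0%:R <= t%:R :> R by rewrite ler_nat ltnW.
have [a2|a2] := ltP alpha 2.
 apply: le_trans (cube t t (le_trans n1 n0t) (leqnn t) tgt0).
 have aE : a = alpha by rewrite /a min_l// ltW.
 apply: (le_via (B * (L * th) `^ a)).
  apply: ler_pM; rewrite ?(ltW e0) ?m0//; first by rewrite /e !ge_min lexx orbT.
  by rewrite ge_min lexx orbT.
 apply: (le_via (c / 4 * (t%:R / L) `^ (- alpha) * (1 / 4))); last first.
  by rewrite ler_wpM2l// mulr_ge0 ?powR_ge0// divr_ge0// ltW.
 have tL0 : 0 < t%:R / L by rewrite divr_gt0// ltr0n.
 have q0 : 0 < pi / (L * th) by rewrite divr_gt0.
 have -> : B * (L * th) `^ a = c / 16 * (pi / (L * th)) `^ (- alpha).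
  rewrite /B aE powRM ?invr_ge0 ?(ltW pi0) ?(ltW Lth0)// -mulrA; congr (_ * (_ * _)).
  by rewrite -[in RHS]powR_inv1 ?(ltW Lth0)// -powRrM mulN1r opprK.
 have -> : c / 4 * (t%:R / L) `^ (- alpha) * (1 / 4) = c / 16 * (t%:R / L) `^ (- alpha) by field.
 rewrite ler_pM2l ?divr_gt0// !powRN lef_pV2; [|rewrite posrE; exact: powR_gt0..].
 apply: ge0_ler_powR; rewrite ?nnegrE ?(ltW alpha_gt0) ?(ltW tL0) ?(ltW q0)//.
 rewrite ler_pdivrMr// (_ : pi / (L * th) * L = pi / th) ?ler_pdivlMr//.
 by field; rewrite !gt_eqF.
apply: le_trans (cube n0 n0 n1 (leqnn _) n3).
have aE : a = 2 by rewrite /a min_r.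
have u1 : n0%:R * th <= pi by apply: le_trans tth1; rewrite ler_wpM2r// ltW.
have u0 : 0 <= n0%:R * th by rewrite mulr_ge0// ltW.
apply: (le_via (A * ((n0%:R * th) ^+ 2 / pi ^+ 2))); last first.
 apply: ler_pM => //; [exact: ltW|by rewrite divr_ge0 ?exprn_ge0// ltW|exact: onecos_lower].
apply: (le_via (A / pi ^+ 2 * (L * th) ^+ 2)).
 apply: ler_pM; rewrite ?(ltW e0) ?m0//; first by rewrite /e !ge_min lexx !orbT.
 by rewrite ge_min aE powR_mulrn ?(ltW Lth0)// lexx orbT.
rewrite -[leLHS]mulrA ler_pM2l// [leLHS]mulrC ler_pM2r ?invr_gt0 ?exprn_gt0//.
rewrite lerXn2r ?nnegrE ?(ltW Lth0)// ler_wpM2r ?(ltW th0)//.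
by apply: le_trans n1; rewrite ler_peMl// ltW.
Qed.

(** The share of one coordinate in the singularity of [gap ^- 2]. It is below 1, hence summable near
    the origin, exactly when [d > 2 * a]. *)
Let ga : R := 2 * a / d%:R.

Lemma ga_ge0 : 0 <= ga.
Proof. by rewrite divr_ge0// mulr_ge0// ltW// a_gt0. Qed.

Lemma ga_lt1 : ga < 1.
Proof. by rewrite ltr_pdivrMr ?ltr0n// mul1r. Qed.

Definition torus_dist (M q : nat) : nat := minn q (M.+1 - q).

(** With [theta] the angle of the grid index, [j / la] is [L * theta]: the weight is its power
    [- ga] where this is below 1. The [maxn] keeps the index at distance 0 from being singular. *)
Definition axis_weight (L : R) M q : R :=
 let la := M.+1%:R / (2 * pi * L) in
 let j := maxn 1 (torus_dist M q) in
 if j%:R < la then (j%:R / la) `^ (- ga) else 0.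

Lemma axis_weight_ge0 L M q : 0 <= axis_weight L M q.
Proof. by rewrite /axis_weight; case: ifP => // _; rewrite powR_ge0. Qed.

Lemma axis_weight_sum L M : 1 <= L ->
 \sum_(q < M.+1) axis_weight L M q <= 3 / (1 - ga) * (M.+1%:R / L).
Proof.
move=> L1; have L0 : 0 < L by apply: lt_le_trans L1.
have pi0 := pi_gt0 R; have g1 := ga_lt1; have g0 := ga_ge0.
set la := M.+1%:R / (2 * pi * L).
have la0 : 0 < la by rewrite divr_gt0// !mulr_gt0.
pose g (j : nat) : R := if j%:R < la then (j%:R / la) `^ (- ga) else 0.
have gp j : 0 <= g j by rewrite /g; case: ifP => // _; rewrite powR_ge0.
pose S := \sum_(j < M.+1) g j.+1.
have S0 : 0 <= S by apply: sumr_ge0 => j _.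
have g1S : g 1%N <= S by rewrite /S big_ord_recl/= lerDl; apply: sumr_ge0 => j _.
have SE : S <= 2 * la / (1 - ga).
 have -> : S = la `^ ga * \sum_(j < M.+1) (if j.+1%:R < la then j.+1%:R `^ (- ga) else 0).
  rewrite /S mulr_sumr; apply: eq_bigr => j _; rewrite /g; case: ifP => _; last by rewrite mulr0.
  rewrite powRM ?ler0n ?invr_ge0 ?(ltW la0)// mulrC; congr (_ * _).
  by rewrite -powR_inv1 ?(ltW la0)// -powRrM mulN1r opprK.
 apply: (le_via (la `^ ga * (2 / (1 - ga) * la `^ (1 - ga)))).
  by rewrite ler_wpM2l ?powR_ge0// sum_neg_power.
 have -> : 2 * la / (1 - ga) = 2 / (1 - ga) * (la `^ ga * la `^ (1 - ga)).
  by rewrite -powRD ?(gt_eqF la0) ?implybT// [ga + _]addrC subrK powRr1 ?(ltW la0)// mulrAC.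
 by apply: le_of_eq; ring.
have step (q : 'I_M.+1) : axis_weight L M q <= g (maxn 1 q) + g (M.+1 - q)%N.
 rewrite /axis_weight -/la -/(g _) /torus_dist.
 have qM := ltn_ord q; rewrite /minn; case: ifP => _; first by rewrite lerDl.
 by rewrite (maxn_idPr _) ?subn_gt0// lerDr.
apply: (le_via (3 * S)).
 apply: (le_via (\sum_(q < M.+1) (g (maxn 1 q) + g (M.+1 - q)%N))); first by apply: ler_sum => q _.
 rewrite big_split/= big_ord_recl/= maxn0.
 have h1 : \sum_(i < M) g (maxn 1 (bump 0 i)) <= S.
  rewrite /S big_ord_recr/= (eq_bigr (fun i : 'I_M => g i.+1)) ?lerDl// => i _.
  by congr g; rewrite /bump/= add1n; apply/maxn_idPr.
 have h2 : \sum_(i < M.+1) g (M.+1 - i)%N = S.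
  rewrite (reindex_inj rev_ord_inj)/=; apply: eq_bigr => i _; congr g.
  by have := ltn_ord i; move: (nat_of_ord i) => q; clear; lia.
 by rewrite h2; lra.
apply: (le_via (3 * (2 * la / (1 - ga)))); first by rewrite ler_pM2l.
have -> : 3 * (2 * la / (1 - ga)) = 3 / (1 - ga) * (M.+1%:R / L) / pi.
 have gn : 1 - ga != 0 by rewrite gt_eqF// subr_gt0.
 have fieldI (p m l G : R) : p != 0 -> l != 0 -> G != 0 -> 3 * (2 * (m / (2 * p * l)) / G) = 3 / G * (m / l) / p.
  by move=> p0 l0 G0; field; rewrite p0 l0.
 by apply: fieldI; rewrite ?gn ?gt_eqF.
rewrite ler_pdivrMr// ler_peMr//; last by have := pi_ge2 R; lra.
by rewrite !mulr_ge0 ?invr_ge0 ?ler0n ?(ltW L0)// subr_ge0 ltW.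
Qed.

(** The grid sum is a product of [d] one-dimensional sums, each of order the grid size over [L]. *)
Lemma avg_axis_weight L M : 1 <= L ->
 (#|{: 'rV['I_M.+1]_d}|%:R)^-1 * \sum_(j : 'rV['I_M.+1]_d) \prod_i axis_weight L M (j 0 i)
  <= (3 / (1 - ga)) ^+ d / L.
Proof.
move=> L1; have L0 : 0 < L by apply: lt_le_trans L1.
have g1 := ga_lt1; have b0 : 0 <= 3 / (1 - ga) by rewrite divr_ge0// subr_ge0 ltW.
rewrite grid_prod_sum card_J natrX -exprVn -exprMn.
apply: (le_via ((3 / (1 - ga) / L) ^+ d)).
 have bL : 0 <= 3 / (1 - ga) / L by rewrite divr_ge0// ltW.
 rewrite lerXn2r ?nnegrE ?bL//.
  by rewrite mulr_ge0// sumr_ge0// => q _; exact: axis_weight_ge0.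
 have i0 : 0 <= M.+1%:R^-1 :> R by rewrite invr_ge0.
 apply: (le_trans (ler_wpM2l i0 (axis_weight_sum M L1))).
 by rewrite mulrCA [M.+1%:R^-1 * _]mulrA mulVf ?mul1r.
rewrite expr_div_n ler_wpM2l ?exprn_ge0// lef_pV2 ?posrE ?exprn_gt0//.
by apply: ler_eXnr.
Qed.

Lemma cos_nat_2pi (t n : nat) (u : R) : cos (t%:R * (n%:R * (2 * pi) - u)) = cos (t%:R * u).
Proof.
have -> : t%:R * (n%:R * (2 * pi) - u) = - (t%:R * u) + ((t * n)%N%:Z)%:~R * (2 * pi).
 by rewrite -[_%:~R]/((t * n)%N%:R) natrM; ring.
by rewrite cos_2pi_int cosN.
Qed.

Lemma torus_dist_cos M q (t : nat) : (q < M.+1)%N ->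
 cos (t%:R * (2 * pi / M.+1%:R * q%:R)) = cos (t%:R * (2 * pi * (torus_dist M q)%:R / M.+1%:R)) :> R.
Proof.
move=> qM; rewrite /torus_dist /minn; case: ifP => _; first by congr cos; ring.
rewrite -(cos_nat_2pi t 1) mul1r natrB; last exact: ltnW.
by congr cos; congr (_ * _); field.
Qed.

(** Here [gap_lower] is applied to the coordinate of largest torus distance. The power [- 2 * a] of
    [L * th] is then split into [d] equal factors, each at most the weight of its own coordinate,
    because a smaller distance has a larger weight. *)
Lemma inv_gap_le : exists2 c : R, 0 < c & forall L M (j : 'rV['I_M.+1]_d), 1 <= L ->
 (j != 0 -> 0 < gap (step_dist h L) (freq R M (lift_idx j))) /\
 (gap (step_dist h L) (freq R M (lift_idx j)))^-2 <= c * (1 + \prod_i axis_weight L M (j 0 i)).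
Proof.
have [c c0 hc] := gap_lower; exists (c^-2); first by rewrite invr_gt0 exprn_gt0.
move=> L M j L1; have L0 : 0 < L by apply: lt_le_trans L1.
have pi0 := pi_gt0 R; set k := freq _ _ _; set gp := gap _ _.
have P0 : 0 <= \prod_i axis_weight L M (j 0 i) by apply: prodr_ge0 => i _; exact: axis_weight_ge0.
have ci0 : 0 <= c^-2 by rewrite invr_ge0 exprn_ge0// ltW.
have [j0|jn] := eqVneq j 0.
 have -> : gp = 0.
  rewrite /gp (_ : k = 0); last by apply/rowP => i; rewrite /k j0 !mxE mulr0.
  rewrite /gap asum_eq0// => x.
  by rewrite ldot0l cos0 subrr mulr0.
 (* The zero mode has gap 0, and the convention [0^-1 = 0] makes its bound trivial. *)
 by split=> //; rewrite expr0n invr0 mulr_ge0// addr_ge0.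
pose td i := torus_dist M (j 0 i).
have m0 : 0 < M.+1%:R :> R by [].
case: (@arg_maxnP _ (Ordinal d_gt0) xpredT td isT) => i0 _ imax.
set q0 := td i0; have q01 : (0 < q0)%N.
 have [i ji] : exists i, j 0 i != 0.
  apply/existsP; rewrite -negb_forall; apply: contraNN jn => /forallP H.
  by apply/eqP/rowP => i; rewrite mxE; apply/eqP.
 apply: leq_trans (imax i isT); rewrite /td /torus_dist leq_min subn_gt0 ltn_ord andbT lt0n.
 by apply: contraNN ji => /eqP e; apply/eqP/val_inj.
pose th : R := 2 * pi * q0%:R / M.+1%:R.
have th0 : 0 < th by rewrite divr_gt0// !mulr_gt0// ltr0n.
have thpi : th <= pi.
 rewrite ler_pdivrMr// mulrAC [leRHS]mulrC ler_pM2r// -natrM ler_nat /q0 /td /torus_dist.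
 by have := ltn_ord (j 0 i0); move: (nat_of_ord _) => q; clear; lia.
have ck t : cos (t%:R * k 0 i0) = cos (t%:R * th).
 by rewrite /k !mxE; apply: torus_dist_cos.
have := hc L k i0 th L1 th0 thpi ck; rewrite -/gp; set mu := Num.min _ _ => hmu.
have Lth : 0 < L * th by rewrite mulr_gt0.
have mu0 : 0 < mu by rewrite lt_min ltr01/= powR_gt0.
have gp0 : 0 < gp by apply: lt_le_trans hmu; rewrite mulr_gt0.
split=> //; apply: (le_via (c^-2 * mu^-2)).
 rewrite -invfM -exprMn lef_pV2 ?posrE ?exprn_gt0 ?mulr_gt0//.
 by rewrite lerXn2r ?nnegrE ?mulr_ge0 ?(ltW c0) ?(ltW mu0) ?(ltW gp0).
rewrite ler_wpM2l//; have [h1|h1] := leP 1 (L * th).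
 rewrite /mu min_l; first by rewrite expr1n invr1 lerDl.
 have := @ge0_ler_powR R a (ltW a_gt0) 1 (L * th); rewrite powR1; apply; rewrite ?nnegrE ?(ltW Lth)//.
have -> : mu^-2 = \prod_(i < d) (L * th) `^ (- ga).
 rewrite prodr_const card_ord -powR_mulrn ?powR_ge0// -powRrM mulNr divfK ?pnatr_eq0 -?lt0n//.
 rewrite /mu min_r; last first.
  have := @ge0_ler_powR R a (ltW a_gt0) (L * th) 1; rewrite powR1; apply; rewrite ?nnegrE ?(ltW Lth)//.
  exact: ltW.
 by rewrite powRN -powR_mulrn ?powR_ge0// -powRrM [a * _]mulrC.
rewrite -[leLHS]add0r lerD//; apply: ler_prod => i _; rewrite powR_ge0/=.
rewrite /axis_weight; set la := _ / _; set q := maxn _ _.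
have la0 : 0 < la by rewrite divr_gt0// !mulr_gt0.
have qq : (q <= q0)%N by rewrite /q geq_max q01; exact: imax.
have qL : q%:R / la <= L * th.
 have -> : L * th = q0%:R / la by rewrite /la /th invf_div; ring.
 by rewrite ler_pM2r ?invr_gt0// ler_nat.
have q1 : (0 < q)%N by rewrite /q leq_max.
rewrite ifT; last by rewrite -[la]mul1r -ltr_pdivrMr//; exact: le_lt_trans h1.
have ql0 : 0 < q%:R / la by rewrite divr_gt0// ltr0n.
rewrite !powRN lef_pV2; [|rewrite posrE; exact: powR_gt0..].
by apply: ge0_ler_powR; rewrite ?nnegrE ?ga_ge0 ?(ltW ql0) ?(ltW Lth).
Qed.

End profile_infrared.

(** * Grid averages of the step distribution *)

Section grid_average.
Variables (R : realType) (d : nat).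
Local Notation Zd := 'rV[int]_d.

Lemma Achar_eq0 M (y : Zd) i : y 0 i != 0 -> (`|y 0%R i| < M.+1)%N -> Achar R M y = 0.
Proof.
move=> yi yM; have := Achar_cos R M (delta_mx 0 i) y.
set u := ldot _ _.
have uE : u = 2 * pi / M.+1%:R * (y 0 i)%:~R.
 rewrite /u /ldot /dot (bigD1 i)//= big1 ?addr0; last first.
  by move=> j ji; rewrite !mxE (negPf ji) andbF mulr0 mul0r.
 by rewrite !mxE !eqxx mulr1.
have cu : cos u < 1.
 have -> : cos u = cos (2 * pi / M.+1%:R * `|(y 0 i)%:~R|).
  by rewrite uE; case: (leP 0 ((y 0 i)%:~R : R)) => h0; rewrite ?(ger0_norm h0)// (ltr0_norm h0) mulrN cosN.
 have pi0 := pi_gt0 R; apply: cos_eq1_small.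
  by rewrite mulr_gt0 ?divr_gt0 ?mulr_gt0// normr_gt0 intr_eq0.
 rewrite mulrAC ltr_pdivrMr// ltr_pM2l ?mulr_gt0//.
 by rewrite -intr_norm -abszE -[ltLHS]/((`|y 0%R i|%N)%:R) ltr_nat.
move=> /eqP; rewrite -subr_eq0 -[X in _ - X]mulr1 -mulrBr mulf_eq0 => /orP[/eqP//|].
by rewrite subr_eq0 => /eqP e; rewrite e ltxx in cu.
Qed.

(* For a large grid only the return probability [conv D D 0] survives in the
  average of the square of the Fourier transform. *)
Lemma avg_sqr_fh (D : Zd -> R) B del : (forall x, 0 <= D x) -> summ D -> asum setT D = 1 ->
 even_fun D -> (forall x, D x <= B) -> 0 < del ->
 exists K : nat, forall M, (K <= M)%N -> avg M (fun q => fh D (freq R M q) ^+ 2) <= B + del.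
Proof.
move=> D0 sD D1 eD DB d0; have sDD : summ (Defs.conv D D) by exact: conv_summ.
have eDD : even_fun (Defs.conv D D).
 move=> y; rewrite /Defs.conv -[LHS](asum_opp (fun w => D w * D (- y - w))); apply: eq_asum => w.
 by rewrite eD -opprB eD opprK addrC.
have DD0 x : 0 <= Defs.conv D D x by apply: asum_ge0 => y; rewrite mulr_ge0.
have [s us hs] := asum_tail_le sDD d0.
pose K : nat := \max_(y <- s) \max_i `|y 0%R i|%N.
exists K => M KM.
have -> : avg M (fun q => fh D (freq R M q) ^+ 2)
  = avg M (fun q => fh (Defs.conv D D) (freq R M q) * cos (ldot (freq R M q) 0)).
 by apply: eq_avg => q; rewrite ldot0r cos0 mulr1 fh_conv// expr2.
rewrite avg_fh_cos//.
have h0 y : `|Defs.conv D D y * Achar R M (y - 0)| <= `|Defs.conv D D y|.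
 by rewrite subr0 normrM ler_piMr// ger0_norm ?Achar_ge0 ?Achar_le1.
have := hs _ h0; rewrite ler_norml => /andP[_]; rewrite lerBlDl => /le_trans; apply; rewrite lerD2r.
have DD0B : Defs.conv D D 0 <= B.
 rewrite /Defs.conv -[leRHS]mul1r -D1 -asumZr//; apply: asum_le => //.
 - exact: conv_term_summ.
 - exact: summZr.
 - by move=> y; rewrite ler_wpM2l.
have B0 : 0 <= B by apply: le_trans (DB 0).
have z0 y : y \in s -> y != 0 -> Defs.conv D D y * Achar R M (y - 0) = 0.
 move=> ys yn; rewrite subr0.
 have [i yi] : exists i, y 0 i != 0.
  apply/existsP; rewrite -negb_forall; apply: contraNN yn => /forallP H.
  by apply/eqP/rowP => i; rewrite mxE; apply/eqP.
 rewrite (Achar_eq0 yi) ?mulr0// ltnS; apply: leq_trans KM.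
 apply: leq_trans (@leq_bigmax_seq _ s xpredT (fun y : Zd => \max_i `|y 0%R i|%N) y ys isT).
 exact: (leq_bigmax i).
have [s0|s0] := boolP (0 \in s).
 rewrite (bigD1_seq 0)//= big_seq_cond big1 ?addr0; last by move=> y /andP[ys yn]; exact: z0.
 by apply: le_trans DD0B; rewrite ler_piMr ?Achar_le1.
rewrite big_seq big1// => y ys; apply: z0 => //.
by apply: contraNN s0 => /eqP <-.
Qed.

(** The pointwise inequality [x <= del / 2 + x ^ 2 / (2 * del)] plays the role of Cauchy-Schwarz. *)
Lemma avg_abs_fh (D : Zd -> R) B del M : 0 < del ->
 avg M (fun q => fh D (freq R M q) ^+ 2) <= B ->
 avg M (fun q => `|fh D (freq R M q)|) <= del / 2 + (2 * del)^-1 * B.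
Proof.
move=> d0 hB; apply: (le_via (avg M (fun q => del / 2 + (2 * del)^-1 * fh D (freq R M q) ^+ 2))).
 apply: avg_le => q; move: (fh D _) => u; rewrite -(real_normK (num_real u)).
 move: `|u| => x; rewrite -subr_ge0.
 have -> : del / 2 + (2 * del)^-1 * x ^+ 2 - x = (2 * del)^-1 * (del - x) ^+ 2.
  by field; rewrite gt_eqF.
 by rewrite mulr_ge0 ?sqr_ge0// invr_ge0 mulr_ge0// ltW.
by rewrite avgD avg_cst avgZ lerD2l ler_wpM2l// invr_ge0 mulr_ge0// ltW.
Qed.

End grid_average.

(** Multiply [inv_gap_le] by the modulus of [fh D]. The constant part is small on average because
    the mean square of [fh D] is essentially a return probability, at most the supremum of [D],
    which is of order [1 / L]; the singular part has an average of order [1 / L] by itself. The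
    constant [C1] does not depend on [L]. *)
Theorem infrared_step_dist (R : realType) (d : nat) (alpha : R) (h : 'rV[R]_d -> R) :
 0 < alpha -> (0 < d)%N -> step_profile alpha h -> 2 * Num.min alpha 2 < d%:R ->
 exists2 C1 : R, 0 <= C1 & forall eta, 0 < eta -> exists2 L0 : R, 1 <= L0 &
  forall L, L0 <= L -> infrared (step_dist h L) C1 eta.
Proof.
move=> al d0 hP dim.
have [c c0 hc] := inv_gap_le al d0 hP.
have [B B0 hB] := step_dist_sup al d0 hP.
pose T : R := (3 / (1 - 2 * Num.min alpha 2 / d%:R)) ^+ d.
have T0 : 0 <= T.
 rewrite exprn_ge0// divr_ge0// subr_ge0 ltW//; exact: ga_lt1.
exists (c * (1 + T)); first by rewrite mulr_ge0 ?(ltW c0)// addr_ge0.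
move=> eta eta0; pose del := eta / c.
have del0 : 0 < del by rewrite divr_gt0.
pose L0 := Num.max 1 (Num.max (2 * T / del) (8 * B / del ^+ 2)).
exists L0; first by rewrite /L0 le_max lexx.
move=> L; rewrite !ge_max => /and3P[L1 LT LB] K P.
have Lp : 0 < L by apply: lt_le_trans L1.
pose D := step_dist h L.
have D0 x : 0 <= D x by exact: (step_dist_ge0 al d0 hP).
have sD : summ D by exact: (step_dist_summ al d0 hP).
have D1 : asum setT D = 1 by exact: (step_dist_sum1 al d0 hP).
have De : even_fun D by move=> x; exact: (step_dist_even hP).
have e8 : 0 < del ^+ 2 / 8 by rewrite divr_gt0// exprn_gt0.
have [X hX] := avg_sqr_fh D0 sD D1 De (fun x => hB L x L1) e8.
(* A refinement of the grid [P] that exceeds both the threshold [X] of [avg_sqr_fh] and the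
   requested [K]. *)
pose M := (P.+1 * (X + K).+1).-1.
have ME : M.+1 = (P.+1 * (X + K).+1)%N by rewrite prednK// muln_gt0.
have MK : (X + K <= M)%N by rewrite -ltnS ME leq_pmull.
exists M; split.
- by rewrite ME dvdn_mulr.
- by apply: leq_trans MK; rewrite leq_addl.
- by move=> j jn; have [h1 _] := hc L M j L1; exact: h1.
- apply: (le_via (c * (1 + T / L))); last first.
  by rewrite ler_pM2l// lerD2l ler_pdivrMr// ler_peMr.
 apply: (le_via ((#|{: 'rV['I_M.+1]_d}|%:R)^-1 * \sum_(j : 'rV['I_M.+1]_d) c * (1 + \prod_i axis_weight d alpha L M (j 0 i)))).
  rewrite /avg ler_wpM2l ?invr_ge0//; apply: ler_sum => j _; exact: (hc L M j L1).2.
 rewrite -mulr_sumr mulrCA ler_pM2l// big_split/= mulrDr lerD//; last exact: avg_axis_weight.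
 by rewrite sumr_const -[X in _ * X]mulr_natr mul1r mulVf// gt_eqF// card_J_gt0.
have TL : T / L <= del / 2.
 by rewrite ler_pdivrMr// mulrC -ler_pdivrMr ?divr_gt0// invf_div mulrA [T * 2]mulrC.
have BL : B / L <= del ^+ 2 / 8.
 by rewrite ler_pdivrMr// mulrC -ler_pdivrMr// invf_div mulrA [B * 8]mulrC.
have a1 : avg M (fun q => `|fh D (freq R M q)|) <= del / 2.
 have := hX M (leq_trans (leq_addr _ _) MK) => /(avg_abs_fh (_ : 0 < del / 2)).
 rewrite divr_gt0// => /(_ isT)/le_trans; apply.
 apply: (le_via (del / 2 / 2 + (2 * (del / 2))^-1 * (del ^+ 2 / 8 + del ^+ 2 / 8))).
  by rewrite lerD2l ler_wpM2l ?lerD2r// invr_ge0 mulr_ge0// divr_ge0// ltW.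
 by apply: le_of_eq; field; rewrite gt_eqF.
apply: (le_via (c * (avg M (fun q => `|fh D (freq R M q)|) + T / L))); last first.
 have -> : eta = c * (del / 2 + del / 2) by rewrite /del; field; rewrite gt_eqF.
 by rewrite ler_pM2l// lerD.
rewrite mulrDr -avgZ.
apply: (le_via (avg M (fun q => c * `|fh D (freq R M q)|) + c * ((#|{: 'rV['I_M.+1]_d}|%:R)^-1 * \sum_(j : 'rV['I_M.+1]_d) \prod_i axis_weight d alpha L M (j 0 i)))); last first.
 by rewrite lerD2l ler_pM2l//; exact: avg_axis_weight.
rewrite mulrCA /avg -mulrDr ler_wpM2l ?invr_ge0// mulr_sumr -big_split/=; apply: ler_sum => j _.
have [_ h1] := hc L M j L1; have := ler_wpM2l (normr_ge0 (fh D (freq R M (lift_idx j)))) h1.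
move=> /le_trans; apply; rewrite -mulrDr mulrCA ler_pM2l// mulrDr mulr1 lerD2l ler_piMl//.
 by apply: prodr_ge0 => i _; exact: axis_weight_ge0.
apply: (le_trans (fh_norm_le _ sD)); rewrite -[leRHS]D1.
by rewrite (eq_asum_to D)// => x; rewrite ger0_norm.
Qed.

(** * Translation of the definitions in the statement *)

Section statement_link.
Variables (R : realType) (d : nat) (D : 'rV[int]_d -> R).
Local Notation Zd := 'rV[int]_d.
Local Notation E := (expect D).
Hypotheses (D_ge0 : forall x, 0 <= D x)
 (D_summ : summ D)
 (D_sum1 : asum setT D = 1)
 (D_even : forall x, D (- x) = D x)
 (D_zero : D 0 = 0).

Definition sites n (ys : seq Zd) : n.+1.-tuple Zd := [tuple walk ys i | i < n.+1].

Lemma sites_nth n ys i : (i <= n)%N -> (sites n ys)`_i = walk ys i.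
Proof.
move=> ni; rewrite -ltnS in ni.
by rewrite -[LHS](tnth_nth 0 (sites n ys) (Ordinal ni)) tnth_mktuple.
Qed.

Lemma sites_bij n : set_bij setT [set w : n.+1.-tuple Zd | w`_0 = 0]
 (fun ys : n.-tuple Zd => sites n ys).
Proof.
split.
- by move=> ys _ /=; rewrite sites_nth// walk0.
- move=> ys zs _ _ e; apply: eq_from_tnth => i.
 have h j : (j <= n)%N -> walk ys j = walk zs j by move=> jn; rewrite -!(sites_nth _ jn) e.
 have := h i.+1 (ltn_ord i); rewrite !walkS ?size_tuple// (h i (ltnW (ltn_ord i))) => /addrI.
 by rewrite !(tnth_nth 0).
- move=> w w0; pose ys := [tuple w`_i.+1 - w`_i | i < n]; exists ys => //.
 have h j : (j <= n)%N -> walk ys j = w`_j.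
  elim: j => [|j IH] jn; first by rewrite walk0 w0.
  rewrite walkS ?size_tuple// IH ?(ltnW jn)//.
  rewrite -[X in _ + X](tnth_nth 0 ys (Ordinal jn)) tnth_mktuple /=.
  by rewrite addrC subrK.
 by apply: eq_from_tnth => i; rewrite tnth_mktuple (h i (ltn_ord i)) (tnth_nth 0).
Qed.

Lemma saw_weight_sites n (ys : n.-tuple Zd) : saw_weight D (sites n ys) = step_weight D ys * sawf R n ys.
Proof.
rewrite /saw_weight; congr (_ * _).
 rewrite /step_weight (big_nth 0) size_tuple big_mkord; apply: eq_bigr => i _; congr D.
 by rewrite !sites_nth ?(ltnW (ltn_ord i))//; rewrite walkS ?size_tuple// addrC addKr.
rewrite /sawf /saw_on leq0n andTb; congr (_%:R); congr nat_of_bool; congr uniq.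
apply: (@eq_from_nth _ 0) => [|i]; rewrite size_tuple ?size_map ?size_iota// => hi.
by rewrite sites_nth// (nth_map 0%N) ?size_iota// nth_iota.
Qed.

Lemma asum_walks n (F : seq Zd -> R) (G : n.+1.-tuple Zd -> R) :
 (forall ys : n.-tuple Zd, G (sites n ys) = F ys) ->
 asum [set w : n.+1.-tuple Zd | w`_0 = 0] (fun w => saw_weight D w * G w) =
 E n (fun ys => sawf R n ys * F ys).
Proof.
move=> GF; rewrite (asum_reindex _ (@sites_bij n)); apply: eq_asum => ys /=.
by rewrite saw_weight_sites GF mulrA.
Qed.

Lemma saw_csaw n : saw D n = csaw D n.
Proof.
apply/funext => x; rewrite /saw asum_mkcond.
rewrite /csaw -(@asum_walks n (fun ys => (pos ys == x)%:R) (fun w => (w`_n == x)%:R)).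
 rewrite [RHS]asum_mkcond; apply: eq_asum => w.
 have [h1|h1] := eqVneq w`_0 0; last first.
  rewrite !ifF//; apply/negbTE/negP; rewrite inE/=; first by move=> e; rewrite e eqxx in h1.
  by case=> e; rewrite e eqxx in h1.
 rewrite [in RHS]ifT ?inE//; have [h2|h2] := eqVneq w`_n x.
  by rewrite ifT ?inE// mulr1.
 rewrite mulr0 ifF//; apply/negbTE/negP; rewrite inE/= => -[_ e].
 by rewrite e eqxx in h2.
by move=> ys; rewrite sites_nth// -walk_size size_tuple.
Qed.

Lemma saw_total_ctot n : saw_total D n = ctot D n.
Proof. by rewrite /saw_total saw_csaw csaw_sum. Qed.

Lemma z_crit_zcrit : z_crit D = zcrit D.
Proof.
have e z : (fun n => saw_total D n * z ^+ n) = (fun n => ctot D n * z ^+ n).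
 by apply/funext => n; rewrite saw_total_ctot.
rewrite /z_crit /zcrit; congr sup; apply/seteqP; split => z /= [z0 h]; split=> //.
 apply/summ_series_cvg; first by move=> n; rewrite mulr_ge0 ?exprn_ge0// ctot_ge0.
 by rewrite -e.
by rewrite e; apply/summ_series_cvg => // n; rewrite mulr_ge0 ?exprn_ge0// ctot_ge0.
Qed.

Lemma fourier_saw0 n : fourier (saw D n) (0 : 'rV[R]_d) = (ctot D n)%:C%C.
Proof.
rewrite /fourier /csum saw_csaw; apply/eqP; rewrite eq_complex /= -csaw_sum//.
have h0 x : dot (0 : 'rV[R]_d) (of_lattice R x) = 0 by exact: ldot0l.
apply/andP; split; apply/eqP.
 by apply: eq_asum => x; rewrite h0 /expi cos0 sin0 /= mulr1 mulr0 subr0.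
rewrite asum_eq0// => x.
by rewrite h0 /expi cos0 sin0 /= mulr0 mul0r addr0.
Qed.

Lemma fourier_gap (k : 'rV[R]_d) : 1 - fourier D k = (gap D k)%:C%C.
Proof.
rewrite /fourier /csum; apply/eqP; rewrite eq_complex /=; apply/andP; split; apply/eqP.
 rewrite gapE// fh0 D_sum1; congr (_ - _); apply: eq_asum => x.
 by rewrite /= mul0r subr0.
rewrite add0r; apply/eqP; rewrite oppr_eq0; apply/eqP.
rewrite -[RHS](sin_sum0 (f := D) k D_summ D_even); apply: eq_asum => x /=.
by rewrite mul0r addr0.
Qed.

Section multi_link.
Variables (mm : nat -> nat) (kk : nat -> 'rV[R]_d).
Hypothesis mm_mono : forall j, (mm j <= mm j.+1)%N.
Definition pieces a p := [seq ((mm j.+1 - mm j)%N, kk j) | j <- iota a p].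

Lemma mm_le a p : (mm a <= mm (a + p))%N.
Proof. by elim: p => [|p IH]; rewrite ?addn0// addnS (leq_trans IH). Qed.

Lemma total_pieces a p : tmax (pieces a p) = (mm (a + p) - mm a)%N.
Proof.
elim: p a => [|p IH] a; first by rewrite addn0 subnn.
rewrite /tmax /= -/(tmax (pieces a.+1 p)) IH addSnnS.
by have := mm_mono a; have := mm_le a.+1 p; rewrite addSnnS; lia.
Qed.

Lemma phase_pieces a p ys : phase (pieces a p) (drop (mm a) ys) =
 \sum_(j <- iota a p) ldot (kk j) (walk ys (mm j.+1) - walk ys (mm j)).
Proof.
elim: p a => [|p IH] a; first by rewrite big_nil.
rewrite /= big_cons drop_drop subnK// IH; congr (ldot _ _ + _).
by rewrite -[LHS]/(walk (drop (mm a) ys) (mm a.+1 - mm a)) walk_drop subnKC.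
Qed.

End multi_link.

(** The imaginary part vanishes by reversing all steps; the real part is the step-sequence form. *)
Lemma saw_multi_multi N (m : 'I_N.+1 -> nat) (k : 'I_N -> 'rV[R]_d) : m ord0 = 0%N ->
 (forall j : 'I_N, (m (widen_ord (leqnSn N) j) <= m (lift ord0 j))%N) ->
 let l := [seq ((m (lift ord0 j) - m (widen_ord (leqnSn N) j))%N, k j) | j <- enum 'I_N] in
 tmax l = m ord_max /\ saw_multi D m k = (multi D l)%:C%C.
Proof.
move=> m0 mono l.
(* Extends the times to all naturals, constant after [N], so that the blocks can be listed by
   [iota]. *)
pose mm j : nat := m (inord (minn j N)).
pose kk j := if insub j is Some i then k i else 0.
have mmw (j : 'I_N) : mm j = m (widen_ord (leqnSn N) j).
 by rewrite /mm; congr m; apply: val_inj; rewrite /= (minn_idPl (ltnW (ltn_ord j))) inordK// ltnS ltnW.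
have mml (j : 'I_N) : mm j.+1 = m (lift ord0 j).
 by rewrite /mm; congr m; apply: val_inj; rewrite /= (minn_idPl _) ?inordK// ltnS.
have kkE (j : 'I_N) : kk j = k j by rewrite /kk valK.
have mono' j : (mm j <= mm j.+1)%N.
 have [h|h] := ltnP j N; first by have := mono (Ordinal h); rewrite -mmw -mml.
 by rewrite /mm !(minn_idPr _)// ltnW.
have lE : l = pieces mm kk 0 N.
 rewrite /pieces -val_enum_ord -map_comp; apply: eq_map => j /=.
 by rewrite mmw mml kkE.
have mm0 : mm 0%N = 0%N by rewrite /mm min0n -[RHS]m0; congr m; apply: val_inj; rewrite /= inordK.
have mmN : mm N = m ord_max by rewrite /mm minnn; congr m; apply: val_inj; rewrite /= inordK.
have tl : tmax l = m ord_max by rewrite lE total_pieces// mm0 subn0 add0n mmN.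
split=> //; rewrite /saw_multi /csum.
have mle j : (j <= N)%N -> (mm j <= m ord_max)%N.
 by move=> jN; have := mm_le mono' j (N - j); rewrite subnKC// mmN.
pose th (w : (m ord_max).+1.-tuple Zd) : R := \sum_(j < N) dot (k j)
    (of_lattice R (w`_(m (lift ord0 j)) - w`_(m (widen_ord (leqnSn N) j)))).
have thE (ys : (m ord_max).-tuple Zd) : th (sites (m ord_max) ys) = phase l ys.
 have := phase_pieces kk mono' 0 N ys; rewrite mm0 drop0 -lE => ->.
 rewrite -val_enum_ord big_map big_enum; apply: eq_bigr => j _.
 by rewrite -mmw -mml !sites_nth ?mle ?ltn_ord ?(ltnW (ltn_ord j))// kkE.
apply/eqP; rewrite eq_complex /=; apply/andP; split; apply/eqP.
 rewrite (eq_asum_to (fun w => saw_weight D w * cos (th w))); last first.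
  by move=> w; rewrite mulr0 subr0 mulrC.
 rewrite (@asum_walks _ (fun ys => cos (phase l ys))); last by move=> ys; rewrite thE.
 by rewrite /multi tl.
rewrite (eq_asum_to (fun w => saw_weight D w * sin (th w))); last first.
 by move=> w; rewrite mulr0 add0r mulrC.
rewrite (@asum_walks _ (fun ys => sin (phase l ys))); last by move=> ys; rewrite thE.
apply: expect_sin0 => //; first exact: sawf_bnd.
- by move=> ys; rewrite sawf_opp.
- exact: phase_antisym.
Qed.

Lemma csaw_recursion n x : csaw D n.+1 x = Defs.conv D (csaw D n) x +
 \sum_(2 <= m < n.+2) Defs.conv (pin D m) (csaw D (n.+1 - m)) x.
Proof.
have bs m : bnd (sawf R m : seq Zd -> R) by exact: sawf_bnd.
have bl m : bnd (lacef R m : seq Zd -> R) by exact: lacef_bnd.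
have bx : bnd (fun ys : seq Zd => (pos ys == x)%:R : R) by exact: (bnd_bool R (fun ys => pos ys == x)).
have b1 : bnd (fun ys => 1 * sawf R n (drop 1 ys) * (pos ys == x)%:R).
 bounded.
have b2 (m : nat) : bnd (fun ys => lacef R m (take m ys) * sawf R (n.+1 - m) (drop m ys) * (pos ys == x)%:R).
 bounded.
transitivity (E n.+1 (fun ys => 1 * sawf R n (drop 1 ys) * (pos ys == x)%:R +
  \sum_(m < n.+2) lacef R m (take m ys) * sawf R (n.+1 - m) (drop m ys) * (pos ys == x)%:R)).
 by apply: (eq_expect_moving D_zero) => ys sys mv; rewrite sawf_recursion// mulrDl mul1r mulr_suml.
rewrite (expectD D_summ)//; last by apply: bnd_sum => m; exact: b2.
congr (_ + _).
 have c1 := @conv_expect R d D D_ge0 D_summ D_sum1 1 n (fun=> 1) (sawf R n) x (bnd_cst d 1) (bs n).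
 apply: (etrans (esym c1)).
 suff -> : (fun y => E 1 (fun ys => 1 * (pos ys == y)%:R)) = D by [].
 apply/funext => y; rewrite expect_one.
 rewrite (@asum_single _ _ _ y) => [|z zy]; first by rewrite pos_cons pos_nil addr0 eqxx !mulr1.
 by rewrite pos_cons pos_nil addr0 (negPf zy) !mulr0.
rewrite (expect_sum D_summ)// -(big_mkord xpredT (fun m => E n.+1 (fun ys => lacef R m (take m ys) * sawf R (n.+1 - m) (drop m ys) * (pos ys == x)%:R))).
rewrite (@big_cat_nat _ _ _ 2)//= [X in X + _]big1_seq ?add0r; last first.
 move=> m; rewrite mem_index_iota => /andP[_ /andP[_ m2]].
 rewrite -(expect0 D (fun=> 0)); rewrite expect0.
 rewrite /expect asum_eq0// => ys.
 by rewrite lacef_small ?mul0r ?mulr0.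
apply: eq_big_nat => m /andP[m2 mn].
have := @conv_expect R d D D_ge0 D_summ D_sum1 m (n.+1 - m) (lacef R m) (sawf R (n.+1 - m)) x (bl m) (bs _).
by rewrite subnKC.
Qed.

Lemma conv_csaw0 (f : Zd -> R) x : Defs.conv f (csaw D 0) x = f x.
Proof.
rewrite /Defs.conv (@asum_single _ _ _ x) => [|y yx]; first by rewrite subrr csaw0 eqxx mulr1.
by rewrite csaw0 subr_eq0 eq_sym (negPf yx) mulr0.
Qed.

(** Uniqueness: in the recursion at order [m] the newest coefficient is convolved with [csaw D 0],
    the unit of convolution, and all earlier ones are known by induction. *)
Lemma lace_coefficients_pin pi : lace_coefficients D pi -> forall m, (2 <= m)%N -> pi m = pin D m.
Proof.
move=> H m; elim/ltn_ind: m => -[//|n] IH m2; apply/funext => x.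
have := H n x; rewrite !saw_csaw csaw_recursion => /addrI.
have split (f : nat -> R) : \sum_(2 <= i < n.+2) f i = \sum_(2 <= i < n.+1) f i + f n.+1.
 by rewrite big_nat_recr.
rewrite !split subnn saw_csaw !conv_csaw0 => e.
apply/esym; apply: (addrI (\sum_(2 <= i < n.+1) Defs.conv (pin D i) (csaw D (n.+1 - i)) x)).
rewrite e; congr (_ + _); apply: eq_big_nat => i /andP[i2 im].
by rewrite IH// saw_csaw.
Qed.

End statement_link.

(** * Lattice symmetries and the constant [K_const] *)

Section lattice_symmetries.
Variable d : nat.
Local Notation Zd := 'rV[int]_d.
Implicit Types (i j : 'I_d) (x y : Zd).

Definition zreflect i x : Zd := \row_l (if l == i then - x 0 l else x 0 l).
Definition zrot i j x : Zd := \row_l (if l == i then - x 0 j else if l == j then x 0 i else x 0 l).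

Lemma zreflectK i : involutive (zreflect i).
Proof. by move=> x; apply/rowP => l; rewrite !mxE; case: eqP => // ->; rewrite opprK. Qed.

Lemma zreflectD i : {morph zreflect i : x y / x + y}.
Proof. by move=> x y; apply/rowP => l; rewrite !mxE; case: eqP => // _; rewrite opprD. Qed.

Lemma zrotD i j : {morph zrot i j : x y / x + y}.
Proof.
move=> x y; apply/rowP => l; rewrite !mxE; case: eqP => _; first by rewrite opprD.
by case: eqP.
Qed.

Lemma zrot_bij i j : i != j -> bijective (zrot i j).
Proof.
move=> ij; exists (fun x => \row_l (if l == j then - x 0 i else if l == i then x 0 j else x 0 l)) => x;
 apply/rowP => l; rewrite !mxE !eqxx ?(negPf ij) ?[j == i]eq_sym ?(negPf ij).
 case: (eqVneq l j) => [->|lj]; first by rewrite opprK.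
 by case: (eqVneq l i) => [->|].
case: (eqVneq l i) => [->|li]; first by rewrite opprK.
by case: (eqVneq l j) => [->|].
Qed.

End lattice_symmetries.

Section symmetric_coefficients.
Variables (R : realType) (d : nat) (D : 'rV[int]_d -> R).
Local Notation Zd := 'rV[int]_d.
Local Notation E := (expect D).

Lemma pin_invariant (T : Zd -> Zd) n x : {morph T : x y / x + y} -> bijective T ->
 (forall x, D (T x) = D x) -> pin D n (T x) = pin D n x.
Proof.
move=> TD bT DT; have iT := bij_inj bT.
have T0 : T 0 = 0 by apply: (addIr (T 0)); rewrite -TD !add0r.
have pT ys : pos (map T ys) = T (pos ys) by rewrite /pos big_map (big_morph T TD T0).
rewrite /pin -(expect_map n (fun ys => _ * (pos ys == T x)%:R) bT DT).
apply: eq_expect => ys _; rewrite pT (inj_eq iT); congr (_ * _).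
rewrite /lacef (@lace_ext _ _ _ (fun i => T (walk ys (0 + i)%N))).
 exact: (@lace_inj _ _ _ T (walk ys) 0 0 1 n iT).
by move=> i _; rewrite /walk -map_take pT.
Qed.

Lemma Pigen_invariant (T : Zd -> Zd) z x : {morph T : x y / x + y} -> bijective T ->
 (forall x, D (T x) = D x) -> Pigen D z (T x) = Pigen D z x.
Proof. by move=> TD bT DT; apply: eq_asum => n; rewrite pin_invariant. Qed.

End symmetric_coefficients.

Section quadratic_moments.
Variables (R : realType) (d : nat) (P : 'rV[int]_d -> R).
Local Notation Zd := 'rV[int]_d.
Hypotheses (P_reflect : forall i x, P (zreflect i x) = P x)
 (P_rot : forall i j x, i != j -> P (zrot i j x) = P x)
 (P_quad : forall k : 'rV[R]_d, summ (fun x => P x * ldot k x ^+ 2)).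

Let s i (x : Zd) : R := (x 0 i)%:~R.

Let ldotE k x : ldot k x = \sum_i k 0 i * s i x.
Proof. by rewrite /ldot /dot; apply: eq_bigr => i _; rewrite mxE. Qed.

Let sq_summ i : summ (fun x => P x * s i x ^+ 2).
Proof.
apply: eq_summ (P_quad (delta_mx 0 i)) => x; congr (_ * _ ^+ 2).
rewrite ldotE (bigD1 i)//= big1 ?addr0 ?mxE ?eqxx ?mul1r// => j ji.
by rewrite mxE (negPf ji) andbF mul0r.
Qed.

Let prod_summ i j : summ (fun x => P x * (s i x * s j x)).
Proof.
apply: summ_le (summD (summ_abs (sq_summ i)) (summ_abs (sq_summ j))) => x.
rewrite normrM [X in _ <= X + _]normrM [X in _ <= _ + X]normrM -mulrDr ler_wpM2l//.
rewrite !(ger0_norm (sqr_ge0 _)) ler_norml.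
by have := sqr_ge0 (s i x - s j x); have := sqr_ge0 (s i x + s j x); move: (s i x) (s j x) => a b; nra.
Qed.

Let diag i j : \asum_x (P x * s i x ^+ 2) = \asum_x (P x * s j x ^+ 2).
Proof.
have [->//|ij] := eqVneq i j.
rewrite [LHS](asum_bij _ (zrot_bij ij)); apply: eq_asum => x.
by rewrite P_rot// /s mxE eqxx rmorphN sqrrN.
Qed.

Let cross i j : i != j -> \asum_x (P x * (s i x * s j x)) = 0.
Proof.
move=> ij; have : \asum_x (P x * (s i x * s j x)) = - \asum_x (P x * (s i x * s j x)).
 rewrite -[RHS](asumN (prod_summ i j)) [LHS](asum_bij _ (inv_bij (zreflectK i))); apply: eq_asum => x.
 by rewrite P_reflect /s !mxE eqxx eq_sym (negPf ij) rmorphN mulNr mulrN.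
lra.
Qed.

(** Reflections kill the mixed second moments, and rotations by ninety degrees equate the diagonal
    ones. *)
Lemma isotropic_moment (k : 'rV[R]_d) : d%:R * asum setT (fun x : Zd => P x * ldot k x ^+ 2) =
 enorm k ^+ 2 * asum setT (fun x : Zd => P x * enorm (of_lattice R x) ^+ 2) :> R.
Proof.
case: (posnP d) => [d0|d0].
 have z x : ldot k x = 0 by rewrite ldotE big1// => i; have := ltn_ord i; rewrite {2}d0.
 have zk : enorm k = 0 by rewrite /enorm /dot big1 ?sqrtr0// => i; have := ltn_ord i; rewrite {2}d0.
 by rewrite zk expr0n mul0r asum_eq0 ?mulr0// => x; rewrite z expr0n mulr0.
pose m := \asum_(x : Zd) (P x * s (Ordinal d0) x ^+ 2).
have eE (y : 'rV[R]_d) : enorm y ^+ 2 = \sum_i y 0 i ^+ 2.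
 rewrite sqr_sqrtr; first by apply: eq_bigr => i _; rewrite expr2.
 by apply: sumr_ge0 => i _; rewrite -expr2 sqr_ge0.
have -> : \asum_(x : Zd) (P x * enorm (of_lattice R x) ^+ 2) = d%:R * m.
 rewrite (eq_asum_to (fun x => \sum_i P x * s i x ^+ 2)); last first.
  by move=> x; rewrite eE mulr_sumr; apply: eq_bigr => i _; rewrite mxE.
 rewrite asum_sum//; rewrite (eq_bigr (fun=> m)) => [|i _]; last exact: diag.
 by rewrite sumr_const card_ord mulr_natl.
rewrite [RHS]mulrCA; congr (_ * _).
rewrite (eq_asum_to (fun x => \sum_i \sum_j (k 0 i * k 0 j) * (P x * (s i x * s j x)))); last first.
 move=> x; rewrite ldotE expr2 mulr_suml mulr_sumr; apply: eq_bigr => i _.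
 by rewrite !mulr_sumr; apply: eq_bigr => j _; ring.
rewrite asum_sum => [|i _]; last by apply: summ_sum => j _; exact: summZ.
rewrite eE mulr_suml; apply: eq_bigr => i _.
rewrite asum_sum => [|j _]; last exact: summZ.
rewrite (bigD1 i)//= big1 ?addr0 => [|j ji]; last by rewrite asumZ// cross 1?eq_sym// mulr0.
rewrite asumZ// -expr2; congr (_ * _); rewrite /m (diag (Ordinal d0) i).
by apply: eq_asum => x; rewrite expr2.
Qed.

End quadratic_moments.

Section step_symmetries.
Variables (R : realType) (d : nat) (alpha : R) (h : 'rV[R]_d -> R).
Hypothesis hP : step_profile alpha h.

Lemma step_dist_zreflect L i x : step_dist h L (zreflect i x) = step_dist h L x.
Proof.
rewrite /step_dist; congr (_ / _); rewrite -[RHS](profile_reflect hP i); congr h.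
by apply/rowP => j; rewrite !mxE; case: eqP => // _; rewrite rmorphN mulrN.
Qed.

Lemma step_dist_zrot L i j x : i != j -> step_dist h L (zrot i j x) = step_dist h L x.
Proof.
move=> ij; rewrite /step_dist; congr (_ / _); rewrite -[RHS](profile_rot90 hP _ ij); congr h.
by apply/rowP => l; rewrite !mxE; case: eqP => _; [rewrite rmorphN mulrN|case: eqP].
Qed.

End step_symmetries.

Section K_link.
Variables (R : realType) (d : nat) (D : 'rV[int]_d -> R).
Local Notation Zd := 'rV[int]_d.
Hypotheses (D_ge0 : forall x, 0 <= D x)
 (D_summ : summ D).
Variable z : R.
Hypotheses (z_gt0 : 0 < z)
 (lt_summ : summ (fun n => n%:R * ltot D n * z ^+ n)).

Let zn_ge0 n : 0 <= z ^+ n. Proof. by rewrite exprn_ge0// ltW. Qed.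

Lemma pin_small n x : (n <= 1)%N -> pin D n x = 0.
Proof.
move=> n1; rewrite /pin /expect asum_eq0// => ys.
by rewrite lacef_small// mul0r mulr0.
Qed.

Lemma time_moment : \asum_(x : Zd) asum [set n | (2 <= n)%N] (fun n => n%:R * pin D n x * z ^+ n.-1)
 = z^-1 * \asum_(n : nat) (n%:R * lhat D n 0 * z ^+ n).
Proof.
pose f (n : nat) (x : Zd) := n%:R * pin D n x * z ^+ n.
have sp : summ (fun p : nat * Zd => f p.1 p.2).
 apply: (@summ_pair R _ _ f (fun n => n%:R * ltot D n * z ^+ n)) => //.
  by move=> n; apply: summZr; apply: summZ; exact: pin_summ.
 move=> n; rewrite (eq_asum_to (fun x => n%:R * z ^+ n * `|pin D n x|)); last first.
  by move=> x; rewrite /f !normrM (ger0_norm (zn_ge0 n)) normr_nat mulrAC.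
 rewrite asumZ; last by apply: summ_abs; exact: pin_summ.
 by rewrite [leRHS]mulrAC ler_wpM2l ?mulr_ge0// pin_abs_sum_le.
have sp' := @summ_swap R _ _ f sp.
rewrite (eq_asum_to (fun x => z^-1 * \asum_(n : nat) f n x)); last first.
 move=> x; rewrite asum_mkcond -asumZ; last exact: (summ_pair_row x sp').
 apply: eq_asum => n; rewrite /f; case: n => [|[|n]].
 - by rewrite mem_setE/= !mul0r mulr0.
 - by rewrite mem_setE/= pin_small// mulr0 mul0r mulr0.
 - by rewrite mem_setE/= [in RHS]exprS; field; rewrite gt_eqF.
rewrite asumZ; last exact: (summ_pair_sum sp').
rewrite -(@asum_swap R _ _ f sp); congr (_ * _); apply: eq_asum => n.
rewrite /f asumZr; last by apply: summZ; exact: pin_summ.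
rewrite asumZ; last exact: pin_summ.
by congr (_ * _ * _); rewrite -pin_fh// fh0.
Qed.

Lemma space_moment : \asum_(x : Zd) asum [set n | (2 <= n)%N]
  (fun n => enorm (of_lattice R x) ^+ 2 * pin D n x * z ^+ n)
 = \asum_(x : Zd) (Pigen D z x * enorm (of_lattice R x) ^+ 2).
Proof.
have ls : summ (fun n => ltot D n * z ^+ n).
 apply: summ_le lt_summ => n; rewrite ger0_norm ?mulr_ge0 ?ltot_ge0//.
 rewrite ler_wpM2r//; case: n => [|n]; first by rewrite /ltot expect0 lacef_small// normr0 mulr0.
 by rewrite ler_peMl ?ltot_ge0// ler1n.
apply: eq_asum => x; rewrite asum_mkcond mulrC /Pigen -asumZ; last exact: Pigen_term_summ.
apply: eq_asum => n; rewrite mulrA; case: n => [|[|n]]; rewrite mem_setE//=.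
 by rewrite pin_small// mulr0 mul0r.
by rewrite pin_small// mulr0 mul0r.
Qed.

(** The definition weights the laces with [z ^ (n - 1)], the renewal theorem with [z ^ n]; this
    accounts for the extra factor [z]. *)
Lemma K_constE alpha v pi : D 0 = 0 -> (forall x, D (- x) = D x) -> asum setT D = 1 -> z_crit D = z -> lace_coefficients D pi ->
 K_const alpha D v pi = (z + \asum_(n : nat) (n%:R * lhat D n 0 * z ^+ n))^-1 * z *
  (if alpha <= 2 then 1 else 1 + (2 * d%:R * z * v)^-1 * \asum_(x : Zd) (Pigen D z x * enorm (of_lattice R x) ^+ 2)).
Proof.
move=> D0 De D1 ze lc; have pE := lace_coefficients_pin D_ge0 D_summ D1 D0 lc.
rewrite /K_const ze; congr (_ * _).
 rewrite (_ : asum setT _ = z^-1 * \asum_(n : nat) (n%:R * lhat D n 0 * z ^+ n)); last first.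
  apply: (etrans _ time_moment); apply: eq_asum => x; rewrite asum_mkcond [RHS]asum_mkcond; apply: eq_asum => n.
  by case: ifP => //; rewrite inE => n2; rewrite pE.
 set S := asum _ _; have -> : z + S = z * (1 + z^-1 * S) by field; rewrite gt_eqF.
 by rewrite invfM mulrAC mulVf ?mul1r// gt_eqF.
case: ifP => // _; congr (_ + _ * _); apply: (etrans _ space_moment); apply: eq_asum => x.
rewrite asum_mkcond [RHS]asum_mkcond; apply: eq_asum => n.
by case: ifP => //; rewrite inE => n2; rewrite pE.
Qed.

End K_link.

(** * Scaling limits *)

Section limits.
Variable R : realType.
Implicit Types u w : nat -> R.

Lemma cvg_eventually u w (l : R) N : (forall n, (N <= n)%N -> u n = w n) ->
 w n @[n --> \oo] --> l -> u n @[n --> \oo] --> l.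
Proof.
move=> uw /cvg_eps H; apply/cvg_eps => e e0; have [n0 h] := H e e0.
by exists (maxn N n0) => n; rewrite geq_max => /andP[h1 h2]; rewrite uw// h.
Qed.

Lemma cvg_to0 u w N : (forall n, (N <= n)%N -> 0 <= u n <= w n) ->
 w n @[n --> \oo] --> (0 : R) -> u n @[n --> \oo] --> (0 : R).
Proof.
move=> uw /cvg_eps H; apply/cvg_eps => e e0; have [n0 h] := H e e0.
exists (maxn N n0) => n; rewrite geq_max => /andP[h1 h2]; have /andP[h3 h4] := uw n h1.
have := h n h2; rewrite !subr0 => h5; rewrite ger0_norm//.
by apply: le_trans h5; apply: (le_trans h4); exact: ler_norm.
Qed.

Lemma powR_cvg0 u p N : 0 < p -> (forall n, (N <= n)%N -> 0 <= u n) ->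
 u n @[n --> \oo] --> (0 : R) -> u n `^ p @[n --> \oo] --> (0 : R).
Proof.
move=> p0 u0 /cvg_eps H; apply/cvg_eps => e e0.
have [n0 h] := H (e `^ p^-1) (powR_gt0 _ e0); exists (maxn N n0) => n; rewrite geq_max => /andP[h1 h2].
have := h n h2; rewrite !subr0 ger0_norm ?u0// => h3.
rewrite ger0_norm ?powR_ge0//.
have -> : e = (e `^ p^-1) `^ p by rewrite -powRrM mulVf ?gt_eqF// powRr1// ltW.
by apply: ge0_ler_powR; rewrite ?nnegrE ?powR_ge0 ?u0// ltW.
Qed.

Lemma cvg_small u (e : R) : 0 < e -> u n @[n --> \oo] --> (0 : R) -> exists N, forall n, (N <= n)%N -> u n <= e.
Proof.
move=> e0 /cvg_eps /(_ e e0)[N h]; exists N => n /h; rewrite subr0; apply: le_trans; exact: ler_norm.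
Qed.

Lemma inv_cvg0 u : (forall B : R, exists N, forall n, (N <= n)%N -> B <= u n) ->
 (u n)^-1 @[n --> \oo] --> (0 : R).
Proof.
move=> H; apply/cvg_eps => e e0; have [N h] := H e^-1; exists N => n /h h1.
have u0 : 0 < u n by apply: lt_le_trans h1; rewrite invr_gt0.
by rewrite subr0 ger0_norm ?invr_ge0 ?(ltW u0)// -[e]invrK lef_pV2// posrE invr_gt0.
Qed.

Lemma nat_large (B : R) : exists N : nat, forall n, (N <= n)%N -> B <= n%:R.
Proof.
exists (Num.bound `|B|) => n Nn; apply: (le_trans (ler_norm B)).
by apply: (le_trans (ltW (archi_boundP (normr_ge0 B)))); rewrite ler_nat.
Qed.

(** The derivative of the sine at 0. *)
Lemma sinc_cvg u N : (forall n, (N <= n)%N -> 0 < u n) -> u n @[n --> \oo] --> (0 : R) ->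
 (u n)^-1 * sin (u n) @[n --> \oo] --> (1 : R).
Proof.
move=> u0 uc; have dv := @derivable_sin R 0.
have e0 : 'D_1 sin (0 : R) = 1 by rewrite derive_val cos0.
have c := dv; rewrite /derivable -[lim _]/('D_1 sin (0 : R)) e0 in c.
apply/cvg_eps => e e0'; move/cvgrPdist_le : c => /(_ e e0').
rewrite /dnbhs /within /= => -[del /= del0 hd].
move/cvg_eps : uc => /(_ (del / 2)); rewrite divr_gt0// => /(_ isT)[n0 h].
exists (maxn N n0) => n; rewrite geq_max => /andP[h1 h2].
have := hd (u n); rewrite /ball_ /= sub0r normrN => hd'.
have := h n h2; rewrite subr0 => h3.
have := hd' (le_lt_trans h3 _); rewrite gt_eqF ?u0// => /(_ _ isT).
by rewrite sin0 subr0 addr0 /GRing.scale /= mulr1 distrC; apply; rewrite ltr_pdivrMr// ltr_pMr// ltr1n.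
Qed.

(** Half-angle formula, then [sinc_cvg] at half of [u n] times the absolute value of [t]. *)
Lemma onecos_scale u (q t : R) N : (forall n, (N <= n)%N -> 0 < u n) -> u n @[n --> \oo] --> (0 : R) ->
 n%:R * u n ^+ 2 @[n --> \oo] --> q ->
 n%:R * (1 - cos (u n * t)) @[n --> \oo] --> q * t ^+ 2 / 2.
Proof.
move=> u0 uc uq; have [->|tn] := eqVneq t 0.
 rewrite expr0n mulr0 mul0r; apply: (@cvg_eventually _ (fun=> 0) _ 0%N); last exact: cvg_cst.
 by move=> n _; rewrite mulr0 cos0 subrr mulr0.
pose s n := u n * (`|t| / 2).
have t0 : 0 < `|t| / 2 by rewrite divr_gt0// normr_gt0.
have s0 n : (N <= n)%N -> 0 < s n by move=> h; rewrite mulr_gt0// u0.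
have sc : s n @[n --> \oo] --> (0 : R).
 by rewrite -(mul0r (`|t| / 2)); apply: cvgM; [exact: uc|exact: cvg_cst].
have sinc := sinc_cvg s0 sc.
have key : (n%:R * u n ^+ 2) * (t ^+ 2 / 2) * ((s n)^-1 * sin (s n)) ^+ 2 @[n --> \oo] --> (q * (t ^+ 2 / 2) * (1 * 1) : R).
 apply: cvgM; first by apply: cvgM; [exact: uq|exact: cvg_cst].
 rewrite (_ : (fun n => _) = (fun n => ((s n)^-1 * sin (s n)) * ((s n)^-1 * sin (s n)))); first exact: cvgM.
 by apply/funext => n; rewrite expr2.
have -> : q * t ^+ 2 / 2 = q * (t ^+ 2 / 2) * (1 * 1) by rewrite !mulr1 mulrA.
suff eqw n : (N <= n)%N -> n%:R * (1 - cos (u n * t)) = (n%:R * u n ^+ 2) * (t ^+ 2 / 2) * ((s n)^-1 * sin (s n)) ^+ 2.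
 exact: cvg_eventually eqw key.
move=> Nn.
have -> : cos (u n * t) = cos ((s n) *+ 2).
 have -> : s n *+ 2 = u n * `|t| by rewrite /s -mulr_natr; field.
 by case: (leP 0 t) => h; rewrite ?(ger0_norm h)// (ltr0_norm h) mulrN cosN.
rewrite cos_mulr2n cos2sin2 exprMn.
have sE : s n ^+ 2 = u n ^+ 2 * (t ^+ 2 / 4).
 by rewrite /s exprMn expr_div_n real_normK ?num_real//; congr (_ * (_ / _)); rewrite -natrX.
have un : u n != 0 by rewrite gt_eqF// u0.
have -> : (s n)^-1 ^+ 2 = (u n ^+ 2 * (t ^+ 2 / 4))^-1 by rewrite exprVn sE.
by field; rewrite un tn.
Qed.

End limits.

Section scaling.
Variables (R : realType) (alpha v : R).
Hypotheses (alpha_gt0 : 0 < alpha) (v_gt0 : 0 < v).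
Let a : R := Num.min alpha 2.
Let f := f_scale alpha v.

Definition scale_weight (u : R) : R :=
 if alpha == 2 then v * u ^+ 2 * ln (1 / u) else v * u `^ a.

Let a0 : 0 < a. Proof. by rewrite /a lt_min alpha_gt0/=. Qed.

(** The third relation decides whether the displacement of the laces enters the rate, the fourth
    normalises the dispersion relation, and the last turns the hypothesis on [b] into smallness of
    [b n / n]. *)
Definition scaling_relations : Prop := [/\ exists N, forall n, (N <= n)%N -> 0 < f n,
 f n @[n --> \oo] --> (0 : R),
 n%:R * f n ^+ 2 @[n --> \oo] --> (if alpha <= 2 then 0 else v^-1),
 forall ka, 0 < ka -> n%:R * scale_weight (f n * ka) @[n --> \oo] --> ka `^ a
 & exists c N, 0 < c /\ forall n, (N <= n)%N -> c <= n%:R * f n `^ Num.min alpha 1].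

Section pure_power.
Hypothesis alpha2 : alpha != 2.

Let fE n : f n = (v * n%:R) `^ (- (1 / a)).
Proof. by rewrite /f /f_scale (negPf alpha2). Qed.

Let f0 n : (1 <= n)%N -> 0 < f n.
Proof. by move=> n1; rewrite fE powR_gt0// mulr_gt0// ltr0n. Qed.

Let fa n : (1 <= n)%N -> f n `^ a = (v * n%:R)^-1.
Proof.
move=> n1; have p : 0 < v * n%:R by rewrite mulr_gt0// ltr0n.
by rewrite fE -powRrM mulNr divfK ?gt_eqF// powR_inv1// ltW.
Qed.

Let fc : f n @[n --> \oo] --> (0 : R).
Proof.
apply: (@cvg_eventually _ f (fun n => ((v * n%:R)^-1) `^ (1 / a)) _ 0%N).
 by move=> n _; rewrite fE -[X in _ = X `^ _]powR_inv1 ?mulr_ge0 ?(ltW v_gt0)// -powRrM mulN1r.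
apply: (@powR_cvg0 _ _ _ 0%N); first by rewrite divr_gt0.
 by move=> n _; rewrite invr_ge0 mulr_ge0// ltW.
apply: inv_cvg0 => B; have [N h] := nat_large (B / v); exists N => n /h.
by rewrite ler_pdivrMr// mulrC.
Qed.

(* [n = v^-1 f^-a], so all scaling relations are powers of [f]. *)
Let nE n p : (1 <= n)%N -> n%:R * f n `^ p = v^-1 * f n `^ (p - a).
Proof.
move=> n1; have nf : n%:R = v^-1 * f n `^ (- a).
 rewrite powRN fa// invrK mulrA mulVf ?mul1r// gt_eqF//.
rewrite nf -mulrA; congr (_ * _); rewrite -powRD; first by rewrite addrC.
by rewrite (gt_eqF (f0 n1)) implybT.
Qed.

Lemma pure_power_scaling : scaling_relations.
Proof.
have f2 n : f n ^+ 2 = f n `^ 2 by rewrite powR_mulrn// fE powR_ge0.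
have fge n : 0 <= f n by rewrite fE powR_ge0.
split=> //.
- by exists 1%N.
- have [al|al] := leP alpha 2.
  have lt : alpha < 2 by rewrite lt_neqAle alpha2.
  apply: (@cvg_eventually _ (fun n => n%:R * f n ^+ 2) (fun n => v^-1 * f n `^ (2 - a)) _ 1%N).
   by move=> n n1; rewrite f2 nE.
  rewrite -(mulr0 v^-1); apply: cvgM; first exact: cvg_cst.
  apply: (@powR_cvg0 _ _ _ 0%N) => //; rewrite subr_gt0 /a gt_min lt//.
 have aE : a = 2 by rewrite /a min_r// ltW.
 apply: (@cvg_eventually _ (fun n => n%:R * f n ^+ 2) (fun=> v^-1) _ 1%N); last exact: cvg_cst.
 by move=> n n1; rewrite f2 nE// aE subrr powRr0 mulr1.
- move=> ka ka0; apply: (@cvg_eventually _ (fun n => n%:R * scale_weight (f n * ka)) (fun=> ka `^ a) _ 1%N); last exact: cvg_cst.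
 move=> n n1; rewrite /scale_weight (negPf alpha2) powRM ?(ltW ka0)// fa//.
 by have n0 : n%:R != 0 :> R by [rewrite pnatr_eq0 -lt0n]; field; rewrite n0 gt_eqF.
- have [N hN] := cvg_small ltr01 fc; exists v^-1, (maxn 1 N); split; first by rewrite invr_gt0.
 move=> n; rewrite geq_max => /andP[n1 nN]; rewrite nE// ler_peMr ?invr_ge0 ?(ltW v_gt0)//.
 have le0 : Num.min alpha 1 - a <= 0.
  rewrite subr_le0 /a le_min !ge_min lexx/=; apply/orP; right; lra.
 rewrite -[X in _ <= _ `^ X]opprK powRN invf_ge1 ?powR_gt0 ?f0//.
 have := @ge0_ler_powR R (- (Num.min alpha 1 - a)) _ (f n) 1; rewrite powR1; apply; rewrite ?nnegrE ?hN//.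
 by rewrite oppr_ge0.
Qed.

End pure_power.

Section logarithmic.
Hypothesis alpha2 : alpha = 2.

Let l n : R := ln (Num.sqrt n%:R).

Let fE n : f n = (v * n%:R * l n) `^ (- (1 / 2)).
Proof. by rewrite /f /f_scale alpha2 eqxx. Qed.

Let l_large (B : R) : exists N, forall n, (N <= n)%N -> B <= l n.
Proof.
have [N h] := nat_large (expR B ^+ 2); exists (maxn N 1) => n; rewrite geq_max => /andP[/h hn n1].
rewrite -ler_expR /l lnK ?posrE ?sqrtr_gt0 ?ltr0n//.
by rewrite -[leLHS]ger0_norm ?expR_ge0// -sqrtr_sqr ler_wsqrtr.
Qed.

Let il_cvg : (l n)^-1 @[n --> \oo] --> (0 : R).
Proof. exact: inv_cvg0 l_large. Qed.

(** Sublinearity of the logarithm at the square root: [ln l = 2 * ln (sqrt l) <= 2 * sqrt l]. *)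
Let lnl_cvg : ln (l n) / l n @[n --> \oo] --> (0 : R).
Proof.
have [N h] := l_large 1.
apply: (@cvg_to0 _ _ (fun n => 2 * (Num.sqrt (l n))^-1) N).
 move=> n /h l1; have l0 : 0 < l n by apply: lt_le_trans l1.
 apply/andP; split; first by apply: divr_ge0; [exact: ln_ge0|exact: ltW].
 have r0 : 0 < Num.sqrt (l n) by rewrite sqrtr_gt0.
 have e : l n = Num.sqrt (l n) ^+ 2 by rewrite sqr_sqrtr// ltW.
 rewrite {1 2}e; move: (Num.sqrt (l n)) r0 => r r0.
 rewrite expr2 lnM ?posrE// ler_pdivrMr ?mulr_gt0// (_ : 2 * r^-1 * (r * r) = r + r).
  by have := ln_sublinear r0; lra.
 by field; rewrite gt_eqF.
rewrite -(mulr0 (2 : R)); apply: cvgM; first exact: cvg_cst.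
apply: inv_cvg0 => B; have [M hM] := l_large (B ^+ 2); exists M => n /hM h1.
by apply: (le_trans (ler_norm B)); rewrite -sqrtr_sqr ler_wsqrtr.
Qed.

(** The logarithm of [1 / f n] is [l n] up to a constant and half of [ln (l n)]; divided by [l n],
    both corrections vanish in the limit. *)
Lemma logarithmic_scaling : scaling_relations.
Proof.
have [N0 h0] := l_large 1; pose N := maxn N0 1.
have lge n : (N <= n)%N -> 1 <= l n by rewrite geq_max => /andP[/h0].
have nge n : (N <= n)%N -> 0 < n%:R :> R by rewrite geq_max ltr0n => /andP[].
have lgt n : (N <= n)%N -> 0 < l n by move=> /lge; apply: lt_le_trans.
have wgt n : (N <= n)%N -> 0 < v * n%:R * l n by move=> h; rewrite !mulr_gt0 ?nge ?lgt.
have fgt n : (N <= n)%N -> 0 < f n by move=> h; rewrite fE powR_gt0 ?wgt.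
have fge n : 0 <= f n by rewrite fE powR_ge0.
have f2 n : (N <= n)%N -> f n ^+ 2 = (v * n%:R * l n)^-1.
 move=> h; rewrite -powR_mulrn// fE -powRrM mulNr divfK ?pnatr_eq0// powR_inv1// ltW// wgt//.
have nf2 n : (N <= n)%N -> n%:R * f n ^+ 2 = v^-1 * (l n)^-1.
 by move=> h; rewrite f2//; field; rewrite !gt_eqF ?lgt ?nge.
have nf2c : n%:R * f n ^+ 2 @[n --> \oo] --> (0 : R).
 apply: (@cvg_eventually _ (fun n => n%:R * f n ^+ 2) (fun n => v^-1 * (l n)^-1) _ N nf2).
 by rewrite -(mulr0 v^-1); apply: cvgM; [exact: cvg_cst|exact: il_cvg].
have fc : f n @[n --> \oo] --> (0 : R).
 apply: (@cvg_eventually _ f (fun n => (n%:R * f n ^+ 2 / n%:R) `^ (1 / 2)) _ N).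
  move=> n h; rewrite mulrAC mulfV ?mul1r; last by rewrite gt_eqF ?nge.
  by rewrite -powR_mulrn// -powRrM mulfV ?pnatr_eq0// powRr1.
 apply: (@powR_cvg0 _ _ _ 0%N) => [|n _|]; first by rewrite divr_gt0.
  by rewrite divr_ge0// mulr_ge0// sqr_ge0.
 rewrite -(mulr0 (0 : R)); apply: cvgM => //; apply: inv_cvg0; exact: nat_large.
split=> //.
- by exists N.
- by rewrite alpha2 lexx.
- move=> ka ka0.
 have key : ka ^+ 2 * (1 + (ln v / 2 - ln ka) * (l n)^-1 + (1 / 2) * (ln (l n) / l n)) @[n --> \oo]
   --> ka ^+ 2 * (1 + (ln v / 2 - ln ka) * 0 + (1 / 2) * 0).
  apply: cvgM; first exact: cvg_cst.
  apply: cvgD; last by apply: cvgM; [exact: cvg_cst|exact: lnl_cvg].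
  apply: cvgD; first exact: cvg_cst.
  by apply: cvgM; [exact: cvg_cst|exact: il_cvg].
 have -> : ka `^ a = ka ^+ 2 * (1 + (ln v / 2 - ln ka) * 0 + (1 / 2) * 0).
  by rewrite /a alpha2 minxx powR_mulrn ?(ltW ka0)// !mulr0 !addr0 mulr1.
 apply: (@cvg_eventually R _ _ _ N _ key) => n h.
 rewrite /scale_weight alpha2 eqxx exprMn f2//.
 have lnn : ln n%:R = 2 * l n :> R.
  have r0 : 0 < Num.sqrt n%:R :> R by rewrite sqrtr_gt0 nge.
  rewrite -[n%:R in LHS](sqr_sqrtr (ler0n R n)) expr2 lnM ?posrE// /l; lra.
 have -> : ln (1 / (f n * ka)) = l n + ln v / 2 + ln (l n) / 2 - ln ka.
  rewrite div1r lnV ?posrE ?mulr_gt0 ?fgt// lnM ?posrE ?fgt//.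
  rewrite fE ln_powR lnM ?posrE ?mulr_gt0 ?nge ?lgt// lnM ?posrE ?nge// lnn; lra.
 by have l1 := lgt n h; have n1 := nge n h; field; rewrite !gt_eqF.
- have [M hM] := cvg_small ltr01 fc; exists (Num.min 1 v^-1), (maxn N M).
 have c0 : 0 < Num.min 1 v^-1 by rewrite lt_min ltr01 invr_gt0.
 split=> // n; rewrite geq_max => /andP[nN nM].
 have -> : Num.min alpha 1 = 1 by rewrite alpha2 min_r// ler1n.
 rewrite powRr1//.
 suff : Num.min 1 v^-1 ^+ 2 <= (n%:R * f n) ^+ 2.
  by rewrite ler_pXn2r// ?nnegrE ?(ltW c0)// mulr_ge0.
 have c1 : Num.min 1 v^-1 ^+ 2 <= v^-1.
  apply: (le_via (Num.min 1 v^-1)); last by rewrite ge_min lexx orbT.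
  by rewrite expr2 ler_piMl ?(ltW c0)// ge_min lexx.
 apply: (le_trans c1); rewrite exprMn [n%:R ^+ 2]expr2 -mulrA nf2//.
 rewrite mulrCA ler_peMr ?invr_ge0 ?(ltW v_gt0)// ler_pdivlMr ?lgt// mul1r.
 have n1 : 1 <= n%:R :> R by move: nN; rewrite geq_max ler1n => /andP[].
 apply: (le_trans (ltW (ln_sublinear _))); first by rewrite sqrtr_gt0 nge.
 rewrite -[leRHS]ger0_norm// -sqrtr_sqr ler_wsqrtr// expr2 ler_peMr//.
Qed.

End logarithmic.

Lemma f_scale_scaling : scaling_relations.
Proof. by have [h|h] := eqVneq alpha 2; [exact: logarithmic_scaling|exact: pure_power_scaling]. Qed.

End scaling.

Section auxiliary.
Variable R : realType.

Lemma norm_real_complex (x : R) : `|x%:C%C| = (`|x|)%:C%C.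
Proof. by rewrite normc_def /= expr0n addr0 sqrtr_sqr. Qed.

Lemma cvg_upper_bound (u : nat -> R) (l : R) : u n @[n --> \oo] --> l -> exists C, forall n, u n <= C.
Proof.
move=> /cvg_eps /(_ 1 ltr01)[N h]; exists (\sum_(i < N) `|u i| + `|l| + 1) => n.
have s0 (P : pred 'I_N) : 0 <= \sum_(i < N | P i) `|u i| by apply: sumr_ge0.
have [nN|nN] := ltnP n N.
 rewrite (bigD1 (Ordinal nN))//=; have := ler_norm (u n); have := normr_ge0 l.
 by have := s0 (fun i => i != Ordinal nN); lra.
have := h n nN; rewrite ler_norml => /andP[_]; have := ler_norm l; have := s0 xpredT; lra.
Qed.

Lemma eventually_ord N (P : 'I_N -> nat -> Prop) :
 (forall i, exists n0, forall n, (n0 <= n)%N -> P i n) ->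
 exists n0, forall n, (n0 <= n)%N -> forall i, P i n.
Proof.
move=> H; have [|n0 h] := @eventually_all (fun a n => forall aN : (a < N)%N, P (Ordinal aN) n) N.
 move=> a; have [aN|aN] := pselect (is_true (a < N)%N); last by exists 0%N => n _ h; case: (aN h).
 have [n0 h] := H (Ordinal aN); exists n0 => n /h p aN'; by rewrite (bool_irrelevance aN' aN).
exists n0 => n /h {}h i; have := h i (ltn_ord i) (ltn_ord i).
by rewrite (_ : Ordinal _ = i)//; exact: val_inj.
Qed.

Lemma expN_dist (x y : R) : 0 <= x -> 0 <= y -> `|expR (- x) - expR (- y)| <= `|x - y|.
Proof.
move=> x0 y0; case: (leP x y) => [h|/ltW h].
 by rewrite distrC [leRHS]distrC [leRHS]ger0_norm ?subr_ge0// distrC expN_lip.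
by rewrite distrC [leRHS]ger0_norm ?subr_ge0// expN_lip.
Qed.

Lemma wsum_map (I : Type) (s : seq I) (th : I -> R) (g : I -> nat) :
 wsum [seq th i | i <- s] [seq g i | i <- s] = \sum_(i <- s) th i * (g i)%:R.
Proof. by elim: s => [|i s IH] /=; rewrite ?big_nil// big_cons IH. Qed.

Lemma truncn_near (x : R) : 0 <= x -> x - 1 <= (Num.truncn x)%:R <= x.
Proof.
move=> x0; have /andP[h1 h2] := truncn_itv x0; rewrite h1 andbT lerBlDr.
by rewrite natr1 ltW.
Qed.

End auxiliary.

Lemma small_parameter (R : realType) (w : R) : 0 < w -> exists2 eta : R, 0 < eta &
 20 * eta <= 1 / 8 /\ 64 * (2 * w) * (20 * eta) <= 1.
Proof.
move=> w0; have [u uE] : exists u : R, u = 160 + 2560 * w by exists (160 + 2560 * w).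
have u0 : 0 < u by move: uE; lra.
exists u^-1; first by rewrite invr_gt0.
have ui : u * u^-1 = 1 by rewrite mulfV// gt_eqF.
have i0 : 0 < u^-1 by rewrite invr_gt0.
have wi : 0 < w * u^-1 by rewrite mulr_gt0.
move: ui; rewrite {1}uE; move: u^-1 i0 wi => i i0 wi; split; lra.
Qed.

(** * The time points *)

Section times.
Variables (R : realType) (N : nat) (t : 'I_N.+1 -> R) (b : nat -> R).
Hypotheses (t0 : t ord0 = 0)
 (t_incr : forall i j : 'I_N.+1, (i < j)%N -> t i < t j)
 (t_le1 : t ord_max <= 1)
 (b_small : forall ep, 0 < ep -> exists n0, forall n, (n0 <= n)%N -> 0 <= b n -> b n / n%:R <= ep).

Let t_ge0 i : 0 <= t i.
Proof.
case: (posnP i) => [i0|i0]; last by rewrite -t0 ltW// t_incr.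
by rewrite (_ : i = ord0) ?t0//; exact: val_inj.
Qed.

Let t_le i : t i <= 1.
Proof.
apply: le_trans t_le1; case: (ltnP i N) => [h|h]; first by rewrite ltW// t_incr.
by rewrite (_ : i = ord_max)//; apply: val_inj => /=; apply/eqP; rewrite eqn_leq h -ltnS ltn_ord.
Qed.

Lemma scaled_times_near ep : 0 < ep -> exists n0, forall n, (n0 <= n)%N -> forall gn, 0 <= gn <= b n / n%:R ->
 forall j, `|(scaled_times t gn n j)%:R / n%:R - t j| <= ep /\ (scaled_times t gn n j)%:R <= n%:R :> R.
Proof.
(* The cap 1 keeps [1 - gn], and with it the argument of the integer part, nonnegative. *)
move=> ep0; pose e2 := Num.min (ep / 2) 1.
have e20 : 0 < e2 by rewrite lt_min divr_gt0//=.
have [n1 h1] := b_small e20; have [n2 h2] := nat_large (2 / ep).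
exists (maxn 1 (maxn n1 n2)) => n; rewrite !geq_max => /and3P[n01 nn1 nn2] gn /andP[g0 g1] j.
have np : 0 < n%:R :> R by rewrite ltr0n.
have b0 : 0 <= b n by have := le_trans g0 g1; rewrite pmulr_lge0// invr_gt0.
have ge : gn <= e2 by apply: (le_trans g1); exact: h1.
have [ge1 ge2] : gn <= ep / 2 /\ gn <= 1 by move: ge; rewrite le_min => /andP.
have inv : n%:R^-1 <= ep / 2 by have := h2 n nn2; rewrite -[ep / 2]invrK lef_pV2 ?posrE ?invr_gt0 ?divr_gt0// invf_div.
pose s := if j == ord_max then t ord_max * (1 - gn) else t j.
have -> : scaled_times t gn n j = Num.truncn (n%:R * s) by rewrite /scaled_times /s; case: ifP.
have s0 : 0 <= s by rewrite /s; case: ifP => // _; rewrite mulr_ge0// subr_ge0.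
have sj : t j - ep / 2 <= s <= t j.
 rewrite /s; case: eqP => [->|_]; last by rewrite lexx andbT gerBl divr_ge0// ltW.
 have := t_le1; have := t_ge0 ord_max; set T := t _ => T0 T1.
 have : T * gn <= ep / 2 by apply: le_trans ge1; rewrite ler_piMl.
 by have : 0 <= T * gn by [rewrite mulr_ge0]; move=> *; apply/andP; split; lra.
have /andP[q1 q2] := truncn_near (mulr_ge0 (ltW np) s0); have /andP[s1 s2] := sj.
split; last by apply: (le_trans q2); rewrite ler_piMr ?(ltW np)//; apply: (le_trans s2).
move: q1 q2; set m : R := (Num.truncn _)%:R => q1 q2.
have q1' : s - n%:R^-1 <= m / n%:R.
 by rewrite ler_pdivlMr// mulrBl mulVf ?gt_eqF// mulrC.
have q2' : m / n%:R <= s by rewrite ler_pdivrMr// mulrC.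
by rewrite ler_norml; apply/andP; split; lra.
Qed.

Lemma scaled_times0 gn n : (0 < N)%N -> scaled_times t gn n ord0 = 0%N.
Proof.
move=> N0; rewrite /scaled_times ifF; first by rewrite t0 mulr0 truncn0.
by apply/negbTE; rewrite -val_eqE /= eq_sym -lt0n.
Qed.

(** Stated for all admissible [gn] at once, so that the threshold in [n] can be found before [gn] is
    chosen. *)
Definition regular_gap (M : nat) (ep : R) (j : 'I_N) (n : nat) := forall gn : R, 0 <= gn <= b n / n%:R ->
 let m := scaled_times t gn n in let m0 := m (widen_ord (leqnSn N) j) in let m1 := m (lift ord0 j) in
 [/\ (m0 <= m1)%N, (M <= m1 - m0)%N
  & `|(m1 - m0)%:R / n%:R - (t (lift ord0 j) - t (widen_ord (leqnSn N) j))| <= ep].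

Lemma scaled_gaps M ep : 0 < ep -> exists n0, forall n, (n0 <= n)%N -> forall j, regular_gap M ep j n.
Proof.
move=> ep0; apply: (@eventually_ord N (regular_gap M ep)) => j; rewrite /regular_gap.
set j1 := lift ord0 j; set j0 := widen_ord _ j.
have tj : t j0 < t j1 by apply: t_incr; rewrite /j0 /j1 /= /bump leq0n add1n.
pose de := t j1 - t j0; have de0 : 0 < de by rewrite subr_gt0.
have e0 : 0 < Num.min (ep / 2) (de / 4) by rewrite lt_min !divr_gt0.
have [n1 h1] := scaled_times_near e0; have [n2 h2] := nat_large (2 * M%:R / de).
exists (maxn 1 (maxn n1 n2)) => n; rewrite !geq_max => /and3P[n01 nn1 nn2] gn hg.
have np : 0 < n%:R :> R by rewrite ltr0n.
have [a1 _] := h1 n nn1 gn hg j1; have [a0 _] := h1 n nn1 gn hg j0.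
move: a1 a0; rewrite !le_min => /andP[b1 c1] /andP[b0 c0].
set m1 := scaled_times _ _ _ j1 in b1 c1 *; set m0 := scaled_times _ _ _ j0 in b0 c0 *.
have hM := h2 n nn2; rewrite ler_pdivrMr// in hM.
have d1 : de / 2 <= m1%:R / n%:R - m0%:R / n%:R :> R.
 by move: c1 c0 de0; rewrite !ler_norml /de => /andP[? ?] /andP[? ?] ?; lra.
have d2 : M%:R <= m1%:R - m0%:R :> R.
 by move: d1; rewrite -mulrBl ler_pdivlMr//; move: hM; lra.
have m01 : (m0 <= m1)%N by rewrite -(ler_nat R) -subr_ge0; apply: le_trans d2.
split=> //; first by rewrite -(ler_nat R) natrB.
rewrite natrB// mulrBl.
by move: b1 b0; rewrite !ler_norml => /andP[? ?] /andP[? ?]; apply/andP; split; lra.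
Qed.

End times.

(** * The limit theorem *)

Section limit_theorem.
Variables (R : realType) (d : nat) (D : 'rV[int]_d -> R) (alpha v : R).
Local Notation Zd := 'rV[int]_d.
Hypotheses (D_ge0 : forall x, 0 <= D x)
 (D_summ : summ D)
 (D_sum1 : asum setT D = 1)
 (D_even : forall x, D (- x) = D x)
 (D_zero : D 0 = 0)
 (D_reflect : forall i x, D (zreflect i x) = D x)
 (D_rot : forall i j x, i != j -> D (zrot i j x) = D x).
Variables C1 eta : R.
Hypotheses (C1_ge0 : 0 <= C1) (eta_gt0 : 0 < eta) (d_gt0 : (0 < d)%N)
 (IR : infrared D C1 eta)
 (eta1 : 20 * eta <= 1 / 8)
 (eta2 : 64 * (2 * W1 C1) * (20 * eta) <= 1)
 (alpha_gt0 : 0 < alpha)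
 (disp : dispersion_const alpha D v).
Variable pi : nat -> Zd -> R.
Hypothesis lc : lace_coefficients D pi.

Let v_gt0 : 0 < v. Proof. exact: disp.1. Qed.
Let a : R := Num.min alpha 2.
Let a0 : 0 < a. Proof. by rewrite /a lt_min alpha_gt0/=. Qed.
Let f := f_scale alpha v.
Let zc := zcrit D.
Let A := Acrit D.
Let K := K_const alpha D v pi.

Let zc_gt0 : 0 < zc.
Proof. exact: (@zcrit_gt0 R d D D_ge0 D_summ D_sum1 D_even D_zero C1 eta). Qed.

Lemma enormZ c (k : 'rV[R]_d) : enorm (c *: k) = `|c| * enorm k.
Proof.
rewrite /enorm (_ : dot (c *: k) (c *: k) = c ^+ 2 * dot k k).
 by rewrite sqrtrM ?sqr_ge0// sqrtr_sqr.
by rewrite /dot mulr_sumr; apply: eq_bigr => i _; rewrite !mxE; ring.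
Qed.

Lemma enorm_eq0 (k : 'rV[R]_d) : enorm k = 0 -> k = 0.
Proof.
move=> k0; apply/rowP => i; rewrite mxE; apply/eqP; rewrite -normr_le0 -k0.
exact: coord_le_enorm.
Qed.

(** The dispersion relation controls the ratio of [gap D] to [scale_weight], and the scaling of the
    latter is known. The case [k = 0] is separate because that relation excludes it. *)
Lemma gap_scaling (k : 'rV[R]_d) : n%:R * gap D (f n *: k) @[n --> \oo] --> enorm k `^ a.
Proof.
have [[N fN] fc _ sw _] := f_scale_scaling alpha_gt0 v_gt0.
have kn0 : 0 <= enorm k by rewrite sqrtr_ge0.
have [k0|k0] := eqVneq (enorm k) 0.
 rewrite k0 powR0 ?gt_eqF//; apply: (@cvg_eventually R _ (fun=> 0) _ 0%N); last exact: cvg_cst.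
 move=> n _; rewrite (enorm_eq0 k0) scaler0 /gap asum_eq0 ?mulr0// => x.
 by rewrite ldot0l cos0 subrr mulr0.
have kp : 0 < enorm k by rewrite lt_neqAle eq_sym k0.
have wc := sw _ kp.
have ratio : gap D (f n *: k) / scale_weight alpha v (f n * enorm k) @[n --> \oo] --> (1 : R).
 apply/cvg_eps => e e0; have [del del0 hd] := disp.2 e e0.
 have [M hM] := cvg_small (divr_gt0 del0 (mulr_gt0 (ltr0Sn R 1) kp)) fc.
 exists (maxn N M) => n; rewrite geq_max => /andP[nN nM].
 have fn := fN n nN; have en : enorm (f n *: k) = f n * enorm k by rewrite enormZ ger0_norm// ltW.
 have h1 : 0 < enorm (f n *: k) < del.
  rewrite en mulr_gt0//= (le_lt_trans (ler_wpM2r kn0 (hM n nM)))//.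
  have -> : del / (2 * enorm k) * enorm k = del / 2 by field; rewrite gt_eqF.
  by rewrite ltr_pdivrMr// ltr_pMr// ltr1n.
 have := hd _ h1; rewrite fourier_gap// en.
 have -> : (if alpha == 2 then v * (f n * enorm k) ^+ 2 * ln (1 / (f n * enorm k))
   else v * (f n * enorm k) `^ Num.min alpha 2) = scale_weight alpha v (f n * enorm k) by [].
 rewrite -fmorph_div -(rmorph1 (real_complex R)) -rmorphB /= norm_real_complex ltcR.
 exact: ltW.
have wr : (n%:R * scale_weight alpha v (f n * enorm k)) * (gap D (f n *: k) / scale_weight alpha v (f n * enorm k))
  @[n --> \oo] --> (enorm k `^ a * 1 : R) by exact: cvgM.
rewrite mulr1 in wr.
have [M hM] : exists M, forall n, (M <= n)%N -> 0 < n%:R * scale_weight alpha v (f n * enorm k).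
 move/cvg_eps : wc => /(_ (enorm k `^ a / 2)); rewrite divr_gt0 ?powR_gt0// => /(_ isT)[M hM].
 by exists M => n /hM; rewrite ler_norml => /andP[+ _]; have := powR_gt0 a kp; lra.
suff eqw n : (M <= n)%N -> n%:R * gap D (f n *: k) =
  (n%:R * scale_weight alpha v (f n * enorm k)) * (gap D (f n *: k) / scale_weight alpha v (f n * enorm k)).
 exact: cvg_eventually eqw wr.
move=> nM.
have := hM n nM; move: (scale_weight _ _ _) (gap _ _) => w g.
have [->|w0] := eqVneq w 0; first by rewrite mulr0 ltxx.
by move=> _; field.
Qed.

Let q : R := if alpha <= 2 then 0 else v^-1.
Let F (k : 'rV[R]_d) (x : Zd) : R := q * ldot k x ^+ 2 / 2.

Lemma onecos_scaling (k : 'rV[R]_d) x : n%:R * (1 - cos (ldot (f n *: k) x)) @[n --> \oo] --> F k x.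
Proof.
have [[N fN] fc fq _ _] := f_scale_scaling alpha_gt0 v_gt0.
have := @onecos_scale R f _ (ldot k x) N fN fc fq.
by under eq_fun do rewrite -ldotZl.
Qed.

Let rate (k : 'rV[R]_d) : R := A * (zc * enorm k `^ a + \asum_x (Pigen D zc x * F k x)).

Let lt_crit := @ltot_crit R d D D_ge0 D_summ D_sum1 D_even D_zero C1 eta C1_ge0 eta_gt0 d_gt0 IR eta1 eta2.

Let one_pt := @one_point R d D D_ge0 D_summ D_sum1 D_even D_zero C1 eta C1_ge0 eta_gt0 d_gt0 IR eta1 eta2.

Let PF_summ k : summ (fun x => Pigen D zc x * F k x).
Proof.
have [Cs hCs] := cvg_upper_bound (@gap_scaling k).
exact: (@Pigen_limit_summ R d D D_ge0 D_summ D_sum1 D_even D_zero C1 eta C1_ge0 eta_gt0 d_gt0 IR eta1 eta2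
 (fun n => f n *: k) Cs (F k) hCs (@onecos_scaling k)).
Qed.

(** For [alpha <= 2] the limit weight [F] is zero, and [A * zc] is all that remains of the laces.
    For [alpha > 2] the quadratic moment is isotropic and yields the second factor of [K_const]. *)
Lemma rateE k : rate k = K * enorm k `^ a.
Proof.
have ze : z_crit D = zc by exact: z_crit_zcrit.
rewrite /K (K_constE D_ge0 D_summ zc_gt0 lt_crit.1 alpha v D_zero D_even D_sum1 ze lc).
rewrite -/(Acrit D) -/A /rate -!mulrA; congr (_ * _).
have [al|al] := leP alpha 2.
 rewrite mul1r asum_eq0 ?addr0// => x.
 by rewrite /F /q al !mul0r mulr0.
have aE : a = 2 by rewrite /a min_r// ltW.
have qE : q = v^-1 by rewrite /q leNgt al.
rewrite aE powR_mulrn ?sqrtr_ge0//.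
have Fsq x : Pigen D zc x * ldot k x ^+ 2 = (2 * v) * (Pigen D zc x * F k x).
 by rewrite /F qE; field; rewrite gt_eqF.
have dn : d%:R != 0 :> R by rewrite pnatr_eq0 -lt0n.
have iso : d%:R * asum setT (fun x : Zd => Pigen D zc x * ldot k x ^+ 2) =
  enorm k ^+ 2 * asum setT (fun x : Zd => Pigen D zc x * enorm (of_lattice R x) ^+ 2).
 apply: isotropic_moment.
 - by move=> i x; apply: Pigen_invariant => //; [exact: zreflectD|exact: inv_bij (zreflectK i)].
 - by move=> i j x ij; apply: Pigen_invariant; [exact: zrotD|exact: zrot_bij|move=> y; exact: D_rot].
 - move=> k'; apply: eq_summ (summZ (2 * v) (PF_summ k')) => x.
  by rewrite /F qE; field; rewrite gt_eqF.
move: iso; rewrite (eq_asum _ Fsq) asumZ; last exact: PF_summ.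
move: (asum setT _) (asum setT _) => S1 S2 iso.
have -> : S2 = (2 * v * d%:R)^-1 * (enorm k ^+ 2 * S1) by rewrite -iso; field; rewrite dn gt_eqF.
by field; rewrite dn !gt_eqF.
Qed.

(** The one-point limit at frequency 0, where the rate is 0. *)
Lemma ctot_limit ep : 0 < ep -> exists M, forall m, (M <= m)%N -> `|ctot D m * zc ^+ m - A| <= ep.
Proof.
move=> ep0.
have g0 : (fun n : nat => n%:R * gap D (0 : 'rV[R]_d)) = fun=> 0.
 apply/funext => n; rewrite /gap asum_eq0 ?mulr0// => x.
 by rewrite ldot0l cos0 subrr mulr0.
have h1 n : n%:R * gap D (0 : 'rV[R]_d) <= 0 by have := congr1 (@^~ n) g0 => /= ->.
have h2 : n%:R * gap D (0 : 'rV[R]_d) @[n --> \oo] --> (0 : R) by rewrite g0; exact: cvg_cst.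
have h3 (x : Zd) : n%:R * (1 - cos (ldot (0 : 'rV[R]_d) x)) @[n --> \oo] --> (0 : R).
 by rewrite ldot0l cos0 subrr; under eq_fun do rewrite mulr0; exact: cvg_cst.
have [M [N H]] := @one_pt
 (fun=> 0) 0 0 (fun=> 0) h1 h2 h3 ep ep0.
exists M => m Mm; have := H (maxn m N); rewrite leq_maxr => /(_ isT m); rewrite Mm leq_maxl => /(_ isT).
rewrite asum_eq0 => [|x]; last by rewrite mulr0.
rewrite !mulr0 addr0 mulr0 !mul0r oppr0 expR0 mulr1; congr (_ <= _); congr (`|_ * _ - _|).
by apply: eq_expect => ys _; rewrite ldot0l cos0 mulr1.
Qed.

Let ctot_bounds m : 1 <= ctot D m * zc ^+ m <= 2.
Proof.
by rewrite (@ctot_zcrit_ge1 R d D D_ge0 D_summ D_sum1 D_even D_zero C1 eta)// (@ctot_zcrit_le2 R d D D_ge0 D_summ D_sum1 D_even D_zero C1 eta).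
Qed.

Let A_bounds : 1 <= A <= 2.
Proof.
apply/andP; split; apply/ler_addgt0Pr => ep ep0; have [M hM] := ctot_limit ep0;
 by have := hM M (leqnn M); have := ctot_bounds M; rewrite ler_norml => /andP[? ?] /andP[? ?]; lra.
Qed.

Let rate_nonneg k : 0 <= rate k.
Proof.
have /andP[A1 _] := A_bounds.
have [Cs hCs] := cvg_upper_bound (@gap_scaling k).
rewrite /rate mulr_ge0//; first exact: le_trans A1.
exact: (@rate_ge0 R d D D_ge0 D_summ D_sum1 D_even D_zero C1 eta C1_ge0 eta_gt0 d_gt0 IR eta1 eta2
 (fun n => f n *: k) Cs (enorm k `^ a) (F k) hCs (@gap_scaling k) (@onecos_scaling k)).
Qed.

Let single k : conv_to D zc A [:: fun n => f n *: k] [:: rate k].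
Proof.
have [Cs hCs] := cvg_upper_bound (@gap_scaling k).
move=> ep ep0.
have [M [N H]] := @one_pt
 (fun n => f n *: k) Cs (enorm k `^ a) (F k) hCs (@gap_scaling k) (@onecos_scaling k) ep ep0.
exists M, N => n nN [|g [|g' gs]]// _ /= /andP[Mg _]; rewrite addn0 => gn.
have := H n nN g; rewrite Mg gn => /(_ isT); rewrite /norm_multi multi1 /tmax /= addn0 addr0.
by rewrite -/A -/zc -/(rate k).
Qed.

Lemma conv_to_sequence (I : finType) (k : I -> 'rV[R]_d) : (0 < #|I|)%N ->
 conv_to D zc A [seq (fun n => f n *: k i) | i <- enum I] [seq rate (k i) | i <- enum I].
Proof.
move=> I0; pose kt := [seq ((fun n => f n *: k i), rate (k i)) | i <- enum I].
have -> : [seq (fun n => f n *: k i) | i <- enum I] = unzip1 kt by rewrite /unzip1 /kt -map_comp.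
have -> : [seq rate (k i) | i <- enum I] = unzip2 kt by rewrite /unzip2 /kt -map_comp.
have /andP[A1 A2] := A_bounds.
apply: conv_to_all => //.
- exact: le_trans A1.
- by move=> m; have /andP[] := ctot_bounds m.
- exact: lt_crit.1.
- exact: lt_crit.2.
- exact: (@critical_equation R d D D_ge0 D_summ D_sum1 D_even D_zero C1 eta).
- by rewrite -size_eq0 size_map -cardE -lt0n.
move=> j; rewrite size_map => jI /=.
case/card_gt0P: I0 => x0 _; rewrite (nth_map x0)//=; set k' := k _.
have [_ fc _ _ _] := f_scale_scaling alpha_gt0 v_gt0.
split; [exact: rate_nonneg| |exact: (single k')].
move=> x; under eq_fun do rewrite ldotZl.
by rewrite -(mul0r (ldot k' x)); apply: cvgM; [exact: fc|exact: cvg_cst].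
Qed.

Variable b : nat -> R.
Hypothesis b_scale : f n `^ Num.min alpha 1 * b n @[n --> \oo] --> (0 : R).

(** Since [n%:R * f n] to the power [Num.min alpha 1], with the power on [f n] alone, is bounded
    below, [b n / n] is at most a multiple of the null sequence in [b_scale]. *)
Let b_small ep : 0 < ep -> exists n0, forall n, (n0 <= n)%N -> 0 <= b n -> b n / n%:R <= ep.
Proof.
move=> ep0; have [_ _ _ _ [c [N [c0 hc]]]] := f_scale_scaling alpha_gt0 v_gt0.
have [M hM] := cvg_small (mulr_gt0 ep0 c0) b_scale.
exists (maxn 1 (maxn N M)) => n; rewrite !geq_max => /and3P[n1 nN nM] b0.
have np : 0 < n%:R :> R by rewrite ltr0n.
rewrite ler_pdivrMr// -(ler_pM2r c0); apply: (le_via (b n * (n%:R * f n `^ Num.min alpha 1))).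
 by rewrite ler_wpM2l// hc.
rewrite mulrCA [leRHS]mulrAC [leRHS]mulrC ler_pM2l// mulrC; exact: hM.
Qed.

(** Numerator and denominator are both multiplied by [zc] to the total time; they then approach [A]
    times the exponential and [A]. The threshold precedes [gn] because [conv_to] and [scaled_gaps]
    are uniform. *)
Theorem finite_dimensional_limit N (k : 'I_N -> 'rV[R]_d) (t : 'I_N.+1 -> R) e :
 (0 < N)%N -> t ord0 = 0 -> (forall i j : 'I_N.+1, (i < j)%N -> t i < t j) -> t ord_max <= 1 -> 0 < e ->
 exists n0 : nat, forall n, (n0 <= n)%N -> forall gn, 0 <= gn <= b n / n%:R ->
  let m := scaled_times t gn n in
  `| saw_multi D m (fun j => f n *: k j) / fourier (saw D (m ord_max)) 0
    - (expR (- (K * \sum_(j < N) enorm (k j) `^ a *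
       (t (lift ord0 j) - t (widen_ord (leqnSn N) j)))))%:C%C | < e%:C%C.
Proof.
move=> N0 t0 ti t1 e0; have /andP[A1 A2] := A_bounds.
pose th j := rate (k j); have th0 j : 0 <= th j by exact: rate_nonneg.
pose Th := \sum_(j < N) th j; have Th0 : 0 <= Th by exact: sumr_ge0.
(* Four shares are spent: one on the numerator, two on the exponent because [A <= 2], one on the
   denominator; the fifth makes the inequality strict. *)
pose ep := e / 5; have ep0 : 0 < ep by rewrite divr_gt0.
have ep1 : 0 < ep / (Th + 1) by rewrite divr_gt0// ltr_wpDl.
have cardN : (0 < #|'I_N|)%N by rewrite card_ord.
have [M1 [n1 H1]] := conv_to_sequence k cardN ep0.
have [M2 H2] := ctot_limit ep0.
have [n2 H2'] := scaled_gaps t0 ti t1 b_small (maxn M1 M2) ep1.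
have [n3 H3] := scaled_times_near t0 ti t1 b_small (ltr01 : 0 < 1).
exists (maxn n1 (maxn n2 n3)) => n; rewrite !geq_max => /and3P[nn1 nn2 nn3] gn hg; cbv zeta.
set m := scaled_times t gn n.
have m0 : m ord0 = 0%N by exact: scaled_times0.
have mono (j : 'I_N) : (m (widen_ord (leqnSn N) j) <= m (lift ord0 j))%N by have [] := H2' n nn2 j gn hg.
pose g (j : 'I_N) := (m (lift ord0 j) - m (widen_ord (leqnSn N) j))%N.
have [tot ->] := @saw_multi_multi R d D D_summ D_even N m (fun j => f n *: k j) m0 mono.
rewrite -/g; set l := [seq _ | _ <- _] in tot *.
have lE : l = zip [seq g j | j <- enum 'I_N] [seq kk n | kk <- [seq (fun n => f n *: k j) | j <- enum 'I_N]].
 rewrite -map_comp /l; elim: (enum 'I_N) => //= j s ->; congr (_ :: _).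
have sg : sumn [seq g j | j <- enum 'I_N] = m ord_max.
 rewrite -tot /tmax /l /unzip1 -map_comp; congr sumn; exact: eq_map.
have gM j : (maxn M1 M2 <= g j)%N by have [] := H2' n nn2 j gn hg.
have mn : (m ord_max <= n)%N by rewrite -(ler_nat R); have [_] := H3 n nn3 gn hg ord_max.
have c1 := H1 n nn1 [seq g j | j <- enum 'I_N].
rewrite !size_map all_map sg mn wsum_map -lE in c1.
have aM : all (preim g (leq M1)) (enum 'I_N).
 by apply/allP => j _ /=; apply: leq_trans (gM j); rewrite leq_maxl.
have {}c1 := c1 erefl aM isT.
have mM : (M2 <= m ord_max)%N.
 rewrite -sg sumnE big_map big_enum (bigD1 (Ordinal N0))//=.
 by apply: leq_trans (leq_addr _ _); apply: leq_trans (gM _); rewrite leq_maxr.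
have c2 := H2 (m ord_max) mM; have /andP[d1 d2] := ctot_bounds (m ord_max).
rewrite fourier_saw0// -fmorph_div -rmorphB norm_real_complex ltcR.
move: c1; rewrite /norm_multi tot; set X := multi D l; set Z := zc ^+ m ord_max.
set W := \sum_(j <- enum _) _; move: c2 d1 d2; rewrite -/Z; set c := ctot D _ => c2 d1 d2 c1.
have Z0 : Z != 0 by apply: contraTneq d1 => ->; rewrite mulr0 -ltNge ltr01.
have -> : X / c = (X * Z) / (c * Z).
 have c0 : c != 0 by apply: contraTneq d1 => ->; rewrite mul0r -ltNge ltr01.
 by rewrite -mulf_div divff// mulr1.
set Y := K * _; move: (X * Z) (c * Z) c1 c2 d1 d2 => u w c1 c2 d1 d2.
have np : 0 <= n%:R^-1 :> R by rewrite invr_ge0.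
have WY : `|W / n%:R - Y| <= ep.
 have -> : W / n%:R - Y = \sum_(j < N) th j * ((g j)%:R / n%:R - (t (lift ord0 j) - t (widen_ord (leqnSn N) j))).
  rewrite /W /Y big_enum mulr_suml mulr_sumr -sumrB; apply: eq_bigr => j _.
  rewrite [K * _]mulrA -rateE -/(th j); move: (th j) (n%:R^-1) => r i; ring.
 apply: (le_trans (ler_norm_sum _ _ _)); apply: (le_via (\sum_(j < N) th j * (ep / (Th + 1)))).
  apply: ler_sum => j _; rewrite normrM (ger0_norm (th0 j)) ler_wpM2l//.
  by have [] := H2' n nn2 j gn hg.
 rewrite -mulr_suml -/Th mulrA ler_pdivrMr ?ltr_wpDl// mulrC ler_wpM2l ?(ltW ep0)// lerDl//.
have W0 : 0 <= W / n%:R by rewrite mulr_ge0// /W big_enum; apply: sumr_ge0 => j _; rewrite mulr_ge0.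
have Y0 : 0 <= Y.
 rewrite /Y mulr_sumr; apply: sumr_ge0 => j _; rewrite mulrA -rateE mulr_ge0//.
 by rewrite subr_ge0 ltW// ti//= /bump leq0n add1n.
have hE := le_trans (expN_dist W0 Y0) WY.
have y1 : 0 <= expR (- Y) <= 1 by rewrite expR_ge0 -expR0 ler_expR oppr_le0.
move: (expR (- (W / n%:R))) (expR (- Y)) c1 hE y1 => x y c1 hE /andP[y0 y1].
have w0 : 0 < w by apply: lt_le_trans d1.
have -> : u / w - y = ((u - A * x) + A * (x - y) - y * (w - A)) / w by field; rewrite gt_eqF.
rewrite normrM normfV (gtr0_norm w0) ltr_pdivrMr//.
apply: (@lt_le_trans _ _ (e * 1)); last by rewrite ler_pM2l.
have b1 : `|A * (x - y)| <= 2 * ep.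
 have A0 : 0 <= A by apply: le_trans A1.
 by rewrite normrM (ger0_norm A0); apply: ler_pM.
have b2 : `|y * (w - A)| <= ep.
 by rewrite normrM (ger0_norm y0); apply: le_trans c2; rewrite ler_piMl.
apply: (le_lt_trans (ler_normB _ _)); have := ler_normD (u - A * x) (A * (x - y)).
by rewrite /ep in ep0 c1 b1 b2 *; lra.
Qed.

End limit_theorem.

Local Open Scope complex_scope.

Theorem theorem1p6 (R : realType) (alpha : R) (d : nat) (h : 'rV[R]_d -> R) :
  0 < alpha -> (1 <= d)%N -> 2 * Num.min alpha 2 < d%:R ->
  step_profile alpha h ->
  exists2 L0 : R, 1 <= L0 &
    forall L : R, L0 <= L ->
    let D := step_dist h L in
    D 0 = 0 ->
    forall (v : R) (pi : nat -> 'rV[int]_d -> R),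
    dispersion_const alpha D v ->
    lace_coefficients D pi ->
    forall b : nat -> R,
    b n @[n --> \oo] --> +oo ->
    f_scale alpha v n `^ Num.min alpha 1 * b n @[n --> \oo] --> (0 : R) ->
    forall (N : nat) (k : 'I_N -> 'rV[R]_d) (t : 'I_N.+1 -> R),
    (0 < N)%N ->
    t ord0 = 0 ->
    (forall i j : 'I_N.+1, (i < j)%N -> t i < t j) ->
    t ord_max <= 1 ->
    forall e : R, 0 < e ->
    exists n0 : nat, forall n : nat, (n0 <= n)%N ->
    forall g : nat -> R,
    (forall m : nat, (0 < m)%N -> 0 <= g m <= b m / m%:R) ->
    let nT := scaled_times t (g n) n in
    `| saw_multi D nT (fun j => f_scale alpha v n *: k j)
         / fourier (saw D (nT ord_max)) 0
       - (expR (- (K_const alpha D v pi *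
            \sum_(j < N) enorm (k j) `^ Num.min alpha 2 *
              (t (lift ord0 j) - t (widen_ord (leqnSn N) j)))))%:C | < e%:C.
Proof.
move=> al d1 dim hP.
have [C1 C10 HC] := infrared_step_dist al d1 hP dim.
have W0 : 0 < W1 C1 by rewrite /W1 mulr_gt0// ltr_wpDl// mulr_ge0.
(* The smallness required of [eta] depends on [C1] only, hence not on [L]; then [L0] is chosen. *)
have [eta eta0 [eta1 eta2]] := small_parameter W0.
have [L0 L01 HL] := HC eta eta0; exists L0 => // L L0L D Dz v pi disp lc b _ bs N k t N0 t0 ti t1 e e1.
have L1 : 1 <= L by exact: le_trans L0L.
have [n0 H] := @finite_dimensional_limit R d D alpha v
 (fun x => step_dist_ge0 al d1 hP x L1) (step_dist_summ al d1 hP L1) (step_dist_sum1 al d1 hP L1)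
 (step_dist_even hP L) Dz (step_dist_zreflect hP L) (fun i j x => @step_dist_zrot R d alpha h hP L i j x)
 C1 eta C10 eta0 d1 (HL L L0L) eta1 eta2 al disp pi lc b bs N k t e N0 t0 ti t1 e1.
(* The bounds on [g m] are assumed for positive [m]. *)
exists (maxn 1 n0) => n; rewrite geq_max => /andP[n1 nn] g hg.
exact: H n nn (g n) (hg n n1).
Qed.
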